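(* Let $\nu>0$ and let $\pi_\nu\propto\exp(-V_\nu)$ on $\mathbb{R}^d$ with $V_\nu(x)=\frac{d+\nu}2\ln(1+\|x\|^2)$. Let $q\in[2,\infty)$ and $0<\varepsilon\le q^{-1}$. (i) There is a constant $C_\nu$ depending only on $\nu$ such that, for the Langevin diffusion with target $\pi_\nu$ started from $\rho_0$ with $R_\infty(\rho_0\,\|\,\pi_\nu)<\infty$, the law $\rho_T$ at time $T$ satisfies $R_q(\rho_T\,\|\,\pi_\nu)\le\varepsilon$ whenever $$T\ge C_\nu\,q\,d\,\exp\Big(\frac{2q\,R_\infty(\rho_0\,\|\,\pi_\nu)}{\nu}\Big)\Big(R_q(\rho_0\,\|\,\pi_\nu)+(1/\varepsilon)^{2/\nu}\ln(1/\varepsilon)\Big).$$ (ii) Furthermore, let $\nu\le cd$ for some absolute constant $c$. Let $\mu_0$ satisfy $R_\infty(\mu_0\,\|\,\pi_\nu)<\infty$, let $T,m,\hat\pi_\nu$ be as defined in the context, and assume $m,T,R_2(\mu_0\,\|\,\hat\pi_\nu)\ge1$. Then, for a suitable sufficiently small step size $h>0$, the law $\mu_N$ of LMC with target $\pi_\nu$ and initial law $\mu_0$ after $N$ iterations satisfies $R_q(\mu_N\,\|\,\pi_\nu)\le\varepsilon$ with $$N=\tilde\Theta_{\nu,q}\left(\frac{d^5\,e^{\frac{4(2q-1)}{\nu}R_\infty(\mu_0\|\pi_\nu)}}{\varepsilon}\Big(R_{2q-1}(\mu_0\,\|\,\pi_\nu)^2+\Big(\frac1\varepsilon\Big)^{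4/\nu}\Big)\max\left\{1,\frac{\sqrt{\varepsilon\,R_2(\mu_0\,\|\,\hat\pi_\nu)\,R_\infty(\mu_0\,\|\,\pi_\nu)}}{d}\right\}\right).$$
   Context: Langevin diffusion for $\pi\propto e^{-V}$: $\mathrm{d}X_t=-\nabla V(X_t)\,\mathrm{d}t+\sqrt2\,\mathrm{d}B_t$, $\rho_t$ the law of $X_t$. Langevin Monte Carlo (LMC) with step size $h>0$: $x_{k+1}=x_k-h\nabla V(x_k)+\sqrt{2h}\,\xi_k$, with $(\xi_k)$ i.i.d. standard Gaussian vectors independent of $x_0\sim\mu_0$; $\mu_k$ is the law of $x_k$. Rényi divergence: for $1<q<\infty$, $R_q(\rho\,\|\,\pi)=\frac1{q-1}\ln\big\|\frac{\mathrm{d}\rho}{\mathrm{d}\pi}\big\|_{L^q(\pi)}^q$ if $\rho\ll\pi$ and $+\infty$ otherwise; $R_\infty(\rho\,\|\,\pi)=\ln\|\mathrm{d}\rho/\mathrm{d}\pi\|_{L^\infty(\pi)}$. Quantities in (ii): $m:=\frac12\inf\{R:\pi_\nu(\|x\|\ge R)\le\frac12\}$; $\delta_0:=\exp((2q-1)R_\infty(\mu_0\,\|\,\pi_\nu))$; $T:=(2q-1)\{\beta(\frac1{4\delta_0})R_{2q-1}(\mu_0\,\|\,\pi_\nu)+\beta(\frac{\varepsilon}{8\delta_0})\ln(\frac2\varepsilon)\}$ with $\beta(r)=\frac2\nu+2(\frac d\nu+1)r^{-2/\nu}$; and $\hat\pi_\nu(x)\propto\exp\big(-V_\nu(x)-\frac1{6144T}\max\{\|x\|-2m,0\}^2\big)$.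 $N=\tilde\Theta_{\nu,q}(A)$ means that $N$ equals $A$ up to multiplicative constants depending only on $\nu,q$ (and the absolute constant $c$) and polylogarithmic factors (in the quantities $d$, $1/\varepsilon$ and the initial divergences). All probability measures have Lebesgue densities. *)

(* Defs.v *)
From HB Require Import structures.
From mathcomp Require Import all_boot all_order all_algebra.
From mathcomp Require Import all_classical all_reals all_analysis.
From mathcomp Require Import measurable_realfun.

Set Implicit Arguments.
Unset Strict Implicit.
Unset Printing Implicit Defensive.

Import Order.TTheory GRing.Theory Num.Theory.
Import numFieldNormedType.Exports.

Local Open Scope classical_set_scope.
Local Open Scope ring_scope.

(* R^n is 'rV[R]_n, with the sigma-algebra generated by the coordinates, that
   is, the Borel sigma-algebra; the library's norm on 'rV[R]_n is the sup norm,
   so the Euclidean norm is enorm below. *)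
Definition rV_display : measure_display -> measure_display.
Proof. exact. Qed.

Section rV_measurable.
Context {R : realType} {n : nat}.

Let coor (i : 'I_n) (x : 'rV[R]_n) : R := x ord0 i.

Let rV_set0 : g_sigma_preimage coor set0.
Proof. exact: sigma_algebra0. Qed.

Let rV_setC A : g_sigma_preimage coor A -> g_sigma_preimage coor (~` A).
Proof. exact: sigma_algebraC. Qed.

Let rV_bigcup (F : _^nat) : (forall i, g_sigma_preimage coor (F i)) ->
  g_sigma_preimage coor (\bigcup_i (F i)).
Proof. exact: sigma_algebra_bigcup. Qed.

HB.instance Definition _ :=
  @isMeasurable.Build (rV_display default_measure_display) 'rV[R]_n
    (g_sigma_preimage coor) rV_set0 rV_setC rV_bigcup.

End rV_measurable.

Lemma measurable_coord (R : realType) n (i : 'I_n) :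
  measurable_fun setT (fun x : 'rV[R]_n => x ord0 i).
Proof.
move=> _ Y mY; rewrite setTI; apply: sub_sigma_algebra => /=.
rewrite -bigcup_seq/=; exists i => /=; first by rewrite mem_index_enum.
by exists Y => //; rewrite setTI.
Qed.

Lemma measurable_fun_rV d (T : measurableType d) (R : realType) n
    (f : T -> 'rV[R]_n) :
  (forall i, measurable_fun setT (fun t => f t ord0 i)) ->
  measurable_fun setT f.
Proof.
move=> mf.
have sub : g_sigma_preimage (fun i t => f t ord0 i) `<=` @measurable d T.
  apply: smallest_sub; first exact: sigma_algebra_measurable.
  case: n => [|n] in f mf *; first by rewrite big_ord0.
  rewrite -bigcup_mkord_ord; apply: bigcup_sub => i Ii A [B mB <-].
  exact: mf.
move=> _ A mA; rewrite setTI; apply: sub.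
have -> : (fun (i : 'I_n) t => f t ord0 i) =
    (fun i => (fun x : 'rV[R]_n => x ord0 i) \o f) by [].
by rewrite g_sigma_preimage_comp; exists A => //; rewrite setTI.
Qed.

Section lebesgue_rV.
Context {R : realType}.

Definition consrV n (p : ('rV[R]_n * R)%type) : 'rV[R]_n.+1 :=
  row_mx (const_mx p.2 : 'rV[R]_1) p.1.

Lemma measurable_consrV n : measurable_fun setT (@consrV n).
Proof.
apply: measurable_fun_rV => i.
have [j ij|j ij] := split_ordP (i : 'I_(1 + n)).
  rewrite (_ : (fun p => consrV p ord0 i) = snd) //; apply/funext => p.
  by rewrite /consrV ij (@row_mxEl _ 1 1 n) mxE.
rewrite (_ : (fun p => consrV p ord0 i) =
  (fun x : 'rV[R]_n => x ord0 j) \o fst).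
  exact: measurableT_comp (measurable_coord j) measurable_fst.
by apply/funext => p; rewrite /consrV ij (@row_mxEr _ 1 1 n).
Qed.

Definition lebesgue_succ n (mu : {measure set 'rV[R]_n -> \bar R}) :
    set 'rV[R]_n.+1 -> \bar R :=
  pushforward (mu \x (@lebesgue_measure R))%E (@consrV n).

Section lebesgue_succ_measure.
Variables (n : nat) (mu : {measure set 'rV[R]_n -> \bar R}).

Let succ0 : lebesgue_succ mu set0 = 0%E.
Proof. by rewrite /lebesgue_succ /pushforward preimage_set0 measure0. Qed.

Let succ_ge0 A : (0 <= lebesgue_succ mu A)%E.
Proof. exact: (@measure_ge0 _ _ _ (mu \x (@lebesgue_measure R))%E). Qed.

Let succ_sigma_additive : semi_sigma_additive (lebesgue_succ mu).
Proof.
exact: (@measure_semi_sigma_additive _ _ _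
  (measure_function_pushforward__canonical__measure_function_Measure
     (mu \x (@lebesgue_measure R))%E (@measurable_consrV n))).
Qed.

HB.instance Definition _ := isMeasure.Build _ _ _ (lebesgue_succ mu)
  succ0 succ_ge0 succ_sigma_additive.

End lebesgue_succ_measure.

Fixpoint lebesgue_rV n : {measure set 'rV[R]_n -> \bar R} :=
  match n with
  | 0%N => dirac (0 : 'rV[R]_0)
  | n'.+1 => lebesgue_succ (lebesgue_rV n')
  end.

End lebesgue_rV.

Definition enorm (R : realType) n (x : 'rV[R]_n) : R :=
  Num.sqrt (\sum_i x ord0 i ^+ 2).

Definition grad (R : realType) n (f : 'rV[R]_n -> R) (x : 'rV[R]_n) :
    'rV[R]_n :=
  \row_i 'D_(delta_mx ord0 i) f x.

Lemma measurable_enorm (R : realType) n :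
  measurable_fun setT (@enorm R n).
Proof.
have -> : @enorm R n = @Num.sqrt R \o (fun x => \sum_i x ord0 i ^+ 2) by [].
apply: measurableT_comp.
  by apply: continuous_measurable_fun; exact: sqrt_continuous.
apply: measurable_sum => i; apply: measurable_funX.
exact: measurable_coord.
Qed.

Section gibbs.
Context {R : realType} {n : nat}.

Definition exp_measure (V : {mfun 'rV[R]_n >-> R}) : set 'rV[R]_n -> \bar R :=
  fun A => (\int[lebesgue_rV n]_(x in A) (expR (- V x))%:E)%E.

Section exp_measure_measure.
Variable V : {mfun 'rV[R]_n >-> R}.

Let exp0 : exp_measure V set0 = 0%E.
Proof. exact: integral_set0. Qed.

Let exp_ge0 A : (0 <= exp_measure V A)%E.
Proof. by apply: integral_ge0 => x _; rewrite lee_fin expR_ge0. Qed.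

Let exp_sigma_additive : semi_sigma_additive (exp_measure V).
Proof.
apply: semi_sigma_additive_nng_induced => [|x]; last by rewrite lee_fin expR_ge0.
apply/measurable_EFinP; apply: measurableT_comp => //.
exact: measurableT_comp.
Qed.

HB.instance Definition _ := isMeasure.Build _ _ _ (exp_measure V)
  exp0 exp_ge0 exp_sigma_additive.

End exp_measure_measure.

(* The probability measure proportional to exp(- V); the default dirac 0 is
   used only when the integral of exp(- V) is infinite. *)
Definition gibbs (V : {mfun 'rV[R]_n >-> R}) : probability 'rV[R]_n R :=
  mnormalize (exp_measure V) (dirac (0 : 'rV[R]_n)).

End gibbs.

Section renyi.
Context d (T : measurableType d) (R : realType).
Implicit Types rho pi : probability T R.
Local Open Scope ereal_scope.

Definition density rho pi : T -> \bar R :=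
  Radon_Nikodym (charge_of_finite_measure rho) pi.

Definition renyi (q : R) rho pi : \bar R :=
  if `[< rho `<< pi >] then
    ((q - 1)^-1)%:E * lne (Lnorm pi q%:E (density rho pi) `^ q)
  else +oo.

Definition renyi_infty rho pi : \bar R :=
  if `[< rho `<< pi >] then lne (Lnorm pi +oo (density rho pi)) else +oo.

End renyi.

Section processes.
Context d (O : measurableType d) (R : realType) (P : probability O R) (n : nat).

Definition mutually_independent (I : eqType) (X : I -> O -> 'rV[R]_n) : Prop :=
  forall (s : seq I) (A : I -> set 'rV[R]_n), uniq s ->
    (forall i, measurable (A i)) ->
    P (\bigcap_(i in [set` s]) X i @^-1` A i) =
      (\prod_(i <- s) P (X i @^-1` A i))%E.

(* Z has law N(0, s^2 I_n); normal_prob takes the standard deviation. *)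
Definition centered_gaussian (s : R) (Z : O -> 'rV[R]_n) : Prop :=
  forall A : 'I_n -> set R, (forall i, measurable (A i)) ->
    P [set w | forall i, A i (Z w ord0 i)] =
      (\prod_(i < n) normal_prob 0 s (A i))%E.

Definition with_initial (x0 : O -> 'rV[R]_n) (z : nat -> O -> 'rV[R]_n) :
    nat -> O -> 'rV[R]_n :=
  fun k => if k is j.+1 then z j else x0.

(* B is a standard Brownian motion on [0, +oo[ independent of the random vector
   x0: as increments and x0 are mutually independent along any sequence of times
   starting at 0 and B starts at 0, x0 is independent of the whole process. *)
Definition brownian_motion_indep (x0 : O -> 'rV[R]_n)
    (B : R -> {mfun O >-> 'rV[R]_n}) : Prop :=
  [/\ {ae P, forall w, B 0 w = 0 /\
        {within `[0, +oo[%classic, continuous (fun t => B t w)}},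
      forall s t, 0 <= s -> s < t ->
        centered_gaussian (Num.sqrt (t - s)) (fun w => B t w - B s w) &
      forall t : nat -> R, t 0%N = 0 -> {homo t : i j / (i <= j)%N >-> i <= j} ->
        mutually_independent
          (with_initial x0 (fun k w => B (t k.+1) w - B (t k) w))].

(* The noise is additive, so the equation is pathwise:
   X_t = X_0 - int_0^t grad V(X_s) ds + sqrt 2 B_t for all t >= 0. *)
Definition langevin_diffusion (V : 'rV[R]_n -> R)
    (X : R -> {mfun O >-> 'rV[R]_n}) : Prop :=
  exists2 B : R -> {mfun O >-> 'rV[R]_n}, brownian_motion_indep (X 0) B &
    {ae P, forall w,
      {within `[0, +oo[%classic, continuous (fun t => X t w)} /\
      forall t, 0 <= t ->
        X t w = X 0 w
          - \row_i (\int[lebesgue_measure]_(s in `[0%R, t])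
                      grad V (X s w) ord0 i)
          + Num.sqrt 2 *: B t w}.

Definition lmc (V : 'rV[R]_n -> R) (h : R)
    (x : nat -> {mfun O >-> 'rV[R]_n}) : Prop :=
  exists xi : nat -> {mfun O >-> 'rV[R]_n},
    [/\ forall k, centered_gaussian 1 (xi k),
        mutually_independent (with_initial (x 0%N) (fun k => xi k)) &
        forall k w, x k.+1 w =
          x k w - h *: grad V (x k w) + Num.sqrt (2 * h) *: xi k w].

Definition has_law (Z : {mfun O >-> 'rV[R]_n}) (mu : probability 'rV[R]_n R) :
    Prop :=
  forall A, measurable A -> distribution P Z A = mu A.

End processes.

Section student.
Context {R : realType} (d : nat).
Implicit Types (nu q eps r T m : R) (mu : probability 'rV[R]_d R).

Definition V_student nu (x : 'rV[R]_d) : R :=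
  (d%:R + nu) / 2 * ln (1 + enorm x ^+ 2).

Lemma measurable_V_student nu : measurable_fun setT (V_student nu).
Proof.
apply: measurable_funM => //; apply: measurableT_comp => //.
apply: measurable_funD => //; apply: measurable_funX.
exact: measurable_enorm.
Qed.

HB.instance Definition _ nu :=
  isMeasurableFun.Build _ _ _ _ (V_student nu) (measurable_V_student nu).

Definition pi_student nu : probability 'rV[R]_d R := gibbs (V_student nu).

Definition m_student nu : R :=
  2^-1 * inf [set r : R | (pi_student nu [set x | (r <= enorm x)%R] <= (2^-1)%:E)%E].

Definition beta_student nu r : R :=
  2 / nu + 2 * (d%:R / nu + 1) * r `^ (- (2 / nu)).

Definition V_hat nu m T (x : 'rV[R]_d) : R :=
  V_student nu x + (6144 * T)^-1 * Num.max (enorm x - 2 * m) 0 ^+ 2.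

Lemma measurable_V_hat nu m T : measurable_fun setT (V_hat nu m T).
Proof.
apply: measurable_funD; first exact: measurable_V_student.
apply: measurable_funM => //; apply: measurable_funX; apply: measurable_maxr => //.
by apply: measurable_funB => //; exact: measurable_enorm.
Qed.

HB.instance Definition _ nu m T :=
  isMeasurableFun.Build _ _ _ _ (V_hat nu m T) (measurable_V_hat nu m T).

(* Below, fine is applied to divergences that are finite where these quantities
   are used: renyi_infty mu (pi_student nu) < +oo makes every divergence from
   pi_student nu finite; finiteness of renyi 2 mu (pi_hat ...) does not follow
   and is to be assumed. *)
Definition delta0 nu q mu : R :=
  expR ((2 * q - 1) * fine (renyi_infty mu (pi_student nu))).

Definition T_student nu q eps mu : R :=
  (2 * q - 1) *
  (beta_student nu (4 * delta0 nu q mu)^-1 *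
     fine (renyi (2 * q - 1) mu (pi_student nu)) +
   beta_student nu (eps / (8 * delta0 nu q mu)) * ln (2 / eps)).

Definition pi_hat nu q eps mu : probability 'rV[R]_d R :=
  gibbs (V_hat nu (m_student nu) (T_student nu q eps mu)).

Definition lmc_rate nu q eps mu : R :=
  let Rinf := fine (renyi_infty mu (pi_student nu)) in
  let R2q1 := fine (renyi (2 * q - 1) mu (pi_student nu)) in
  let R2hat := fine (renyi 2 mu (pi_hat nu q eps mu)) in
  d%:R ^+ 5 * expR (4 * (2 * q - 1) / nu * Rinf) / eps *
  (R2q1 ^+ 2 + eps^-1 `^ (4 / nu)) *
  Num.max 1 (Num.sqrt (eps * R2hat * Rinf) / d%:R).

(* Every polylogarithmic factor in d, 1/eps and the initial divergences is
   bounded by a constant times a power of log_factor. *)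
Definition log_factor nu q eps mu : R :=
  1 + ln d%:R + ln eps^-1 +
  ln (1 + fine (renyi_infty mu (pi_student nu))) +
  ln (1 + fine (renyi (2 * q - 1) mu (pi_student nu))) +
  ln (1 + fine (renyi 2 mu (pi_hat nu q eps mu))).

End student.

(* Main.v *)
From HB Require Import structures.
From mathcomp Require Import all_boot all_order all_algebra.
From mathcomp Require Import all_classical all_reals all_analysis.
From mathcomp Require Import measurable_realfun.
From mathcomp Require Import ring lra.
Require Import Defs.
Set Implicit Arguments.
Unset Strict Implicit.
Unset Printing Implicit Defensive.
Import Order.TTheory GRing.Theory Num.Theory.
Import numFieldNormedType.Exports.
Local Open Scope classical_set_scope.
Local Open Scope ring_scope.

(** Both parts go through one reversible Markov chain whose step of size h imitates an LMC step. Let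
    [w = wgt c] with [c = (nu/2 + n/2)/2], the square root of the unnormalised Student density, so
    that pi is proportional to w^2. The kernel [chain_kernel h w] moves x to y with density
    proportional to heat_h(x,y) w(y), where heat_h is Gaussian of covariance 2h. Since ln w = -V/2,
    its drift is -h grad V to first order. It is reversible for p proportional to w heat_h(w), which
    differs from pi by a factor at most exp(34 n h c + 2 h c^2).

    Functional inequality. The Student law is a mixture of centered Gaussians of log-scale u, where
    u is the logarithm of a gamma variable of parameter a = nu/2. Each Gaussian satisfies a nonlocal
    Poincare inequality with differences at heat-kernel distance ([local_poincare]), by a discrete
    Maurey-Pisier rotation. The mean of g under the Gaussian of log-scale u varies with u at a rate
    controlled by the variance of g ([scale_derivative_bound]), so Hardy's inequality on the line
    ([hardy]) bounds the variance of the means by the mean of the variances. Scales |u| > U are paid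
    for with the supremum of g and contribute B^2 e^(-aU). The result is [weak_poincare], whose
    constant depends on a only and is linear in n.

    Decay of the chain. By Jensen, one step lowers E f^q by at least the mean local variance of
    f^(q/2) ([chain_step]). By the heat semigroup that mean dominates the nonlocal energy at
    bandwidth 2h ([chain_energy]), and the variance of f^(q/2) is at least E f^q times min(R_q, 1)/2
    ([variance_half_pow]). The bound f <= M is preserved, which keeps the remainder of the weak
    Poincare inequality under control. A moderate U brings R_q linearly below 1; a larger U then
    brings it geometrically below eps ([two_phase_decay]).

    From the chain to LMC. The ratio of the LMC kernel to the chain kernel is, up to normalisation,
    the exponential of a second-order Taylor remainder of -ln w. Its moment of order A + 1 is at
    most exp(1064 n h^2 A^2 c^2) ([lmc_ratio_moment]), again by a rotation argument, and Jensen
    propagates this along N steps ([lmc_compare], [lmc_iter]). For (ii), A = 2q - 1 and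
    Cauchy-Schwarz combine this with the decay of the chain at order 2q - 1 ([lmc_renyi]). The total
    time N h is of order n up to the other factors, c is of order n, and the accumulated error n N
    h^2 c^2 must stay below eps; this forces N of order n^5/eps ([step_size_exists]).

    From LMC to the diffusion. The Euler scheme driven by the increments of B has the law of LMC,
    and its paths converge to X_T because the drift is Lipschitz ([euler_cvg]). With A = 1 the
    chi-square distance between scheme and chain is at most exp(O(T h)) - 1, hence vanishes as h
    does. The chain densities with respect to pi, bounded by 4M uniformly in the number of steps,
    thus converge weakly to the law of X_T; the uniform bound upgrades this to convergence against
    all bounded measurable functions ([limit_test_bounded]), under which R_q is lower semicontinuous
    ([renyi_limit]). *)

(** * Integrals of nonnegative real functions and measurability *)

Section tonelli_real.
Context d1 d2 (T1 : measurableType d1) (T2 : measurableType d2) (R : realType).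

Section one_space.
Variable m : {measure set T1 -> \bar R}.
Implicit Types f g : T1 -> R.

Lemma eint_ge0 f : (forall x, 0 <= f x) -> (0 <= \int[m]_x (f x)%:E)%E.
Proof. by move=> f0; apply: integral_ge0 => x _; rewrite lee_fin. Qed.

Lemma eintZ c f : 0 <= c -> measurable_fun setT f -> (forall x, 0 <= f x) ->
  (\int[m]_x (c * f x)%:E = c%:E * \int[m]_x (f x)%:E)%E.
Proof.
move=> c0 mf f0; rewrite -ge0_integralZl_EFin//.
- by move=> x _; rewrite lee_fin.
- exact/measurable_EFinP.
Qed.

Lemma eintD f g : measurable_fun setT f -> measurable_fun setT g ->
  (forall x, 0 <= f x) -> (forall x, 0 <= g x) ->
  (\int[m]_x (f x + g x)%:E = \int[m]_x (f x)%:E + \int[m]_x (g x)%:E)%E.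
Proof.
move=> mf mg f0 g0; rewrite -ge0_integralD//.
- by move=> x _; rewrite lee_fin.
- exact/measurable_EFinP.
- by move=> x _; rewrite lee_fin.
- exact/measurable_EFinP.
Qed.

Lemma le_eint f g : measurable_fun setT f -> measurable_fun setT g ->
  (forall x, 0 <= f x) -> (forall x, f x <= g x) ->
  (\int[m]_x (f x)%:E <= \int[m]_x (g x)%:E)%E.
Proof.
move=> mf mg f0 fg; apply: ge0_le_integral => //.
- by move=> x _; rewrite lee_fin.
- exact/measurable_EFinP.
- exact/measurable_EFinP.
- by move=> x _; rewrite lee_fin.
Qed.

Lemma eq_eint f g : f =1 g -> (\int[m]_x (f x)%:E = \int[m]_x (g x)%:E)%E.
Proof. by move=> fg; apply: eq_integral => x _; rewrite fg. Qed.

End one_space.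

Variables (m1 : {sigma_finite_measure set T1 -> \bar R})
  (m2 : {sigma_finite_measure set T2 -> \bar R}) (f : T1 -> T2 -> R).
Hypotheses (mf : measurable_fun setT (fun z => f z.1 z.2))
  (f0 : forall x y, 0 <= f x y).

Lemma tonelliE : (\int[m1 \x m2]_z (f z.1 z.2)%:E =
  \int[m1]_x \int[m2]_y (f x y)%:E)%E.
Proof.
rewrite (fubini_tonelli1 (fun z : T1 * T2 => (f z.1 z.2)%:E)) //.
- exact/measurable_EFinP.
- by move=> z; rewrite lee_fin.
Qed.

Lemma tonelli : (\int[m1]_x \int[m2]_y (f x y)%:E =
  \int[m2]_y \int[m1]_x (f x y)%:E)%E.
Proof.
apply: (fubini_tonelli (fun z : T1 * T2 => (f z.1 z.2)%:E)).
- exact/measurable_EFinP.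
- by move=> z; rewrite lee_fin.
Qed.

Lemma measurable_eint : measurable_fun setT (fun x => \int[m2]_y (f x y)%:E)%E.
Proof.
apply: (@measurable_fun_fubini_tonelli_F _ _ _ _ _ m2 (fun z : T1 * T2 => (f z.1 z.2)%:E)).
- exact/measurable_EFinP.
- by move=> z; rewrite lee_fin.
Qed.

End tonelli_real.

Lemma measurable_rvD d (T : measurableType d) (R : realType) n (f g : T -> 'rV[R]_n) :
  measurable_fun setT f -> measurable_fun setT g ->
  measurable_fun setT (fun t => f t + g t).
Proof.
move=> mf mg; apply: measurable_fun_rV => i.
rewrite (_ : (fun _ => _) = (fun t => f t ord0 i + g t ord0 i)); last first.
  by apply/funext => t; rewrite mxE.
apply: measurable_funD.
- exact: (measurableT_comp (measurable_coord i) mf).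
- exact: (measurableT_comp (measurable_coord i) mg).
Qed.

Lemma measurable_rvZ d (T : measurableType d) (R : realType) n (a : T -> R)
    (f : T -> 'rV[R]_n) :
  measurable_fun setT a -> measurable_fun setT f ->
  measurable_fun setT (fun t => a t *: f t).
Proof.
move=> ma mf; apply: measurable_fun_rV => i.
rewrite (_ : (fun _ => _) = (fun t => a t * f t ord0 i)); last first.
  by apply/funext => t; rewrite mxE.
apply: measurable_funM => //.
exact: (measurableT_comp (measurable_coord i) mf).
Qed.

Lemma measurable_rvN d (T : measurableType d) (R : realType) n (f : T -> 'rV[R]_n) :
  measurable_fun setT f -> measurable_fun setT (fun t => - f t).
Proof.
move=> mf; under eq_fun do rewrite -scaleN1r.
exact: measurable_rvZ.
Qed.

(** Inversion is continuous off 0, and at 0 its value is fixed by [invr0]. *)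
Lemma measurable_invr (R : realType) : measurable_fun setT (@GRing.inv R).
Proof.
have -> : (@GRing.inv R : R -> R) = (fun x => if x == 0 then 0 else (@GRing.inv R x)).
  by apply/funext => x; case: ifPn => // /eqP ->; rewrite invr0.
apply: measurable_fun_if => //=.
- exact: measurable_fun_eqr.
- rewrite setTI (_ : _ @^-1` _ = ~` [set 0 : R]); last first.
    by apply/seteqP; split => x /=; [move=> /negbT/eqP | move=> /eqP/negbTE].
  apply: open_continuous_measurable_fun.
    by rewrite openC; apply: accessible_closed_set1; apply: hausdorff_accessible; exact: norm_hausdorff.
  by move=> x; rewrite inE/= => /eqP; exact: inv_continuous.
Qed.

(** Recursion on the shape of the function. A joint measurability hypothesis on [g z.1 z.2] or
    [g z.2 z.1] is used by composing with a pair. *)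
Ltac meas := repeat (first
  [ assumption
  | exact: measurable_cst
  | exact: measurable_id
  | exact: measurable_fst
  | exact: measurable_snd
  | exact: measurable_coord
  | exact: measurable_enorm
  | exact: measurable_funP
  | match goal with
    | H : measurable_fun setT (fun z => ?g z.1 z.2)
        |- @measurable_fun _ _ ?T _ _ (fun x => ?g (@?h x) (@?k x)) =>
        refine (@measurableT_comp _ _ _ T _ _ _ setT
          (fun x : Measurable.sort T => (h x, k x)) H _)
    | H : measurable_fun setT (fun z => ?g z.2 z.1)
        |- @measurable_fun _ _ ?T _ _ (fun x => ?g (@?h x) (@?k x)) =>
        refine (@measurableT_comp _ _ _ T _ _ _ setT
          (fun x : Measurable.sort T => (k x, h x)) H _)
    | |- measurable_fun _ (fun x => expR (@?h x)) =>
        apply: (measurableT_comp (@measurable_expR _) (g := h))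
    | |- measurable_fun _ (fun x => ln (@?h x)) =>
        apply: (measurableT_comp (@measurable_ln _) (g := h))
    | |- measurable_fun _ (fun x => enorm (@?h x)) =>
        apply: (measurableT_comp (@measurable_enorm _ _) (g := h))
    | |- measurable_fun _ (fun x => (@?h x) `^ ?p) =>
        apply: (measurableT_comp (@measurable_powR _ p) (g := h))
    | |- measurable_fun _ (fun x => (@?h x)^-1) =>
        apply: (measurableT_comp (@measurable_invr _) (g := h))
    | |- measurable_fun _ (fun x => fine (@?h x)) =>
        apply: (measurableT_comp (@fine_measurable _ setT measurableT) (g := h))
    | |- measurable_fun _ (fun x => (@?h x)%:E) => apply/measurable_EFinP
    | |- measurable_fun _ (fun x => \int[?m]_y (@?f x y)%:E)%E =>
        apply: (measurable_eint m (f := f))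
    | |- measurable_fun _ (fun x => fun_of_matrix (@?h x) ord0 ?i) =>
        apply: (measurableT_comp (measurable_coord i) (g := h))
    | |- measurable_fun _ (fun x => (@?h x, @?k x)) => apply: measurable_fun_pair
    | |- measurable_fun _ (fun x => Num.max (@?h x) (@?k x)) => apply: measurable_maxr
    | |- measurable_fun _ (fun x => `|@?h x|) =>
        apply: (measurableT_comp (@normr_measurable _ setT) (g := h))
    | |- measurable_fun _ (fun x => (@?h x) ^+ ?n) => apply: measurable_funX
    | |- measurable_fun _ (fun x => @?h x - @?k x) => apply: measurable_funB
    | |- measurable_fun _ (fun x => @?h x + @?k x) =>
        first [apply: measurable_funD | apply: measurable_rvD]
    | |- measurable_fun _ (fun x => - @?k x) =>
        first [apply: (measurableT_comp (@oppr_measurable _ setT) (g := k)) | apply: measurable_rvN]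
    | |- measurable_fun _ (fun x => @?h x * @?k x) => apply: measurable_funM
    | |- measurable_fun _ (fun x => @?h x *: @?k x) => apply: measurable_rvZ
    | |- measurable_fun _ (fun x => fst (@?h x)) =>
        apply: (measurableT_comp measurable_fst (g := h))
    | |- measurable_fun _ (fun x => snd (@?h x)) =>
        apply: (measurableT_comp measurable_snd (g := h))
    | H : measurable_fun setT ?g |- measurable_fun _ (fun x => ?g (@?h x)) =>
        apply: (measurableT_comp H (g := h))
    end
  | exact: measurable_funP
  | apply: measurable_sum => ? /= ]).

(** The Lebesgue measure lives on [measurableTypeR R], an alias convertible to [R]; the four casts
    here restate measurability on the alias. *)
Lemma measurable_lebR (R : realType) d (T : measurableType d) (f : R -> T) :
  measurable_fun setT f -> measurable_fun setT (f : measurableTypeR R -> T).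
Proof. exact. Qed.

Lemma measurable_prodlebR (R : realType) d (T : measurableType d) d' (U : measurableType d')
    (f : (T * R)%type -> U) : measurable_fun setT f ->
  measurable_fun setT (f : (T * measurableTypeR R)%type -> U).
Proof. exact. Qed.

Lemma measurable_lebRprod (R : realType) d (T : measurableType d) d' (U : measurableType d')
    (f : (R * T)%type -> U) : measurable_fun setT f ->
  measurable_fun setT (f : (measurableTypeR R * T)%type -> U).
Proof. exact. Qed.

Lemma measurable_lebRlebR (R : realType) d' (U : measurableType d')
    (f : (R * R)%type -> U) : measurable_fun setT f ->
  measurable_fun setT (f : (measurableTypeR R * measurableTypeR R)%type -> U).
Proof. exact. Qed.


(** * Lebesgue measure, Gaussian integrals and rotations *)

Section lebesgue_line.
Context {R : realType}.
Notation lam := (@lebesgue_measure R).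

(** Lebesgue measure is determined by its values on half-open intervals, and a translation keeps
    their length. *)
Lemma lebesgue_translation (a : R) (f : R -> \bar R) :
  measurable_fun setT f -> (forall x, (0 <= f x)%E) ->
  (\int[lam]_x f (x + a)%R = \int[lam]_x f x)%E.
Proof.
move=> mf f0.
pose phi : measurableTypeR R -> measurableTypeR R := fun x => x + a.
have mD : measurable_fun setT phi.
  have : measurable_fun setT (fun x : R => x + a) by meas.
  exact.
transitivity (\int[pushforward lam phi]_x f x)%E.
  by rewrite ge0_integral_pushforward.
apply: eq_measure_integral => A mA _.
apply/esym; apply: lebesgue_measure_unique => // X [[u v] _ <-].
change (lam [set` `]u, v]%R] = lam (phi @^-1` [set` `]u, v]%R])).
rewrite (_ : phi @^-1` _ = [set` `]u - a, v - a]%R])%classic; last first.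
  by apply/seteqP; split => x /=; rewrite !in_itv/= ltrBlDr lerBrDr.
by rewrite !lebesgue_measure_itv/= !lte_fin ltrD2r -!EFinB opprB addrA subrK.
Qed.

Lemma lebesgue_scaling (c : R) (f : R -> \bar R) : 0 < c ->
  measurable_fun setT f -> (forall x, (0 <= f x)%E) ->
  (\int[lam]_x f x = c%:E * \int[lam]_x f (c * x)%R)%E.
Proof.
move=> c0 mf f0.
pose phi : measurableTypeR R -> measurableTypeR R := fun x => c * x.
have mD : measurable_fun setT phi.
  have : measurable_fun setT (fun x : R => c * x) by meas.
  exact.
transitivity (c%:E * \int[pushforward lam phi]_x f x)%E; last first.
  by rewrite ge0_integral_pushforward.
rewrite -(@ge0_integral_mscale _ _ _ _ _ _ (NngNum (ltW c0)))//.
apply: eq_measure_integral => A mA _.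
apply: lebesgue_measure_unique => // X [[u v] _ <-].
change (lam [set` `]u, v]%R] = c%:E * lam (phi @^-1` [set` `]u, v]%R]))%E.
rewrite (_ : phi @^-1` _ = [set` `]u / c, v / c]%R])%classic; last first.
  by apply/seteqP; split => x /=; rewrite !in_itv/= ltr_pdivrMr// ler_pdivlMr// ![x * _]mulrC.
rewrite !lebesgue_measure_itv/= !lte_fin ltr_pM2r ?invr_gt0//.
case: ifP => _; last by rewrite mule0.
by rewrite -!EFinB -EFinM -mulrBl mulrC divfK ?gt_eqF.
Qed.

Lemma gauss_int1 (s : R) : 0 < s ->
  (\int[lam]_x (expR (- (s * x ^+ 2)))%:E = (Num.sqrt (pi / s))%:E)%E.
Proof.
(* The standard deviation for which the normal density is proportional to exp(-s x^2). *)
move=> s0; pose sg := Num.sqrt ((2 * s)^-1).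
have sg2 : sg ^+ 2 = (2 * s)^-1 by rewrite sqr_sqrtr// invr_ge0 mulr_ge0// ltW.
have sg0 : sg != 0 by rewrite gt_eqF// sqrtr_gt0 invr_gt0 mulr_gt0.
have pk : normal_peak sg = (Num.sqrt (pi / s))^-1.
  congr (Num.sqrt _)^-1; rewrite sg2 -mulr_natr; field; lra.
have Hs : 0 < Num.sqrt (pi / s) by rewrite sqrtr_gt0 divr_gt0 ?pi_gt0.
have := integral_normal_pdf 0 sg; rewrite normal_pdfE// => H.
rewrite -[RHS]mule1 -H -eintZ ?ltW//; last 2 first.
- have := measurable_normal_pdf 0 sg; by rewrite normal_pdfE.
- by move=> x; have := normal_pdf_ge0 0 sg x; rewrite normal_pdfE.
apply: eq_eint => x.
rewrite /= pk mulVKf ?gt_eqF// /normal_fun subr0 sg2.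
congr expR; rewrite -mulNr -mulr_natr; field; lra.
Qed.

End lebesgue_line.

Section euclid.
Context {R : realType} {n : nat}.
Implicit Types x y z : 'rV[R]_n.

Definition dot x y := \sum_i x ord0 i * y ord0 i.

Lemma dotC x y : dot x y = dot y x.
Proof. by apply: eq_bigr => i _; rewrite mulrC. Qed.

Lemma dotDl x y z : dot (x + y) z = dot x z + dot y z.
Proof. by rewrite -big_split; apply: eq_bigr => i _; rewrite mxE mulrDl. Qed.

Lemma dotDr x y z : dot x (y + z) = dot x y + dot x z.
Proof. by rewrite ![dot x _]dotC dotDl. Qed.

Lemma dotZl a x z : dot (a *: x) z = a * dot x z.
Proof. by rewrite mulr_sumr; apply: eq_bigr => i _; rewrite mxE mulrA. Qed.

Lemma dotZr a x z : dot x (a *: z) = a * dot x z.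
Proof. by rewrite ![dot x _]dotC dotZl. Qed.

Lemma dotNl x z : dot (- x) z = - dot x z.
Proof. by rewrite -scaleN1r dotZl mulN1r. Qed.

Lemma dotNr x z : dot x (- z) = - dot x z.
Proof. by rewrite ![dot x _]dotC dotNl. Qed.

Lemma dot0l x : dot 0 x = 0.
Proof. by rewrite -(scale0r x) dotZl mul0r. Qed.

Definition dotE := (dotDl, dotDr, dotZl, dotZr, dotNl, dotNr).

Lemma enorm2 x : enorm x ^+ 2 = dot x x.
Proof.
rewrite sqr_sqrtr; last by apply: sumr_ge0 => i _; exact: sqr_ge0.
by apply: eq_bigr => i _; rewrite expr2.
Qed.

Lemma dot_ge0 x : 0 <= dot x x.
Proof. by rewrite -enorm2 sqr_ge0. Qed.

Lemma enorm_ge0 x : 0 <= enorm x. Proof. exact: sqrtr_ge0. Qed.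

Lemma dot_cauchy x y : dot x y ^+ 2 <= dot x x * dot y y.
Proof.
have h t : 0 <= dot x x - 2 * t * dot x y + t ^+ 2 * dot y y.
  have := dot_ge0 (x - t *: y); rewrite !dotE (dotC y x); lra.
have [y0|y0] := eqVneq (dot y y) 0.
  rewrite y0 mulr0; have [->|xy0] := eqVneq (dot x y) 0; first by rewrite expr0n.
  (* When y has norm 0 the quadratic in t is affine; at this t it takes the value -1. *)
  have := h ((dot x x + 1) / (2 * dot x y)).
  rewrite y0 mulr0 addr0 (_ : 2 * _ * _ = dot x x + 1); last by field.
  lra.
have yp : 0 < dot y y by rewrite lt_neqAle eq_sym y0 dot_ge0.
have := h (dot x y / dot y y).
rewrite (_ : _ + _ = (dot x x * dot y y - dot x y ^+ 2) / dot y y); last by field.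
by rewrite pmulr_lge0 ?invr_gt0// subr_ge0.
Qed.

Lemma dot_young x y e : 0 < e -> `|dot x y| <= e * dot x x + dot y y / (4 * e).
Proof.
move=> e0; rewrite ler_norml.
have := dot_ge0 ((2 * e) *: x + y); have := dot_ge0 ((2 * e) *: x - y).
rewrite !dotE (dotC y x) => h1 h2; apply/andP; split.
  have : 0 <= ((2 * e) * (2 * e * dot x x + dot x y) + (2 * e * dot x y + dot y y)) / (4 * e).
    by apply: divr_ge0; lra.
  rewrite (_ : _ / _ = e * dot x x + dot y y / (4 * e) + dot x y); last by field; lra.
  lra.
have : 0 <= ((2 * e) * (2 * e * dot x x - dot x y) + - (2 * e * dot x y - dot y y)) / (4 * e).
  by apply: divr_ge0; lra.
rewrite (_ : _ / _ = e * dot x x + dot y y / (4 * e) - dot x y); last by field; lra.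
lra.
Qed.

Lemma measurable_dot d (T : measurableType d) (f g : T -> 'rV[R]_n) :
  measurable_fun setT f -> measurable_fun setT g ->
  measurable_fun setT (fun t => dot (f t) (g t)).
Proof. by move=> mf mg; rewrite /dot; meas. Qed.

End euclid.

Ltac meas2 := repeat (meas; try match goal with
  | |- measurable_fun _ (fun x => dot (@?h x) (@?k x)) => apply: measurable_dot
  end).

Section lebesgue_space.
Context {R : realType}.

(** A name of its own for the fixpoint [lebesgue_rV], to which the sigma-finite structure required
    by Tonelli can be attached for every [n]. *)
Definition leb n : set 'rV[R]_n -> \bar R := lebesgue_rV n.
Arguments leb n _ : clear implicits.

HB.instance Definition _ n := isMeasure.Build _ _ _ (leb n)
  (measure0 (lebesgue_rV n)) (measure_ge0 (lebesgue_rV n))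
  (@measure_semi_sigma_additive _ _ _ (lebesgue_rV n)).

Definition uncons n (x : 'rV[R]_n.+1) : ('rV[R]_n * R)%type :=
  (@rsubmx _ 1 1 n x, x ord0 ord0).

Lemma measurable_uncons n : measurable_fun setT (@uncons n).
Proof.
apply: measurable_fun_pair; last exact: measurable_coord.
apply: measurable_fun_rV => i.
rewrite (_ : (fun _ => _) = (fun x : 'rV[R]_n.+1 => x ord0 (@rshift 1 n i))).
  exact: measurable_coord.
by apply/funext => x; rewrite mxE.
Qed.

Lemma consrVK n : cancel (@consrV R n) (@uncons n).
Proof.
move=> [x t]; rewrite /uncons /consrV /=; congr pair.
  exact: row_mxKr.
have -> : (ord0 : 'I_n.+1) = @lshift 1 n ord0 by apply/val_inj.
by rewrite (@row_mxEl _ 1 1 n) mxE.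
Qed.

Lemma unconsK n : cancel (@uncons n) (@consrV R n).
Proof.
move=> x; rewrite /uncons /consrV /= -[RHS](@hsubmxK _ 1 1 n).
apply: (congr1 (fun u => @row_mx _ 1 1 n u _)).
apply/rowP => i; rewrite !mxE; congr (x _ _); apply/val_inj => /=.
by rewrite (ord1 i).
Qed.

Lemma leb_sigma_finite n : sigma_finite setT (leb n).
Proof.
elim: n => [|n [F FT mF]].
  exists (fun=> setT) => [|i].
    by apply/seteqP; split => // x _; exists 0%N.
  by split => //; rewrite /leb/= diracT ltry.
have /sigma_finiteP[F' [F'T ndF' F'oo]] : sigma_finite setT (leb n) by exists F.
have /sigma_finiteP[G' [G'T ndG' G'oo]] := sigma_finiteT (@lebesgue_measure R).
exists (fun i => @uncons n @^-1` (F' i `*` G' i)).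
  apply/seteqP; split => // x _.
  have : setT (uncons x).1 by []; rewrite F'T => -[i _ Fi].
  have : setT (uncons x).2 by []; rewrite G'T => -[j _ Gj].
  exists (maxn i j) => //; split.
    by move: Fi; exact/subsetPset/ndF'/leq_maxl.
  by move: Gj; exact/subsetPset/ndG'/leq_maxr.
move=> i; have [mFi Fi] := F'oo i; have [mGi Gi] := G'oo i; split.
  rewrite -[X in measurable X]setTI; apply: measurable_uncons => //.
  exact: measurableX.
change ((leb n \x lebesgue_measure) (@consrV R n @^-1` (@uncons n @^-1` (F' i `*` G' i))) < +oo)%E.
rewrite (_ : @consrV R n @^-1` _ = F' i `*` G' i); last first.
  by apply/seteqP; split => z; rewrite /preimage/mkset consrVK.
by rewrite product_measure1E// lte_mul_pinfty// ge0_fin_numE.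
Qed.

HB.instance Definition _ n := Measure_isSigmaFinite.Build _ _ _ (leb n) (@leb_sigma_finite n).

Lemma int_lebS n (f : 'rV[R]_n.+1 -> \bar R) : measurable_fun setT f ->
  (forall x, 0 <= f x)%E ->
  (\int[leb n.+1]_x f x =
   \int[leb n]_x \int[lebesgue_measure]_t f (consrV (x, t)))%E.
Proof.
move=> mf f0; have mfc : measurable_fun setT (f \o @consrV R n).
  exact: measurableT_comp (@measurable_consrV _ _).
have f0' z : (0 <= (f \o @consrV R n) z)%E by exact: f0.
transitivity (\int[leb n \x @lebesgue_measure R]_z (f \o @consrV R n) z)%E; last first.
  exact: (@fubini_tonelli1 _ _ _ _ _ (leb n) (@lebesgue_measure R) (f \o @consrV R n) mfc f0').
have mc : measurable_fun setT
  (@consrV R n : ('rV[R]_n * measurableTypeR R)%type -> 'rV[R]_n.+1).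
  exact: measurable_consrV.
have := @ge0_integral_pushforward _ _ _ _ _ _ mc (leb n \x lebesgue_measure)%E setT f measurableT mf.
by rewrite preimage_setT; apply=> y _; exact: f0.
Qed.

Lemma leb_translation n (a : 'rV[R]_n) (f : 'rV[R]_n -> \bar R) :
  measurable_fun setT f -> (forall x, 0 <= f x)%E ->
  (\int[leb n]_x f (x + a)%R = \int[leb n]_x f x)%E.
Proof.
elim: n a f => [|n IH] a f mf f0.
  by apply: eq_integral => x _; rewrite !(thinmx0 (_ + _)) (thinmx0 x).
have mfa : measurable_fun setT (fun x : 'rV[R]_n.+1 => f (x + a)) by meas.
rewrite !int_lebS//.
pose g x := (\int[lebesgue_measure]_t f (consrV (x, t)))%E.
rewrite -(IH (uncons a).1 g); last 2 first.
- apply: (@measurable_fun_fubini_tonelli_F _ _ _ _ _ lebesgue_measure (f \o @consrV _ n)).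
    exact: measurableT_comp (@measurable_consrV _ _).
  by move=> x; exact: f0.
- by move=> x; rewrite /g; apply: integral_ge0 => t _; exact: f0.
apply: eq_integral => x _; rewrite /g.
rewrite -(lebesgue_translation (uncons a).2 (f := fun t => f (consrV (x + (uncons a).1, t)))) //.
  apply: eq_integral => t _; congr f; rewrite -{1}(unconsK a) /consrV/=.
  rewrite [LHS](@add_row_mx _ 1 1 n); apply: (f_equal2 (@row_mx _ 1 1 n)) => //.
  by apply/rowP => i; rewrite !mxE.
apply: (measurableT_comp mf).
apply: (measurableT_comp (@measurable_consrV _ _)).
by apply: measurable_fun_pair.
Qed.

Lemma dot_consrV n (x y : 'rV[R]_n) t u :
  dot (consrV (x, t)) (consrV (y, u)) = t * u + dot x y.
Proof.
rewrite /dot /consrV/= (@big_split_ord _ _ _ 1 n) big_ord1/=; congr (_ + _).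
  by rewrite !(@row_mxEl _ 1 1 n) !mxE.
by apply: eq_bigr => i _; rewrite !(@row_mxEr _ 1 1 n).
Qed.

Lemma gauss_int n (s : R) : 0 < s ->
  (\int[leb n]_x (expR (- (s * dot x x)))%:E = (Num.sqrt (pi / s) ^+ n)%:E)%E.
Proof.
move=> s0; elim: n => [|n IH].
  rewrite [LHS](@integral_dirac _ _ (0 : 'rV[R]_0) R)//; last by apply/measurable_EFinP; meas2.
  rewrite diracT mul1e /dot big_ord0.
  by rewrite mulr0 oppr0 expR0.
rewrite int_lebS; last 2 first.
- by apply/measurable_EFinP; meas2.
- by move=> x; rewrite lee_fin expR_ge0.
have H x : (\int[lebesgue_measure]_t
    (expR (- (s * dot (consrV (x, t)) (consrV (x, t)))))%:E =
    (Num.sqrt (pi / s) * expR (- (s * dot x x)))%:E)%E.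
  under eq_integral => t _ do
    rewrite dot_consrV mulrDr opprD expRD mulrC -expr2.
  rewrite eintZ ?expR_ge0//; last by refine (measurable_lebR _); meas.
  by rewrite gauss_int1// -EFinM mulrC.
under eq_integral do rewrite H.
rewrite eintZ ?sqrtr_ge0//; last by meas2.
by rewrite IH -EFinM exprS.
Qed.

(** Completing the square: the translation by b/(2s) removes the linear term. *)
Lemma gauss_lin n (s : R) (b : 'rV[R]_n) : 0 < s ->
  (\int[leb n]_x (expR (- (s * dot x x) + dot b x))%:E =
   (Num.sqrt (pi / s) ^+ n * expR (dot b b / (4 * s)))%:E)%E.
Proof.
move=> s0.
rewrite -(leb_translation ((2 * s)^-1 *: b) (f := fun x => (expR (- (s * dot x x) + dot b x))%:E)); last 2 first.
- by apply/measurable_EFinP; meas2.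
- by move=> x; rewrite lee_fin expR_ge0.
rewrite (mulrC (Num.sqrt _ ^+ n)) EFinM -gauss_int// -eintZ ?expR_ge0//; last by meas2.
apply: eq_eint => x; rewrite -expRD; congr expR.
rewrite !dotE (dotC b x); field; lra.
Qed.

End lebesgue_space.
Arguments leb {R} n _.


Section rotations.
Context {R : realType}.

Lemma leb_scaling n (c : R) (f : 'rV[R]_n -> \bar R) : 0 < c ->
  measurable_fun setT f -> (forall x, 0 <= f x)%E ->
  (\int[leb n]_x f x = (c ^+ n)%:E * \int[leb n]_x f (c *: x))%E.
Proof.
move=> c0; elim: n f => [|n IH] f mf f0.
  rewrite expr0 mul1e; apply: eq_integral => x _.
  by rewrite (thinmx0 (_ *: _)) (thinmx0 x).
have mfc : measurable_fun setT (fun x : 'rV[R]_n.+1 => f (c *: x)) by meas.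
rewrite !int_lebS//.
have mfk : measurable_fun setT (f \o @consrV R n).
  exact: measurableT_comp (@measurable_consrV _ _).
pose g x := (\int[lebesgue_measure]_t f (consrV (x, t)))%E.
have mg : measurable_fun setT g.
  apply: (@measurable_fun_fubini_tonelli_F _ _ _ _ _ lebesgue_measure (f \o @consrV _ n)) => //.
  by move=> z; exact: f0.
have g0 x : (0 <= g x)%E by apply: integral_ge0 => t _; exact: f0.
have ccons x t : consrV (c *: x, c * t) = c *: (consrV (x, t) : 'rV[R]_n.+1).
  rewrite /consrV/= [RHS](@scale_row_mx _ 1 1 n).
  apply: (f_equal2 (@row_mx _ 1 1 n)) => //.
  by apply/rowP => i; rewrite !mxE.
have Hg x : (g (c *: x) = c%:E * \int[lebesgue_measure]_t f (c *: (consrV (x, t) : 'rV[R]_n.+1)))%E.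
  rewrite /g (lebesgue_scaling c0 (f := fun t => f (consrV (c *: x, t)))) //.
    by congr *%E; apply: eq_integral => t _; rewrite ccons.
  apply: (measurableT_comp mfk (g := fun t : R => (c *: x, t))).
  by apply: measurable_fun_pair.
rewrite [LHS](IH g)// exprSr EFinM -muleA; congr *%E.
under eq_integral do rewrite Hg.
have mi : measurable_fun setT
    (fun x => \int[lebesgue_measure]_t f (c *: (consrV (x, t) : 'rV[R]_n.+1)))%E.
  apply: (@measurable_fun_fubini_tonelli_F _ _ _ _ _ lebesgue_measure (fun z => f (c *: (consrV z : 'rV[R]_n.+1)))).
    exact: (measurableT_comp mfc (@measurable_consrV _ _)).
  by move=> z; exact: f0.
rewrite ge0_integralZl//; first by move=> x _; apply: integral_ge0 => t _; exact: f0.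
by rewrite lee_fin ltW.
Qed.

Context {n : nat}.
Implicit Type F : 'rV[R]_n -> 'rV[R]_n -> R.

Lemma shear_r t F : measurable_fun setT (fun z => F z.1 z.2) -> (forall x y, 0 <= F x y) ->
  (\int[leb n]_x \int[leb n]_y (F x (y + t *: x))%:E =
   \int[leb n]_x \int[leb n]_y (F x y)%:E)%E.
Proof.
move=> mF F0; apply: eq_integral => x _.
apply: (leb_translation (t *: x) (f := fun y => (F x y)%:E)).
  apply/measurable_EFinP; exact: (measurableT_comp mF (pair1_measurable x)).
by move=> y; rewrite lee_fin.
Qed.

Lemma shear_l t F : measurable_fun setT (fun z => F z.1 z.2) -> (forall x y, 0 <= F x y) ->
  (\int[leb n]_x \int[leb n]_y (F (x + t *: y) y)%:E =
   \int[leb n]_x \int[leb n]_y (F x y)%:E)%E.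
Proof.
move=> mF F0.
rewrite (tonelli (leb n) (leb n) (f := fun x y => F (x + t *: y) y))//; last by meas.
rewrite (shear_r t (F := fun x y => F y x))//; last by meas.
by rewrite (tonelli (leb n) (leb n) (f := F)).
Qed.

(* The rotation is the product of three shears. *)
Lemma rotation_invariance (c s k : R) F : c ^+ 2 + s ^+ 2 = 1 -> s != 0 -> k != 0 ->
  measurable_fun setT (fun z => F z.1 z.2) -> (forall x y, 0 <= F x y) ->
  (\int[leb n]_x \int[leb n]_y
     (F (c *: x + (s * k) *: y)%R (- (s / k) *: x + c *: y)%R)%:E =
   \int[leb n]_x \int[leb n]_y (F x y)%:E)%E.
Proof.
move=> cs s0 k0 mF F0.
(* [k] times the tangent of the half-angle. The rotation is the shear by [t], the shear by -s/k, and
   the shear by [t] again. *)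
pose t := k * (1 - c) / s.
pose H1 (x y : 'rV[R]_n) := F (x + t *: y) y.
have mH1 : measurable_fun setT (fun z => H1 z.1 z.2) by rewrite /H1; meas.
pose H2 (x y : 'rV[R]_n) := H1 x (y + (- (s / k)) *: x).
have mH2 : measurable_fun setT (fun z => H2 z.1 z.2) by rewrite /H2; meas.
transitivity (\int[leb n]_x \int[leb n]_y (H1 x y)%:E)%E; last exact: (shear_l t mF F0).
have H10 x y : 0 <= H1 x y by exact: F0.
have H20 x y : 0 <= H2 x y by exact: H10.
transitivity (\int[leb n]_x \int[leb n]_y (H2 x y)%:E)%E; last exact: (shear_r (- (s / k)) mH1 H10).
transitivity (\int[leb n]_x \int[leb n]_y (H2 (x + t *: y)%R y)%:E)%E; last exact: (shear_l t mH2 H20).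
apply: eq_integral => x _; apply: eq_eint => y; rewrite /H2 /H1.
have k' : (s / k) * t = 1 - c by rewrite /t; field; rewrite s0 k0.
have k'' : t * (1 + c) = s * k.
  have s2 : (1 - c) * (1 + c) = s ^+ 2 by rewrite -[in RHS](subrK (c^+2) (s^+2)); lra.
  by rewrite /t; apply: (mulIf s0); rewrite -[LHS]mulrAC divfK// -!mulrA s2; ring.
congr F; apply/rowP => i; rewrite !mxE.
  have -> : c = 1 - s / k * t by rewrite k'; ring.
  have <- : t * (2 - s / k * t) = s * k by rewrite k' -k''; ring.
  ring.
have -> : c = 1 - s / k * t by rewrite k'; ring.
ring.
Qed.

End rotations.


(** * A rotation argument and a nonlocal Poincare inequality for Gaussians *)

Section maurey_pisier.
Context {R : realType} {n : nat}.

(** Maurey-Pisier without derivatives. Turning x into y through N equal angles writes g x - g y as a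
    sum of N increments. Convexity, given here by supporting lines, bounds [Psi] of the sum by the
    average of [Psi] of N times each increment, and rotation invariance of the Gaussian weight makes
    the N terms equal. No regularity of [g] is used beyond measurability. *)
Lemma discrete_maurey_pisier (Psi : R -> R) (N : nat) (s th : R) (g : 'rV[R]_n -> R) :
  measurable_fun setT Psi -> (forall u, 0 <= Psi u) ->
  (forall m, exists l, forall v, Psi m + l * (v - m) <= Psi v) ->
  measurable_fun setT g ->
  (0 < N)%N -> th = pi / (2 * N%:R) ->
  (\int[leb n]_x \int[leb n]_y
     (Psi (g x - g y) * expR (- (s * (dot x x + dot y y))))%:E <=
   ((sin th)^-1 ^+ n)%:E * \int[leb n]_x \int[leb n]_y
     (Psi (N%:R * (g x - g (cos th *: x + y)%R)) *
      expR (- (s * (dot x x + (sin th)^-2 * dot y y))))%:E)%E.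
Proof.
move=> mPsi Psi0 cPsi mg N0 thE.
have Np : 0 < N%:R :> R by rewrite ltr0n.
have N1 : 1 <= N%:R :> R by rewrite ler1n.
have th0 : 0 < th by rewrite thE divr_gt0 ?pi_gt0// mulr_gt0.
have thpi i : (i <= N)%N -> i%:R * th <= pi / 2.
  move=> iN; rewrite thE -[leRHS]mul1r.
  rewrite (_ : i%:R * _ = (i%:R / N%:R) * (pi / 2)); last by field; rewrite gt_eqF.
  by rewrite ler_wpM2r ?divr_ge0 ?pi_ge0// ler_pdivrMr// mul1r ler_nat.
have sinp i : (0 < i)%N -> (i <= N)%N -> 0 < sin (i%:R * th).
  move=> i0 iN; apply: sin_gt0_pi; apply/andP; split.
    by rewrite mulr_gt0// ltr0n.
  by rewrite (le_lt_trans (thpi _ iN))// ltr_pdivrMr// ltr_pMr ?pi_gt0// ltr1n.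
have sth : 0 < sin th by have := sinp 1%N isT N0; rewrite mul1r.
have Nth : N%:R * th = pi / 2 by rewrite thE; field; rewrite gt_eqF.
pose k := (sin th)^-1; have k0 : 0 < k by rewrite invr_gt0.
pose X i (x y : 'rV[R]_n) := cos (i%:R * th) *: x + (sin (i%:R * th) * k) *: y.
pose Y i (x y : 'rV[R]_n) := (- (sin (i%:R * th) / k)) *: x + cos (i%:R * th) *: y.
have XS i x y : X i.+1 x y = cos th *: X i x y + Y i x y.
  have E : i.+1%:R * th = i%:R * th + th by rewrite -natr1 mulrDl mul1r.
  apply/rowP => j; rewrite !mxE E cosD sinD /k; field; lra.
have X0 x y : X 0%N x y = x by rewrite /X mul0r cos0 sin0 mul0r scale0r addr0 scale1r.
have XN x y : X N x y = k *: y.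
  by rewrite /X Nth cos_pihalf sin_pihalf scale0r add0r mul1r.
pose W (x y : 'rV[R]_n) := expR (- (s * (dot x x + k ^+ 2 * dot y y))).
have mW : measurable_fun setT (fun z => W z.1 z.2) by rewrite /W; meas2.
have WXY i x y : W (X i x y) (Y i x y) = W x y.
  rewrite /W; congr expR; congr (- (s * _)).
  have cs := cos2Dsin2 (i%:R * th); rewrite /X /Y !dotE (dotC y x).
  set c := cos _ in cs *; set si := sin _ in cs *.
  have kk : k / k = 1 by rewrite divff// gt_eqF.
  transitivity ((c ^+ 2 + si ^+ 2 * (k/k)^+2) * dot x x + (c^+2 + si ^+2) * (k^+2 * dot y y)
     + 2 * c * si * k * (1 - (k / k)) * dot x y); first by ring.
  by rewrite kk expr1n mulr1 cs subrr mulr0 mul0r addr0 !mul1r.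
pose Q (x y : 'rV[R]_n) := Psi (N%:R * (g x - g (cos th *: x + y))) * W x y.
have mQ : measurable_fun setT (fun z => Q z.1 z.2) by rewrite /Q; meas.
have Q0 x y : 0 <= Q x y by rewrite mulr_ge0// expR_ge0.
have mX i : measurable_fun setT (fun z => X i z.1 z.2) by rewrite /X; meas.
have mY i : measurable_fun setT (fun z => Y i z.1 z.2) by rewrite /Y; meas.
have rotQ i : (i < N)%N -> (\int[leb n]_x \int[leb n]_y (Q (X i x y) (Y i x y))%:E =
    \int[leb n]_x \int[leb n]_y (Q x y)%:E)%E.
  case: i => [|i] iN.
    apply: eq_integral => x _; apply: eq_eint => y; rewrite X0 /Y.
    by rewrite mul0r sin0 mul0r oppr0 scale0r add0r cos0 scale1r.
  rewrite -(rotation_invariance (cos2Dsin2 (i.+1%:R * th)) _ (lt0r_neq0 k0) mQ)//.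
  by rewrite gt_eqF// sinp// ltnW.
have pw x y : Psi (g x - g (k *: y)) * W x y <=
    \sum_(i < N) N%:R^-1 * Q (X i x y) (Y i x y).
  pose u i := g (X i x y) - g (X i.+1 x y).
  have tele : g x - g (k *: y) = \sum_(i < N) u i.
    rewrite -(big_mkord xpredT) -[LHS]opprB -(XN x y) -{2}(X0 x y).
    rewrite -(telescope_sumr (fun i => g (X i x y)) (leq0n N)) -sumrN.
    by apply: eq_bigr => i _; rewrite opprB.
  have [l Hl] := cPsi (g x - g (k *: y)); set m := g x - g (k *: y) in tele Hl *.
  (* The supporting line at [m], averaged over the N scaled increments: their mean is [m], so the
     linear terms cancel. *)
  have J : Psi m <= \sum_(i < N) N%:R^-1 * Psi (N%:R * u i).
    rewrite -mulr_sumr ler_pdivlMl//.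
    apply: (@le_trans _ _ (\sum_(i < N) (Psi m + l * (N%:R * u i - m)))); last exact: ler_sum.
    rewrite big_split/= sumr_const card_ord -mulr_sumr sumrB -mulr_sumr -tele.
    by rewrite sumr_const card_ord -[m *+ N]mulr_natl subrr mulr0 addr0 mulr_natl.
  have W0 : 0 <= W x y by exact: expR_ge0.
  apply: le_trans (ler_wpM2r W0 J) _; rewrite mulr_suml.
  by apply: ler_sum => i _; rewrite /Q WXY -XS mulrA.
have mL : measurable_fun setT (fun z : ('rV[R]_n * 'rV[R]_n)%type =>
   Psi (g z.1 - g (k *: z.2)) * W z.1 z.2) by meas.
have mS i : measurable_fun setT (fun z : ('rV[R]_n * 'rV[R]_n)%type =>
   N%:R^-1 * Q (X i z.1 z.2) (Y i z.1 z.2)).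
  by apply: measurable_funM => //; apply: (measurableT_comp mQ (g := fun z => (X i z.1 z.2, Y i z.1 z.2))); meas.
have S0 i x y : 0 <= N%:R^-1 * Q (X i x y) (Y i x y) by rewrite mulr_ge0// invr_ge0 ltW.
have step : (\int[leb n]_x \int[leb n]_y (Psi (g x - g (k *: y)%R) * W x y)%:E <=
    \int[leb n]_x \int[leb n]_y (Q x y)%:E)%E.
  rewrite -(tonelliE (leb n) (leb n) mQ)//.
  rewrite -(tonelliE (leb n) (leb n) (f := fun x y => Psi (g x - g (k *: y)) * W x y)); last 2 first.
  - exact: mL.
  - by move=> x y; rewrite mulr_ge0// expR_ge0.
  apply: (@le_trans _ _ (\int[leb n \x leb n]_z
      (\sum_(i < N) N%:R^-1 * Q (X i z.1 z.2) (Y i z.1 z.2))%:E)%E).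
    apply: le_eint => //.
    - by apply: measurable_sum => i; exact: mS.
    - by move=> z; rewrite mulr_ge0// expR_ge0.
  under eq_integral do rewrite -sumEFin.
  rewrite ge0_integral_sum//; last 2 first.
  - by move=> i; apply/measurable_EFinP; exact: mS.
  - by move=> i z _; rewrite lee_fin; exact: S0.
  have E i : (i < N)%N -> (\int[leb n \x leb n]_z
      (N%:R^-1 * Q (X i z.1 z.2) (Y i z.1 z.2))%:E =
      N%:R^-1%:E * \int[leb n \x leb n]_z (Q z.1 z.2)%:E)%E.
    move=> iN; rewrite eintZ ?invr_ge0 ?(ltW Np)//; last first.
      by apply: (measurableT_comp mQ (g := fun z => (X i z.1 z.2, Y i z.1 z.2))); meas.
    congr *%E; rewrite (tonelliE (leb n) (leb n) (f := fun x y => Q (X i x y) (Y i x y))).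
    - by rewrite rotQ// (tonelliE (leb n) (leb n) mQ).
    - by apply: (measurableT_comp mQ (g := fun z => (X i z.1 z.2, Y i z.1 z.2))); meas.
    - by move=> x y; exact: Q0.
  rewrite (eq_bigr (fun _ => N%:R^-1%:E * \int[leb n \x leb n]_z (Q z.1 z.2)%:E)%E); last first.
    by move=> i _; rewrite E.
  rewrite -ge0_sume_distrl; last by move=> i _; rewrite lee_fin invr_ge0.
  rewrite sumEFin sumr_const card_ord -[_ *+ N]mulr_natr mulVf ?mul1e//.
  by rewrite gt_eqF.
(* Rescaling y by 1/sin th restores the isotropic weight; the Jacobian is the factor (sin
   th)^(-n). *)
apply: le_trans (_ : _ <= ((k ^+ n)%:E * \int[leb n]_x \int[leb n]_y (Psi (g x - g (k *: y)%R) * W x y)%:E))%E _.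
  rewrite -ge0_integralZl//; last 3 first.
  - by apply: (measurable_eint (leb n) mL) => x y; rewrite mulr_ge0// expR_ge0.
  - by move=> x _; apply: eint_ge0 => y; rewrite mulr_ge0// expR_ge0.
  - by rewrite lee_fin exprn_ge0// ltW.
  rewrite le_eqVlt; apply/orP; left; apply/eqP.
  apply: eq_integral => x _.
  rewrite (leb_scaling k0 (f := fun y => (Psi (g x - g y) * expR (- (s * (dot x x + dot y y))))%:E)).
  - by congr *%E; apply: eq_eint => y; rewrite /W !dotE; congr (_ * expR (- (s * (_ + _)))); ring.
  - by apply/measurable_EFinP; meas2.
  - by move=> y; rewrite lee_fin mulr_ge0// expR_ge0.
rewrite /k; apply: lee_wpmul2l; first by rewrite lee_fin exprn_ge0// ltW.
apply: le_trans step _; rewrite /Q /W /k exprVn; exact: le_refl.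
Qed.

End maurey_pisier.


Section angles.
Context {R : realType}.
Implicit Types x eta : R.

Lemma sin_mvt x : 0 <= x -> exists2 c, 0 <= c <= x & sin x = cos c * x.
Proof.
move=> x0; have cs : {within `[0, x], continuous (@sin R)}.
  by apply: continuous_subspaceT; exact: continuous_sin.
have [c cx H] := MVT_segment x0 (fun y _ => is_derive_sin y) cs.
exists c; first by rewrite in_itv in cx.
by rewrite sin0 !subr0 in H.
Qed.

Lemma sin_le x : 0 <= x -> sin x <= x.
Proof. by move=> x0; have [c _ ->] := sin_mvt x0; rewrite ler_piMl// cos_le1. Qed.

Lemma cos_ge x : 0 <= x <= 1 -> 1 - x ^+ 2 / 2 <= cos x.
Proof.
move=> /andP[x0 x1]; pose y := x / 2; have y0 : 0 <= y by rewrite /y; lra.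
have -> : x = y *+ 2 by rewrite /y -mulr_natr divfK.
have s0 : 0 <= sin y.
  by apply: sin_ge0_pi; rewrite y0/= /y; have := @pihalf_ge1 R; lra.
have h : sin y ^+ 2 <= y ^+ 2 by rewrite ler_sqr ?nnegrE// sin_le.
rewrite cos_mulr2n; have := cos2Dsin2 y => cs.
have -> : cos y ^+ 2 = 1 - sin y ^+ 2 by rewrite -cs addrK.
rewrite (mulr2n y) (mulr2n (_ - _)) (_ : (y + y) ^+ 2 = 4 * y ^+ 2); last by ring.
by move: (sin y ^+ 2) (y ^+ 2) h => u v h; lra.
Qed.

Lemma sin_ge x : 0 <= x <= 1 -> x * (1 - x ^+ 2 / 2) <= sin x.
Proof.
move=> /andP[x0 x1]; have [c /andP[c0 cx] ->] := sin_mvt x0.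
rewrite mulrC ler_wpM2r//; apply: le_trans (cos_ge _); last by rewrite c0 (le_trans cx).
by rewrite lerB// ler_wpM2r// ler_sqr.
Qed.

Let angle_aux1 (r : R) : 0 <= r <= 1 / 32 -> (2 * r * (1 - r)) ^+ 2 * (1 + 2 * r ^+ 2) <= 4 * r ^+ 2.
Proof.
move=> /andP[r0 r1]; rewrite -subr_ge0.
have -> : 4 * r ^+ 2 - (2 * r * (1 - r)) ^+ 2 * (1 + 2 * r ^+ 2) =
  4 * r ^+ 2 * (r * ((2 - 3 * r) + r ^+ 2 * (4 - 2 * r))) by ring.
apply: mulr_ge0; first by rewrite mulr_ge0 ?sqr_ge0.
by rewrite mulr_ge0// addr_ge0 ?mulr_ge0 ?sqr_ge0//; lra.
Qed.

Let angle_aux2 x : 0 <= x <= 1 / 2 -> 1 - 3 * x <= ((1 - x) * (1 - x ^+ 2 / 2)) ^+ 2.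
Proof.
move=> /andP[x0 x1].
have h : 1 - 3 / 2 * x <= (1 - x) * (1 - x ^+ 2 / 2).
  rewrite -subr_ge0 (_ : _ - _ = x / 2 * ((1 - x) + x ^+ 2)); last by field.
  by apply: mulr_ge0; [lra|have := sqr_ge0 x; move: (x ^+ 2) => v; lra].
have h0 : 0 <= 1 - 3 / 2 * x by lra.
apply: (@le_trans _ _ ((1 - 3 / 2 * x) ^+ 2)).
  rewrite -subr_ge0 (_ : _ - _ = (3 / 2 * x) ^+ 2) ?sqr_ge0//; by field.
by rewrite ler_sqr ?nnegrE// (le_trans h0).
Qed.

(** The angle must divide the quarter turn exactly, yet sin^2 th has to agree with 4 eta up to the
    factor cos th on one side and a relative error 1/(2D) on the other. With r = sqrt eta, an angle
    just below 2r(1 - r) works: the loss r absorbs cos th, and rounding to an integer N costs a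
    further relative error of order r, affordable since 32 D r <= 1. *)
Lemma angle_choice eta (D : R) : 0 < eta -> 1 <= D -> 1024 * D ^+ 2 * eta <= 1 ->
  exists (N : nat) (th : R), [/\ (0 < N)%N /\ th = pi / (2 * N%:R),
    sin th ^+ 2 <= 4 * eta * cos th, 4 * eta * (1 - (2 * D)^-1) <= sin th ^+ 2,
    N%:R ^+ 2 * eta <= 4 & 0 < sin th /\ 0 <= cos th].
Proof.
move=> e0 D1 De.
pose r := Num.sqrt eta.
have r0 : 0 < r by rewrite sqrtr_gt0.
have re : eta = r ^+ 2 by rewrite sqr_sqrtr// ltW.
have rD : 32 * D * r <= 1.
  rewrite -(@ler_pXn2r _ 2)// ?nnegrE ?expr1n//; last by rewrite !mulr_ge0// ?ltW//; lra.
  by apply: le_trans De; rewrite re le_eqVlt; apply/orP; left; apply/eqP; ring.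
have r32 : 32 * r <= 1 by nra.
pose t := 2 * r * (1 - r).
have t0 : 0 < t by rewrite /t; nra.
have pi4 : pi < 4 :> R by have /andP[_] := @pihalf_02 R; lra.
have pi2 : 2 <= pi :> R by have := @pihalf_ge1 R; lra.
have y0 : 0 <= pi / (2 * t) by rewrite divr_ge0 ?pi_ge0//; lra.
(* Rounding up gives th <= t, and th >= t(1 - t) because N exceeds pi/(2t) by at most 1. *)
pose N := (Num.trunc (pi / (2 * t))).+1.
have /andP[Nl Nr] := truncn_itv y0.
have Np : 0 < N%:R :> R by rewrite ltr0n.
have NE : N%:R = (Num.trunc (pi / (2 * t)))%:R + 1 :> R by rewrite /N -natr1.
have Nub : N%:R <= pi / (2 * t) + 1 by rewrite NE; lra.
pose th : R := pi / (2 * N%:R).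
have thE : th * N%:R = pi / 2 by rewrite /th; field; lra.
have th0 : 0 < th by rewrite divr_gt0 ?pi_gt0//; lra.
have yt : pi / (2 * t) * t = pi / 2 by field; lra.
have tht : th <= t.
  rewrite -(ler_pM2r Np) thE -yt mulrC ler_pM2l//; apply: ltW; exact: Nr.
have tht2 : t * (1 - t) <= th.
  have : th * N%:R <= th * (pi / (2 * t) + 1) by rewrite ler_pM2l.
  rewrite thE -yt => h.
  have : t * (pi / (2 * t)) <= th * (pi / (2 * t)) + th by lra.
  set y := pi / (2 * t) in y0 yt h *; nra.
have t1 : t <= 1 by rewrite /t; nra.
have th1 : 0 <= th <= 1 by rewrite ltW//= (le_trans tht).
have sl := sin_le (ltW th0); have sg := sin_ge th1; have cg := cos_ge th1.
have tht' : th ^+ 2 <= t ^+ 2 by rewrite ler_sqr ?nnegrE// ltW.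
have th21 : th ^+ 2 <= 1 by rewrite expr_le1 ?(ltW th0)//; case/andP: th1.
have cpos : 0 < 1 - th ^+ 2 / 2 by move: (th ^+ 2) th21 => v v1; lra.
have s0 : 0 < sin th by apply: lt_le_trans sg; rewrite mulr_gt0.
have r01 : 0 <= r <= 1 / 32 by rewrite (ltW r0)/=; lra.
have e4 : 0 <= 4 * eta by rewrite mulr_ge0 ?(ltW e0).
have t2r : t <= 2 * r by rewrite /t ler_piMr ?mulr_ge0 ?(ltW r0)//; move/andP: r01 => [_ ?]; lra.
have t01 : 0 <= t <= 1 / 2 by rewrite (ltW t0)/=; move/andP: r01 => [_ ?]; lra.
have tt1 : 0 <= t * (1 - t) by rewrite mulr_ge0 ?(ltW t0)//; lra.
have t21 : 0 <= 1 - t ^+ 2 / 2.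
  have : t ^+ 2 <= 1 by rewrite expr_le1 ?(ltW t0).
  by move: (t ^+ 2) => v v1; lra.
exists N, th; split => //.
- apply: (@le_trans _ _ (th ^+ 2)); first by rewrite ler_sqr ?nnegrE ?(ltW s0) ?(ltW th0).
  apply: (@le_trans _ _ (4 * eta * (1 - th ^+ 2 / 2))); last by rewrite ler_wpM2l.
  have h := angle_aux1 r01; rewrite -/t -re in h.
  have : th ^+ 2 * (1 + 2 * eta) <= 4 * eta.
    by apply: le_trans h; rewrite ler_wpM2r// addr_ge0 ?mulr_ge0 ?(ltW e0).
  by move: (th ^+ 2) => v hv; lra.
- apply: (@le_trans _ _ ((t * (1 - t) * (1 - t ^+ 2 / 2)) ^+ 2)); last first.
    rewrite ler_sqr ?nnegrE ?(ltW s0) ?(mulr_ge0 tt1 t21)//.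
    apply: le_trans sg; apply: ler_pM => //.
    by rewrite lerB// ler_wpM2r.
  rewrite (_ : _ ^+ 2 = t ^+ 2 * ((1 - t) * (1 - t ^+ 2 / 2)) ^+ 2); last by ring.
  have D2 : 8 * r <= (2 * D)^-1.
    rewrite -(@ler_pM2r _ (2 * D)) ?mulVf ?gt_eqF//; [|lra|lra].
    have -> : 8 * r * (2 * D) = (32 * D * r) / 2 by field.
    by move: (32 * D * r) rD => v v1; lra.
  apply: (@le_trans _ _ (4 * eta * (1 - r) ^+ 2 * (1 - 3 * t))); last first.
    rewrite (_ : 4 * eta * (1 - r) ^+ 2 = t ^+ 2); last by rewrite /t re; ring.
    by rewrite ler_wpM2l ?sqr_ge0//; exact: angle_aux2.
  rewrite -[leRHS]mulrA ler_wpM2l//.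
  have h1 : (1 - 2 * r) * (1 - 3 * t) <= (1 - r) ^+ 2 * (1 - 3 * t).
    rewrite ler_wpM2r//; first by move/andP: r01 => [_ ?]; lra.
    by rewrite -subr_ge0 (_ : _ - _ = r ^+ 2) ?sqr_ge0//; ring.
  apply: le_trans h1; have : 0 <= 6 * (r * t) by apply: mulr_ge0 => //; apply: mulr_ge0; exact: ltW.
  have -> : (1 - 2 * r) * (1 - 3 * t) = 1 - 2 * r - 3 * t + 6 * (r * t) by ring.
  by move: (r * t) D2 t2r => v; move: ((2 * D)^-1) => w; move=> *; lra.
- have Nr2 : N%:R <= 2 / r.
    apply: (le_trans Nub); rewrite ler_pdivlMr// /t mulrDl mul1r.
    have -> : pi / (2 * (2 * r * (1 - r))) * r = pi / 4 / (1 - r).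
      by field; apply/andP; split; lra.
    have : pi / 4 / (1 - r) <= 1 + 1/16.
      by rewrite ler_pdivrMr; lra.
    by lra.
  have -> : N%:R ^+ 2 * eta = (N%:R * r) ^+ 2 by rewrite re exprMn.
  have : N%:R * r <= 2 by rewrite -ler_pdivlMr.
  have -> : (4 : R) = 2 ^+ 2 by ring.
  by move=> h; rewrite ler_sqr ?nnegrE// mulr_ge0 ?(ltW Np) ?(ltW r0).
- by split => //; apply: le_trans cg; exact: ltW.
Qed.

End angles.


Section double_integrals.
Context d1 d2 (T1 : measurableType d1) (T2 : measurableType d2) (R : realType).
Variables (m1 : {sigma_finite_measure set T1 -> \bar R})
  (m2 : {sigma_finite_measure set T2 -> \bar R}).
Implicit Types f g : T1 -> T2 -> R.

Lemma le_eint2 f g : measurable_fun setT (fun z => f z.1 z.2) ->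
  measurable_fun setT (fun z => g z.1 z.2) ->
  (forall x y, 0 <= f x y) -> (forall x y, f x y <= g x y) ->
  (\int[m1]_x \int[m2]_y (f x y)%:E <= \int[m1]_x \int[m2]_y (g x y)%:E)%E.
Proof.
move=> mf mg f0 fg.
have g0 x y : 0 <= g x y := le_trans (f0 x y) (fg x y).
rewrite -(tonelliE m1 m2 mf f0) -(tonelliE m1 m2 mg g0).
by apply: le_eint.
Qed.

Lemma eintZ2 c f : 0 <= c -> measurable_fun setT (fun z => f z.1 z.2) ->
  (forall x y, 0 <= f x y) ->
  (\int[m1]_x \int[m2]_y (c * f x y)%:E =
   c%:E * \int[m1]_x \int[m2]_y (f x y)%:E)%E.
Proof.
move=> c0 mf f0; rewrite -(tonelliE m1 m2 mf f0).
have mcf : measurable_fun setT (fun z => c * f z.1 z.2) by meas.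
have cf0 x y : 0 <= c * f x y by rewrite mulr_ge0.
rewrite -(tonelliE m1 m2 (f := fun x y => c * f x y) mcf cf0).
by apply: eintZ.
Qed.

End double_integrals.

Section heat_kernel.
Context {R : realType} {n : nat}.
Implicit Types x y z : 'rV[R]_n.

(** The Gaussian density with covariance I/(2s). *)
Definition gam (s : R) x : R := Num.sqrt (s / pi) ^+ n * expR (- (s * dot x x)).

(** The heat kernel at time [h], with covariance 2h I: the noise of an LMC step of size [h]. *)
Definition heat (h : R) x y : R := gam (4 * h)^-1 (x - y).

Lemma gam_ge0 s x : 0 <= gam s x.
Proof. by rewrite mulr_ge0 ?exprn_ge0 ?sqrtr_ge0 ?expR_ge0. Qed.

Lemma gam_gt0 s x : 0 < s -> 0 < gam s x.
Proof.
by move=> s0; rewrite mulr_gt0 ?exprn_gt0 ?expR_gt0 ?sqrtr_gt0 ?divr_gt0 ?pi_gt0.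
Qed.

Lemma measurable_gam s d (T : measurableType d) (f : T -> 'rV[R]_n) :
  measurable_fun setT f -> measurable_fun setT (fun t => gam s (f t)).
Proof. by move=> mf; rewrite /gam; meas2. Qed.

Lemma measurable_heat h d (T : measurableType d) (f g : T -> 'rV[R]_n) :
  measurable_fun setT f -> measurable_fun setT g ->
  measurable_fun setT (fun t => heat h (f t) (g t)).
Proof. by move=> mf mg; apply: measurable_gam; meas. Qed.

Lemma gam_lin s (b : 'rV[R]_n) : 0 < s ->
  (\int[leb n]_x (gam s x * expR (dot b x))%:E = (expR (dot b b / (4 * s)))%:E)%E.
Proof.
move=> s0; have h0 : 0 < s / pi by rewrite divr_gt0 ?pi_gt0.
under eq_integral do rewrite /gam -mulrA -expRD.
rewrite eintZ ?exprn_ge0 ?sqrtr_ge0//; last by meas2.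
rewrite gauss_lin// -EFinM mulrA -exprMn -sqrtrM ?(ltW h0)//.
have -> : s / pi * (pi / s) = 1 by rewrite mulrA divfK ?divff// gt_eqF ?pi_gt0.
by rewrite sqrtr1 expr1n mul1r.
Qed.

Lemma gam_int s : 0 < s -> (\int[leb n]_x (gam s x)%:E = 1)%E.
Proof.
move=> s0; rewrite -[1%E](_ : (expR (dot (0 : 'rV[R]_n) 0 / (4 * s)))%:E = 1)%E.
  rewrite -gam_lin//; apply: eq_eint => x.
  by rewrite dot0l expR0 mulr1.
by rewrite dot0l mul0r expR0.
Qed.

Lemma heatC h x y : heat h x y = heat h y x.
Proof. by rewrite /heat /gam -(opprB y x) dotNl dotNr opprK. Qed.

Lemma heat_ge0 h x y : 0 <= heat h x y. Proof. exact: gam_ge0. Qed.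

Lemma heat_gt0 h x y : 0 < h -> 0 < heat h x y.
Proof. by move=> h0; apply: gam_gt0; rewrite invr_gt0 mulr_gt0. Qed.

Lemma heat_translation h x (f : 'rV[R]_n -> R) : 0 < h ->
  measurable_fun setT f -> (forall x, 0 <= f x) ->
  (\int[leb n]_y (heat h x y * f y)%:E = \int[leb n]_y (gam (4 * h)^-1 y * f (x + y)%R)%:E)%E.
Proof.
move=> h0 mf f0.
rewrite -[LHS](leb_translation x (f := fun y => (heat h x y * f y)%:E)); last 2 first.
- by apply/measurable_EFinP; apply: measurable_funM => //; apply: measurable_heat.
- by move=> y; rewrite lee_fin mulr_ge0// heat_ge0.
by apply: eq_eint => y; rewrite heatC /heat addrK addrC.
Qed.

Lemma heat_int h x : 0 < h -> (\int[leb n]_y (heat h x y)%:E = 1)%E.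
Proof.
move=> h0; rewrite -(@gam_int (4 * h)^-1) ?invr_gt0 ?mulr_gt0//.
rewrite -[LHS](leb_translation x (f := fun y => (heat h x y)%:E)); last 2 first.
- by apply/measurable_EFinP; apply: measurable_heat.
- by move=> y; rewrite lee_fin heat_ge0.
by apply: eq_eint => y; rewrite heatC /heat addrK.
Qed.

Lemma bernoulli_ineq (a : R) k : 0 <= a <= 1 -> 1 - k%:R * a <= (1 - a) ^+ k.
Proof.
move=> /andP[a0 a1]; elim: k => [|k IH]; first by rewrite mul0r subr0 expr0.
rewrite exprS -natr1; apply: (@le_trans _ _ ((1 - a) * (1 - k%:R * a))).
  have : 0 <= k%:R * (a * a) by rewrite !mulr_ge0.
  rewrite mulrA; lra.
by rewrite ler_wpM2l//; lra.
Qed.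

(** The rotation bound for the square function, with an angle such that sin^2 th is close to 4hs.
    One increment of the rotation is then dominated by [heat h] times the geometric mean of the two
    Gaussian densities. The constant 8 is 4, from N^2 h s <= 4, times 2, from the normalising
    constants. *)
Lemma local_poincare (s h : R) (g : 'rV[R]_n -> R) : (0 < n)%N -> 0 < s -> 0 < h ->
  1024 * n%:R ^+ 2 * (h * s) <= 1 -> measurable_fun setT g ->
  (\int[leb n]_x \int[leb n]_y ((g x - g y) ^+ 2 * (gam s x * gam s y))%:E <=
   (8 / (h * s))%:E * \int[leb n]_x \int[leb n]_y ((g x - g y) ^+ 2 *
     (Num.sqrt (s / pi) ^+ n * expR (- (s / 2 * (dot x x + dot y y))) *
      heat h x y))%:E)%E.
Proof.
move=> n0 s0 h0 small mg.
have hs0 : 0 < h * s by rewrite mulr_gt0.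
have np : 1 <= n%:R :> R by rewrite ler1n.
have [N [th [[N0 thE] ub lb Nhs [sn0 cs0]]]] := angle_choice hs0 np small.
set c := cos th in ub cs0 *; set sn := sin th in ub lb sn0 *.
have c1 : c <= 1 by exact: cos_le1.
have cs : c ^+ 2 + sn ^+ 2 = 1 by exact: cos2Dsin2.
pose K := Num.sqrt (s / pi) ^+ n.
have K0 : 0 <= K by rewrite exprn_ge0// sqrtr_ge0.
pose Psi (u : R) := u ^+ 2.
have mPsi : measurable_fun setT Psi by rewrite /Psi; meas.
have cPsi m : exists l, forall v, Psi m + l * (v - m) <= Psi v.
  by exists (2 * m) => v; rewrite -subr_ge0 (_ : _ - _ = (v - m)^+2) ?sqr_ge0// /Psi; ring.
have MP := discrete_maurey_pisier s mPsi (fun u => sqr_ge0 u) cPsi mg N0 thE.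
have sp : 0 <= s / pi by rewrite divr_ge0 ?pi_ge0// ltW.
pose f0 (x y : 'rV[R]_n) := (g x - g y) ^+ 2 * expR (- (s * (dot x x + dot y y))).
have mf0 : measurable_fun setT (fun z : ('rV[R]_n * 'rV[R]_n)%type => f0 z.1 z.2) by rewrite /f0; meas2.
have -> : (\int[leb n]_x \int[leb n]_y ((g x - g y) ^+ 2 * (gam s x * gam s y))%:E =
   (K ^+ 2)%:E * \int[leb n]_x \int[leb n]_y (f0 x y)%:E)%E.
  have f00 x y : 0 <= f0 x y by rewrite /f0 mulr_ge0 ?sqr_ge0 ?expR_ge0.
  rewrite -(eintZ2 (leb n) (leb n) (sqr_ge0 K) mf0 f00).
  apply: eq_integral => x _; apply: eq_eint => y.
  rewrite /f0 /gam -/K mulrDr opprD expRD; ring.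
pose f1 (x y : 'rV[R]_n) := (g x - g y) ^+ 2 * (expR (- (s / 2 * (dot x x + dot y y))) *
  expR (- ((4 * h)^-1 * dot (x - y) (x - y)))).
have mf1 : measurable_fun setT (fun z : ('rV[R]_n * 'rV[R]_n)%type => f1 z.1 z.2) by rewrite /f1; meas2.
have f10 x y : 0 <= f1 x y.
  by rewrite /f1; apply: mulr_ge0; rewrite ?sqr_ge0// mulr_ge0 ?expR_ge0.
pose Kh := Num.sqrt ((4 * h)^-1 / pi) ^+ n.
have Kh0 : 0 <= Kh by rewrite exprn_ge0// sqrtr_ge0.
have -> : (\int[leb n]_x \int[leb n]_y ((g x - g y) ^+ 2 *
     (Num.sqrt (s / pi) ^+ n * expR (- (s / 2 * (dot x x + dot y y))) *
      heat h x y))%:E = (K * Kh)%:E * \int[leb n]_x \int[leb n]_y (f1 x y)%:E)%E.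
  rewrite -(eintZ2 (leb n) (leb n) (mulr_ge0 K0 Kh0) mf1 f10).
  apply: eq_integral => x _; apply: eq_eint => y.
  rewrite /f1 /heat /gam -/K -/Kh; ring.
(* Change of variables from the increment to the endpoint, which replaces y by y - cos th x in the
   weight. *)
have step : (\int[leb n]_x \int[leb n]_y (Psi (N%:R * (g x - g (c *: x + y)%R)) *
      expR (- (s * (dot x x + sn ^- 2 * dot y y))))%:E <=
    (N%:R ^+ 2)%:E * \int[leb n]_x \int[leb n]_y (f1 x y)%:E)%E.
  pose f2 (x y : 'rV[R]_n) := Psi (N%:R * (g x - g y)) *
      expR (- (s * (dot x x + sn ^- 2 * dot (y - c *: x) (y - c *: x)))).
  have mf2 : measurable_fun setT (fun z : ('rV[R]_n * 'rV[R]_n)%type => f2 z.1 z.2) by rewrite /f2 /Psi; meas2.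
  have f20 x y : 0 <= f2 x y by rewrite /f2 /Psi; apply: mulr_ge0; rewrite ?sqr_ge0 ?expR_ge0.
  have -> : (\int[leb n]_x \int[leb n]_y (Psi (N%:R * (g x - g (c *: x + y)%R)) *
      expR (- (s * (dot x x + sn ^- 2 * dot y y))))%:E =
      \int[leb n]_x \int[leb n]_y (f2 x y)%:E)%E.
    rewrite -(shear_r c mf2 f20); apply: eq_integral => x _; apply: eq_eint => y.
    by rewrite /f2 addrK (addrC y).
  rewrite -(eintZ2 (leb n) (leb n) (sqr_ge0 N%:R) mf1 f10); apply: le_eint2 => //; first by meas.
  move=> x y; rewrite /f2 /f1 /Psi exprMn -[leLHS]mulrA.
  apply: ler_wpM2l; first exact: sqr_ge0.
  apply: ler_wpM2l; first exact: sqr_ge0.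
  rewrite -expRD ler_expR -opprD lerN2.
  pose P := dot x x + dot y y; pose Q := dot (x - y) (x - y).
  have P0 : 0 <= P by rewrite addr_ge0 ?dot_ge0.
  have Q0 : 0 <= Q by exact: dot_ge0.
  have sn2 : 0 < sn ^+ 2 by rewrite exprn_gt0.
  have -> : dot x x + sn ^- 2 * dot (y - c *: x) (y - c *: x) =
     sn ^- 2 * ((1 - c) * P + c * Q).
    apply: (mulfI (lt0r_neq0 sn2)); rewrite mulrDr !mulrA divff ?gt_eqF// !mul1r.
    rewrite (_ : sn ^+ 2 = 1 - c ^+ 2); last by rewrite -cs; ring.
    by rewrite /P /Q !dotE (dotC y x); ring.
  rewrite -/P -/Q.
  (* Since sin^2 = (1 - cos)(1 + cos), the coefficient (1 - cos)/sin^2 is at least 1/2. In [e2], the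
     upper bound on sin^2 makes s cos/sin^2 at least 1/(4h). *)
  have e1 : s / 2 * P <= s * (sn ^- 2 * ((1 - c) * P)).
    rewrite -mulrA ler_wpM2l ?(ltW s0)// mulrA ler_wpM2r//.
    rewrite ler_pdivlMl// (_ : sn ^+ 2 = (1 - c) * (1 + c)); last by rewrite -[LHS](addKr (c^+2)) cs; ring.
    by rewrite -mulrA ler_piMr//; lra.
  have e2 : (4 * h)^-1 * Q <= s * (sn ^- 2 * (c * Q)).
    rewrite !mulrA ler_wpM2r// -[s / _]mulrC -mulrA ler_pdivlMl//.
    rewrite -(@ler_pM2r _ (4 * h)) ?mulr_gt0// -mulrA mulVf ?mulr1; first by lra.
    by rewrite gt_eqF// mulr_gt0.
  apply: le_trans (lerD e1 e2) _.
  by rewrite -(mulrDr s) -(mulrDr (sn ^- 2)).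
apply: (@le_trans _ _ ((K ^+ 2)%:E * ((sn^-1 ^+ n)%:E * ((N%:R ^+ 2)%:E *
     \int[leb n]_x \int[leb n]_y (f1 x y)%:E)))%E).
  apply: lee_wpmul2l; first by rewrite lee_fin sqr_ge0.
  apply: le_trans MP _; apply: lee_wpmul2l => //.
  by rewrite lee_fin exprn_ge0// invr_ge0 ltW.
rewrite !muleA -!EFinM; apply: lee_wpmul2r.
  by apply: integral_ge0 => x _; apply: eint_ge0.
rewrite lee_fin.
(* The squared ratio of the normalising constants is at most (1 - 1/(2n))^(-n), which Bernoulli
   bounds by 2; hence the accuracy 1/(2n) asked of the angle. *)
have key : K * sn^-1 ^+ n <= 2 * Kh.
  have Yp : 0 <= (4 * h)^-1 / pi by rewrite divr_ge0 ?pi_ge0// invr_ge0 mulr_ge0// ltW.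
  have sni : 0 <= sn^-1 by rewrite invr_ge0 ltW.
  rewrite -(@ler_pXn2r _ 2)// ?nnegrE ?mulr_ge0 ?exprn_ge0//.
  have -> : (K * sn^-1 ^+ n) ^+ 2 = (s / pi * sn^-1 ^+ 2) ^+ n.
    rewrite (exprMn _ K) /K (exprAC (Num.sqrt _)) (exprAC sn^-1) sqr_sqrtr//.
    by rewrite [in RHS]exprMn.
  have -> : (2 * Kh) ^+ 2 = 4 * ((4 * h)^-1 / pi) ^+ n.
    rewrite /Kh exprMn [(_ ^+ n) ^+ 2]exprAC sqr_sqrtr//; congr (_ * _); ring.
  set Y := (4 * h)^-1 / pi.
  have Y0 : 0 <= Y by rewrite divr_ge0 ?pi_ge0// invr_ge0 mulr_ge0// ltW.
  pose de := (2 * n%:R)^-1 : R.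
  have de0 : 0 < de by rewrite invr_gt0; lra.
  have de1 : de <= 2^-1 by rewrite lef_pV2 ?posrE; lra.
  have h1 : s / pi * sn^-1 ^+ 2 * (1 - de) <= Y.
    have sn2 : 0 < sn ^+ 2 by rewrite exprn_gt0.
    rewrite exprVn -(@ler_pM2r _ (sn ^+ 2 * (pi * 4 * h)))//; last first.
      by rewrite !mulr_gt0// pi_gt0.
    have -> : s / pi * sn ^- 2 * (1 - de) * (sn ^+ 2 * (pi * 4 * h)) = 4 * (h * s) * (1 - de).
      by move: (@pi_gt0 R); move: (@pi R) => p p0; field; rewrite !gt_eqF.
    have -> : Y * (sn ^+ 2 * (pi * 4 * h)) = sn ^+ 2.
      by rewrite /Y; move: (@pi_gt0 R); move: (@pi R) => p p0; field; rewrite !gt_eqF.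
    exact: lb.
  have h2 : 2^-1 <= (1 - de) ^+ n.
    apply: le_trans (bernoulli_ineq n (_ : 0 <= de <= 1)); last by rewrite (ltW de0); lra.
    rewrite (_ : n%:R * de = 2^-1); first by lra.
    by rewrite /de; field; rewrite gt_eqF//; lra.
  have X0 : 0 <= s / pi * sn^-1 ^+ 2 by rewrite mulr_ge0 ?sqr_ge0.
  have d0 : 0 <= 1 - de by move: de1; clear; lra.
  have h3 : (s / pi * sn^-1 ^+ 2) ^+ n * (1 - de) ^+ n <= Y ^+ n.
    by rewrite -exprMn lerXn2r// nnegrE mulr_ge0.
  have h4 : 0 <= (s / pi * sn^-1 ^+ 2) ^+ n by rewrite exprn_ge0.
  have h5 : 0 <= Y ^+ n by rewrite exprn_ge0.
  move: h2 h3 h4 h5.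
  move: ((s / pi * sn^-1 ^+ 2) ^+ n) ((1 - de) ^+ n) (Y ^+ n) => A B D hB hAB A0 D0.
  have : A * 2^-1 <= A * B by rewrite ler_wpM2l.
  move=> hA; clear -hA hAB D0; lra.
have h1 : K * sn^-1 ^+ n * (N%:R ^+ 2 * (h * s)) <= 2 * Kh * 4.
  apply: ler_pM => //.
  - by apply: mulr_ge0 => //; rewrite exprn_ge0// invr_ge0 ltW.
  - by apply: mulr_ge0; rewrite ?sqr_ge0 ?(ltW hs0).
have -> : 8 / (h * s) * (K * Kh) = K * (8 * Kh / (h * s)) by ring.
have -> : K ^+ 2 * sn^-1 ^+ n * N%:R ^+ 2 = K * (K * sn^-1 ^+ n * N%:R ^+ 2) by ring.
apply: ler_wpM2l => //; rewrite ler_pdivlMr// -[leLHS]mulrA; apply: le_trans h1 _.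
by rewrite le_eqVlt; apply/orP; left; apply/eqP; ring.
Qed.

End heat_kernel.


(** * Cauchy-Schwarz, means, variances and Jensen under a probability density *)

Section cauchy_schwarz.
Context d (T : measurableType d) (R : realType) (m : {measure set T -> \bar R}).

(** Signed integrals are computed by adding terms until every integrand is nonnegative; the
    subtraction then takes place in the reals. *)
Lemma eadd_real (A : \bar R) (x y : R) : (A + x%:E = y%:E)%E -> A = (y - x)%:E.
Proof. by case: A => //= r [<-]; rewrite addrK. Qed.

(** The inequality at l = I/A; if A = 0, a large l forces I = 0. *)
Lemma sqr_le_of_quad (I A B : R) : 0 <= I -> 0 <= A -> 0 <= B ->
  (forall l, 0 < l -> 2 * l * I <= l ^+ 2 * A + B) -> I ^+ 2 <= A * B.
Proof.
move=> I0 A0 B0 H; have [->|In0] := eqVneq I 0; first by rewrite expr0n/= mulr_ge0.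
have Ip : 0 < I by rewrite lt_neqAle eq_sym In0.
have [A00|An0] := eqVneq A 0.
  have := H ((B + 1) / (2 * I)) _; rewrite divr_gt0 ?mulr_gt0 ?ltr_wpDl// => /(_ isT).
  by rewrite A00 mulr0 add0r (_ : 2 * _ * I = B + 1); [lra|field].
have Ap : 0 < A by rewrite lt_neqAle eq_sym An0.
have := H (I / A) (divr_gt0 Ip Ap).
rewrite (_ : 2 * _ * I = (2 * I ^+ 2) / A); last by field.
rewrite (_ : _ ^+ 2 * A = I ^+ 2 / A); last by field.
rewrite -lerBlDl -mulrBl ler_pdivrMr//; lra.
Qed.

(** Integrate 2 l f g <= l^2 f^2 + g^2 and optimise in l. Finiteness of the integral of f g belongs
    to the conclusion. *)
Lemma cauchy_schwarz (f g : T -> R) (A B : R) :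
  measurable_fun setT f -> measurable_fun setT g ->
  (forall x, 0 <= f x) -> (forall x, 0 <= g x) ->
  (\int[m]_x (f x ^+ 2)%:E <= A%:E)%E -> (\int[m]_x (g x ^+ 2)%:E <= B%:E)%E ->
  exists I : R, [/\ (\int[m]_x (f x * g x)%:E = I%:E)%E, 0 <= I & I ^+ 2 <= A * B].
Proof.
move=> mf mg f0 g0 fA gB.
have mfg : measurable_fun setT (fun x => f x * g x) by meas.
have fg0 x : 0 <= f x * g x by rewrite mulr_ge0.
have A0 : 0 <= A by rewrite -lee_fin; apply: le_trans fA; apply: eint_ge0 => x; exact: sqr_ge0.
have B0 : 0 <= B by rewrite -lee_fin; apply: le_trans gB; apply: eint_ge0 => x; exact: sqr_ge0.
have H l : 0 < l -> ((2 * l)%:E * \int[m]_x (f x * g x)%:E <= (l ^+ 2 * A + B)%:E)%E.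
  move=> l0; rewrite -eintZ ?mulr_ge0 ?(ltW l0)//.
  apply: (@le_trans _ _ (\int[m]_x (l ^+ 2 * f x ^+ 2 + g x ^+ 2)%:E)%E).
    apply: le_eint; [by meas|by meas| |] => x; first by rewrite !mulr_ge0 ?(ltW l0).
    by rewrite -subr_ge0 (_ : _ - _ = (l * f x - g x) ^+ 2) ?sqr_ge0//; ring.
  rewrite eintD; [|by meas|by meas| |]; last 2 first.
  - by move=> x; rewrite mulr_ge0 ?sqr_ge0.
  - by move=> x; exact: sqr_ge0.
  rewrite eintZ ?sqr_ge0//; [|by meas|by move=> x; exact: sqr_ge0].
  rewrite EFinD (EFinM (l ^+ 2)); apply: leeD => //; apply: lee_wpmul2l => //.
  by rewrite lee_fin sqr_ge0.
have I0 : (0 <= \int[m]_x (f x * g x)%:E)%E by exact: eint_ge0.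
move: (\int[m]_x (f x * g x)%:E)%E I0 H => [I| |]; last 2 first.
- by move=> _ /(_ 1 ltr01); rewrite gt0_muley ?lte_fin ?mulr_gt0// leye_eq.
- by rewrite leeNy_eq.
rewrite lee_fin => I0 H; exists I; split => //.
by apply: sqr_le_of_quad => // l l0; have := H l l0; rewrite -EFinM lee_fin.
Qed.

End cauchy_schwarz.

Section weighted_mean.
Context d (T : measurableType d) (R : realType)
  (m : {sigma_finite_measure set T -> \bar R}).
Variable th : T -> R.
Hypotheses (mth : measurable_fun setT th) (th0 : forall x, 0 <= th x)
  (th1 : (\int[m]_x (th x)%:E = 1)%E).
Implicit Type g : T -> R.

(** The expectation under the density [th]. An infinite integral would be sent to 0 by [fine], hence
    the boundedness assumptions of the lemmas that follow. *)
Definition mean g : R := fine (\int[m]_x (g x * th x)%:E)%E.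

Lemma mean_cst c : 0 <= c -> (\int[m]_x (c * th x)%:E = c%:E)%E.
Proof. by move=> c0; rewrite eintZ// th1 mule1. Qed.

Section bounded.
Variables (g : T -> R) (B : R).
Hypotheses (mg : measurable_fun setT g) (g0 : forall x, 0 <= g x)
  (gB : forall x, g x <= B).

Let mgth : measurable_fun setT (fun x => g x * th x). Proof. by meas. Qed.
Let gth0 x : 0 <= g x * th x. Proof. by rewrite mulr_ge0. Qed.

Let B0 : 0 <= B.
Proof.
have [[y _]|Te] := pselect (exists x : T, True).
  exact: le_trans (g0 y) (gB y).
exfalso; move: th1; rewrite (_ : (fun x => _) = (fun=> 0%E)); last first.
  by apply/funext => x; exfalso; apply: Te; exists x.
by rewrite integral0 => -[] /eqP; rewrite eq_sym oner_eq0.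
Qed.

Lemma mean_bound : (0 <= \int[m]_x (g x * th x)%:E <= B%:E)%E.
Proof.
rewrite eint_ge0//= -(mean_cst B0); apply: le_eint => //; first by meas.
by move=> x; rewrite ler_wpM2r.
Qed.

Lemma meanE : (\int[m]_x (g x * th x)%:E = (mean g)%:E)%E.
Proof.
rewrite fineK// ge0_fin_numE ?eint_ge0//.
by have /andP[_ h] := mean_bound; rewrite (le_lt_trans h)// ltry.
Qed.

Lemma mean_ge0 : 0 <= mean g.
Proof. by rewrite -lee_fin -meanE eint_ge0. Qed.

Lemma mean_le : mean g <= B.
Proof. by rewrite -lee_fin -meanE; have /andP[] := mean_bound. Qed.

End bounded.

Section variance.
Variables (g : T -> R) (B : R).
Hypotheses (mg : measurable_fun setT g) (g0 : forall x, 0 <= g x)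
  (gB : forall x, g x <= B).

Let mg2 : measurable_fun setT (fun x => g x ^+ 2). Proof. by meas. Qed.
Let g20 x : 0 <= g x ^+ 2. Proof. exact: sqr_ge0. Qed.
Let g2B x : g x ^+ 2 <= B ^+ 2.
Proof. by rewrite ler_sqr ?nnegrE// (le_trans (g0 x)). Qed.

Lemma mean_sqr_dist c : 0 <= c -> (\int[m]_x ((g x - c) ^+ 2 * th x)%:E =
  (mean (fun x => g x ^+ 2) - 2 * c * mean g + c ^+ 2)%:E)%E.
Proof.
move=> c0.
have -> : mean (fun x => g x ^+ 2) - 2 * c * mean g + c ^+ 2 =
  (mean (fun x => g x ^+ 2) + c ^+ 2) - 2 * c * mean g by ring.
apply: eadd_real; rewrite EFinD EFinM -(meanE mg g0 gB) -(meanE mg2 g20 g2B).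
rewrite -(mean_cst (sqr_ge0 c)) -eintZ ?mulr_ge0//; [|by meas|by move=> x; rewrite mulr_ge0].
rewrite -eintD; [|by meas|by meas| |]; last 2 first.
- by move=> x; rewrite mulr_ge0 ?sqr_ge0.
- by move=> x; rewrite !mulr_ge0.
rewrite -eintD; [|by meas|by meas| |]; last 2 first.
- by move=> x; rewrite mulr_ge0 ?sqr_ge0.
- by move=> x; rewrite mulr_ge0 ?sqr_ge0.
by apply: eq_eint => x; ring.
Qed.

Definition variance := mean (fun x => g x ^+ 2) - mean g ^+ 2.

Lemma variance_mean : (\int[m]_x ((g x - mean g) ^+ 2 * th x)%:E = variance%:E)%E.
Proof.
rewrite mean_sqr_dist; last exact: (mean_ge0 mg g0 gB).
by congr EFin; rewrite /variance; ring.
Qed.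

Lemma variance_ge0 : 0 <= variance.
Proof.
by rewrite -lee_fin -variance_mean; apply: eint_ge0 => x; rewrite mulr_ge0 ?sqr_ge0.
Qed.

Lemma variance_le : variance <= B ^+ 2.
Proof.
have := mean_le mg2 g20 g2B; have := sqr_ge0 (mean g); rewrite /variance; lra.
Qed.

Lemma variance_pair : (\int[m]_x \int[m]_y ((g x - g y) ^+ 2 * (th x * th y))%:E =
  (2 * variance)%:E)%E.
Proof.
have inner x : (\int[m]_y ((g x - g y) ^+ 2 * (th x * th y))%:E =
   ((mean (fun x => g x ^+ 2) - 2 * g x * mean g + g x ^+ 2) * th x)%:E)%E.
  rewrite mulrC EFinM -(mean_sqr_dist (g0 x)) -eintZ//; [|by meas|].
    by apply: eq_eint => y; ring.
  by move=> y; rewrite mulr_ge0 ?sqr_ge0.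
under eq_integral do rewrite inner.
have -> : 2 * variance = (mean (fun x => g x ^+ 2) + mean (fun x => g x ^+ 2)) -
   2 * mean g * mean g by rewrite /variance; ring.
have M0 := mean_ge0 mg g0 gB; have M20 := mean_ge0 mg2 g20 g2B.
apply: eadd_real; rewrite EFinD EFinM -{1}(meanE mg g0 gB) -{2}(meanE mg2 g20 g2B).
rewrite -(mean_cst M20) -eintZ ?mulr_ge0//; [|by meas|by move=> x; rewrite mulr_ge0].
rewrite -eintD; [|by meas|by meas| |]; last 2 first.
- move=> x; apply: mulr_ge0 => //.
  rewrite -lee_fin -(mean_sqr_dist (g0 x)); apply: eint_ge0 => y.
  by rewrite mulr_ge0 ?sqr_ge0.
- by move=> x; rewrite !mulr_ge0.
rewrite -eintD; [|by meas|by meas| |]; last 2 first.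
- by move=> x; rewrite mulr_ge0.
- by move=> x; rewrite mulr_ge0 ?sqr_ge0.
by apply: eq_eint => x; ring.
Qed.

End variance.

(** The tangent line of the power at [M], that is, Young's inequality for the exponents s and s/(s -
    1). *)
Lemma powR_tangent (s u M : R) : 1 <= s -> 0 <= u -> 0 <= M ->
  s * M `^ (s - 1) * u <= u `^ s + (s - 1) * M `^ s.
Proof.
rewrite le_eqVlt => /orP[/eqP <-|s1] u0 M0.
  by rewrite subrr powRr0 mul0r addr0 mulr1 mul1r powRr1.
have s0 : 0 < s by apply: lt_trans s1.
have s10 : 0 < s - 1 by rewrite subr_gt0.
pose q := s / (s - 1).
have q0 : 0 < q by rewrite divr_gt0.
have sq : s^-1 + q^-1 = 1 by rewrite /q; field; rewrite !gt_eqF.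
have := conjugate_powR u0 (powR_ge0 M (s - 1)) s0 q0 sq.
rewrite -powRrM (_ : (s - 1) * q = s); last by rewrite /q; field; rewrite gt_eqF.
rewrite -(ler_pM2l s0) => /le_trans h; rewrite -mulrA [M `^ _ * u]mulrC; apply: h.
by rewrite le_eqVlt; apply/orP; left; apply/eqP; rewrite /q; field; rewrite !gt_eqF.
Qed.

(** Integrate the tangent line at the mean [M]. The right-hand side may be infinite, so [u] may be
    unbounded. *)
Lemma jensen_powR (s M : R) (u : T -> R) : 1 <= s -> measurable_fun setT u ->
  (forall x, 0 <= u x) -> (\int[m]_x (u x * th x)%:E = M%:E)%E ->
  ((M `^ s)%:E <= \int[m]_x (u x `^ s * th x)%:E)%E.
Proof.
move=> s1 mu u0 uM.
have M0 : 0 <= M by rewrite -lee_fin -uM; apply: eint_ge0 => x; rewrite mulr_ge0.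
have s10 : 0 <= s - 1 by rewrite subr_ge0.
have s0 : 0 <= s by apply: le_trans s1.
have Ms0 : 0 <= (s - 1) * M `^ s by rewrite mulr_ge0// powR_ge0.
have : ((s * M `^ (s - 1))%:E * M%:E <=
    \int[m]_x (u x `^ s * th x)%:E + ((s - 1) * M `^ s)%:E)%E.
  rewrite -uM -(mean_cst Ms0) -eintZ; [|by rewrite mulr_ge0 ?powR_ge0|by meas|]; last first.
    by move=> x; rewrite mulr_ge0.
  rewrite -eintD; [|by meas|by meas| |]; last 2 first.
  - by move=> x; rewrite mulr_ge0 ?powR_ge0.
  - by move=> x; rewrite mulr_ge0.
  apply: le_eint; [by meas|by meas| |] => x.
    by rewrite !mulr_ge0 ?powR_ge0.
  by rewrite mulrA -mulrDl ler_wpM2r// powR_tangent.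
rewrite -EFinM; have -> : s * M `^ (s - 1) * M = s * M `^ s.
  have [->|Mn0] := eqVneq M 0.
    by rewrite mulr0 powR0 ?mulr0// gt_eqF// (lt_le_trans _ s1).
  by rewrite -mulrA [_ * M]mulrC mulr_powRB1// (lt_le_trans _ s1).
move: (\int[m]_x (u x `^ s * th x)%:E)%E => [I| |]//; last by move=> _; rewrite leey.
rewrite -EFinD !lee_fin; lra.
Qed.

End weighted_mean.


(** * Hardy's inequality and the log-gamma weight on the line *)

Section exponential_line.
Context {R : realType}.
Notation lam := (@lebesgue_measure R).

Lemma expR_ge_quad (x : R) : 0 <= x -> 1 + x + x ^+ 2 / 4 <= expR x.
Proof.
move=> x0; have -> : x = x / 2 + x / 2 by field.
rewrite expRD -expr2; have h := expR_ge1Dx (x / 2).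
have -> : 1 + (x / 2 + x / 2) + (x / 2 + x / 2) ^+ 2 / 4 = (1 + x / 2) ^+ 2 by field.
by rewrite ler_sqr// nnegrE; [lra|exact: expR_ge0].
Qed.

Lemma exp_abs_int (c : R) : 0 < c -> exists K : R, 0 <= K /\
  (\int[lam]_u (expR (- (c * `|u|)))%:E = K%:E)%E.
Proof.
move=> c0.
have mE : measurable_fun setT (fun u : R => expR (- (c * `|u|))) by meas.
have e0 (u : R) : 0 <= expR (- (c * `|u|)) by exact: expR_ge0.
have cE : continuous (fun u : R => expR (- (c * `|u|))).
  move=> x; apply: (@continuous_comp _ _ _ (fun u : R => - (c * `|u|)) expR); last exact: continuous_expR.
  by apply: cvgN; apply: cvgMr; exact: norm_continuous.
have H := ge0_symfun_integralT e0 cE (fun u => congr1 (fun z => expR (- (c * z))) (esym (normrN u))).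
have le : (\int[lam]_(x in [set x : R | (0 <= x)%R]) (expR (- (c * `|x|)))%:E <= (c^-1)%:E)%E.
  rewrite -[leRHS]mule1 -(integral_exponential_pdf c0) integral_mkcond.
  rewrite -eintZ ?invr_ge0 ?(ltW c0)//; last 2 first.
  - exact: measurable_exponential_pdf.
  - by move=> x; apply: exponential_pdf_ge0; exact: ltW.
  rewrite le_eqVlt; apply/orP; left; apply/eqP; apply: eq_integral => x _.
  rewrite patchE; have [x0|x0] := leP 0 x.
    by rewrite ifT ?inE//= exponential_pdfE// ger0_norm// mulrA mulVf ?gt_eqF// mul1r mulNr.
  rewrite lt0_exponential_pdf// mulr0 ifF//.
  by apply/negP; rewrite inE/= leNgt x0.
exists (fine (\int[lam]_u (expR (- (c * `|u|)))%:E)%E); split.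
  by rewrite fine_ge0// eint_ge0.
rewrite fineK// ge0_fin_numE ?eint_ge0// H.
apply: (@le_lt_trans _ _ (2%:E * (c^-1)%:E)%E); last by rewrite -EFinM ltry.
by apply: lee_wpmul2l.
Qed.

Lemma exp_deriv (b r v : R) :
  is_derive v 1 (fun v : R => expR (b * v - r * expR v))
    ((b - r * expR v) * expR (b * v - r * expR v)).
Proof.
have h2 : is_derive v 1 (b \*: (id : R -> R)) (b *: 1) by apply: is_deriveZ.
have h3 : is_derive v 1 (r \*: (expR : R -> R)) (r *: expR v) by apply: is_deriveZ.
have h1 : is_derive v 1 (fun v : R => b * v - r * expR v) (b - r * expR v).
  by have := is_deriveB h2 h3; rewrite /GRing.scale/= mulr1.
have := @is_derive1_comp _ expR (fun v : R => b * v - r * expR v) v _ _ (is_derive_expR _) h1.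
by rewrite mulrC.
Qed.

Lemma exp_continuous (b r : R) : continuous (fun v : R => expR (b * v - r * expR v)).
Proof.
move=> v; have h := exp_deriv b r v.
apply: differentiable_continuous; apply/derivable1_diffP; exact: ex_derive.
Qed.

Lemma ftc_exp (b r s t : R) : 0 <= b -> 0 <= r -> s < t ->
  ((expR (b * t - r * expR t))%:E +
   \int[lam]_(v in `[s, t]) (r * expR v * expR (b * v - r * expR v))%:E =
   (expR (b * s - r * expR s))%:E +
   \int[lam]_(v in `[s, t]) (b * expR (b * v - r * expR v))%:E)%E.
Proof.
move=> b0 r0 st; pose E v := expR (b * v - r * expR v).
have cE : continuous E by exact: exp_continuous.
have c1 : continuous (fun v : R => r * expR v * E v).
  move=> v; apply: cvgM; last exact: cE.
  by apply: cvgMr; exact: continuous_expR.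
have c2 : continuous (fun v : R => b * E v) by move=> v; apply: cvgMr; exact: cE.
have c3 : continuous (fun v : R => (b - r * expR v) * E v).
  move=> v; apply: cvgM; last exact: cE.
  by apply: cvgB; [exact: cvg_cst|apply: cvgMr; exact: continuous_expR].
have i1 : lam.-integrable `[s, t] (EFin \o (fun v : R => r * expR v * E v)).
  by apply: continuous_compact_integrable; [exact: segment_compact|exact: continuous_subspaceT].
have i3 : lam.-integrable `[s, t] (EFin \o (fun v : R => (b - r * expR v) * E v)).
  by apply: continuous_compact_integrable; [exact: segment_compact|exact: continuous_subspaceT].
have F : (\int[lam]_(v in `[s, t]) ((b - r * expR v) * E v)%:E = (E t)%:E - (E s)%:E)%E.
  apply: continuous_FTC2 => //; first exact: continuous_subspaceT.
    split.
    - by move=> v _; have h := exp_deriv b r v; exact: ex_derive.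
    - by apply: cvg_at_right_filter; exact: cE.
    - by apply: cvg_at_left_filter; exact: cE.
  by move=> v _; rewrite derive1E; have h := exp_deriv b r v; exact: derive_val.
have -> : (\int[lam]_(v in `[s, t]) (b * E v)%:E =
   \int[lam]_(v in `[s, t]) ((b - r * expR v) * E v)%:E +
   \int[lam]_(v in `[s, t]) (r * expR v * E v)%:E)%E.
  rewrite -integralD//; apply: eq_integral => v _ /=.
  by rewrite -EFinD; congr EFin; ring.
have e1 : ((E s)%:E + ((E t)%:E - (E s)%:E) = (E t)%:E)%E by rewrite addeC subeK.
by rewrite F; change (expR (b * s - r * expR s)) with (E s); rewrite [RHS]addeA e1.
Qed.

(** The indicator of a half-line as a real factor, so that truncations can be multiplied into
    integrands. *)
Definition step (x : R) : R := (0 <= x)%R%:R.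

Lemma measurable_step d (T : measurableType d) (f : T -> R) :
  measurable_fun setT f -> measurable_fun setT (fun t => step (f t)).
Proof.
move=> mf; apply: (measurableT_comp (f := step)) => //.
rewrite (_ : step = \1_[set` `[0, +oo[%R]) //.
apply/funext => x; rewrite /step indicE; congr (_%:R).
by rewrite mem_setE in_itv/= andbT.
Qed.

Lemma step_ge0 x : 0 <= step x. Proof. exact: ler0n. Qed.

Lemma step01 x : step x = 0 \/ step x = 1 /\ 0 <= x.
Proof. by rewrite /step; case: (leP 0 x) => h; [right|left]. Qed.

(** The indicator that v lies between 0 and s, whatever the sign of s. *)
Definition btw (s v : R) : R := Num.max (step v * step (s - v)) (step (- v) * step (v - s)).

Lemma measurable_btw d (T : measurableType d) (f g : T -> R) :
  measurable_fun setT f -> measurable_fun setT g ->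
  measurable_fun setT (fun t => btw (f t) (g t)).
Proof.
move=> mf mg; apply: measurable_maxr; apply: measurable_funM; apply: measurable_step; meas.
Qed.

Lemma btw01 s v : btw s v = 0 \/ [/\ btw s v = 1, `|v| <= `|s| & `|s - v| = `|s| - `|v|].
Proof.
rewrite /btw; have [->|[-> v0]] := step01 v.
  have [->|[-> v1]] := step01 (- v); first by left; rewrite !mul0r maxxx.
  have [->|[-> sv]] := step01 (v - s); first by left; rewrite mul0r mulr0 maxxx.
  right; have v0 : v <= 0 by rewrite -oppr_ge0.
  have s0 : s <= 0 by lra.
  rewrite mul0r mul1r; split; first by rewrite max_r.
    by rewrite !ler0_norm//; lra.
  by rewrite !ler0_norm//; lra.
have [->|[-> sv]] := step01 (s - v).
  have [->|[-> v1]] := step01 (- v); first by left; rewrite !(mul0r, mulr0) maxxx.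
  have [->|[-> sv]] := step01 (v - s); first by left; rewrite !(mul0r, mulr0) maxxx.
  right; have v00 : v = 0 by apply/eqP; rewrite eq_le v0 -oppr_ge0 v1.
  rewrite v00 in sv *; have s0 : s <= 0 by lra.
  by rewrite mulr0 mul1r; split; [rewrite max_r|rewrite normr0|rewrite subr0 normr0 subr0].
right; have s0 : 0 <= s by lra.
rewrite mul1r; split.
- apply: max_l; have [->|[-> v1]] := step01 (- v); first by rewrite mul0r.
  by rewrite mul1r; have [->|[-> _]] := step01 (v - s).
- by rewrite !ger0_norm//; lra.
- by rewrite !ger0_norm//; lra.
Qed.

Lemma btw_ge0 s v : 0 <= btw s v.
Proof. by have [->|[-> _ _]] := btw01 s v. Qed.

Lemma btw_idem s v : btw s v ^+ 2 = btw s v.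
Proof. by have [->|[-> _ _]] := btw01 s v; rewrite ?expr0n ?expr1n. Qed.

Lemma exp_abs_translation_le (c K s : R) : (\int[lam]_u (expR (- (c * `|u|)))%:E <= K%:E)%E ->
  (\int[lam]_u (expR (- (c * `|s - u|)))%:E <= K%:E)%E.
Proof.
move=> KE; rewrite (_ : (\int[lam]_u _)%E = (\int[lam]_u (expR (- (c * `|u|)))%:E)%E)//.
rewrite -[RHS](lebesgue_translation (- s) (f := fun u => (expR (- (c * `|u|)))%:E)).
- by apply: eq_eint => u; rewrite distrC.
- by apply/measurable_EFinP; meas.
- by move=> u; rewrite lee_fin expR_ge0.
Qed.

(* Hardy's inequality in the weighted form [int p (int_0^s phi)^2 <= C int p phi^2],
   for a weight that decays exponentially away from the origin. *)
Lemma hardy (p phi D : R -> R) (k c K U : R) :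
  measurable_fun setT p -> measurable_fun setT phi -> measurable_fun setT D ->
  (forall u, 0 <= p u) -> (forall u, 0 <= phi u) -> (forall u, 0 <= D u) -> 0 <= k -> 0 < K ->
  (forall s v, btw s v = 1 -> p s <= k * p v * expR (- (c * (`|s| - `|v|)))) ->
  (\int[lam]_u (expR (- (c / 2 * `|u|)))%:E <= K%:E)%E ->
  (forall s, (D s)%:E <= \int[lam]_v (btw s v * phi v)%:E)%E ->
  (\int[lam]_s (step (U - `|s|) * (p s * D s ^+ 2))%:E <=
   (k * K ^+ 2)%:E * \int[lam]_v (step (U - `|v|) * (phi v ^+ 2 * p v))%:E)%E.
Proof.
move=> mp mphi mD p0 phi0 D0 k0 K0 pk EK Dphi.
pose A s := (\int[lam]_v (btw s v * phi v ^+ 2 * expR (- (c / 2 * `|v|)))%:E)%E.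
have mbtw (s : R) : measurable_fun setT (btw s) by apply: (measurable_btw (f := fun=> s)).
have mb2 : measurable_fun setT (fun z : R * R => btw z.1 z.2) by apply: measurable_btw; meas.
have q0 s v : 0 <= btw s v * phi v ^+ 2 * expR (- (c / 2 * `|v|)).
  by rewrite !mulr_ge0 ?btw_ge0 ?expR_ge0 ?sqr_ge0.
(* Cauchy-Schwarz between 0 and s, moving a factor exp(c|v|/4) from [phi] to the constant function;
   the latter's square then integrates to at most K exp(c|s|/2). *)
have cs s : ((D s ^+ 2)%:E <= (K * expR (c / 2 * `|s|))%:E * A s)%E.
  have A0 : (0 <= A s)%E by exact: eint_ge0.
  have Ke : 0 < K * expR (c / 2 * `|s|) by rewrite mulr_gt0 ?expR_gt0.
  case E : (A s) A0 => [a| |] //; last by move=> _; rewrite gt0_muley ?lte_fin// leey.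
  rewrite lee_fin => a0.
  pose f v := btw s v * phi v * expR (- (c / 4 * `|v|)).
  pose g v := btw s v * expR (c / 4 * `|v|).
  have mf : measurable_fun setT f by rewrite /f; meas.
  have mg : measurable_fun setT g by rewrite /g; meas.
  have f0 v : 0 <= f v by rewrite !mulr_ge0 ?btw_ge0 ?expR_ge0.
  have g0 v : 0 <= g v by rewrite !mulr_ge0 ?btw_ge0 ?expR_ge0.
  have fA : (\int[lam]_v (f v ^+ 2)%:E <= a%:E)%E.
    rewrite -E /A le_eqVlt; apply/orP; left; apply/eqP; apply: eq_eint => v.
    rewrite /f !exprMn btw_idem -expRM_natl; congr (_ * expR _); by field.
  have gB : (\int[lam]_v (g v ^+ 2)%:E <= (K * expR (c / 2 * `|s|))%:E)%E.
    apply: (@le_trans _ _ (\int[lam]_v (expR (c / 2 * `|s|) * expR (- (c / 2 * `|s - v|)))%:E)%E).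
      apply: le_eint.
      - by refine (measurable_lebR _); meas.
      - by refine (measurable_lebR _); meas.
      - by move=> v; exact: sqr_ge0.
      move=> v; rewrite /g exprMn btw_idem -expRM_natl -expRD.
      have [->|[-> vs ->]] := btw01 s v; first by rewrite mul0r expR_ge0.
      rewrite mul1r ler_expR le_eqVlt; apply/orP; left; apply/eqP; by field.
    rewrite eintZ ?expR_ge0//; last by refine (measurable_lebR _); meas.
    rewrite (mulrC K) EFinM; apply: lee_wpmul2l; first by rewrite lee_fin expR_ge0.
    exact: exp_abs_translation_le.
  have [I [EI I0 I2]] := @cauchy_schwarz _ (measurableTypeR R) R lam f g _ _ mf mg f0 g0 fA gB.
  rewrite -EFinM lee_fin mulrC; apply: le_trans I2; rewrite ler_sqr ?nnegrE//.
  rewrite -lee_fin -EI; apply: le_trans (Dphi s) _.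
  rewrite le_eqVlt; apply/orP; left; apply/eqP; apply: eq_eint => v.
  have e : expR (- (c / 4 * `|v|)) * expR (c / 4 * `|v|) = 1 by rewrite -expRD addNr expR0.
  transitivity (btw s v ^+ 2 * phi v * (expR (- (c / 4 * `|v|)) * expR (c / 4 * `|v|))).
    by rewrite e mulr1 btw_idem.
  rewrite /f /g; ring.
pose H s v := step (U - `|s|) * p s * (K * expR (c / 2 * `|s|)) *
   (btw s v * phi v ^+ 2 * expR (- (c / 2 * `|v|))).
have mH : measurable_fun setT (fun z : R * R => H z.1 z.2).
  rewrite /H; meas; apply: measurable_step; meas.
have H0 s v : 0 <= H s v.
  by apply: mulr_ge0 => //; rewrite !mulr_ge0 ?step_ge0 ?expR_ge0// ltW.
have mst : measurable_fun setT (fun s : R => step (U - `|s|)) by apply: measurable_step; meas.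
apply: (@le_trans _ _ (\int[lam]_s \int[lam]_v (H s v)%:E)%E).
  apply: ge0_le_integral => //.
  - by move=> s _; rewrite lee_fin !mulr_ge0 ?step_ge0 ?sqr_ge0.
  - by apply/measurable_EFinP; refine (measurable_lebR _); meas.
  - have := measurable_eint lam mH H0; exact.
  - move=> s _; rewrite /H eintZ; last 3 first.
    + by rewrite !mulr_ge0 ?step_ge0 ?expR_ge0// ltW.
    + by refine (measurable_lebR _); meas.
    + by move=> v; exact: q0.
    rewrite mulrA EFinM [X in (_ <= X * _)%E]EFinM -muleA; apply: lee_wpmul2l => //.
    by rewrite lee_fin mulr_ge0 ?step_ge0.
(* After the swap, for fixed v the decay of [p] leaves exp(-c(|s| - |v|)/2), whose integral in s is
   at most K. The truncation survives because |v| <= |s| <= U. *)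
rewrite (tonelli lam lam mH H0).
pose Q v := step (U - `|v|) * (phi v ^+ 2 * p v).
have mQ : measurable_fun setT Q by rewrite /Q; meas.
have Q0 v : 0 <= Q v by rewrite !mulr_ge0 ?step_ge0 ?sqr_ge0.
have kK : 0 <= k * K by rewrite mulr_ge0// ltW.
have -> : ((k * K ^+ 2)%:E * \int[lam]_v (Q v)%:E = \int[lam]_v (k * K * Q v * K)%:E)%E.
  rewrite -eintZ//; last by rewrite mulr_ge0 ?sqr_ge0.
  by apply: eq_eint => v; ring.
apply: ge0_le_integral => //.
- by move=> v _; apply: eint_ge0 => s; exact: H0.
- have mH' : measurable_fun setT (fun z : R * R => H z.2 z.1).
    by apply: (measurableT_comp mH (g := fun z : R * R => (z.2, z.1))); meas.
  have := measurable_eint lam mH' (fun v s => H0 s v); exact.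
- by apply/measurable_EFinP; refine (measurable_lebR _); meas.
move=> v _.
apply: (@le_trans _ _ (\int[lam]_s (k * K * Q v * expR (- (c / 2 * `|v - s|)))%:E)%E).
  apply: le_eint.
  - refine (measurable_lebR _).
    exact: (measurableT_comp mH (pair2_measurable v)).
  - by refine (measurable_lebR _); meas.
  - by move=> s; exact: H0.
  move=> s; rewrite /H /Q distrC; have [->|[b1 vs ->]] := btw01 s v.
    by rewrite !mul0r mulr0; apply: mulr_ge0; [exact: (mulr_ge0 kK (Q0 v))|exact: expR_ge0].
  rewrite b1 mul1r.
  have [->|[-> Us]] := step01 (U - `|s|); first by
    rewrite !mul0r; apply: mulr_ge0; [exact: (mulr_ge0 kK (Q0 v))|exact: expR_ge0].
  have -> : step (U - `|v|) = 1 by rewrite /step (_ : 0 <= U - `|v|)//; lra.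
  rewrite !mul1r; have := pk s v b1 => /(ler_wpM2r (_ : 0 <= K * expR (c / 2 * `|s|) * (phi v ^+ 2 * expR (- (c / 2 * `|v|))))) h.
  have h0 : 0 <= K * expR (c / 2 * `|s|) * (phi v ^+ 2 * expR (- (c / 2 * `|v|))).
    by apply: mulr_ge0; apply: mulr_ge0; rewrite ?sqr_ge0 ?expR_ge0// ltW.
  rewrite -mulrA; apply: le_trans (h h0) _.
  have -> : expR (- (c / 2 * (`|s| - `|v|))) =
    expR (- (c * (`|s| - `|v|))) * expR (c / 2 * `|s|) * expR (- (c / 2 * `|v|)).
    by rewrite -!expRD; congr expR; field.
  rewrite le_eqVlt; apply/orP; left; apply/eqP; ring.
have kQ := mulr_ge0 kK (Q0 v).
rewrite eintZ//; last by refine (measurable_lebR _); meas.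
rewrite [X in (_ <= X)%E]EFinM; apply: lee_wpmul2l; first by rewrite lee_fin.
exact: exp_abs_translation_le.
Qed.


End exponential_line.


Section gamma_weight.
Context {R : realType}.
Notation lam := (@lebesgue_measure R).

(** The density of the logarithm of a gamma variable of parameter [a], up to the factor Gamma(a). *)
Definition gweight (a u : R) : R := expR (a * u - expR u).

Lemma gweight_gt0 a u : 0 < gweight a u. Proof. exact: expR_gt0. Qed.

Lemma gweight_ge0 a u : 0 <= gweight a u. Proof. exact: expR_ge0. Qed.

Lemma measurable_gweight a : measurable_fun setT (gweight a).
Proof. by rewrite /gweight; meas. Qed.

(** On the right, e^u >= u^2/4 and a completed square beat the growth of 2 a u; on the left, e^(au)
    already decays. *)
Lemma gweight_decay (a u : R) : 0 < a ->
  gweight a u <= expR (4 * a ^+ 2) * expR (- (a * `|u|)).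
Proof.
move=> a0; rewrite /gweight -expRD ler_expR; have [u0|u0] := leP 0 u.
  rewrite ger0_norm//; have := expR_ge_quad u0.
  have : 0 <= (u / 2 - 2 * a) ^+ 2 by exact: sqr_ge0.
  rewrite (_ : (u / 2 - 2 * a) ^+ 2 = u ^+ 2 / 4 - 2 * (a * u) + 4 * a ^+ 2); last by field.
  by move: (expR u) (u ^+ 2) (a * u) (a ^+ 2) => *; lra.
rewrite ltr0_norm//; have := expR_gt0 u; have := sqr_ge0 a; rewrite mulrN.
by move: (expR u) (a * u) (a ^+ 2) => *; lra.
Qed.

(** The decay that [hardy] asks for. Left of 0 the factor e^(au) decays at rate a. Right of 0, with
    d = s - v, the increment e^s - e^v is at least d + d^2/4: the term d gives the rate 1, and d^2/4
    pays for a d. *)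
Lemma gweight_ratio (a s v : R) : 0 < a -> btw s v = 1 ->
  gweight a s <= expR (1 + a ^+ 2) * gweight a v *
    expR (- (Num.min 1 a * (`|s| - `|v|))).
Proof.
move=> a0 b1; rewrite /gweight -!expRD ler_expR.
have c1 : Num.min 1 a <= 1 by rewrite ge_min lexx.
have ca : Num.min 1 a <= a by rewrite ge_min lexx orbT.
move: (Num.min 1 a) c1 ca => c c1 ca.
have a20 := sqr_ge0 a.
move: b1; rewrite /btw; have [->|[-> v0]] := step01 v.
  have [->|[-> v1]] := step01 (- v); first by rewrite !mul0r maxxx => /eqP; rewrite eq_sym oner_eq0.
  have [->|[-> sv]] := step01 (v - s); first by rewrite mul0r mulr0 maxxx => /eqP; rewrite eq_sym oner_eq0.
  move=> _; have v0 : v <= 0 by rewrite -oppr_ge0.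
  have s0 : s <= 0 by lra.
  rewrite !ler0_norm//.
  have : c * (v - s) <= a * (v - s) by rewrite ler_wpM2r.
  have : expR v <= 1 by rewrite -expR0 ler_expR.
  have := expR_gt0 s; move: (expR s) (expR v) => es ev; nra.
have [->|[-> sv]] := step01 (s - v).
  have [->|[-> v1]] := step01 (- v); first by rewrite !(mul0r, mulr0) maxxx => /eqP; rewrite eq_sym oner_eq0.
  have v00 : v = 0 by apply/eqP; rewrite eq_le v0 -oppr_ge0 v1.
  rewrite v00 sub0r mul1r; have [->|[-> s0]] := step01 (- s).
    by rewrite mulr0 maxxx => /eqP; rewrite eq_sym oner_eq0.
  move=> _; rewrite mulr0 normr0 subr0 expR0 ler0_norm; last by lra.
  have : c * (- s) <= a * (- s) by rewrite ler_wpM2r.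
  have := expR_gt0 s; move: (expR s) => es; lra.
move=> _; have s0 : 0 <= s by lra.
rewrite !ger0_norm//; set d := s - v in sv *.
have es : expR s = expR v * expR d by rewrite -expRD /d addrC subrK.
have ev : 1 <= expR v by rewrite -expR0 ler_expR.
have ed := expR_ge_quad sv.
have h1 : d + d ^+ 2 / 4 <= expR s - expR v.
  rewrite es; have -> : expR v * expR d - expR v = expR v * (expR d - 1) by ring.
  apply: (@le_trans _ _ (expR d - 1)); first by lra.
  by rewrite ler_peMl// subr_ge0 -expR0 ler_expR.
have h2 : c * d <= d by rewrite ler_piMl.
have h3 : 0 <= (d / 2 - a) ^+ 2 by exact: sqr_ge0.
rewrite (_ : (d / 2 - a) ^+ 2 = d ^+ 2 / 4 - a * d + a ^+ 2) in h3; last by field.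
have -> : a * s = a * v + a * d by rewrite /d; ring.
move: h1 h2 h3; move: (expR s) (expR v) (a * d) (c * d) (d ^+ 2) (a ^+ 2) (a * v) => *; lra.
Qed.

Lemma gamma_int (a : R) : 0 < a -> exists G : R, 0 < G /\
  (\int[lam]_u (gweight a u)%:E = G%:E)%E.
Proof.
move=> a0; have [K [K0 EK]] := exp_abs_int a0.
have mg := measurable_gweight a.
have fin : (\int[lam]_u (gweight a u)%:E <= (expR (4 * a ^+ 2) * K)%:E)%E.
  rewrite EFinM -EK -eintZ ?expR_ge0//; last by refine (measurable_lebR _); meas.
  apply: le_eint.
  - exact: measurable_lebR.
  - by refine (measurable_lebR _); meas.
  - by move=> u; exact: gweight_ge0.
  - by move=> u; exact: gweight_decay.
have pos : ((expR (- expR 1))%:E <= \int[lam]_u (gweight a u)%:E)%E.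
  have -> : (expR (- expR 1))%:E = (\int[lam]_(u in `[0%R, 1%R]) cst (expR (- expR 1))%:E u)%E.
    by rewrite integral_cst//= lebesgue_measure_itv/= lte_fin ltr01 oppr0 adde0 mule1.
  apply: (@le_trans _ _ (\int[lam]_(u in `[0%R, 1%R]) (gweight a u)%:E)%E).
    apply: ge0_le_integral => //.
    - by move=> u _; rewrite lee_fin expR_ge0.
    - by apply/measurable_EFinP; apply: measurable_funTS; exact: measurable_lebR.
    move=> u; rewrite /= in_itv/= => /andP[u0 u1]; rewrite lee_fin ler_expR.
    have : expR u <= expR 1 by rewrite ler_expR.
    have : 0 <= a * u by rewrite mulr_ge0// ltW.
    lra.
  apply: ge0_subset_integral => //.
  - by apply/measurable_EFinP; exact: measurable_lebR.
  - by move=> u _; rewrite lee_fin gweight_ge0.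
move: (\int[lam]_u (gweight a u)%:E)%E fin pos => [G| |] //.
rewrite !lee_fin => _ G0; exists G; split => //.
by apply: lt_le_trans G0; exact: expR_gt0.
Qed.

(** Shifting u by ln l is the scaling of the gamma integral, whence the power l^(-b). *)
Lemma gamma_mixture (b l G : R) : 0 < l -> (\int[lam]_u (gweight b u)%:E = G%:E)%E ->
  (\int[lam]_u (expR (b * u - l * expR u))%:E = (expR (- (b * ln l)) * G)%:E)%E.
Proof.
move=> l0 EG; rewrite EFinM -EG -eintZ ?expR_ge0//; [|exact: measurable_lebR (measurable_gweight _)|by move=> u; exact: gweight_ge0].
rewrite -[LHS](lebesgue_translation (- ln l) (f := fun u => (expR (b * u - l * expR u))%:E)).
- apply: eq_eint => u; rewrite /gweight -expRD; congr expR.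
  rewrite expRD expRN lnK ?posrE// mulrDr mulrCA divff ?gt_eqF// mulr1; ring.
- by apply/measurable_EFinP; meas.
- by move=> u; rewrite lee_fin expR_ge0.
Qed.

Lemma gamma_tail (a : R) : 0 < a -> exists C : R, 0 < C /\ forall U, 0 <= U ->
  (\int[lam]_u ((1 - step (U - `|u|)) * gweight a u)%:E <= (C * expR (- (a * U)))%:E)%E.
Proof.
move=> a0; have [K [K0 EK]] := exp_abs_int a0.
exists (expR (4 * a ^+ 2) * (2 * K + 1)); split; first by rewrite mulr_gt0 ?expR_gt0//; lra.
move=> U U0.
have EKle : (\int[lam]_u (expR (- (a * `|u|)))%:E <= K%:E)%E by rewrite EK.
have st (u : R) : 0 <= 1 - step (U - `|u|) by have [->|[-> _]] := step01 (U - `|u|); lra.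
pose c := expR (4 * a ^+ 2) * expR (- (a * U)).
have c0 : 0 <= c by rewrite mulr_ge0 ?expR_ge0.
have mst : measurable_fun setT (fun s : R => step (U - `|s|)) by apply: measurable_step; meas.
have mg := measurable_gweight a.
(* Beyond U, exp(-a|u|) is exp(-aU) times an exponential decaying from U or from -U. *)
apply: (@le_trans _ _ (\int[lam]_u (c * (expR (- (a * `|U - u|)) + expR (- (a * `|- U - u|))))%:E)%E).
  apply: le_eint.
  - by refine (measurable_lebR _); meas.
  - by refine (measurable_lebR _); meas.
  - by move=> u; rewrite mulr_ge0 ?gweight_ge0.
  move=> u; have [Uu|uU] := leP 0 (U - `|u|).
    by rewrite /step Uu subrr mul0r; apply: mulr_ge0 => //; apply: addr_ge0; exact: expR_ge0.
  have -> : step (U - `|u|) = 0 by rewrite /step leNgt uU.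
  rewrite subr0 mul1r; apply: le_trans (gweight_decay u a0) _.
  rewrite /c -mulrA; apply: ler_wpM2l; first exact: expR_ge0.
  rewrite mulrDr -!expRD; have [u0|u0] := leP 0 u.
    rewrite ger0_norm// in uU *; rewrite ler_wpDr ?expR_ge0// ler_expR ltr0_norm//.
    by rewrite le_eqVlt; apply/orP; left; apply/eqP; ring.
  rewrite ltr0_norm// in uU *; rewrite ler_wpDl ?expR_ge0// ler_expR gtr0_norm; last by lra.
  by rewrite le_eqVlt; apply/orP; left; apply/eqP; ring.
rewrite eintZ//; last by refine (measurable_lebR _); meas.
rewrite eintD; [|by refine (measurable_lebR _); meas|by refine (measurable_lebR _); meas|by move=> u; exact: expR_ge0|by move=> u; exact: expR_ge0].
apply: (@le_trans _ _ (c%:E * (K%:E + K%:E))%E).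
  by apply: lee_wpmul2l; rewrite ?lee_fin//; apply: leeD; exact: exp_abs_translation_le.
rewrite -EFinD -EFinM lee_fin /c -!mulrA ler_wpM2l ?expR_ge0// [leRHS]mulrC.
by rewrite ler_wpM2l ?expR_ge0//; lra.
Qed.

End gamma_weight.


(** * Gaussians in log-scale and the variation of their means *)

Section scale_family.
Context {R : realType} {n : nat}.
Notation lam := (@lebesgue_measure R).
Notation E := 'rV[R]_n.
Implicit Types x y : E.

Let Cn : R := Num.sqrt pi^-1 ^+ n.

Let Cn0 : 0 <= Cn. Proof. by rewrite exprn_ge0// sqrtr_ge0. Qed.

(** As a function of u = ln s the density has the shape exp(b u - r e^u), the one handled by
    [ftc_exp] and [gamma_mixture]. *)
Lemma gam_exp u x : gam (expR u) x =
  Cn * expR (n%:R / 2 * u - dot x x * expR u).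
Proof.
rewrite /gam sqrtrM ?expR_ge0// exprMn.
have -> : Num.sqrt (expR u) = expR (u / 2).
  have -> : expR u = expR (u / 2) ^+ 2 by rewrite -expRM_natl; congr expR; field.
  by rewrite sqrtr_sqr ger0_norm// expR_ge0.
rewrite -expRM_natl mulrAC mulrC -expRD; congr (_ * expR _); by field.
Qed.

Definition ind (s t v : R) : R := step (v - s) * step (t - v).

Lemma ind_ge0 s t v : 0 <= ind s t v. Proof. by rewrite mulr_ge0 ?step_ge0. Qed.

Lemma measurable_ind s t d (T : measurableType d) (f : T -> R) :
  measurable_fun setT f -> measurable_fun setT (fun z => ind s t (f z)).
Proof. by move=> mf; apply: measurable_funM; apply: measurable_step; meas. Qed.

Lemma int_ind s t (f : R -> R) :
  (\int[lam]_(v in `[s, t]) (f v)%:E = \int[lam]_v (ind s t v * f v)%:E)%E.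
Proof.
rewrite integral_mkcond; apply: eq_integral => v _; rewrite patchE mem_setE in_itv/=.
rewrite /ind /step !subr_ge0.
by case: (leP s v) => _ /=; case: (leP v t) => _ /=; rewrite ?(mul0r, mul1r, mulr0).
Qed.

Lemma int_ind1 s t : s < t -> (\int[lam]_v (ind s t v)%:E = (t - s)%:E)%E.
Proof.
move=> st; have := int_ind s t (fun=> 1).
under [X in _ = X -> _]eq_integral do rewrite mulr1.
move=> <-; transitivity (\int[lam]_(v in `[s, t]) cst 1%E v)%E => //.
by rewrite integral_cst//= mul1e lebesgue_measure_itv/= lte_fin st EFinB.
Qed.

Let sq x u := dot x x * expR u.

Let sq0 x u : 0 <= sq x u. Proof. by rewrite mulr_ge0 ?dot_ge0 ?expR_ge0. Qed.

Let msq d (T : measurableType d) (f : T -> E) (g : T -> R) :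
  measurable_fun setT f -> measurable_fun setT g ->
  measurable_fun setT (fun z => sq (f z) (g z)).
Proof. by move=> mf mg; apply: measurable_funM; meas2. Qed.

Let mgam d (T : measurableType d) (f : T -> E) (g : T -> R) :
  measurable_fun setT f -> measurable_fun setT g ->
  measurable_fun setT (fun z => gam (expR (g z)) (f z)).
Proof.
move=> mf mg; under eq_fun do rewrite gam_exp.
apply: measurable_funM => //; apply: (measurableT_comp (@measurable_expR _)).
by apply: measurable_funB; [meas|apply: msq].
Qed.

(* d/du (|x|^2 e^u)^k gam_{e^u}(x) = (k + n/2 - |x|^2 e^u) (|x|^2 e^u)^k gam_{e^u}(x) *)
Lemma gam_ftc k x s t : s < t ->
  ((sq x t ^+ k * gam (expR t) x)%:E +
    \int[lam]_v (ind s t v * (sq x v ^+ k.+1 * gam (expR v) x))%:E =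
   (sq x s ^+ k * gam (expR s) x)%:E +
    \int[lam]_v (ind s t v * ((k%:R + n%:R / 2) * (sq x v ^+ k * gam (expR v) x)))%:E)%E.
Proof.
move=> st; pose b : R := k%:R + n%:R / 2; pose r := dot x x.
have b0 : 0 <= b by rewrite addr_ge0// divr_ge0.
have r0 : 0 <= r by exact: dot_ge0.
have EE v : sq x v ^+ k * gam (expR v) x = Cn * r ^+ k * expR (b * v - r * expR v).
  rewrite gam_exp /sq exprMn -/r -expRM_natl.
  have -> : b * v - r * expR v = k%:R * v + (n%:R / 2 * v - r * expR v) by rewrite /b; ring.
  rewrite [in RHS]expRD; ring.
have c0 : 0 <= Cn * r ^+ k by rewrite mulr_ge0// exprn_ge0.
rewrite -!int_ind !EE.
have mE : measurable_fun setT (fun v : R => expR (b * v - r * expR v)) by meas.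
have -> : (\int[lam]_(v in `[s, t]) (sq x v ^+ k.+1 * gam (expR v) x)%:E =
   (Cn * r ^+ k)%:E * \int[lam]_(v in `[s, t]) (r * expR v * expR (b * v - r * expR v))%:E)%E.
  rewrite -ge0_integralZl_EFin; [|exact: measurable_itv| | |exact: c0].
  - by apply: eq_integral => v _; rewrite -EFinM; congr EFin; rewrite exprS -mulrA EE /sq -/r; ring.
  - by move=> v _; rewrite lee_fin !mulr_ge0 ?expR_ge0.
  - apply/measurable_EFinP; apply: measurable_funTS; refine (measurable_lebR _); meas.
have -> : (\int[lam]_(v in `[s, t]) (b * (sq x v ^+ k * gam (expR v) x))%:E =
   (Cn * r ^+ k)%:E * \int[lam]_(v in `[s, t]) (b * expR (b * v - r * expR v))%:E)%E.
  rewrite -ge0_integralZl_EFin; [|exact: measurable_itv| | |exact: c0].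
  - by apply: eq_integral => v _; rewrite -EFinM; congr EFin; rewrite EE; ring.
  - by move=> v _; rewrite lee_fin !mulr_ge0 ?expR_ge0.
  - apply/measurable_EFinP; apply: measurable_funTS; refine (measurable_lebR _); meas.
have := ftc_exp b0 r0 st => /(congr1 (fun z => (Cn * r ^+ k)%:E * z)%E).
have pos (f : R -> R) : (forall v, 0 <= f v) ->
  (0 <= \int[lam]_(v in `[s, t]) (f v)%:E)%E.
  by move=> f0; apply: integral_ge0 => v _; rewrite lee_fin.
have e1 v : (0 <= (expR (b * v - r * expR v))%:E)%E by rewrite lee_fin expR_ge0.
have p1 := pos (fun v => r * expR v * expR (b * v - r * expR v)).
have p2 := pos (fun v => b * expR (b * v - r * expR v)).
rewrite (ge0_muleDr _ (e1 t) (p1 _)); last by move=> v; rewrite !mulr_ge0 ?expR_ge0.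
rewrite (ge0_muleDr _ (e1 s) (p2 _)); last by move=> v; rewrite mulr_ge0 ?expR_ge0.
by rewrite -!EFinM.
Qed.

Lemma gam_scaling u (H : R -> R) : measurable_fun setT H -> (forall r, 0 <= H r) ->
  (\int[leb n]_x (H (sq x u) * gam (expR u) x)%:E =
   \int[leb n]_x (H (dot x x) * gam 1 x)%:E)%E.
Proof.
move=> mH H0; have e0 := expR_gt0 (- u / 2).
have mf : measurable_fun setT (fun x => H (sq x u) * gam (expR u) x).
  by apply: measurable_funM; [apply: (measurableT_comp mH); apply: msq|apply: mgam]; meas.
rewrite (leb_scaling e0 (f := fun x => (H (sq x u) * gam (expR u) x)%:E)); last 2 first.
- exact/measurable_EFinP.
- by move=> x; rewrite lee_fin mulr_ge0 ?gam_ge0.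
have mg1 : measurable_fun setT (fun x => H (dot x x) * gam 1 x).
  by apply: measurable_funM; [apply: (measurableT_comp mH); meas2|apply: measurable_gam; meas].
rewrite -ge0_integralZl_EFin ?exprn_ge0 ?(ltW e0)//; last 2 first.
- by move=> x _; rewrite lee_fin mulr_ge0 ?gam_ge0.
- apply/measurable_EFinP; apply: (measurableT_comp mf (g := fun x : E => expR (- u / 2) *: x)); meas.
have ee : expR (- u / 2) * expR (- u / 2) * expR u = 1.
  by rewrite -!expRD (_ : _ + _ = 0) ?expR0//; field.
apply: eq_eint => x; rewrite mulrCA.
have -> : sq (expR (- u / 2) *: x) u = dot x x.
  transitivity (expR (- u / 2) * expR (- u / 2) * expR u * dot x x); last by rewrite ee mul1r.
  by rewrite /sq !dotE; ring.
congr (_ * _); rewrite /gam mulrA -exprMn !dotE.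
have -> : expR u * (expR (- u / 2) * (expR (- u / 2) * dot x x)) = 1 * dot x x.
  by rewrite -[in RHS]ee; ring.
congr (_ ^+ n * _); rewrite -[LHS]ger0_norm ?mulr_ge0 ?sqrtr_ge0 ?(ltW e0)//.
rewrite -sqrtr_sqr exprMn sqr_sqrtr ?divr_ge0 ?pi_ge0 ?expR_ge0//.
congr Num.sqrt; transitivity (expR (- u / 2) * expR (- u / 2) * expR u / pi); last by rewrite ee.
ring.
Qed.

Let mom k : \bar R := (\int[leb n]_x (dot x x ^+ k * gam 1 x)%:E)%E.

Let momE k u : (\int[leb n]_x (sq x u ^+ k * gam (expR u) x)%:E = mom k)%E.
Proof.
have mH : measurable_fun setT (fun r : R => `|r| ^+ k) by meas.
have H0 (r : R) : 0 <= `|r| ^+ k by rewrite exprn_ge0.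
have := gam_scaling u mH H0.
under eq_integral do rewrite ger0_norm ?sq0//.
by under [in X in _ = X -> _]eq_integral do rewrite ger0_norm ?dot_ge0//.
Qed.

Let sgam k x v := sq x v ^+ k * gam (expR v) x.

Let sgam0 k x v : 0 <= sgam k x v.
Proof. by rewrite mulr_ge0 ?gam_ge0// exprn_ge0. Qed.

Let msgam k d (T : measurableType d) (f : T -> E) (g : T -> R) :
  measurable_fun setT f -> measurable_fun setT g ->
  measurable_fun setT (fun z => sgam k (f z) (g z)).
Proof.
move=> mf mg; apply: measurable_funM; last exact: mgam.
by apply: measurable_funX; apply: msq.
Qed.

Lemma gam_ftc_int k (g : E -> R) s t : s < t -> measurable_fun setT g ->
  (forall x, 0 <= g x) ->
  (\int[leb n]_x (g x * sgam k x t)%:E +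
    \int[lam]_v \int[leb n]_x (ind s t v * (g x * sgam k.+1 x v))%:E =
   \int[leb n]_x (g x * sgam k x s)%:E +
    \int[lam]_v \int[leb n]_x (ind s t v * ((k%:R + n%:R / 2) * (g x * sgam k x v)))%:E)%E.
Proof.
move=> st mg g0; have b0 : 0 <= k%:R + n%:R / 2 :> R by rewrite addr_ge0// divr_ge0.
pose H1 x v := ind s t v * (g x * sgam k.+1 x v).
pose H2 x v := ind s t v * ((k%:R + n%:R / 2) * (g x * sgam k x v)).
have mi : measurable_fun setT (fun z : E * R => ind s t z.2) by apply: measurable_ind; meas.
have ms j : measurable_fun setT (fun z : E * R => sgam j z.1 z.2) by apply: msgam; meas.
have ms1 j v : measurable_fun setT (fun x : E => sgam j x v) by apply: (msgam j (g := fun=> v)); meas.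
have ms2 j x : measurable_fun setT (fun v : R => sgam j x v) by apply: (msgam j (f := fun=> x)); meas.
have mind : measurable_fun setT (ind s t) by apply: (measurable_ind s t (f := id)).
have mgs j : measurable_fun setT (fun z : E * R => g z.1 * sgam j z.1 z.2).
  by apply: measurable_funM; [exact: (measurableT_comp mg measurable_fst)|exact: ms].
have mH1 : measurable_fun setT (fun z : E * R => H1 z.1 z.2).
  exact: (measurable_funM mi (mgs k.+1)).
have mH2 : measurable_fun setT (fun z : E * R => H2 z.1 z.2).
  exact: (measurable_funM mi (measurable_funM (measurable_cst _) (mgs k))).
have H10 x v : 0 <= H1 x v by rewrite mulr_ge0 ?ind_ge0// mulr_ge0.
have H20 x v : 0 <= H2 x v by rewrite mulr_ge0 ?ind_ge0// mulr_ge0// mulr_ge0.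
rewrite -(tonelli (leb n) lam mH1 H10) -(tonelli (leb n) lam mH2 H20).
have mI1 : measurable_fun setT (fun x => \int[lam]_v (H1 x v)%:E)%E by exact: (measurable_eint lam mH1 H10).
have mI2 : measurable_fun setT (fun x => \int[lam]_v (H2 x v)%:E)%E by exact: (measurable_eint lam mH2 H20).
have msv j v : measurable_fun setT (fun x => (g x * sgam j x v)%:E).
  by apply/measurable_EFinP; apply: measurable_funM => //; exact: ms1.
have sv0 j v x : setT x -> (0 <= (g x * sgam j x v)%:E)%E by move=> _; rewrite lee_fin mulr_ge0.
have I10 x : setT x -> (0 <= \int[lam]_v (H1 x v)%:E)%E by move=> _; exact: eint_ge0.
have I20 x : setT x -> (0 <= \int[lam]_v (H2 x v)%:E)%E by move=> _; exact: eint_ge0.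
apply: (etrans (esym (@ge0_integralD _ _ _ (leb n) setT measurableT _ _ (sv0 k t) (msv k t) I10 mI1))).
apply: (etrans _ (@ge0_integralD _ _ _ (leb n) setT measurableT _ _ (sv0 k s) (msv k s) I20 mI2)).
apply: eq_integral => x _; have := gam_ftc k x st.
move=> /(congr1 (fun z => (g x)%:E * z)%E).
have q1 v : 0 <= ind s t v * (sq x v ^+ k.+1 * gam (expR v) x).
  by rewrite mulr_ge0 ?ind_ge0//; exact: (sgam0 k.+1).
have q2 v : 0 <= ind s t v * ((k%:R + n%:R / 2) * (sq x v ^+ k * gam (expR v) x)).
  by rewrite mulr_ge0 ?ind_ge0// mulr_ge0//; exact: (sgam0 k).
have e1 v : (0 <= (sq x v ^+ k * gam (expR v) x)%:E)%E by rewrite lee_fin; exact: (sgam0 k).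
rewrite (ge0_muleDr _ (e1 t) (eint_ge0 lam q1)) (ge0_muleDr _ (e1 s) (eint_ge0 lam q2)).
have Z1 := @eintZ _ (measurableTypeR R) R lam (g x) _ (g0 x) _ q1.
have Z2 := @eintZ _ (measurableTypeR R) R lam (g x) _ (g0 x) _ q2.
rewrite -Z1; last first.
  by refine (measurable_lebR _); apply: measurable_funM => //; exact: (ms2 k.+1).
rewrite -Z2; last first.
  by refine (measurable_lebR _); apply: measurable_funM => //; apply: measurable_funM => //; exact: (ms2 k).
rewrite -!EFinM.
move=> h; rewrite -/(sgam k x t) -/(sgam k x s) in h.
transitivity ((g x * sgam k x t)%:E + \int[lam]_v (g x * (ind s t v * (sq x v ^+ k.+1 * gam (expR v) x)))%:E)%E.
  by congr (_ + _)%E; apply: eq_eint => v; rewrite /H1 /sgam; ring.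
rewrite h; congr (_ + _)%E; apply: eq_eint => v; rewrite /H2 /sgam; ring.
Qed.

(** By scaling, the moments of |x|^2 e^u do not depend on u. In [gam_ftc_int] with g = 1 the
    boundary terms therefore cancel, and the two remaining integrals must agree. *)
Let mom_rec k (m : R) : mom k = m%:E -> mom k.+1 = ((k%:R + n%:R / 2) * m)%:E.
Proof.
move=> mk; have m0 : 0 <= m.
  by rewrite -lee_fin -mk; apply: eint_ge0 => x; rewrite mulr_ge0 ?gam_ge0// exprn_ge0// dot_ge0.
have b0 : 0 <= k%:R + n%:R / 2 :> R by rewrite addr_ge0// divr_ge0.
have := @gam_ftc_int k (fun=> 1) 0 1 ltr01 (@measurable_cst _ _ _ _ setT (1 : R)) (fun=> ler01).
have ms1 j v : measurable_fun setT (fun x : E => sgam j x v) by apply: (msgam j (g := fun=> v)); meas.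
have s1 j v : (\int[leb n]_x (1 * sgam j x v)%:E = mom j)%E.
  by rewrite -(momE j v); apply: eq_eint => x; rewrite mul1r.
rewrite !s1 mk.
have mind : measurable_fun setT (ind 0 1) by apply: (measurable_ind 0 1 (f := id)).
have mo j v : measurable_fun setT (fun x : E => 1 * sgam j x v).
  by apply: measurable_funM => //; exact: ms1.
have o0 j v x : 0 <= 1 * sgam j x v by rewrite mul1r.
have e1 v : (\int[leb n]_x (ind 0 1 v * (1 * sgam k.+1 x v))%:E = (ind 0 1 v)%:E * mom k.+1)%E.
  by rewrite (eintZ _ (ind_ge0 0 1 v) (mo _ v) (o0 _ v)) s1.
have e2 v : (\int[leb n]_x (ind 0 1 v * ((k%:R + n%:R / 2) * (1 * sgam k x v)))%:E =
    (ind 0 1 v * ((k%:R + n%:R / 2) * m))%:E)%E.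
  rewrite (eintZ _ (ind_ge0 0 1 v)); [|by apply: measurable_funM|by move=> x; rewrite mulr_ge0].
  by rewrite (eintZ _ b0 (mo _ v) (o0 _ v)) s1 mk -!EFinM.
have -> : (\int[lam]_v \int[leb n]_x (ind 0 1 v * (1 * sgam k.+1 x v))%:E = mom k.+1)%E.
  under eq_integral => v _ do rewrite e1.
  rewrite ge0_integralZr//.
  - by rewrite int_ind1// subr0 mul1e.
  - by apply/measurable_EFinP; exact: measurable_lebR.
  - by move=> v _; rewrite lee_fin ind_ge0.
  - by apply: eint_ge0 => x; rewrite mulr_ge0 ?gam_ge0// exprn_ge0// dot_ge0.
have -> : (\int[lam]_v \int[leb n]_x (ind 0 1 v * ((k%:R + n%:R / 2) * (1 * sgam k x v)))%:E = ((k%:R + n%:R / 2) * m)%:E)%E.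
  under eq_integral => v _ do rewrite e2.
  rewrite (eq_eint lam (g := fun v => (k%:R + n%:R / 2) * m * ind 0 1 v)); last by move=> v; rewrite mulrC.
  rewrite (@eintZ _ (measurableTypeR R) R lam _ _ (mulr_ge0 b0 m0)); first by rewrite int_ind1// subr0 mule1.
  - exact: measurable_lebR.
  - by move=> v; exact: ind_ge0.
by case: (mom k.+1) => //= r [] /addrI ->.
Qed.

Let mom0 : mom 0 = 1%:E.
Proof. by rewrite /mom -(@gam_int R n 1 ltr01); apply: eq_eint => x; rewrite expr0 mul1r. Qed.

Lemma sq_mean u : (\int[leb n]_x (sq x u * gam (expR u) x)%:E = (n%:R / 2)%:E)%E.
Proof.
have := mom_rec mom0; rewrite add0r mulr1 => <-.
by rewrite -(momE 1 u); apply: eq_eint => x; rewrite expr1.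
Qed.

Lemma sq_second u : (\int[leb n]_x (sq x u ^+ 2 * gam (expR u) x)%:E =
  ((1 + n%:R / 2) * (n%:R / 2))%:E)%E.
Proof.
have := mom_rec mom0; rewrite add0r mulr1 => /mom_rec.
by rewrite -(momE 2 u).
Qed.

End scale_family.


Section scale_variation.
Context {R : realType} {n : nat}.
Notation lam := (@lebesgue_measure R).
Notation E := 'rV[R]_n.

Lemma dist_le2 (a b c : R) : `|a - b| <= c -> a <= b + c /\ b <= a + c.
Proof. by rewrite ler_norml => /andP[? ?]; split; lra. Qed.

Lemma dist_le_of_eq (a b x y c : R) : a + x = b + y -> x <= y + c -> y <= x + c -> `|a - b| <= c.
Proof. by move=> *; rewrite ler_norml; apply/andP; split; lra. Qed.

Lemma measurable_sqrt d (T : measurableType d) (f : T -> R) :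
  measurable_fun setT f -> measurable_fun setT (fun z => Num.sqrt (f z)).
Proof.
move=> mf; apply: (measurableT_comp (f := @Num.sqrt R)) => //.
by apply: continuous_measurable_fun; exact: sqrt_continuous.
Qed.

Lemma measurable_gam_exp d (T : measurableType d) (f : T -> E) (g : T -> R) :
  measurable_fun setT f -> measurable_fun setT g ->
  measurable_fun setT (fun z => gam (expR (g z)) (f z)).
Proof.
move=> mf mg; under eq_fun do rewrite gam_exp.
apply: measurable_funM => //; apply: (measurableT_comp (@measurable_expR _)).
apply: measurable_funB; first by meas.
by apply: measurable_funM; [apply: measurable_dot|meas].
Qed.

Variables (g : E -> R) (B : R).
Hypotheses (mg : measurable_fun setT g) (g0 : forall x, 0 <= g x)
  (gB : forall x, g x <= B).

Definition scale_mean u := mean (leb n) (gam (expR u)) g.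
Definition scale_var u := variance (leb n) (gam (expR u)) g.

Let mgu u : measurable_fun setT (gam (expR u) : E -> R).
Proof. by apply: (measurable_gam_exp (g := fun=> u)); meas. Qed.
Let gu0 u x : 0 <= gam (expR u) (x : E). Proof. exact: gam_ge0. Qed.
Let gu1 u : (\int[leb n]_x (gam (expR u) (x : E))%:E = 1 :> \bar R)%E.
Proof. by apply: gam_int; exact: expR_gt0. Qed.

Let F := scale_mean.
Let V := scale_var.

Let FE u : (\int[leb n]_x (g x * gam (expR u) x)%:E = (F u)%:E)%E.
Proof. exact: (meanE (mgu u) (gu0 u) (gu1 u) mg g0 gB). Qed.

Lemma scale_mean_ge0 u : 0 <= F u.
Proof. exact: (mean_ge0 (mgu u) (gu0 u) (gu1 u) mg g0 gB). Qed.

Lemma scale_mean_le u : F u <= B.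
Proof. exact: (mean_le (mgu u) (gu0 u) (gu1 u) mg g0 gB). Qed.

Lemma scale_var_ge0 u : 0 <= V u.
Proof. exact: (variance_ge0 (mgu u) (gu0 u) (gu1 u) mg g0 gB). Qed.

Let mgg : measurable_fun setT (fun z : R * E => gam (expR z.1) z.2).
Proof. by apply: (measurable_gam_exp (f := snd)); meas. Qed.

Lemma measurable_scale_mean : measurable_fun setT F.
Proof.
apply: (measurableT_comp (@fine_measurable _ setT measurableT)).
apply: (measurable_eint (leb n) (f := fun u x => g x * gam (expR u) x)).
- by apply: measurable_funM; [exact: (measurableT_comp mg measurable_snd)|exact: mgg].
- by move=> u x; rewrite mulr_ge0.
Qed.

Lemma measurable_scale_var : measurable_fun setT V.
Proof.
apply: measurable_funB; last by apply: measurable_funX; exact: measurable_scale_mean.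
apply: (measurableT_comp (@fine_measurable _ setT measurableT)).
apply: (measurable_eint (leb n) (f := fun u x => g x ^+ 2 * gam (expR u) x)).
- apply: measurable_funM; last exact: mgg.
  by apply: measurable_funX; exact: (measurableT_comp mg measurable_snd).
- by move=> u x; rewrite mulr_ge0 ?sqr_ge0.
Qed.

(** The square root of Var(g) times n/2, where n/2 is the variance of |x|^2 e^v under gam (e^v); it
    bounds the derivative of [scale_mean]. *)
Definition scale_rate v := Num.sqrt (n%:R / 2 * V v).

Lemma measurable_scale_rate : measurable_fun setT scale_rate.
Proof. by apply: measurable_sqrt; apply: measurable_funM => //; exact: measurable_scale_var. Qed.

Let sq (x : E) (u : R) := dot x x * expR u.
Let sq0 x u : 0 <= sq x u. Proof. by rewrite mulr_ge0 ?dot_ge0 ?expR_ge0. Qed.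
Let msq u : measurable_fun setT (sq^~ u).
Proof. by apply: measurable_funM => //; apply: measurable_dot. Qed.

Let M v := fine (\int[leb n]_x (g x * (sq x v * gam (expR v) x))%:E)%E.

Let n20 : 0 <= n%:R / 2 :> R. Proof. by rewrite divr_ge0. Qed.

Let ME v : (\int[leb n]_x (g x * (sq x v * gam (expR v) x))%:E = (M v)%:E)%E.
Proof.
have m1 : measurable_fun setT (fun x => sq x v * gam (expR v) x) by apply: measurable_funM.
have p0 x : 0 <= sq x v * gam (expR v) x by rewrite mulr_ge0.
have B0 : 0 <= B := le_trans (g0 0) (gB 0).
have h : (\int[leb n]_x (g x * (sq x v * gam (expR v) x))%:E <= (B * (n%:R / 2))%:E)%E.
  rewrite EFinM -(sq_mean v) -(eintZ _ B0 m1 p0); apply: le_eint.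
  - exact: measurable_funM.
  - exact: measurable_funM.
  - by move=> x; rewrite mulr_ge0.
  - by move=> x; rewrite ler_wpM2r.
rewrite fineK// ge0_fin_numE; first by rewrite (le_lt_trans h)// ltry.
by apply: eint_ge0 => x; rewrite mulr_ge0.
Qed.

Let M0 v : 0 <= M v.
Proof. by rewrite -lee_fin -ME; apply: eint_ge0 => x; rewrite mulr_ge0// mulr_ge0. Qed.

Let sq_var v : (\int[leb n]_x ((sq x v - n%:R / 2) ^+ 2 * gam (expR v) x)%:E = (n%:R / 2)%:E)%E.
Proof.
have m1 : measurable_fun setT (fun x => sq x v * gam (expR v) x) by apply: measurable_funM.
have m2 : measurable_fun setT (fun x => sq x v ^+ 2 * gam (expR v) x).
  by apply: measurable_funM => //; exact: measurable_funX.
have p1 x : 0 <= sq x v * gam (expR v) x by rewrite mulr_ge0.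
have p2 x : 0 <= sq x v ^+ 2 * gam (expR v) x by rewrite mulr_ge0 ?sqr_ge0.
have -> : (n%:R / 2)%:E = (((1 + n%:R / 2) * (n%:R / 2) + (n%:R / 2) ^+ 2) - n%:R * (n%:R / 2))%:E :> \bar R.
  by congr EFin; field.
apply: eadd_real.
rewrite EFinD EFinM -(sq_mean v) -(sq_second v) -(eintZ _ (ler0n R n) m1 p1).
rewrite -(mean_cst (mgu v) (gu0 v) (gu1 v) (sqr_ge0 (n%:R / 2))).
have m3 : measurable_fun setT (fun x : E => (n%:R / 2) ^+ 2 * gam (expR v) x) by apply: measurable_funM.
have m4 : measurable_fun setT (fun x => n%:R * (sq x v * gam (expR v) x)) by apply: measurable_funM.
have m5 : measurable_fun setT (fun x => (sq x v - n%:R / 2) ^+ 2 * gam (expR v) x).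
  by apply: measurable_funM => //; apply: measurable_funX; apply: measurable_funB.
rewrite -(eintD _ m2 m3 p2); last by move=> x; rewrite mulr_ge0 ?sqr_ge0.
rewrite -(eintD _ m5 m4); [|by move=> x; rewrite mulr_ge0 ?sqr_ge0|by move=> x; rewrite mulr_ge0].
by apply: eq_eint => x; field.
Qed.

(** The left side is the absolute value of the covariance of g and |x|^2 e^v, so Cauchy-Schwarz
    applies. It is also the absolute derivative of [scale_mean] at v. *)
Lemma scale_derivative_bound v : `|M v - n%:R / 2 * F v| <= scale_rate v.
Proof.
pose f x := `|g x - F v| * Num.sqrt (gam (expR v) x).
pose h x := `|sq x v - n%:R / 2| * Num.sqrt (gam (expR v) x).
have mf : measurable_fun setT f.
  by apply: measurable_funM; [meas|apply: measurable_sqrt].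
have mh : measurable_fun setT h.
  apply: measurable_funM; last exact: measurable_sqrt.
  by apply: (measurableT_comp (@normr_measurable _ setT)); apply: measurable_funB.
have f0 x : 0 <= f x by rewrite mulr_ge0 ?sqrtr_ge0.
have h0 x : 0 <= h x by rewrite mulr_ge0 ?sqrtr_ge0.
have fA : (\int[leb n]_x (f x ^+ 2)%:E <= (V v)%:E)%E.
  rewrite -(variance_mean (mgu v) (gu0 v) (gu1 v) mg g0 gB) le_eqVlt; apply/orP; left; apply/eqP.
  by apply: eq_eint => x; rewrite /f exprMn real_normK ?num_real// sqr_sqrtr.
have hB : (\int[leb n]_x (h x ^+ 2)%:E <= (n%:R / 2)%:E)%E.
  rewrite -(sq_var v) le_eqVlt; apply/orP; left; apply/eqP.
  by apply: eq_eint => x; rewrite /h exprMn real_normK ?num_real// sqr_sqrtr.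
have [I [EI I0 I2]] := cauchy_schwarz mf mh f0 h0 fA hB.
have IV : I <= scale_rate v.
  rewrite -(@ler_pXn2r _ 2)// ?nnegrE ?sqrtr_ge0// sqr_sqrtr ?mulr_ge0 ?scale_var_ge0//.
  by rewrite mulrC.
apply: le_trans IV.
have fh x : f x * h x = `|(g x - F v) * (sq x v - n%:R / 2)| * gam (expR v) x.
  by rewrite /f /h normrM mulrACA -expr2 sqr_sqrtr.
have F0 := scale_mean_ge0 v.
pose Gx x := g x * gam (expR v) x. pose Zx x := sq x v * gam (expR v) x.
have mG : measurable_fun setT Gx by apply: measurable_funM.
have mZ : measurable_fun setT Zx by apply: measurable_funM.
have mGZ : measurable_fun setT (fun x => g x * Zx x) by apply: measurable_funM.
have Gx0 x : 0 <= Gx x by rewrite mulr_ge0.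
have Zx0 x : 0 <= Zx x by rewrite mulr_ge0.
have GZ0 x : 0 <= g x * Zx x by rewrite mulr_ge0.
have mfh : measurable_fun setT (fun x => f x * h x) by apply: measurable_funM.
have fh0 x : 0 <= f x * h x by rewrite mulr_ge0.
have mFg : measurable_fun setT (fun x : E => n%:R / 2 * F v * gam (expR v) x) by apply: measurable_funM.
have Fg0 (x : E) : 0 <= n%:R / 2 * F v * gam (expR v) x by rewrite mulr_ge0// mulr_ge0.
have mnG : measurable_fun setT (fun x => n%:R / 2 * Gx x) by apply: measurable_funM.
have nG0 x : 0 <= n%:R / 2 * Gx x by rewrite mulr_ge0.
have mFZ : measurable_fun setT (fun x => F v * Zx x) by apply: measurable_funM.
have FZ0 x : 0 <= F v * Zx x by rewrite mulr_ge0.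
have s1 : (\int[leb n]_x (g x * Zx x + n%:R / 2 * F v * gam (expR v) x)%:E =
    (M v + n%:R / 2 * F v)%:E)%E.
  by rewrite (eintD _ mGZ mFg GZ0 Fg0) ME (mean_cst (mgu v) (gu0 v) (gu1 v)) ?mulr_ge0.
have s2 : (\int[leb n]_x (n%:R / 2 * Gx x + F v * Zx x)%:E =
    (n%:R / 2 * F v + F v * (n%:R / 2))%:E)%E.
  by rewrite (eintD _ mnG mFZ nG0 FZ0) (eintZ _ n20 mG Gx0) (eintZ _ F0 mZ Zx0) FE sq_mean.
have key x : g x * Zx x + n%:R / 2 * F v * gam (expR v) x - (n%:R / 2 * Gx x + F v * Zx x) =
    (g x - F v) * (sq x v - n%:R / 2) * gam (expR v) x.
  by rewrite /Zx /Gx; ring.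
have mS1 : measurable_fun setT (fun x : E => g x * Zx x + n%:R / 2 * F v * gam (expR v) x) := measurable_funD mGZ mFg.
have mS2 : measurable_fun setT (fun x : E => n%:R / 2 * Gx x + F v * Zx x) := measurable_funD mnG mFZ.
have S10 (x : E) : 0 <= g x * Zx x + n%:R / 2 * F v * gam (expR v) x by rewrite addr_ge0.
have S20 (x : E) : 0 <= n%:R / 2 * Gx x + F v * Zx x by rewrite addr_ge0.
have k1 x : `|(g x * Zx x + n%:R / 2 * F v * gam (expR v) x) - (n%:R / 2 * Gx x + F v * Zx x)| <= f x * h x.
  by rewrite key fh normrM (ger0_norm (gu0 v x)).
rewrite ler_norml; apply/andP; split.
  have : (\int[leb n]_x (n%:R / 2 * Gx x + F v * Zx x)%:E <=
      \int[leb n]_x ((g x * Zx x + n%:R / 2 * F v * gam (expR v) x) + f x * h x)%:E)%E.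
    apply: (le_eint _ mS2 (measurable_funD mS1 mfh) S20).
    by move=> x; have [] := dist_le2 (k1 x).
  rewrite (eintD _ mS1 mfh S10 fh0).
  rewrite s1 s2 EI -EFinD lee_fin; lra.
have : (\int[leb n]_x (g x * Zx x + n%:R / 2 * F v * gam (expR v) x)%:E <=
    \int[leb n]_x ((n%:R / 2 * Gx x + F v * Zx x) + f x * h x)%:E)%E.
  apply: (le_eint _ mS1 (measurable_funD mS2 mfh) S10).
  by move=> x; have [] := dist_le2 (k1 x).
rewrite (eintD _ mS2 mfh S20 fh0).
rewrite s1 s2 EI -EFinD lee_fin; lra.
Qed.

(** [gam_ftc_int] at k = 0 expresses F t - F s by the integral of n/2 F - M, which
    [scale_derivative_bound] controls. *)
Lemma scale_mean_lipschitz s t : s < t ->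
  ((`|F t - F s|)%:E <= \int[lam]_v (ind s t v * scale_rate v)%:E)%E.
Proof.
move=> st; have B0 : 0 <= B := le_trans (g0 0) (gB 0).
have mind : measurable_fun setT (ind s t) by apply: (measurable_ind s t (f := id)).
have mF := measurable_scale_mean.
have mR := measurable_scale_rate.
have mM : measurable_fun setT M.
  apply: (measurableT_comp (@fine_measurable _ setT measurableT)).
  apply: (measurable_eint (leb n) (f := fun v x => g x * (sq x v * gam (expR v) x))).
  - apply: measurable_funM; first exact: (measurableT_comp mg measurable_snd).
    apply: measurable_funM; last exact: mgg.
    by apply: measurable_funM; [apply: measurable_dot; exact: measurable_snd|meas].
  - by move=> v x; rewrite mulr_ge0// mulr_ge0.
have F0 := scale_mean_ge0.
have r0 v : 0 <= scale_rate v by exact: sqrtr_ge0.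
have i0 := ind_ge0 s t.
have := gam_ftc_int 0 st mg g0.
have e1 v : (\int[leb n]_x (ind s t v * (g x * ((dot x x * expR v) ^+ 1 * gam (expR v) x)))%:E =
    (ind s t v * M v)%:E)%E.
  rewrite eintZ//.
  - by rewrite [RHS]EFinM -ME.
  - by apply: measurable_funM => //; apply: measurable_funM => //; exact: msq.
  - by move=> x; rewrite mulr_ge0// mulr_ge0//; exact: sq0.
have e0 v : (\int[leb n]_x (g x * ((dot x x * expR v) ^+ 0 * gam (expR v) x))%:E = (F v)%:E)%E.
  by rewrite -FE; apply: eq_eint => x; rewrite expr0 mul1r.
have e2 v : (\int[leb n]_x (ind s t v * ((0%:R + n%:R / 2) * (g x * ((dot x x * expR v) ^+ 0 * gam (expR v) x))))%:E =
    (ind s t v * (n%:R / 2 * F v))%:E)%E.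
  have mm : measurable_fun setT (fun x => g x * ((dot x x * expR v) ^+ 0 * gam (expR v) x)).
    by apply: measurable_funM => //; apply: measurable_funM.
  have pp x : 0 <= g x * ((dot x x * expR v) ^+ 0 * gam (expR v) x) by rewrite mulr_ge0// mulr_ge0.
  rewrite add0r (eintZ _ (i0 v)).
  - by rewrite (eintZ _ n20 mm pp) e0 -!EFinM.
  - exact: measurable_funM.
  - by move=> x; rewrite mulr_ge0.
rewrite !e0; under eq_integral do rewrite e1.
under [in X in _ = X -> _]eq_integral do rewrite e2.
have Yfin : (\int[lam]_v (ind s t v * (n%:R / 2 * F v))%:E <= (n%:R / 2 * B * (t - s))%:E)%E.
  rewrite EFinM -int_ind1// -(@eintZ _ (measurableTypeR R) R lam); last 3 first.
  - by rewrite mulr_ge0.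
  - exact: measurable_lebR.
  - exact: i0.
  apply: le_eint.
  - by refine (measurable_lebR _); apply: measurable_funM => //; apply: measurable_funM.
  - by refine (measurable_lebR _); apply: measurable_funM.
  - by move=> v; rewrite mulr_ge0// mulr_ge0.
  - by move=> v; rewrite mulrC ler_wpM2r// ler_wpM2l// scale_mean_le.
have Y0 : (0 <= \int[lam]_v (ind s t v * (n%:R / 2 * F v))%:E)%E.
  by apply: eint_ge0 => v; rewrite mulr_ge0// mulr_ge0.
have X0 : (0 <= \int[lam]_v (ind s t v * M v)%:E)%E by apply: eint_ge0 => v; rewrite mulr_ge0.
have db v := scale_derivative_bound v.
have XY : (\int[lam]_v (ind s t v * M v)%:E <= \int[lam]_v (ind s t v * (n%:R / 2 * F v))%:E +
    \int[lam]_v (ind s t v * scale_rate v)%:E)%E.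
  rewrite -(@eintD _ (measurableTypeR R) R lam); last 4 first.
  - by refine (measurable_lebR _); apply: measurable_funM => //; apply: measurable_funM.
  - by refine (measurable_lebR _); apply: measurable_funM.
  - by move=> v; rewrite mulr_ge0// mulr_ge0.
  - by move=> v; rewrite mulr_ge0.
  apply: le_eint.
  - by refine (measurable_lebR _); apply: measurable_funM.
  - refine (measurable_lebR _); apply: measurable_funD; apply: measurable_funM => //.
    exact: measurable_funM.
  - by move=> v; rewrite mulr_ge0.
  - move=> v; rewrite -mulrDr ler_wpM2l// -lerBlDl.
    by apply: le_trans (db v); rewrite ler_norm.
have YX : (\int[lam]_v (ind s t v * (n%:R / 2 * F v))%:E <= \int[lam]_v (ind s t v * M v)%:E +
    \int[lam]_v (ind s t v * scale_rate v)%:E)%E.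
  rewrite -(@eintD _ (measurableTypeR R) R lam); last 4 first.
  - by refine (measurable_lebR _); apply: measurable_funM.
  - by refine (measurable_lebR _); apply: measurable_funM.
  - by move=> v; rewrite mulr_ge0.
  - by move=> v; rewrite mulr_ge0.
  apply: le_eint.
  - by refine (measurable_lebR _); apply: measurable_funM => //; apply: measurable_funM.
  - by refine (measurable_lebR _); apply: measurable_funD; apply: measurable_funM.
  - by move=> v; rewrite mulr_ge0// mulr_ge0.
  - move=> v; rewrite -mulrDr ler_wpM2l// -lerBlDl.
    by apply: le_trans (db v); rewrite distrC ler_norm.
move: Yfin Y0 X0 XY YX.
move: (\int[lam]_v (ind s t v * (n%:R / 2 * F v))%:E)%E => [Y| |]//.
move: (\int[lam]_v (ind s t v * M v)%:E)%E => [X| |]//.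
move: (\int[lam]_v (ind s t v * scale_rate v)%:E)%E => [P| |]//; last first.
  by move=> *; rewrite leey.
move=> _ _ _ + + [] eq; rewrite -!EFinD !lee_fin => XY YX.
exact: dist_le_of_eq eq XY YX.
Qed.

End scale_variation.


(** * The weak Poincare inequality for the Student law *)

Section product_measure.
Context d1 d2 (T1 : measurableType d1) (T2 : measurableType d2) (R : realType).
Variables (m1 : {sigma_finite_measure set T1 -> \bar R})
  (m2 : {sigma_finite_measure set T2 -> \bar R}).

(* The library's own sigma-finite instance on [m1 \x m2] is shadowed by the one
   for subprobabilities. *)
Definition prodm : set (T1 * T2) -> \bar R := (m1 \x m2)%E.

HB.instance Definition _ := isMeasure.Build _ _ _ prodm
  (measure0 (m1 \x m2)%E) (measure_ge0 (m1 \x m2)%E)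
  (@measure_semi_sigma_additive _ _ _ (m1 \x m2)%E).

Let prodm_sigma_finite : sigma_finite setT prodm.
Proof.
have /sigma_finiteP[F [FT Fnd Foo]] := sigma_finiteT m1.
have /sigma_finiteP[G [GT Gnd Goo]] := sigma_finiteT m2.
exists (fun k => F k `*` G k) => [|k].
  apply/esym/seteqP; split => // -[x y] _.
  have [i _ Fx] : (\bigcup_k F k) x by rewrite -FT.
  have [j _ Gy] : (\bigcup_k G k) y by rewrite -GT.
  exists (maxn i j) => //; split => /=.
    by move: x Fx; apply/subsetPset/Fnd/leq_maxl.
  by move: y Gy; apply/subsetPset/Gnd/leq_maxr.
have [mF oF] := Foo k; have [mG oG] := Goo k; split; first exact: measurableX.
by rewrite /prodm product_measure1E// lte_mul_pinfty// ge0_fin_numE.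
Qed.

HB.instance Definition _ := Measure_isSigmaFinite.Build _ _ _ prodm prodm_sigma_finite.

End product_measure.

Section weak_poincare.
Context {R : realType}.
Notation lam := (@lebesgue_measure R).

(** Tonelli and the gamma integral: averaging exp(-l e^u) over u with weight e^(bu) produces l^(-b),
    inside any further integral. *)
Lemma mixture d (T : measurableType d) (m : {sigma_finite_measure set T -> \bar R})
    (b G : R) (f l : T -> R) :
  measurable_fun setT f -> measurable_fun setT l -> (forall t, 0 <= f t) ->
  (forall t, 0 < l t) -> (\int[lam]_u (gweight b u)%:E = G%:E)%E -> 0 <= G ->
  (\int[lam]_u \int[m]_t (f t * expR (b * u - l t * expR u))%:E =
   G%:E * \int[m]_t (f t * expR (- (b * ln (l t))))%:E)%E.
Proof.
move=> mf ml f0 l0 EG G0.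
rewrite (@tonelli _ _ (measurableTypeR R) T R lam m
  (fun u t => f t * expR (b * u - l t * expR u))); first last.
- by move=> u t; rewrite mulr_ge0 ?expR_ge0.
- refine (measurable_lebRprod _).
  apply: measurable_funM; first exact: (measurableT_comp mf measurable_snd).
  apply: (measurableT_comp (@measurable_expR _)); apply: measurable_funB; first by meas.
  by apply: measurable_funM; [exact: (measurableT_comp ml measurable_snd)|meas].
rewrite -(eintZ m G0); last by move=> t; rewrite mulr_ge0 ?expR_ge0.
  apply: eq_integral => t _; rewrite (@eintZ _ (measurableTypeR R) R lam)//; last first.
    by refine (measurable_lebR _); meas.
  by rewrite (gamma_mixture (l0 t) EG) -EFinM; congr EFin; ring.
apply: measurable_funM => //; apply: (measurableT_comp (@measurable_expR _)).
apply: measurableT_comp => //; apply: measurable_funM => //.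
by apply: (measurableT_comp (@measurable_ln R)).
Qed.

Context {n : nat}.
Notation E := 'rV[R]_n.

(** This is (1 + |x|^2)^(-b). The value b = nu/2 + n/2 gives the unnormalised Student density, and
    half of it gives its square root. *)
Definition wgt (b : R) (x : E) : R := expR (- (b * ln (1 + dot x x))).

Lemma wgt_gt0 b x : 0 < wgt b x. Proof. exact: expR_gt0. Qed.

Lemma wgt_ge0 b x : 0 <= wgt b x. Proof. exact: expR_ge0. Qed.

Lemma dot1_gt0 (x : E) : 0 < 1 + dot x x.
Proof. by rewrite ltr_wpDr ?dot_ge0. Qed.

Lemma measurable_ln_dot d (T : measurableType d) (f : T -> E) : measurable_fun setT f ->
  measurable_fun setT (fun t => ln (1 + dot (f t) (f t))).
Proof.
move=> mf; apply: (measurableT_comp (@measurable_ln R)).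
by apply: measurable_funD => //; exact: measurable_dot.
Qed.

Lemma measurable_wgt b d (T : measurableType d) (f : T -> E) : measurable_fun setT f ->
  measurable_fun setT (fun t => wgt b (f t)).
Proof.
move=> mf; apply: (measurableT_comp (@measurable_expR _)); apply: measurableT_comp => //.
by apply: measurable_funM => //; exact: measurable_ln_dot.
Qed.

Lemma wgtD b c x : wgt b x * wgt c x = wgt (b + c) x.
Proof. by rewrite /wgt -expRD; congr expR; ring. Qed.

Let Cn : R := Num.sqrt pi^-1 ^+ n.

Let Cn0 : 0 < Cn. Proof. by rewrite exprn_gt0// sqrtr_gt0 invr_gt0 pi_gt0. Qed.

(* Student's law is the Gaussian scale mixture of density [gweight a] in log-scale. *)
Lemma student_mixture (a Gb : R) (f : E -> R) : measurable_fun setT f ->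
  (forall x, 0 <= f x) -> 0 <= Gb ->
  (\int[lam]_u (gweight (a + n%:R / 2) u)%:E = Gb%:E)%E ->
  (\int[lam]_u \int[leb n]_x (gweight a u * (f x * gam (expR u) x))%:E =
   (Cn * Gb)%:E * \int[leb n]_x (f x * wgt (a + n%:R / 2) x)%:E)%E.
Proof.
move=> mf f0 G0 EG; rewrite mulrC EFinM -muleA.
have m1 : measurable_fun setT (fun x => f x * wgt (a + n%:R / 2) x).
  by apply: measurable_funM => //; exact: (measurable_wgt _ (f := id)).
rewrite -(eintZ (leb n) (ltW Cn0) m1); last by move=> x; rewrite mulr_ge0 ?wgt_ge0.
have -> : (\int[leb n]_x (Cn * (f x * wgt (a + n%:R / 2) x))%:E =
    \int[leb n]_x (Cn * f x * expR (- ((a + n%:R / 2) * ln (1 + dot x x))))%:E)%E.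
  by apply: eq_eint => x; rewrite mulrA.
have mCf : measurable_fun setT (fun x => Cn * f x) by exact: measurable_funM.
have ml : measurable_fun setT (fun x : E => 1 + dot x x).
  by apply: measurable_funD => //; apply: measurable_dot.
have Cf0 x : 0 <= Cn * f x by rewrite mulr_ge0// ltW.
rewrite -(mixture (leb n) mCf ml Cf0 dot1_gt0 EG G0).
apply: eq_integral => u _; apply: eq_eint => x.
rewrite gam_exp /gweight -/Cn.
rewrite (_ : (a + n%:R / 2) * u - (1 + dot x x) * expR u =
  (a * u - expR u) + (n%:R / 2 * u - dot x x * expR u)); last by ring.
rewrite [in RHS]expRD; ring.
Qed.


(** [student_mixture] at f = 1. The explicit ratio later trades the n-dependent [Cn] and [Gb] for
    the mass of [wgt b]. *)
Lemma wgt_int (a Ga Gb : R) (b := a + n%:R / 2) : (\int[lam]_u (gweight a u)%:E = Ga%:E)%E -> 0 < Gb ->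
  (\int[lam]_u (gweight b u)%:E = Gb%:E)%E ->
  (\int[leb n]_x (wgt b x)%:E = (Ga / (Cn * Gb))%:E)%E.
Proof.
move=> EGa Gb0 EGb.
have K0 : 0 < Cn * Gb by rewrite mulr_gt0.
have := @student_mixture a Gb (fun=> 1) (measurable_cst _) (fun=> ler01) (ltW Gb0) EGb.
under [X in _ = (_ * X)%E -> _]eq_eint do rewrite mul1r.
have -> : (\int[lam]_u \int[leb n]_x (gweight a u * (1 * gam (expR u) x))%:E = Ga%:E)%E.
  rewrite -EGa; apply: eq_integral => u _.
  under eq_eint do rewrite mul1r.
  rewrite eintZ ?gweight_ge0//; [|by apply: (measurable_gam_exp (f := id) (g := fun=> u))|by move=> x; exact: gam_ge0].
  by rewrite gam_int ?mule1 ?expR_gt0.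
move=> eq.
have : ((Cn * Gb)%:E * \int[leb n]_x (wgt b x)%:E = (Cn * Gb)%:E * (Ga / (Cn * Gb))%:E)%E.
  by rewrite -eq -EFinM; congr EFin; field; rewrite !gt_eqF//.
have := @eint_ge0 _ _ _ (leb n) (wgt b) (wgt_ge0 b).
case: (\int[leb n]_x (wgt b x)%:E)%E => [r _|_|//].
  by rewrite -!EFinM => -[] /mulfI -> //; rewrite gt_eqF.
by rewrite gt0_muley ?lte_fin// -EFinM.
Qed.


(** The product of 1 + |x|^2 and 1 + |z|^2 is at most the square of their average. This separates
    the variables after the Gaussian pairs have been mixed. *)
Lemma wgt_pair (b : R) (x z : E) : 0 <= b ->
  expR (- (b * ln (1 + (dot x x + dot z z) / 2))) <= wgt (b / 2) x * wgt (b / 2) z.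
Proof.
move=> b0; have x0 := dot_ge0 x. have z0 := dot_ge0 z.
have p1 : 0 < 1 + (dot x x + dot z z) / 2 by lra.
rewrite /wgt -expRD ler_expR.
have : ln (1 + dot x x) + ln (1 + dot z z) <= 2 * ln (1 + (dot x x + dot z z) / 2).
  rewrite mulr_natl -lnM ?posrE ?dot1_gt0// -lnXn// ler_ln ?posrE ?exprn_gt0 ?mulr_gt0 ?dot1_gt0//.
  rewrite -subr_ge0 (_ : _ - _ = ((dot x x - dot z z) / 2) ^+ 2) ?sqr_ge0//; by field.
move=> /(ler_wpM2l b0); lra.
Qed.

End weak_poincare.

Section weak_poincare_inequality.
Context {R : realType}.
Notation lam := (@lebesgue_measure R).

Lemma eq_lexx d (T : porderType d) (x y : T) : x = y -> (x <= y)%O.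
Proof. by move=> ->. Qed.

Lemma mul3_le1 (k h x y : R) : 0 <= k -> 0 <= h -> x <= y -> k * (h * y) <= 1 -> k * (h * x) <= 1.
Proof. by move=> k0 h0 xy; apply: le_trans; do 2 apply: ler_wpM2l => //. Qed.

(** For |u| <= U, [local_poincare] holds with a constant at most a multiple of e^U/h. Mixing over u
    turns the geometric mean of the two Gaussian densities into a power of 1 + (|x|^2 + |z|^2)/2, to
    which [wgt_pair] applies. *)
Lemma weak_poincare_scale (a b : R) n (h U B Gb : R) (g : 'rV[R]_n -> R) : 0 < b ->
  b = a + n%:R / 2 -> (\int[lam]_u (gweight b u)%:E = Gb%:E)%E ->
  (0 < n)%N -> 0 < h -> 1024 * n%:R ^+ 2 * (h * expR U) <= 1 -> measurable_fun setT g ->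
  (forall x, 0 <= g x) -> (forall x, g x <= B) ->
  (\int[lam]_u (step (U - `|u|) * (gweight a u * scale_var g u))%:E <=
    (4 * expR U / h)%:E * ((Num.sqrt pi^-1 ^+ n * Gb)%:E * \int[leb n]_x \int[leb n]_z
      ((g x - g z) ^+ 2 * (heat h x z * (wgt (b / 2) x * wgt (b / 2) z)))%:E))%E.
Proof.
move=> b0 bE EGb n0 h0 small mg g0 gB; set Cn := Num.sqrt pi^-1 ^+ n.
have Cn0 : 0 < Cn by rewrite exprn_gt0// sqrtr_gt0 invr_gt0 pi_gt0.
have Gb0 : 0 <= Gb by rewrite -lee_fin -EGb; apply: eint_ge0 => u; exact: gweight_ge0.
pose m2 : {sigma_finite_measure set ('rV[R]_n * 'rV[R]_n)%type -> \bar R} := prodm (leb n) (leb n).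
pose Dw (z : ('rV[R]_n * 'rV[R]_n)%type) := (g z.1 - g z.2) ^+ 2 * heat h z.1 z.2.
pose lw (z : ('rV[R]_n * 'rV[R]_n)%type) := 1 + (dot z.1 z.1 + dot z.2 z.2) / 2.
have mDw : measurable_fun setT Dw.
  apply: measurable_funM; last by apply: measurable_heat; meas.
  by apply: measurable_funX; apply: measurable_funB; [exact: (measurableT_comp mg measurable_fst)|exact: (measurableT_comp mg measurable_snd)].
have mlw : measurable_fun setT lw.
  by apply: measurable_funD => //; apply: measurable_funM => //; apply: measurable_funD; apply: measurable_dot; meas.
have Dw0 z : 0 <= Dw z by rewrite mulr_ge0 ?sqr_ge0 ?heat_ge0.
have lw0 z : 0 < lw z.
  by rewrite ltr_wpDr// divr_ge0// addr_ge0 ?dot_ge0.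
have mCD : measurable_fun setT (fun z => Cn * Dw z) by exact: measurable_funM.
have CD0 z : 0 <= Cn * Dw z by rewrite mulr_ge0// ltW.
have mK : measurable_fun setT (fun t : R * ('rV[R]_n * 'rV[R]_n) =>
    Cn * Dw t.2 * expR (b * t.1 - lw t.2 * expR t.1)).
  apply: measurable_funM; first exact: (measurableT_comp mCD measurable_snd).
  apply: (measurableT_comp (@measurable_expR _)); apply: measurable_funB; first by meas.
  by apply: measurable_funM; [exact: (measurableT_comp mlw measurable_snd)|meas].
have K0 u z : 0 <= Cn * Dw z * expR (b * u - lw z * expR u) by rewrite mulr_ge0 ?expR_ge0.
have ptw u : ((step (U - `|u|) * (gweight a u * scale_var g u))%:E <= (4 * expR U / h)%:E *
    \int[m2]_z (Cn * Dw z * expR (b * u - lw z * expR u))%:E)%E.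
  have I0 : (0 <= \int[m2]_z (Cn * Dw z * expR (b * u - lw z * expR u))%:E)%E.
    by apply: eint_ge0.
  have c0 : 0 <= 4 * expR U / h by rewrite divr_ge0 ?mulr_ge0 ?expR_ge0// ltW.
  have [->|[-> uU]] := step01 (U - `|u|); first by rewrite mul0r mule_ge0// lee_fin.
  have eu0 : 0 < expR u by exact: expR_gt0.
  have eU : expR u <= expR U by rewrite ler_expR; move: uU (ler_norm u); lra.
  have eU' : expR (- u) <= expR U by rewrite ler_expR; move: uU (ler_norm (- u)); rewrite normrN; lra.
  have small' : 1024 * n%:R ^+ 2 * (h * expR u) <= 1.
    exact: (mul3_le1 (mulr_ge0 (ler0n R 1024) (sqr_ge0 _)) (ltW h0) eU small).
  have lp := local_poincare n0 eu0 h0 small' mg.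
  have mgu : measurable_fun setT (fun x : 'rV[R]_n => gam (expR u) x).
    by apply: (measurable_gam_exp (f := id) (g := fun=> u)).
  have gu0 x : 0 <= gam (expR u) (x : 'rV[R]_n) by exact: gam_ge0.
  have gu1 : (\int[leb n]_x (gam (expR u) (x : 'rV[R]_n))%:E = 1 :> \bar R)%E by apply: gam_int.
  pose j (z : ('rV[R]_n * 'rV[R]_n)%type) := (g z.1 - g z.2) ^+ 2 *
     (Num.sqrt (expR u / pi) ^+ n * expR (- (expR u / 2 * (dot z.1 z.1 + dot z.2 z.2))) * heat h z.1 z.2).
  have mj : measurable_fun setT j.
    apply: measurable_funM.
      by apply: measurable_funX; apply: measurable_funB; [exact: (measurableT_comp mg measurable_fst)|exact: (measurableT_comp mg measurable_snd)].
    apply: measurable_funM; last by apply: measurable_heat; meas.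
    apply: measurable_funM; first exact: measurable_cst.
    apply: (measurableT_comp (@measurable_expR _)).
    apply: measurableT_comp; first exact: oppr_measurable.
    apply: measurable_funM; first exact: measurable_cst.
    by apply: measurable_funD; apply: measurable_dot; meas.
  have mj' : measurable_fun setT (fun z : ('rV[R]_n * 'rV[R]_n)%type => j (z.1, z.2)).
    by rewrite (_ : (fun z => _) = j)//; apply/funext => -[].
  have j0' x y : 0 <= j (x, y).
    apply: mulr_ge0; first exact: sqr_ge0.
    apply: mulr_ge0; last exact: heat_ge0.
    by apply: mulr_ge0; [rewrite exprn_ge0// sqrtr_ge0|exact: expR_ge0].
  pose J := (\int[leb n]_x \int[leb n]_y (j (x, y))%:E)%E.
  have vp := variance_pair mgu gu0 gu1 mg g0 gB.
  have {lp vp}lp : ((2 * scale_var g u)%:E <= (8 / (h * expR u))%:E * J)%E.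
    by apply: le_trans lp; apply: eq_lexx; apply: esym; exact: vp.
  have JE : (\int[m2]_z (Cn * Dw z * expR (b * u - lw z * expR u))%:E = (gweight a u)%:E * J)%E.
    have mk : measurable_fun setT (fun z : ('rV[R]_n * 'rV[R]_n)%type =>
        Cn * Dw (z.1, z.2) * expR (b * u - lw (z.1, z.2) * expR u)).
      apply: measurable_funM; first exact: mCD.
      apply: (measurableT_comp (@measurable_expR _)); apply: measurable_funB; first exact: measurable_cst.
      by apply: measurable_funM; [exact: mlw|exact: measurable_cst].
    apply: (etrans (@tonelliE _ _ _ _ _ (leb n) (leb n)
      (fun x y => Cn * Dw (x, y) * expR (b * u - lw (x, y) * expR u)) mk (fun x y => K0 u (x, y)))).
    rewrite /J -(eintZ2 (leb n) (leb n) (f := fun x y => j (x, y)) (gweight_ge0 a u) mj' j0').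
    apply: eq_integral => x _; apply: eq_eint => y; rewrite /Dw /lw /j /=.
    have := @gam_exp R n u 0; rewrite /gam dot0l !mulr0 mul0r oppr0 addr0 expR0 mulr1 => ->.
    rewrite -/Cn /gweight.
    rewrite (_ : b * u - (1 + (dot x x + dot y y) / 2) * expR u = (a * u - expR u) +
      (n%:R / 2 * u + - (expR u / 2 * (dot x x + dot y y)))); last by rewrite bE; field.
    rewrite (expRD (a * u - expR u)) (expRD (n%:R / 2 * u)).
    move: (expR (a * u - _)) (expR (n%:R / 2 * u)) (expR (- _)) => x1 x2 x3; ring.
  rewrite JE muleA -EFinM.
  have -> : 1 * (gweight a u * scale_var g u) = gweight a u / 2 * (2 * scale_var g u) by field.
  have J0 : (0 <= J)%E.
    by apply: integral_ge0 => x _; apply: eint_ge0 => y.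
  apply: (@le_trans _ _ ((gweight a u / 2)%:E * ((8 / (h * expR u))%:E * J))%E).
    by rewrite EFinM; apply: lee_wpmul2l => //; rewrite lee_fin divr_ge0 ?gweight_ge0.
  rewrite muleA -EFinM; apply: lee_wpmul2r => //; rewrite lee_fin.
  rewrite (_ : gweight a u / 2 * (8 / (h * expR u)) = 4 * expR (- u) / h * gweight a u).
    rewrite ler_wpM2r ?gweight_ge0// ler_wpM2r ?invr_ge0 ?ler_wpM2l//; exact: ltW.
  by rewrite expRN; field; rewrite !gt_eqF.
apply: (@le_trans _ _ (\int[lam]_u ((4 * expR U / h)%:E *
    \int[m2]_z (Cn * Dw z * expR (b * u - lw z * expR u))%:E))%E).
  have mJ := @measurable_eint _ _ (measurableTypeR R) _ R m2
    (fun u z => Cn * Dw z * expR (b * u - lw z * expR u)) (measurable_lebRprod mK) K0.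
  apply: ge0_le_integral => //.
  - by move=> u _; rewrite lee_fin mulr_ge0 ?step_ge0// mulr_ge0 ?gweight_ge0// (scale_var_ge0 mg g0 gB).
  - apply/measurable_EFinP; refine (measurable_lebR _); apply: measurable_funM.
      by apply: measurable_step; meas.
    by apply: measurable_funM; [exact: measurable_gweight|exact: measurable_scale_var].
  - by apply: measurable_funeM.
have I0 u : (0 <= \int[m2]_z (Cn * Dw z * expR (b * u - lw z * expR u))%:E)%E.
  by apply: eint_ge0.
have c0 : 0 <= 4 * expR U / h by rewrite divr_ge0 ?mulr_ge0 ?expR_ge0// ltW.
rewrite ge0_integralZl_EFin//; last first.
  exact: (@measurable_eint _ _ (measurableTypeR R) _ R m2
    (fun u z => Cn * Dw z * expR (b * u - lw z * expR u)) (measurable_lebRprod mK) K0).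
apply: lee_wpmul2l; first by rewrite lee_fin.
rewrite (mixture m2 mCD mlw CD0 lw0 EGb Gb0) [(Cn * Gb)%:E]EFinM.
rewrite [(Cn%:E * Gb%:E)%E]muleC -muleA; apply: lee_wpmul2l; first by rewrite lee_fin.
have mW : measurable_fun setT (fun z : ('rV[R]_n * 'rV[R]_n)%type => (g z.1 - g z.2) ^+ 2 * (heat h z.1 z.2 * (wgt (b / 2) z.1 * wgt (b / 2) z.2))).
  under eq_fun do rewrite mulrA.
  by apply: measurable_funM => //; apply: measurable_funM; apply: measurable_wgt; meas.
have W0 (x y : 'rV[R]_n) : 0 <= (g x - g y) ^+ 2 * (heat h x y * (wgt (b / 2) x * wgt (b / 2) y)).
  by rewrite mulr_ge0 ?sqr_ge0// mulr_ge0 ?heat_ge0// mulr_ge0 ?wgt_ge0.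
apply: (@le_trans _ _ (Cn%:E * \int[m2]_z ((g z.1 - g z.2) ^+ 2 * (heat h z.1 z.2 * (wgt (b / 2) z.1 * wgt (b / 2) z.2)))%:E)%E); last first.
  by apply: eq_lexx; congr (_ * _)%E; exact: (tonelliE (leb n) (leb n) mW W0).
rewrite -(eintZ m2 (ltW Cn0) mW); last by move=> z; exact: W0.
apply: le_eint.
- apply: measurable_funM => //; apply: (measurableT_comp (@measurable_expR _)).
  apply: measurableT_comp => //; apply: measurable_funM => //.
  by apply: (measurableT_comp (@measurable_ln R)).
- exact: measurable_funM.
- by move=> z; rewrite mulr_ge0 ?expR_ge0.
move=> z; rewrite -[X in X <= _]mulrA; apply: ler_wpM2l; first exact: ltW.
rewrite /Dw -[X in X <= _]mulrA; apply: ler_wpM2l; first exact: sqr_ge0.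
apply: ler_wpM2l; first exact: heat_ge0.
exact: wgt_pair (ltW b0).
Qed.

Lemma scale_sqr_dist n (g : 'rV[R]_n -> R) B u c : measurable_fun setT g ->
  (forall x, 0 <= g x) -> (forall x, g x <= B) -> 0 <= c ->
  (\int[leb n]_x ((g x - c) ^+ 2 * gam (expR u) x)%:E =
   (scale_var g u + `|scale_mean g u - c| ^+ 2)%:E)%E.
Proof.
move=> mg g0 gB c0.
have mgam : measurable_fun setT (fun x : 'rV[R]_n => gam (expR u) x).
  by apply: (measurable_gam_exp (f := id) (g := fun=> u)).
have g0' x : 0 <= gam (expR u) (x : 'rV[R]_n) by exact: gam_ge0.
have gam1 : (\int[leb n]_x (gam (expR u) (x : 'rV[R]_n))%:E = 1 :> \bar R)%E.
  by apply: gam_int; exact: expR_gt0.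
rewrite (mean_sqr_dist mgam g0' gam1 mg g0 gB c0); congr EFin.
by rewrite real_normK ?num_real// /scale_var /variance /scale_mean; ring.
Qed.

Lemma scale_sqr_dist_le n (g : 'rV[R]_n -> R) B u v : measurable_fun setT g ->
  (forall x, 0 <= g x) -> (forall x, g x <= B) ->
  scale_var g u + `|scale_mean g u - scale_mean g v| ^+ 2 <= B ^+ 2.
Proof.
move=> mg g0 gB.
have mgam : measurable_fun setT (fun x : 'rV[R]_n => gam (expR u) x).
  by apply: (measurable_gam_exp (f := id) (g := fun=> u)).
have g0' x : 0 <= gam (expR u) (x : 'rV[R]_n) by exact: gam_ge0.
have gam1 : (\int[leb n]_x (gam (expR u) (x : 'rV[R]_n))%:E = 1 :> \bar R)%E.
  by apply: gam_int; exact: expR_gt0.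
have c0 := scale_mean_ge0 mg g0 gB v; have := scale_mean_le mg g0 gB v.
have := scale_sqr_dist u mg g0 gB c0.
move: (scale_mean g v) c0 => c c0 eq cB.
have B0 : 0 <= B := le_trans (g0 0) (gB 0).
rewrite -lee_fin -eq -(mean_cst mgam g0' gam1 (sqr_ge0 B)).
apply: le_eint.
- exact: measurable_funM (measurable_funX _ (measurable_funB mg (measurable_cst _))) mgam.
- exact: measurable_funM.
- by move=> x; rewrite mulr_ge0 ?sqr_ge0.
move=> x; rewrite ler_wpM2r// -real_normK ?num_real// ler_sqr ?nnegrE// ler_norml.
by move: (g0 x) (gB x) => *; apply/andP; split; lra.
Qed.

(** Under the mixture, the squared distance to a constant is the mean over u of a variance V u and
    of a squared deviation D u of the conditional mean. On |u| <= U, Hardy bounds the second by n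
    times the first, and [weak_poincare_scale] bounds the first by the energy; on |u| > U, V + D^2
    <= B^2 and the gamma tail gives e^(-aU). The constant is independent of n because Z = Ga/(Cn Gb)
    absorbs the dimensional factors. *)
Lemma weak_poincare (a : R) : 0 < a -> exists C : R, 0 < C /\
  forall (n : nat) (h U B Z : R) (g : 'rV[R]_n -> R), (0 < n)%N -> 0 < h -> 0 <= U ->
  1024 * n%:R ^+ 2 * (h * expR U) <= 1 -> measurable_fun setT g ->
  (forall x, 0 <= g x) -> (forall x, g x <= B) ->
  (\int[leb n]_x (wgt (a + n%:R / 2) x)%:E = Z%:E)%E ->
  exists2 c : R, 0 <= c &
  (\int[leb n]_x ((g x - c) ^+ 2 * wgt (a + n%:R / 2) x)%:E <=
   (C * n%:R * expR U / h)%:E * \int[leb n]_x \int[leb n]_z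
      ((g x - g z) ^+ 2 * (heat h x z *
         (wgt ((a + n%:R / 2) / 2) x * wgt ((a + n%:R / 2) / 2) z)))%:E +
   (C * B ^+ 2 * expR (- (a * U)) * Z)%:E)%E.
Proof.
move=> a0; have [Ga [Ga0 EGa]] := gamma_int a0; have [Ct [Ct0 HCt]] := gamma_tail a0.
pose c1 := Num.min 1 a.
have c10 : 0 < c1 by rewrite lt_min ltr01.
have [K [K0 EK]] := exp_abs_int (divr_gt0 c10 (ltr0n R 2)).
pose k := expR (1 + a ^+ 2); have k0 : 0 <= k by exact: expR_ge0.
pose C1 := 1 + k * (K + 1) ^+ 2 / 2.
have C10 : 0 < C1 by rewrite /C1 ltr_pwDl// divr_ge0// mulr_ge0// sqr_ge0.
exists (4 * C1 + Ct / Ga); split; first by rewrite addr_gt0 ?divr_gt0 ?mulr_gt0.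
move=> n h U B Z g n0 h0 U0 small mg g0 gB EZ.
pose b := a + n%:R / 2; rewrite -/b in EZ *.
have b0 : 0 < b by rewrite ltr_wpDr.
have [Gb [Gb0 EGb]] := gamma_int b0.
pose Cn : R := Num.sqrt pi^-1 ^+ n.
have Cn0 : 0 < Cn by rewrite exprn_gt0// sqrtr_gt0 invr_gt0 pi_gt0.
have KK0 : 0 < Cn * Gb by rewrite mulr_gt0.
have ZE : Z = Ga / (Cn * Gb).
  by apply/EFin_inj; rewrite -EZ; exact: (wgt_int EGa Gb0 EGb).
pose F := scale_mean g; pose V := scale_var g; pose p := gweight a.
have mF : measurable_fun setT F := measurable_scale_mean mg g0.
have mV : measurable_fun setT V := measurable_scale_var mg g0.
have mp : measurable_fun setT p := measurable_gweight a.
have p0 u : 0 <= p u by exact: gweight_ge0.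
have V0 u : 0 <= V u := scale_var_ge0 mg g0 gB u.
have F0 u : 0 <= F u := scale_mean_ge0 mg g0 gB u.
have B0 : 0 <= B := le_trans (g0 0) (gB 0).
have np : 1 <= n%:R :> R by rewrite ler1n.
(* The mean at log-scale 0, the origin from which Hardy's inequality integrates. *)
exists (F 0); first exact: F0.
pose D u := `|F u - F 0|.
have mD : measurable_fun setT D :=
  measurableT_comp (@normr_measurable _ setT) (measurable_funB mF (@measurable_cst _ _ R _ setT (F 0))).
have mgam u : measurable_fun setT (fun x : 'rV[R]_n => gam (expR u) x).
  by apply: (measurable_gam_exp (f := id) (g := fun=> u)).
have g0' u x : 0 <= gam (expR u) (x : 'rV[R]_n) by exact: gam_ge0.
have gam1 u : (\int[leb n]_x (gam (expR u) (x : 'rV[R]_n))%:E = 1 :> \bar R)%E.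
  by apply: gam_int; exact: expR_gt0.
have inner u : (\int[leb n]_x ((g x - F 0) ^+ 2 * gam (expR u) x)%:E = (V u + D u ^+ 2)%:E)%E.
  exact: (scale_sqr_dist u mg g0 gB (F0 0)).
have mgF : measurable_fun setT (fun x => (g x - F 0) ^+ 2).
  exact: measurable_funX (measurable_funB mg (measurable_cst _)).
have VD u : V u + D u ^+ 2 <= B ^+ 2 := scale_sqr_dist_le u 0 mg g0 gB.
pose st (u : R) := step (U - `|u|).
have mst : measurable_fun setT st by apply: measurable_step; meas.
have st0 u : 0 <= st u by exact: step_ge0.
have st1 u : 0 <= 1 - st u.
  by rewrite /st; have [->|[-> _]] := step01 (U - `|u|); rewrite ?subr0 ?subrr.
pose T1 := (\int[lam]_u (st u * (p u * V u))%:E)%E.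
have T10 : (0 <= T1)%E by apply: eint_ge0 => u; rewrite mulr_ge0 ?mulr_ge0.
have T2 : (\int[lam]_u (st u * (p u * D u ^+ 2))%:E <= (k * (K + 1) ^+ 2 / 2 * n%:R)%:E * T1)%E.
  have mR := measurable_scale_rate mg g0.
  have r0 v : 0 <= scale_rate g v by exact: sqrtr_ge0.
  have D0 u : 0 <= D u by exact: normr_ge0.
  (* [hardy] asks for a positive constant, while K is only known to be nonnegative. *)
  have K10 : 0 < K + 1 by lra.
  have EK1 : (\int[lam]_u (expR (- (c1 / 2 * `|u|)))%:E <= (K + 1)%:E)%E by rewrite EK lee_fin; lra.
  have DE s : ((D s)%:E <= \int[lam]_v (btw s v * scale_rate g v)%:E)%E.
    have [s0|s0|->] := ltgtP s 0.
    - rewrite /D distrC; apply: (le_trans (scale_mean_lipschitz mg g0 gB s0)).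
      apply: le_eint.
      + by refine (measurable_lebR _); apply: measurable_funM => //; apply: (measurable_ind _ _ (f := id)).
      + by refine (measurable_lebR _); apply: measurable_funM => //; apply: (measurable_btw (f := fun=> s)).
      + by move=> v; rewrite mulr_ge0 ?ind_ge0.
      by move=> v; rewrite ler_wpM2r// /ind /btw le_max sub0r (mulrC (step (v - s))) lexx orbT.
    - apply: (le_trans (scale_mean_lipschitz mg g0 gB s0)).
      apply: le_eint.
      + by refine (measurable_lebR _); apply: measurable_funM => //; apply: (measurable_ind _ _ (f := id)).
      + by refine (measurable_lebR _); apply: measurable_funM => //; apply: (measurable_btw (f := fun=> s)).
      + by move=> v; rewrite mulr_ge0 ?ind_ge0.
      by move=> v; rewrite ler_wpM2r// /ind /btw le_max subr0 lexx.
    - by rewrite /D subrr normr0; apply: eint_ge0 => v; rewrite mulr_ge0 ?btw_ge0.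
  apply: (le_trans (hardy U mp mR mD p0 r0 D0 k0 K10 (fun s v => @gweight_ratio _ a s v a0) EK1 DE)).
  have -> : (\int[lam]_v (step (U - `|v|) * (scale_rate g v ^+ 2 * gweight a v))%:E =
     (n%:R / 2)%:E * T1)%E.
    rewrite -(@eintZ _ (measurableTypeR R) R lam) ?divr_ge0//; first last.
    + by move=> u; rewrite mulr_ge0 ?mulr_ge0.
    + by refine (measurable_lebR _); apply: measurable_funM => //; exact: measurable_funM.
    apply: eq_eint => u; rewrite /scale_rate sqr_sqrtr; last by rewrite mulr_ge0 ?divr_ge0.
    rewrite -/(st u) -/(V u) -/(p u); ring.
  rewrite muleA -EFinM; apply/lee_wpmul2r => //.
  by rewrite lee_fin le_eqVlt; apply/orP; left; apply/eqP; ring.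
have T3 : (T1 <= (4 * expR U / h)%:E * ((Cn * Gb)%:E * \int[leb n]_x \int[leb n]_z
      ((g x - g z) ^+ 2 * (heat h x z * (wgt (b / 2) x * wgt (b / 2) z)))%:E))%E.
  exact: (weak_poincare_scale b0 (erefl b) EGb n0 h0 small mg g0 gB).
have LE : ((Cn * Gb)%:E * \int[leb n]_x ((g x - F 0) ^+ 2 * wgt b x)%:E <=
    T1 + (k * (K + 1) ^+ 2 / 2 * n%:R)%:E * T1 + (Ct * B ^+ 2 * expR (- (a * U)))%:E)%E.
  rewrite -(student_mixture mgF (fun x => sqr_ge0 (g x - F 0)) (ltW Gb0) EGb).
  have -> : (\int[lam]_u \int[leb n]_x (gweight a u * ((g x - F 0) ^+ 2 * gam (expR u) x))%:E =
      \int[lam]_u (p u * (V u + D u ^+ 2))%:E)%E.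
    apply: eq_integral => u _; rewrite eintZ ?gweight_ge0//.
    - by rewrite inner -EFinM.
    - exact: measurable_funM.
    - by move=> x; rewrite mulr_ge0 ?sqr_ge0.
  have mpV : measurable_fun setT (fun u => st u * (p u * V u)).
    by apply: measurable_funM => //; exact: measurable_funM.
  have mpD : measurable_fun setT (fun u => st u * (p u * D u ^+ 2)).
    by apply: measurable_funM => //; apply: measurable_funM => //; exact: measurable_funX.
  have m1s : measurable_fun setT (fun u => (1 - st u) * p u).
    by apply: measurable_funM => //; exact: measurable_funB.
  have mtl : measurable_fun setT (fun u => B ^+ 2 * ((1 - st u) * p u)) by exact: measurable_funM.
  have pV0 u : 0 <= st u * (p u * V u) by rewrite mulr_ge0// mulr_ge0.
  have pD0 u : 0 <= st u * (p u * D u ^+ 2) by rewrite mulr_ge0// mulr_ge0// sqr_ge0.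
  have s10 u : 0 <= (1 - st u) * p u by rewrite mulr_ge0.
  have tl0 u : 0 <= B ^+ 2 * ((1 - st u) * p u) by rewrite mulr_ge0// sqr_ge0.
  have mVD : measurable_fun setT (fun u => st u * (p u * V u) + st u * (p u * D u ^+ 2)) by exact: measurable_funD.
  have VD0 u : 0 <= st u * (p u * V u) + st u * (p u * D u ^+ 2) by rewrite addr_ge0.
  have le1 : (\int[lam]_u (p u * (V u + D u ^+ 2))%:E <= \int[lam]_u ((st u * (p u * V u) +
     st u * (p u * D u ^+ 2)) + B ^+ 2 * ((1 - st u) * p u))%:E)%E.
    apply: le_eint.
    - refine (measurable_lebR _); apply: measurable_funM => //; apply: measurable_funD => //.
      exact: measurable_funX.
    - by refine (measurable_lebR _); exact: measurable_funD.
    - by move=> u; rewrite mulr_ge0// addr_ge0 ?sqr_ge0.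
    move=> u; have := ler_wpM2l (s10 u) (VD u).
    by move: (st u) (p u) (V u) (D u) => s' p' V' D'; lra.
  apply: (le_trans le1).
  rewrite (@eintD _ (measurableTypeR R) R lam _ _ (measurable_lebR mVD) (measurable_lebR mtl) VD0 tl0).
  rewrite (@eintD _ (measurableTypeR R) R lam _ _ (measurable_lebR mpV) (measurable_lebR mpD) pV0 pD0).
  rewrite (@eintZ _ (measurableTypeR R) R lam _ _ (sqr_ge0 B) (measurable_lebR m1s) s10).
  apply: leeD; first by apply: leeD => //; exact: lexx.
  rewrite (_ : Ct * B ^+ 2 * expR (- (a * U)) = B ^+ 2 * (Ct * expR (- (a * U)))); last by ring.
  by rewrite [leRHS]EFinM; apply: lee_wpmul2l; [rewrite lee_fin sqr_ge0|exact: HCt].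
move: T10 T3 LE.
set Y := (\int[leb n]_x \int[leb n]_z _)%E.
set X := (\int[leb n]_x _)%E.
have Y0 : (0 <= Y)%E.
  apply: integral_ge0 => x _; apply: eint_ge0 => z.
  by rewrite mulr_ge0 ?sqr_ge0// mulr_ge0 ?heat_ge0// mulr_ge0 ?wgt_ge0.
move=> T10 T3 LE; clearbody Y X T1.
have e10 : 0 <= 4 * expR U / h by rewrite divr_ge0 ?mulr_ge0 ?expR_ge0// ltW.
have kk0 : 0 <= k * (K + 1) ^+ 2 / 2 * n%:R by rewrite mulr_ge0// divr_ge0// mulr_ge0// sqr_ge0.
have s1 : (T1 + (k * (K + 1) ^+ 2 / 2 * n%:R)%:E * T1 <= (C1 * n%:R)%:E * T1)%E.
  rewrite -{1}(mul1e T1) -ge0_muleDl ?lee_fin//.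
  apply: lee_wpmul2r => //; rewrite -EFinD lee_fin /C1 mulrDl lerD2r.
  by rewrite mul1r.
have s2 : ((C1 * n%:R)%:E * T1 <= (Cn * Gb)%:E * ((C1 * n%:R * (4 * expR U / h))%:E * Y))%E.
  rewrite [leRHS]muleCA [X in (_ <= X * _)%E]EFinM -[leRHS]muleA.
  by apply: lee_wpmul2l => //; rewrite lee_fin mulr_ge0// ltW.
(* The tail involves only [Ct] and [Ga], which depend on a; writing it with Z lets Cn Gb be divided
   out of the whole inequality. *)
have tE : Ct * B ^+ 2 * expR (- (a * U)) = Cn * Gb * ((Ct / Ga) * B ^+ 2 * expR (- (a * U)) * Z).
  by rewrite ZE; field; rewrite !gt_eqF.
have Z0 : 0 <= Z by rewrite ZE divr_ge0 ?ltW.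
rewrite -(@lee_pmul2l _ (Cn * Gb)%:E) ?lte_fin//.
apply: (le_trans LE); rewrite tE.
apply: (@le_trans _ _ ((Cn * Gb)%:E * ((C1 * n%:R * (4 * expR U / h))%:E * Y) +
   (Cn * Gb * ((Ct / Ga) * B ^+ 2 * expR (- (a * U)) * Z))%:E)%E).
  by apply: leeD; [exact: le_trans s1 s2|exact: lexx].
have CC0 : 0 <= 4 * C1 + Ct / Ga by rewrite addr_ge0 ?divr_ge0 ?mulr_ge0// ltW.
have t10 : (0 <= ((4 * C1 + Ct / Ga) * n%:R * expR U / h)%:E * Y)%E.
  by rewrite mule_ge0// lee_fin divr_ge0 ?mulr_ge0 ?expR_ge0// ltW.
have t20 : (0 <= ((4 * C1 + Ct / Ga) * B ^+ 2 * expR (- (a * U)) * Z)%:E)%E.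
  by rewrite lee_fin !mulr_ge0 ?expR_ge0 ?sqr_ge0.
rewrite (ge0_muleDr _ t10 t20).
apply: leeD.
  apply: lee_wpmul2l; first by rewrite lee_fin ltW.
  apply: lee_wpmul2r => //; rewrite lee_fin.
  rewrite (_ : C1 * n%:R * (4 * expR U / h) = 4 * C1 * (n%:R * expR U / h)); last by ring.
  rewrite (_ : (4 * C1 + Ct / Ga) * n%:R * expR U / h =
    (4 * C1 + Ct / Ga) * (n%:R * expR U / h)); last by ring.
  by rewrite ler_wpM2r ?lerDl ?divr_ge0 ?mulr_ge0 ?expR_ge0// ltW.
rewrite -EFinM lee_fin ler_wpM2l//; first exact: ltW.
rewrite ler_wpM2r// ler_wpM2r ?expR_ge0// ler_wpM2r ?sqr_ge0// lerDr.
by rewrite mulr_ge0// ltW.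
Qed.

End weak_poincare_inequality.

(** * Decay of the Renyi divergence along a reversible chain *)

Lemma one_sub_expN (R : realType) (t : R) : 0 <= t -> Num.min t 1 / 2 <= 1 - expR (- t).
Proof.
move=> t0; have h (u : R) : 0 <= u -> u <= 1 -> expR (- u) <= 1 - u / 2.
  move=> u0 u1; have e := expR_ge1Dx u; have e0 := expR_gt0 u.
  have : expR u * (1 - u / 2) >= 1.
    have : (1 + u) * (1 - u / 2) <= expR u * (1 - u / 2) by rewrite ler_wpM2r//; lra.
    have : 0 <= u * (1 - u) by rewrite mulr_ge0//; lra.
    lra.
  rewrite expRN -[X in _ -> X <= _]div1r ler_pdivrMr// mulrC; exact.
rewrite minEle; case: ifP => t1; first by have := h _ t0 t1; lra.
have : expR (- t) <= expR (- 1) by rewrite ler_expR lerN2 ltW// ltNge t1.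
by have := h 1 ler01 (lexx 1); lra.
Qed.

Section interpolation.
Context d (T : measurableType d) (R : realType) (m : {sigma_finite_measure set T -> \bar R}).
Variable th : T -> R.
Hypotheses (mth : measurable_fun setT th) (th0 : forall x, 0 <= th x)
  (th1 : (\int[m]_x (th x)%:E = 1)%E).

Lemma ge0_le_mean (f g : T -> R) B : measurable_fun setT f -> measurable_fun setT g ->
  (forall x, 0 <= f x) -> (forall x, f x <= g x) -> (forall x, g x <= B) ->
  mean m th f <= mean m th g.
Proof.
move=> mf mg f0 fg gB.
have g0 x : 0 <= g x := le_trans (f0 x) (fg x).
have fB x : f x <= B := le_trans (fg x) (gB x).
rewrite -lee_fin -(meanE mth th0 th1 mf f0 fB) -(meanE mth th0 th1 mg g0 gB).
apply: le_eint; [exact: measurable_funM|exact: measurable_funM|by move=> x; rewrite mulr_ge0|].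
by move=> x; rewrite ler_wpM2r.
Qed.

Lemma measurable_powRf d' (U : measurableType d') (f : U -> R) a :
  measurable_fun setT f -> measurable_fun setT (fun x => f x `^ a).
Proof. by move=> mf; apply: (measurableT_comp (measurable_powR a)). Qed.

Variables (q B : R) (f : T -> R).
Hypotheses (q2 : 2 <= q) (mf : measurable_fun setT f) (f0 : forall x, 0 <= f x)
  (fB : forall x, f x <= B) (f1 : (\int[m]_x (f x * th x)%:E = 1)%E).

Let q0 : 0 <= q. Proof. by move: q2; lra. Qed.
Let qh0 : 0 <= q / 2. Proof. by rewrite divr_ge0. Qed.
Let q10 : 0 < q - 1. Proof. by move: q2; lra. Qed.
Let B0 : 0 <= B.
Proof.
have [//|B0] := leP 0 B; have := f1.
rewrite integral0_eq => [/eqP|x _]; first by rewrite eqe eq_sym oner_eq0.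
by have := le_trans (f0 x) (fB x); rewrite leNgt B0.
Qed.
Let powB a x : 0 <= a -> f x `^ a <= B `^ a.
Proof. by move=> a0; apply: ge0_ler_powR; rewrite ?nnegrE//; exact: f0. Qed.

Lemma mean_pow_ge1 : 1 <= mean m th (fun x => f x `^ q).
Proof.
have q1 : 1 <= q by move: q2; lra.
have := jensen_powR mth th0 th1 q1 mf f0 f1.
rewrite (meanE mth th0 th1 (measurable_powRf q mf) (fun x => powR_ge0 _ _) (fun x => powB x q0)).
by rewrite lee_fin powR1.
Qed.

(** Interpolation of f^(q/2) between f and f^q: Jensen under the probability density f th with
    exponent s = (q - 1)/(q/2 - 1). At q = 2 this exponent degenerates, and both sides equal 1. *)
Lemma mean_half_pow :
  mean m th (fun x => f x `^ (q / 2)) ^+ 2 <= mean m th (fun x => f x `^ q) `^ ((q - 2) / (q - 1)).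
Proof.
have h0 := qh0.
have Eq := meanE mth th0 th1 (measurable_powRf q mf) (fun x => powR_ge0 _ _) (fun x => powB x q0).
have Eh := meanE mth th0 th1 (measurable_powRf (q / 2) mf) (fun x => powR_ge0 _ _) (fun x => powB x h0).
have [q2e|q2n] := eqVneq q 2.
  rewrite q2e subrr mul0r powRr0 divff ?pnatr_eq0//.
  suff -> : mean m th (fun x => f x `^ 1) = 1 by rewrite expr1n.
  rewrite /mean (_ : (\int[m]_x (f x `^ 1 * th x)%:E)%E = 1%E)//; rewrite -f1.
  by apply: eq_eint => x; rewrite powRr1.
have q2' : 0 < q - 2 by rewrite subr_gt0 lt_neqAle eq_sym q2n.
pose s := (q - 1) / (q / 2 - 1).
have s1 : 1 <= s by rewrite /s ler_pdivlMr; move: q2 q2'; lra.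
have mft : measurable_fun setT (fun x => f x * th x) by exact: measurable_funM.
have ft0 x : 0 <= f x * th x by rewrite mulr_ge0.
have e1 x : f x `^ (q / 2 - 1) * f x = f x `^ (q / 2).
  by rewrite mulrC mulr_powRB1//; move: q2 q2'; lra.
have e2 x : (f x `^ (q / 2 - 1)) `^ s * f x = f x `^ q.
  rewrite -powRrM (_ : (q / 2 - 1) * s = q - 1); last by rewrite /s; field; rewrite gt_eqF//; move: q2 q2'; lra.
  by rewrite mulrC mulr_powRB1//; move: q2 q2'; lra.
have := jensen_powR mft ft0 f1 s1 (measurable_powRf (q / 2 - 1) mf) (fun x => powR_ge0 _ _) (M := mean m th (fun x => f x `^ (q / 2))).
under eq_eint do rewrite mulrA e1.
move=> /(_ Eh).
under eq_eint do rewrite mulrA e2.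
rewrite Eq lee_fin => js.
have M0 : 0 <= mean m th (fun x => f x `^ (q / 2)) by exact: (mean_ge0 mth th0 th1 (measurable_powRf (q / 2) mf) (fun x => powR_ge0 _ _) (fun x => powB x h0)).
have -> : mean m th (fun x => f x `^ (q / 2)) ^+ 2 =
    (mean m th (fun x => f x `^ (q / 2)) `^ s) `^ (2 / s).
  rewrite -powRrM (_ : s * (2 / s) = 2); last by field; rewrite gt_eqF//; move: q2 q2'; lra.
  by rewrite powR_mulrn.
have -> : (q - 2) / (q - 1) = 2 / s by rewrite /s; field; rewrite !gt_eqF//; move: q2 q2'; lra.
apply: ge0_ler_powR => //; rewrite ?nnegrE ?powR_ge0//; first by rewrite divr_ge0//; move: q2 q2'; lra.
exact: le_trans (powR_ge0 _ _) js.
Qed.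

(** The Renyi divergence of order q from [th] of the law whose density relative to [th] is f. *)
Definition renyi_mean := ln (mean m th (fun x => f x `^ q)) / (q - 1).

(** With F = E f^q and R = ln F/(q - 1), [mean_half_pow] bounds the square of E f^(q/2) by F e^(-R).
    The variance is thus at least F (1 - e^(-R)), and [one_sub_expN] concludes. *)
Lemma variance_half_pow : mean m th (fun x => f x `^ q) * (Num.min renyi_mean 1 / 2) <=
  variance m th (fun x => f x `^ (q / 2)).
Proof.
have F1 := mean_pow_ge1.
have -> : variance m th (fun x => f x `^ (q / 2)) =
    mean m th (fun x => f x `^ q) - mean m th (fun x => f x `^ (q / 2)) ^+ 2.
  rewrite /variance; congr (_ - _); congr mean; apply/funext => x.
  by rewrite -powR_mulrn ?powR_ge0// -powRrM; congr powR; field.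
have := mean_half_pow; rewrite /renyi_mean.
move: (mean m th (fun x => f x `^ q)) F1 (mean m th _) => F F1 G GF.
have F0 : 0 < F by lra.
have t0 : 0 <= ln F / (q - 1) by rewrite divr_ge0 ?ln_ge0//; exact: ltW.
have := one_sub_expN t0 => /(ler_wpM2l (ltW F0)).
rewrite mulrBr mulr1; suff <- : F `^ ((q - 2) / (q - 1)) = F * expR (- (ln F / (q - 1))) by lra.
rewrite /powR gt_eqF// -{2}(lnK F0) -expRD; congr expR; field; rewrite gt_eqF//; move: q10; lra.
Qed.

End interpolation.

Section reversible_chain.
Context d (T : measurableType d) (R : realType) (m : {sigma_finite_measure set T -> \bar R}).
Variables (p : T -> R) (k : T -> T -> R).
Hypotheses (mp : measurable_fun setT p) (p0 : forall x, 0 <= p x)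
  (p1 : (\int[m]_x (p x)%:E = 1)%E)
  (mk : measurable_fun setT (fun z => k z.1 z.2)) (k0 : forall x y, 0 <= k x y)
  (k1 : forall x, (\int[m]_y (k x y)%:E = 1)%E)
  (rev : forall x y, p x * k x y = p y * k y x).

(** The action of the chain on functions; by reversibility it is also its action on densities
    relative to [p]. *)
Definition smooth f x := mean m (k x) f.

Let mkx x : measurable_fun setT (k x).
Proof. exact: (measurableT_comp mk (measurable_fun_pair (@measurable_cst _ _ _ _ setT x) (@measurable_id _ _ setT))). Qed.

Section function.
Variables (B : R) (f : T -> R).
Hypotheses (mf : measurable_fun setT f) (f0 : forall x, 0 <= f x) (fB : forall x, f x <= B).

Lemma measurable_smooth : measurable_fun setT (smooth f).
Proof.
apply: (measurableT_comp (@fine_measurable _ setT measurableT)).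
apply: (measurable_eint m (f := fun x y => f y * k x y)).
- by apply: measurable_funM => //; exact: (measurableT_comp mf measurable_snd).
- by move=> x y; rewrite mulr_ge0.
Qed.

Lemma smooth_ge0 x : 0 <= smooth f x.
Proof. exact: (mean_ge0 (mkx x) (k0 x) (k1 x) mf f0 fB). Qed.

Lemma smooth_le x : smooth f x <= B.
Proof. exact: (mean_le (mkx x) (k0 x) (k1 x) mf f0 fB). Qed.

Lemma smoothE x : (\int[m]_y (f y * k x y)%:E = (smooth f x)%:E)%E.
Proof. exact: (meanE (mkx x) (k0 x) (k1 x) mf f0 fB). Qed.

Lemma smooth_invariant : (\int[m]_x (smooth f x * p x)%:E = \int[m]_x (f x * p x)%:E)%E.
Proof.
have mfpk : measurable_fun setT (fun z => p z.1 * (f z.2 * k z.1 z.2)).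
  apply: measurable_funM; first exact: (measurableT_comp mp measurable_fst).
  by apply: measurable_funM => //; exact: (measurableT_comp mf measurable_snd).
have fpk0 x y : 0 <= p x * (f y * k x y) by rewrite !mulr_ge0.
transitivity (\int[m]_x \int[m]_y (p x * (f y * k x y))%:E)%E.
  apply: eq_integral => x _; rewrite mulrC EFinM -smoothE -eintZ//.
  - by apply: measurable_funM => //; exact: mkx.
  - by move=> y; rewrite mulr_ge0.
rewrite (tonelli m m mfpk fpk0); apply: eq_integral => y _.
transitivity (\int[m]_x (f y * p y * k y x)%:E)%E.
  by apply: eq_eint => x; rewrite mulrCA rev mulrA.
by rewrite (eintZ m (mulr_ge0 (f0 y) (p0 y)) (mkx y) (k0 y)) k1 mule1.
Qed.

End function.

Lemma smooth_density (f : T -> R) B : measurable_fun setT f -> (forall x, 0 <= f x) ->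
  (forall x, f x <= B) -> (\int[m]_x (f x * p x)%:E = 1)%E ->
  (\int[m]_x (smooth f x * p x)%:E = 1)%E.
Proof. by move=> mf f0 fB <-; exact: (smooth_invariant mf f0 fB). Qed.

Variables (q B : R) (f : T -> R).
Hypotheses (q2 : 2 <= q) (mf : measurable_fun setT f) (f0 : forall x, 0 <= f x)
  (fB : forall x, f x <= B) (f1 : (\int[m]_x (f x * p x)%:E = 1)%E).

Let g x := f x `^ (q / 2).
Let mg : measurable_fun setT g. Proof. exact: measurable_powRf. Qed.
Let g0 x : 0 <= g x. Proof. exact: powR_ge0. Qed.
Let gB x : g x <= B `^ (q / 2).
Proof.
have qh : 0 <= q / 2 by move: q2; lra.
have x0 := f0 x; have xB := fB x; have B0 := le_trans x0 xB.
by apply: ge0_ler_powR; rewrite ?nnegrE.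
Qed.
Let g2 x : g x ^+ 2 = f x `^ q.
Proof. by rewrite -powR_mulrn ?powR_ge0// -powRrM; congr powR; field. Qed.
Let mg2 : measurable_fun setT (fun x => g x ^+ 2). Proof. exact: measurable_funX. Qed.
Let g20 x : 0 <= g x ^+ 2. Proof. exact: sqr_ge0. Qed.
Let g2B x : g x ^+ 2 <= (B `^ (q / 2)) ^+ 2.
Proof. by rewrite ler_sqr ?nnegrE ?powR_ge0//; exact: gB. Qed.

Definition local_var x := variance m (k x) g.

Lemma measurable_local_var : measurable_fun setT local_var.
Proof.
by apply: measurable_funB; [exact: measurable_smooth|apply: measurable_funX; exact: measurable_smooth].
Qed.

Lemma local_var_ge0 x : 0 <= local_var x.
Proof. exact: (variance_ge0 (mkx x) (k0 x) (k1 x) mg g0 gB). Qed.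

Lemma local_var_le x : local_var x <= (B `^ (q / 2)) ^+ 2.
Proof. exact: (variance_le (mkx x) (k0 x) (k1 x) mg g0 gB). Qed.

(* Jensen's inequality for the exponent [q / 2], then the variance identity. *)
Lemma chain_step : mean m p (fun x => smooth f x `^ q) + mean m p local_var <=
  mean m p (fun x => f x `^ q).
Proof.
have q0 : 0 <= q by move: q2; lra.
have q21 : 1 <= q / 2 by move: q2; lra.
have mKf := measurable_smooth mf f0.
have Kf0 := smooth_ge0 mf f0 fB.
have KfB := smooth_le mf f0 fB.
have mKq : measurable_fun setT (fun x => smooth f x `^ q) by exact: measurable_powRf.
have Kq0 x : 0 <= smooth f x `^ q by exact: powR_ge0.
have KqB x : smooth f x `^ q <= B `^ q.
  by apply: ge0_ler_powR; rewrite ?nnegrE//; exact: le_trans (Kf0 x) (KfB x).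
have pt x : smooth f x `^ q + local_var x <= smooth (fun x => g x ^+ 2) x.
  rewrite /local_var /variance -/(smooth _ x) -lerBrDr opprB addrCA subrr addr0.
  have -> : smooth f x `^ q = (smooth f x `^ (q / 2)) ^+ 2.
    by rewrite -powR_mulrn ?powR_ge0// -powRrM; congr powR; field.
  rewrite ler_sqr ?nnegrE ?powR_ge0 ?(mean_ge0 (mkx x) (k0 x) (k1 x) mg g0 gB)//.
  have := jensen_powR (mkx x) (k0 x) (k1 x) q21 mf f0 (smoothE mf f0 fB x).
  by rewrite (meanE (mkx x) (k0 x) (k1 x) mg g0 gB) lee_fin.
have mV := measurable_local_var.
have V0 := local_var_ge0.
have mKg := measurable_smooth mg2 g20.
have Kg0 := smooth_ge0 mg2 g20 g2B.
have -> : mean m p (fun x => f x `^ q) = mean m p (smooth (fun x => g x ^+ 2)).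
  rewrite /mean (smooth_invariant mg2 g20 g2B); congr fine.
  by apply: eq_eint => x; rewrite g2.
rewrite -lee_fin EFinD -(meanE mp p0 p1 mKq Kq0 KqB) -(meanE mp p0 p1 mV V0 local_var_le).
rewrite -(meanE mp p0 p1 mKg Kg0 (smooth_le mg2 g20 g2B)).
rewrite -eintD; [|exact: measurable_funM|exact: measurable_funM|by move=> x; rewrite mulr_ge0|by move=> x; rewrite mulr_ge0].
apply: le_eint.
- by apply: measurable_funD; exact: measurable_funM.
- exact: measurable_funM.
- by move=> x; rewrite addr_ge0// mulr_ge0.
- by move=> x; rewrite -mulrDl ler_wpM2r.
Qed.

(* A weak Poincare inequality for the chain decreases the divergence of order [q]. *)
Lemma renyi_step gm r : 0 <= gm -> 0 <= r ->
  gm * (variance m p g - r) <= mean m p local_var ->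
  renyi_mean m p q (smooth f) <=
  renyi_mean m p q f - gm / (q - 1) * (Num.min (renyi_mean m p q f) 1 / 2 - r).
Proof.
move=> gm0 r0 wp.
have Kf1 := smooth_density mf f0 fB f1.
have mKf := measurable_smooth mf f0.
have Kf0 := smooth_ge0 mf f0 fB.
have KfB := smooth_le mf f0 fB.
have F'1 := mean_pow_ge1 mp p0 p1 q2 mKf Kf0 KfB Kf1.
have F1 := mean_pow_ge1 mp p0 p1 q2 mf f0 fB f1.
have := chain_step; have := variance_half_pow mp p0 p1 q2 mf f0 fB f1.
rewrite -/g; move: wp; rewrite /renyi_mean.
move: (Num.min _ 1 / 2) (variance m p g) (mean m p local_var) => t v l.
move: (mean m p (fun x => smooth f x `^ q)) F'1 (mean m p (fun x => f x `^ q)) F1 => F' F'1 F F1.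
move=> wp ht hc.
have F0 : 0 < F by lra. have F'0 : 0 < F' by lra.
(* F >= 1 lets the additive remainder r be bounded by F r, so that the recursion closes on ln F. *)
have hF : F' <= F * (1 + - (gm * (t - r))).
  have := ler_wpM2l gm0 (_ : F * t - F * r <= v - r).
  have : r <= F * r by rewrite ler_peMl.
  move=> h1 /(_ ltac:(lra)) h2; rewrite mulrDr mulr1 mulrN mulrCA mulrBr; lra.
have x1 : -1 < - (gm * (t - r)).
  rewrite -subr_gt0 opprK addrC; rewrite -(pmulr_rgt0 _ F0); exact: lt_le_trans F'0 hF.
have : ln F' <= ln F - gm * (t - r).
  apply: (@le_trans _ _ (ln (F * (1 + - (gm * (t - r)))))).
    by rewrite ler_ln ?posrE//; exact: lt_le_trans F'0 hF.
  rewrite lnM ?posrE//; last by move: x1; lra.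
  by rewrite lerD2l le_ln1Dx.
have iq0 : 0 <= (q - 1)^-1 by rewrite invr_ge0; move: q2; lra.
move=> /(ler_wpM2r iq0) h; apply: (le_trans h); apply: eq_lexx; ring.
Qed.

End reversible_chain.

Section two_phases.
Context {R : realType}.
Implicit Types (t : nat -> R) (dl e : R).

(** Above 1 the minimum equals 1 and every step gains dl/4; a value below 1 never returns above
    1. *)
Lemma linear_phase t dl : 0 <= dl <= 1 ->
  (forall k, t k.+1 <= t k - dl * (Num.min (t k) 1 / 2 - 4^-1)) ->
  (forall k, 0 <= t k) ->
  forall k, t k <= Num.max 1 (t 0%N - k%:R * (dl / 4)).
Proof.
move=> /andP[dl0 dl1] H t0; elim=> [|k IH]; first by rewrite mul0r subr0 le_max lexx orbT.
have := H k; have p0 := t0 k; have := IH; rewrite !le_max -[k.+1%:R]natr1.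
have [t1|t1] := leP (t k) 1.
  move=> _ h; apply/orP; left; apply: (le_trans h).
  have : 0 <= (1 - t k) * (1 - dl / 2) by rewrite mulr_ge0//; lra.
  by have := mulr_ge0 dl0 p0; lra.
rewrite /= => h1 h.
by apply/orP; right; move: h h1; lra.
Qed.

(** Below 1 the recursion is dominated by the contraction t -> (1 - dl/2) t + dl e/4, whose fixed
    point is e/2. *)
Lemma geometric_phase t dl e : 0 <= dl <= 1 -> 0 <= e <= 1 ->
  (forall k, t k.+1 <= t k - dl * (Num.min (t k) 1 / 2 - e / 4)) -> t 0%N <= 1 ->
  forall k, t k <= 1 /\ t k <= (1 - dl / 2) ^+ k + e / 2.
Proof.
move=> /andP[dl0 dl1] /andP[e0 e1] H t0; elim=> [|k [IH1 IH2]].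
  by split=> //; rewrite expr0; apply: (le_trans t0); lra.
have := H k; rewrite (min_idPl IH1) => h; split.
  apply: (le_trans h).
  have h1 : 0 <= (1 - t k) * (1 - dl / 2) by rewrite mulr_ge0//; lra.
  have h2 : 0 <= dl * (1 - e) by rewrite mulr_ge0//; lra.
  lra.
apply: (le_trans h); rewrite exprS.
have d0 : 0 <= 1 - dl / 2 by lra.
by have := ler_wpM2l d0 IH2; lra.
Qed.

Lemma geometric_le dl (e : R) k : 0 <= dl <= 1 -> 0 < e -> ln (2 / e) <= k%:R * (dl / 2) ->
  (1 - dl / 2) ^+ k <= e / 2.
Proof.
move=> /andP[dl0 dl1] e0 h.
apply: (@le_trans _ _ (expR (- (dl / 2)) ^+ k)).
  have a0 : 0 <= 1 - dl / 2 by lra.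
  have a1 : 1 - dl / 2 <= expR (- (dl / 2)) by have := expR_ge1Dx (- (dl / 2)); lra.
  by apply: lerXn2r; rewrite ?nnegrE ?expR_ge0.
rewrite -expRM_natl -[leRHS]lnK ?posrE ?divr_gt0// ler_expR.
have -> : ln (e / 2) = - ln (2 / e) by rewrite -lnV ?posrE ?divr_gt0// invf_div.
lra.
Qed.

End two_phases.

(** * The heat-kernel chain reversible for an approximation of the target *)

Section heat_chain.
Context {R : realType} {n : nat}.
Notation E := 'rV[R]_n.

Lemma variance_quad (u v c : R) : u - v ^+ 2 <= u - 2 * c * v + c ^+ 2.
Proof. by have := sqr_ge0 (v - c); lra. Qed.

(** The parallelogram identity around the midpoint of x and y factors the product into heat (2h) x y
    and a heat kernel at time h/2 centered there, of mass 1. *)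
Lemma heat_semigroup h x y : 0 < h ->
  (\int[leb n]_z (heat h z x * heat h z y)%:E = (heat (2 * h) x (y : E))%:E)%E.
Proof.
move=> h0; pose mid := 2^-1 *: (x + y).
have m1 : measurable_fun setT (heat (h / 2) mid) by apply: measurable_heat.
have h2 : 0 < h / 2 by rewrite divr_gt0.
rewrite -[RHS]mule1 -(heat_int mid h2) -(eintZ (leb n) (heat_ge0 _ _ _) m1 (heat_ge0 _ _)).
have prod (u v P Q : R) : u ^+ n * expR (- P) * (v ^+ n * expR (- Q)) = (u * v) ^+ n * expR (- P - Q).
  by rewrite expRD exprMn; ring.
apply: eq_eint => z; rewrite /heat /gam !prod; congr (_ ^+ _ * expR _).
  have p0 := @pi_gt0 R; rewrite -!sqrtrM ?divr_ge0 ?invr_ge0 ?mulr_ge0 ?pi_ge0 ?ltW//.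
  by congr Num.sqrt; move: (@pi R) p0 => p p0; field; rewrite !gt_eqF.
by rewrite /mid !dotE (dotC z x) (dotC z y) (dotC y x); field; rewrite gt_eqF.
Qed.

Variables (h bm bp Z : R) (w : E -> R).
Hypotheses (h0 : 0 < h) (mw : measurable_fun setT w) (w0 : forall x, 0 < w x)
  (w1 : forall x, w x <= 1) (bm0 : 0 < bm) (Z0 : 0 < Z)
  (EZ : (\int[leb n]_x (w x ^+ 2)%:E = Z%:E)%E).

Let hm x : measurable_fun setT (heat h x : E -> R). Proof. by apply: measurable_heat. Qed.
Let w0' x : 0 <= w x. Proof. exact: ltW. Qed.

Definition heat_mean x := mean (leb n) (heat h x) w.
Notation Gw := heat_mean.

Hypotheses (Gm : forall x, bm * w x <= Gw x) (Gp : forall x, Gw x <= bp * w x).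

Lemma heat_meanE x : (\int[leb n]_y (w y * heat h x y)%:E = (Gw x)%:E)%E.
Proof. exact: (meanE (hm x) (heat_ge0 h x) (heat_int x h0) mw w0' w1). Qed.

Lemma heat_mean_gt0 x : 0 < Gw x.
Proof. by apply: lt_le_trans (Gm x); rewrite mulr_gt0. Qed.

Lemma measurable_heat_mean : measurable_fun setT Gw.
Proof.
apply: (measurableT_comp (@fine_measurable _ setT measurableT)).
apply: (measurable_eint (leb n) (f := fun x y => w y * heat h x y)).
- apply: measurable_funM; first exact: (measurableT_comp mw measurable_snd).
  by apply: measurable_heat; meas.
- by move=> x y; rewrite mulr_ge0 ?heat_ge0.
Qed.

Let bp0 : 0 < bp.
Proof.
have := le_trans (Gm 0) (Gp 0); rewrite ler_pM2r// => /(lt_le_trans bm0); exact.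
Qed.

Let mwG : measurable_fun setT (fun x => w x * Gw x).
Proof. by apply: measurable_funM => //; exact: measurable_heat_mean. Qed.
Let wG0 x : 0 <= w x * Gw x. Proof. by rewrite mulr_ge0// ltW// heat_mean_gt0. Qed.

Definition chain_mass := fine (\int[leb n]_x (w x * Gw x)%:E)%E.
Notation Zp := chain_mass.

Let mw2 : measurable_fun setT (fun x => w x ^+ 2). Proof. exact: measurable_funX. Qed.

Let massP : (\int[leb n]_x (w x * Gw x)%:E = Zp%:E)%E /\ bm * Z <= Zp <= bp * Z.
Proof.
have le1 : ((bm * Z)%:E <= \int[leb n]_x (w x * Gw x)%:E)%E.
  rewrite EFinM -EZ -(eintZ _ (ltW bm0) mw2 (fun x => sqr_ge0 (w x))).
  apply: le_eint => //; first exact: measurable_funM.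
    by move=> x; rewrite mulr_ge0 ?sqr_ge0// ltW.
  by move=> x; rewrite expr2 mulrCA ler_wpM2l.
have le2 : (\int[leb n]_x (w x * Gw x)%:E <= (bp * Z)%:E)%E.
  rewrite EFinM -EZ -(eintZ _ (ltW bp0) mw2 (fun x => sqr_ge0 (w x))).
  apply: le_eint => //; first exact: measurable_funM.
  by move=> x; rewrite expr2 mulrCA ler_wpM2l.
have e : (\int[leb n]_x (w x * Gw x)%:E = Zp%:E)%E.
  rewrite fineK// ge0_fin_numE; first by rewrite (le_lt_trans le2)// ltry.
  by apply: eint_ge0.
by split=> //; move: le1 le2; rewrite e !lee_fin => -> ->.
Qed.

Lemma chain_massE : (\int[leb n]_x (w x * Gw x)%:E = Zp%:E)%E. Proof. by case: massP. Qed.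
Lemma chain_mass_ge : bm * Z <= Zp. Proof. by case: massP => _ /andP[]. Qed.
Lemma chain_mass_le : Zp <= bp * Z. Proof. by case: massP => _ /andP[]. Qed.
Lemma chain_mass_gt0 : 0 < Zp. Proof. by apply: lt_le_trans chain_mass_ge; rewrite mulr_gt0. Qed.

(** The reversible density of [chain_kernel]: p x k x y equals w x heat h x y w y divided by the
    mass, which is symmetric. As [w] is the square root of the target and the heat mean of [w] is
    close to [w], this density is close to the target for small h. *)
Definition chain_density x := w x * Gw x / Zp.
Definition chain_kernel x y := heat h x y * w y / Gw x.
Notation p := chain_density.
Notation k := chain_kernel.

Lemma chain_density_gt0 x : 0 < p x.
Proof. by rewrite divr_gt0 ?mulr_gt0 ?heat_mean_gt0 ?chain_mass_gt0. Qed.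

Lemma measurable_chain_density : measurable_fun setT p.
Proof. exact: measurable_funM. Qed.

Lemma chain_density_int : (\int[leb n]_x (p x)%:E = 1)%E.
Proof.
under eq_eint do rewrite /p mulrC.
rewrite (eintZ (leb n) _ mwG wG0) ?invr_ge0 ?(ltW chain_mass_gt0)//.
by rewrite chain_massE -EFinM mulVf// gt_eqF// chain_mass_gt0.
Qed.

Lemma chain_kernel_ge0 x y : 0 <= k x y.
Proof. by rewrite divr_ge0 ?mulr_ge0 ?heat_ge0// ltW// heat_mean_gt0. Qed.

Lemma measurable_chain_kernel : measurable_fun setT (fun z : (E * E)%type => k z.1 z.2).
Proof.
apply: measurable_funM.
  apply: measurable_funM; first by apply: measurable_heat; meas.
  exact: (measurableT_comp mw measurable_snd).
apply: (measurableT_comp (@measurable_invr R)).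
exact: (measurableT_comp measurable_heat_mean measurable_fst).
Qed.

Lemma chain_kernel_int x : (\int[leb n]_y (k x y)%:E = 1)%E.
Proof.
have G0 := heat_mean_gt0 x.
transitivity (\int[leb n]_y ((Gw x)^-1 * (w y * heat h x y))%:E)%E.
  by apply: eq_eint => y; rewrite /k mulrC (mulrC (w y)).
rewrite eintZ; [|by rewrite invr_ge0 ltW|exact: measurable_funM|by move=> y; rewrite mulr_ge0 ?heat_ge0].
by rewrite heat_meanE -EFinM mulVf// gt_eqF.
Qed.

Lemma chain_reversible x y : p x * k x y = p y * k y x.
Proof.
rewrite /p /k (heatC h y x); have := heat_mean_gt0 x; have := heat_mean_gt0 y; have := chain_mass_gt0.
by move=> ? ? ?; field; rewrite !gt_eqF.
Qed.

Let mp := measurable_chain_density.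
Let p0 x : 0 <= p x. Proof. exact: ltW (chain_density_gt0 x). Qed.
Let mk := measurable_chain_kernel.
Let k0 := chain_kernel_ge0.
Let mkx x : measurable_fun setT (k x).
Proof. exact: (measurableT_comp mk (measurable_fun_pair (@measurable_cst _ _ _ _ setT x) (@measurable_id _ _ setT))). Qed.

Section energy.
Variables (g : E -> R) (B : R).
Hypotheses (mg : measurable_fun setT g) (g0 : forall x, 0 <= g x) (gB : forall x, g x <= B).

Let V z := variance (leb n) (k z) g.
Let V0 z : 0 <= V z.
Proof. exact: (variance_ge0 (mkx z) (k0 z) (chain_kernel_int z) mg g0 gB). Qed.
Let VB z : V z <= B ^+ 2.
Proof. exact: (variance_le (mkx z) (k0 z) (chain_kernel_int z) mg g0 gB). Qed.
Let mV : measurable_fun setT V.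
Proof.
have g20 x : 0 <= g x ^+ 2 by exact: sqr_ge0.
apply: measurable_funB; first exact: (measurable_smooth (leb n) mk k0 (measurable_funX _ mg) g20).
by apply: measurable_funX; exact: (measurable_smooth (leb n) mk k0 mg g0).
Qed.

(** Two points drawn from the same z have joint density p z k z x k z y, which is heat h z x heat h
    z y w x w y times w z/Gw z, up to the mass. That quotient is at least 1/bp, and integrating the
    heat kernels over z gives heat (2h) x y. Hence the bandwidth doubles. *)
Lemma chain_energy :
  (\int[leb n]_x \int[leb n]_y ((g x - g y) ^+ 2 * (heat (2 * h) x y * (w x * w y)))%:E <=
   (2 * bp * Zp * mean (leb n) p V)%:E)%E.
Proof.
have bZ : 0 <= bp * Zp by rewrite mulr_ge0 ?ltW// chain_mass_gt0.
pose D (t : (E * E)%type) := (g t.1 - g t.2) ^+ 2.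
have mD : measurable_fun setT D.
  by apply: measurable_funX; apply: measurable_funB; [exact: (measurableT_comp mg measurable_fst)|exact: (measurableT_comp mg measurable_snd)].
have D0 t : 0 <= D t by exact: sqr_ge0.
pose ww (t : (E * E)%type) := w t.1 * w t.2.
have mww : measurable_fun setT ww.
  by apply: measurable_funM; [exact: (measurableT_comp mw measurable_fst)|exact: (measurableT_comp mw measurable_snd)].
have ww0 t : 0 <= ww t by rewrite mulr_ge0.
pose f1 (t : (E * E)%type) z := D t * ww t * (heat h z t.1 * heat h z t.2).
pose f2 (t : (E * E)%type) z := bp * Zp * (p z * (D t * (k z t.1 * k z t.2))).
pose m2 : {sigma_finite_measure set (E * E)%type -> \bar R} := prodm (leb n) (leb n).
have mf1 : measurable_fun setT (fun s => f1 s.1 s.2).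
  apply: measurable_funM; first exact: (measurableT_comp (measurable_funM mD mww) measurable_fst).
  by apply: measurable_funM; apply: measurable_heat; meas.
have mkk (i : (E * E)%type -> E) : measurable_fun setT i ->
    measurable_fun setT (fun s : ((E * E) * E)%type => k s.2 (i s.1)).
  move=> mi; apply: (measurableT_comp (f := fun z : (E * E)%type => k z.1 z.2) mk (g := fun s => (s.2, i s.1))).
  by apply: measurable_fun_pair; [exact: measurable_snd|exact: (measurableT_comp mi measurable_fst)].
have mf2 : measurable_fun setT (fun s => f2 s.1 s.2).
  apply: measurable_funM; first exact: measurable_cst.
  apply: measurable_funM; first exact: (measurableT_comp mp measurable_snd).
  apply: measurable_funM; first exact: (measurableT_comp mD measurable_fst).
  by apply: measurable_funM; apply: mkk; meas.
have f10 t z : 0 <= f1 t z.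
  by apply: mulr_ge0; [exact: mulr_ge0|apply: mulr_ge0; exact: heat_ge0].
have f12 t z : f1 t z <= f2 t z.
  rewrite /f1 /f2 /p /k /ww; have G0 := heat_mean_gt0 z; have q0 := chain_mass_gt0; have wz := w0 z.
  have -> : bp * Zp * (w z * Gw z / Zp * (D t * (heat h z t.1 * w t.1 / Gw z * (heat h z t.2 * w t.2 / Gw z)))) =
    D t * (w t.1 * w t.2) * (heat h z t.1 * heat h z t.2) * (bp * w z / Gw z).
    by field; rewrite !gt_eqF.
  apply: ler_peMr; first exact: f10.
  by rewrite ler_pdivlMr// mul1r.
have f20 t z : 0 <= f2 t z := le_trans (f10 t z) (f12 t z).
have mL : measurable_fun setT (fun z : (E * E)%type => (g z.1 - g z.2) ^+ 2 * (heat (2 * h) z.1 z.2 * (w z.1 * w z.2))).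
  apply: measurable_funM => //; apply: measurable_funM; first by apply: measurable_heat; meas.
  exact: mww.
have L0 x y : 0 <= (g x - g y) ^+ 2 * (heat (2 * h) x y * (w x * w y)).
  by rewrite mulr_ge0 ?sqr_ge0// mulr_ge0 ?heat_ge0// mulr_ge0.
rewrite -(tonelliE (leb n) (leb n) mL L0).
apply: (@le_trans _ _ (\int[m2]_t \int[leb n]_z (f1 t z)%:E)%E).
  apply: eq_lexx; apply: eq_integral => t _.
  have mhh : measurable_fun setT (fun z : E => heat h z t.1 * heat h z t.2).
    by apply: measurable_funM; apply: measurable_heat; meas.
  have hh0 z : 0 <= heat h z t.1 * heat h z t.2 by rewrite mulr_ge0 ?heat_ge0.
  rewrite /f1 (eintZ (leb n) (mulr_ge0 (D0 t) (ww0 t)) mhh hh0).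
  by rewrite heat_semigroup// -EFinM; congr EFin; rewrite /D /ww; ring.
apply: (le_trans (le_eint2 m2 (leb n) mf1 mf2 f10 f12)).
rewrite (tonelli m2 (leb n) mf2 f20).
have -> : 2 * bp * Zp * mean (leb n) p V = bp * Zp * 2 * mean (leb n) p V by ring.
rewrite [leRHS]EFinM -(meanE mp p0 chain_density_int mV V0 VB).
have bZ2 : 0 <= bp * Zp * 2 by rewrite mulr_ge0.
rewrite -(eintZ (leb n) bZ2 (measurable_funM mV mp)); last by move=> z; rewrite mulr_ge0.
apply: eq_lexx; apply: eq_integral => z _.
have mDk : measurable_fun setT (fun t : (E * E)%type => D t * (k z t.1 * k z t.2)).
  apply: measurable_funM => //; apply: measurable_funM.
    exact: (measurableT_comp (mkx z) measurable_fst).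
  exact: (measurableT_comp (mkx z) measurable_snd).
have Dk0 t : 0 <= D t * (k z t.1 * k z t.2) by rewrite mulr_ge0// mulr_ge0.
transitivity ((bp * Zp * p z)%:E * \int[m2]_t (D t * (k z t.1 * k z t.2))%:E)%E.
  rewrite -(eintZ m2 (mulr_ge0 bZ (p0 z)) mDk Dk0).
  by apply: eq_eint => t; rewrite /f2 mulrA.
have -> : (\int[m2]_t (D t * (k z t.1 * k z t.2))%:E = (2 * V z)%:E)%E.
  rewrite -(variance_pair (mkx z) (k0 z) (chain_kernel_int z) mg g0 gB).
  exact: (tonelliE (leb n) (leb n) (f := fun x y => (g x - g y) ^+ 2 * (k z x * k z y)) mDk (fun x y => Dk0 (x, y))).
by rewrite -EFinM; congr EFin; rewrite /=; ring.
Qed.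

(** The mean minimises the quadratic distance to constants, so any c bounds the variance. The rest
    is the comparison of [p] with w^2: p <= bp w^2/Zp, and Z/Zp <= 1/bm. *)
Lemma chain_poincare A c r : 0 <= A -> 0 <= c -> 0 <= r ->
  (\int[leb n]_x ((g x - c) ^+ 2 * w x ^+ 2)%:E <=
   A%:E * \int[leb n]_x \int[leb n]_y ((g x - g y) ^+ 2 * (heat (2 * h) x y * (w x * w y)))%:E +
   (r * Z)%:E)%E ->
  variance (leb n) p g <= 2 * A * bp ^+ 2 * mean (leb n) p V + bp / bm * r.
Proof.
move=> A0 c0 r0 wp; have q0 := chain_mass_gt0.
have mc : measurable_fun setT (fun x => (g x - c) ^+ 2).
  exact: measurable_funX (measurable_funB mg (measurable_cst _)).
have b0 : 0 <= bp / Zp by rewrite divr_ge0 ?ltW.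
have s1 : ((variance (leb n) p g)%:E <= \int[leb n]_x ((g x - c) ^+ 2 * p x)%:E)%E.
  rewrite (mean_sqr_dist mp p0 chain_density_int mg g0 gB c0) lee_fin /variance.
  exact: variance_quad.
have s2 : (\int[leb n]_x ((g x - c) ^+ 2 * p x)%:E <=
    (bp / Zp)%:E * \int[leb n]_x ((g x - c) ^+ 2 * w x ^+ 2)%:E)%E.
  have m1 : measurable_fun setT (fun x => (g x - c) ^+ 2 * w x ^+ 2) by exact: measurable_funM.
  rewrite -(eintZ _ b0 m1); last by move=> x; rewrite mulr_ge0 ?sqr_ge0.
  apply: le_eint.
  - exact: measurable_funM.
  - exact: measurable_funM.
  - by move=> x; rewrite mulr_ge0 ?sqr_ge0.
  move=> x; rewrite [leRHS]mulrCA; apply: ler_wpM2l; first exact: sqr_ge0.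
  rewrite /p mulrAC (_ : bp / Zp * w x ^+ 2 = w x / Zp * (bp * w x)); last by field; rewrite gt_eqF.
  by apply: ler_wpM2l; [rewrite divr_ge0 ?ltW|exact: Gp].
have s3 := lee_wpmul2l (_ : 0 <= A%:E)%E chain_energy.
have {}s3 := s3 ltac:(by rewrite lee_fin).
have s4 : (\int[leb n]_x ((g x - c) ^+ 2 * w x ^+ 2)%:E <= (A * (2 * bp * Zp * mean (leb n) p V) + r * Z)%:E)%E.
  apply: (le_trans wp); rewrite EFinD; apply: leeD; last exact: lexx.
  by rewrite EFinM.
have b0' : (0 <= (bp / Zp)%:E)%E by rewrite lee_fin.
have := le_trans s1 (le_trans s2 (lee_wpmul2l b0' s4)).
rewrite -EFinM lee_fin => s5; apply: (le_trans s5).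
have -> : bp / Zp * (A * (2 * bp * Zp * mean (leb n) p V) + r * Z) =
  2 * A * bp ^+ 2 * mean (leb n) p V + bp * r * (Z / Zp) by field; rewrite gt_eqF.
rewrite lerD2l (_ : bp / bm * r = bp * r * bm^-1); last by ring.
apply: ler_wpM2l; first by rewrite mulr_ge0// ltW.
rewrite -[leRHS]div1r ler_pdivlMr// mulrAC ler_pdivrMr// mul1r mulrC.
exact: chain_mass_ge.
Qed.

End energy.
End heat_chain.

Section decay.
Context {R : realType}.

Lemma powR_inv_expN (a x : R) : 0 < a -> 0 < x -> expR (- (a * ln (x `^ a^-1))) = x^-1.
Proof. by move=> a0 x0; rewrite ln_powR mulrA divff ?gt_eqF// mul1r expRN lnK. Qed.

Section one_chain.
Variables (a C0 : R) (n : nat) (h bm bp Z M q : R).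
Notation E := 'rV[R]_n.
Notation w := (@wgt R n ((a + n%:R / 2) / 2)).
Notation p := (chain_density h w).
Notation k := (chain_kernel h w).
Hypotheses (n0 : (0 < n)%N) (h0 : 0 < h) (h1 : h <= 1) (bm0 : 0 < bm)
  (Gm : forall x, bm * w x <= heat_mean h w x) (Gp : forall x, heat_mean h w x <= bp * w x)
  (bp2 : bp ^+ 2 <= 2) (bpm : bp <= 2 * bm) (Z0 : 0 < Z)
  (EZ : (\int[leb n]_x (wgt (a + n%:R / 2) x)%:E = Z%:E)%E)
  (q2 : 2 <= q) (a0 : 0 < a) (M1 : 1 <= M).

Let b0 : 0 <= a + n%:R / 2. Proof. by rewrite addr_ge0 ?divr_ge0// ltW. Qed.

Lemma wgt_le1 c x : 0 <= c -> @wgt R n c x <= 1.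
Proof.
move=> c0; rewrite -expR0 /wgt ler_expR oppr_le0 mulr_ge0// ln_ge0// lerDl.
exact: dot_ge0.
Qed.

Let mw : measurable_fun setT w. Proof. exact: (measurable_wgt _ (f := id)). Qed.
Let w0 x : 0 < w x. Proof. exact: wgt_gt0. Qed.
Let w1 x : w x <= 1. Proof. by apply: wgt_le1; rewrite divr_ge0. Qed.
Let w2 x : w x ^+ 2 = wgt (a + n%:R / 2) x.
Proof. by rewrite expr2 wgtD; congr (wgt _ x); field. Qed.
Let EZ2 : (\int[leb n]_x (w x ^+ 2)%:E = Z%:E)%E.
Proof. by rewrite -EZ; apply: eq_eint => x; rewrite w2. Qed.

Let mp : measurable_fun setT p.
Proof. exact: (@measurable_chain_density _ _ h w). Qed.
Let p0 x : 0 <= p x. Proof. exact: ltW (chain_density_gt0 mw w0 bm0 Z0 EZ2 Gm Gp x). Qed.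
Let p1 : (\int[leb n]_x (p x)%:E = 1)%E := chain_density_int mw w0 bm0 Z0 EZ2 Gm Gp.
Let mk : measurable_fun setT (fun z : (E * E)%type => k z.1 z.2).
Proof. exact: (@measurable_chain_kernel _ _ h w). Qed.
Let k0 x y : 0 <= k x y. Proof. exact: (chain_kernel_ge0 w0 bm0 Gm). Qed.
Let k1 x : (\int[leb n]_y (k x y)%:E = 1)%E.
Proof. exact: (chain_kernel_int h0 mw w0 w1 bm0 Gm). Qed.
Let rev x y : p x * k x y = p y * k y x.
Proof. exact: (chain_reversible mw w0 bm0 Z0 EZ2 Gm Gp). Qed.

(** Densities relative to [p] with a fixed bound [M]. The class is stable under the chain, so the
    supremum in the remainder of the weak Poincare inequality does not grow. *)
Definition admissible (f : E -> R) := [/\ measurable_fun setT f, (forall x, 0 <= f x),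
  (forall x, f x <= M) & (\int[leb n]_x (f x * p x)%:E = 1)%E].

Lemma smooth_admissible f : admissible f -> admissible (smooth (leb n) k f).
Proof.
move=> [mf f0 fM f1]; split.
- exact: measurable_smooth.
- exact: (smooth_ge0 mk k0 k1 mf f0 fM).
- exact: (smooth_le mk k0 k1 mf f0 fM).
- exact: (smooth_density mp p0 mk k0 k1 rev mf f0 fM f1).
Qed.

Lemma iter_admissible j f : admissible f -> admissible (iter j (smooth (leb n) k) f).
Proof. by move=> af; elim: j => //= j IH; exact: smooth_admissible. Qed.

Lemma renyi_mean_ge0 f : admissible f -> 0 <= renyi_mean (leb n) p q f.
Proof.
move=> [mf f0 fM f1]; have := mean_pow_ge1 mp p0 p1 q2 mf f0 fM f1 => F1.
by rewrite /renyi_mean divr_ge0 ?ln_ge0//; move: q2; lra.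
Qed.

Hypotheses (C00 : 0 < C0)
  (wp : forall (U B : R) (g : E -> R), 0 <= U ->
  1024 * n%:R ^+ 2 * (2 * h * expR U) <= 1 -> measurable_fun setT g ->
  (forall x, 0 <= g x) -> (forall x, g x <= B) ->
  exists2 c : R, 0 <= c &
  (\int[leb n]_x ((g x - c) ^+ 2 * wgt (a + n%:R / 2) x)%:E <=
   (C0 * n%:R * expR U / (2 * h))%:E * \int[leb n]_x \int[leb n]_z
      ((g x - g z) ^+ 2 * (heat (2 * h) x z * (w x * w z)))%:E +
   (C0 * B ^+ 2 * expR (- (a * U)) * Z)%:E)%E).

Notation C := (C0 + 1).

(** The gain per step at truncation level D = e^U: the inverse of a bound 2 C n D/h for the Poincare
    constant of the chain, divided by q - 1. *)
Definition chain_rate D := h / (2 * C * n%:R * D) / (q - 1).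

Lemma chain_rate01 D : 1 <= D -> 0 <= chain_rate D <= 1.
Proof.
move=> D1; have np : 1 <= n%:R :> R by rewrite ler1n.
have q1 : 1 <= q - 1 by move: q2; lra.
have CnD : 1 <= C * n%:R * D by rewrite !mulr_ege1//; move: C00; lra.
rewrite /chain_rate; apply/andP; split.
  by rewrite !divr_ge0//; move: h0 CnD q1; [move=> *; exact: ltW|rewrite -!mulrA => *; lra|lra].
rewrite ler_pdivrMr; last lra.
rewrite ler_pdivrMr; last by rewrite -!mulrA mulr_gt0// mulrA; lra.
apply: (le_trans h1); rewrite -[leLHS]mulr1 mul1r -!mulrA [C * (_ * _)]mulrA.
by have := mulr_ege1 q1 CnD; lra.
Qed.

(** [weak_poincare] at U = ln D for f^(q/2), which is bounded by M^(q/2), leaves a remainder of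
    order M^q D^(-a); [chain_poincare] and [renyi_step] turn this into one step of the recursion. *)
Lemma admissible_step D f : 1 <= D -> 1024 * n%:R ^+ 2 * (2 * h * D) <= 1 -> admissible f ->
  renyi_mean (leb n) p q (smooth (leb n) k f) <= renyi_mean (leb n) p q f -
    chain_rate D * (Num.min (renyi_mean (leb n) p q f) 1 / 2 -
      2 * C * M `^ q * expR (- (a * ln D))).
Proof.
move=> D1 small [mf f0 fM f1].
have D0 : 0 < D by apply: lt_le_trans D1.
have M0 : 0 <= M by apply: le_trans M1.
pose g x := f x `^ (q / 2).
have mg : measurable_fun setT g by exact: measurable_powRf.
have g0 x : 0 <= g x by exact: powR_ge0.
have gB x : g x <= M `^ (q / 2).
  have x0 := f0 x; have xM := fM x; have qh : 0 <= q / 2 by move: q2; lra.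
  by apply: ge0_ler_powR; rewrite ?nnegrE.
have B2 : (M `^ (q / 2)) ^+ 2 = M `^ q.
  by rewrite -powR_mulrn ?powR_ge0// -powRrM; congr powR; field.
have U0 : 0 <= ln D by exact: ln_ge0.
have small' : 1024 * n%:R ^+ 2 * (2 * h * expR (ln D)) <= 1 by rewrite lnK.
have [c c0] := wp U0 small' mg g0 gB.
rewrite B2 lnK// => wpc.
set r0 := C0 * M `^ q * expR (- (a * ln D)) in wpc.
have r00 : 0 <= r0 by rewrite !mulr_ge0 ?powR_ge0 ?expR_ge0// ltW.
have A0 : 0 <= C0 * n%:R * D / (2 * h).
  by rewrite divr_ge0 ?mulr_ge0// ltW.
have wpc' : (\int[leb n]_x ((g x - c) ^+ 2 * w x ^+ 2)%:E <=
   (C0 * n%:R * D / (2 * h))%:E * \int[leb n]_x \int[leb n]_y ((g x - g y) ^+ 2 * (heat (2 * h) x y * (w x * w y)))%:E +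
   (r0 * Z)%:E)%E.
  by apply: le_trans wpc; apply: eq_lexx; apply: eq_eint => x; rewrite w2.
have := chain_poincare h0 mw w0 w1 bm0 Z0 EZ2 Gm Gp mg g0 gB A0 c0 r00 wpc'.
set V := mean (leb n) p _ => vle.
have V0 : 0 <= V.
  exact: (mean_ge0 mp p0 p1 (measurable_local_var (leb n) mk k0 q mf) (local_var_ge0 mk k0 k1 q2 mf f0 fM) (local_var_le mk k0 k1 q2 mf f0 fM)).
pose r := 2 * C * M `^ q * expR (- (a * ln D)).
have np : 1 <= n%:R :> R by rewrite ler1n.
have n00 : 0 < n%:R :> R by lra.
have rr : bp / bm * r0 <= r.
  apply: (@le_trans _ _ (2 * r0)).
    by rewrite ler_wpM2r// ler_pdivrMr.
  rewrite /r /r0 -!mulrA ler_wpM2l// ler_wpM2r ?mulr_ge0 ?powR_ge0 ?expR_ge0//; lra.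
have r0' : 0 <= r by rewrite /r !mulr_ge0 ?powR_ge0 ?expR_ge0//; move: C00; lra.
pose gm := h / (2 * C * n%:R * D).
have C1 : 0 < C by move: C00; lra.
have gm0 : 0 <= gm by rewrite divr_ge0 ?mulr_ge0 ?ltW.
apply: (renyi_step mp p0 p1 mk k0 k1 rev q2 mf f0 fM f1 gm0 r0').
rewrite -/V; apply: (@le_trans _ _ (gm * (2 * (C0 * n%:R * D / (2 * h)) * bp ^+ 2 * V))).
  by apply: ler_wpM2l => //; move: vle rr; rewrite -/g; move: (variance _ _ _) => v; lra.
have -> : gm * (2 * (C0 * n%:R * D / (2 * h)) * bp ^+ 2 * V) = bp ^+ 2 / 2 * (C0 / C) * V.
  by rewrite /gm; field; rewrite !gt_eqF.
rewrite -[leRHS]mul1r; apply: ler_wpM2r => //.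
have y0 : 0 <= bp ^+ 2 / 2 by rewrite divr_ge0// sqr_ge0.
have y1 : bp ^+ 2 / 2 <= 1 by rewrite ler_pdivrMr// mul1r.
have z0 : 0 <= C0 / C by rewrite divr_ge0 ?ltW.
have z1 : C0 / C <= 1 by rewrite ler_pdivrMr// mul1r lerDl.
exact: mulr_ile1.
Qed.

(** The level [D1] makes the remainder 2 C M^q D^(-a) equal to 1/4, and [D2] makes it e/4. The
    coarser level has the faster rate and is enough to come below 1. *)
Lemma two_phase_decay e k1' k2' f : 0 < e <= 1 -> admissible f ->
  let D1 := (8 * C * M `^ q) `^ a^-1 in let D2 := (8 * C * M `^ q / e) `^ a^-1 in
  1024 * n%:R ^+ 2 * (2 * h * D2) <= 1 ->
  8 * C * n%:R * D1 * (q - 1) * renyi_mean (leb n) p q f <= k1'%:R * h ->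
  4 * C * n%:R * D2 * (q - 1) * ln (2 / e) <= k2'%:R * h ->
  renyi_mean (leb n) p q (iter (k2' + k1') (smooth (leb n) k) f) <= e.
Proof.
move=> /andP[e0 e1] af D1 D2 small hk1 hk2.
have C1 : 1 <= C by move: C00; lra.
have Mq : 1 <= M `^ q.
  by rewrite -(powRr0 M); apply: ler_powR => //; move: q2; lra.
have x1 : 1 <= 8 * C * M `^ q by rewrite !mulr_ege1//; lra.
have x12 : 8 * C * M `^ q <= 8 * C * M `^ q / e.
  by rewrite ler_pdivlMr// ler_piMr//; lra.
have x2 : 1 <= 8 * C * M `^ q / e := le_trans x1 x12.
have ia : 0 <= a^-1 by rewrite invr_ge0 ltW.
have D11 : 1 <= D1 by rewrite -(powRr0 (8 * C * M `^ q)); apply: ler_powR.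
have D12 : D1 <= D2 by apply: ge0_ler_powR; rewrite ?nnegrE//; lra.
have D21 : 1 <= D2 := le_trans D11 D12.
have small1 : 1024 * n%:R ^+ 2 * (2 * h * D1) <= 1.
  exact: (mul3_le1 (mulr_ge0 (ler0n R 1024) (sqr_ge0 _)) (mulr_ge0 (ler0n R 2) (ltW h0)) D12 small).
have X0 : 0 < 8 * C * M `^ q by lra.
have q10 : 0 < q - 1 by move: q2; lra.
have np : 0 < n%:R :> R by rewrite ltr0n.
have C0' : 0 < C by lra.
have D10 : 0 < D1 by lra. have D20 : 0 < D2 by lra.
have Mq0 : 0 < M `^ q by lra.
pose t j := renyi_mean (leb n) p q (iter j (smooth (leb n) k) f).
have t0 j : 0 <= t j by apply: renyi_mean_ge0; exact: iter_admissible.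
have s1 j : t j.+1 <= t j - chain_rate D1 * (Num.min (t j) 1 / 2 - 4^-1).
  have := admissible_step D11 small1 (iter_admissible j af).
  rewrite powR_inv_expN// (_ : 2 * C * M `^ q * (8 * C * M `^ q)^-1 = 4^-1)//.
  by field; rewrite !gt_eqF.
have p1e : t k1' <= 1.
  apply: (le_trans (linear_phase (chain_rate01 D11) s1 t0 k1')).
  rewrite ge_max lexx/= lerBlDr; apply: ler_wpDl; first exact: ler01.
  rewrite [t 0%N]/(t 0%N) /= /chain_rate.
  rewrite (_ : k1'%:R * _ = k1'%:R * h / (8 * C * n%:R * D1 * (q - 1))).
    by rewrite ler_pdivlMr ?mulr_gt0// mulrC.
  by field; rewrite !gt_eqF.
have s2 j : t (j.+1 + k1')%N <= t (j + k1')%N - chain_rate D2 * (Num.min (t (j + k1')%N) 1 / 2 - e / 4).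
  have := admissible_step D21 small (iter_admissible (j + k1') af).
  rewrite powR_inv_expN ?divr_gt0// (_ : 2 * C * M `^ q * (8 * C * M `^ q / e)^-1 = e / 4)//.
  by field; rewrite !gt_eqF.
have e01 : 0 <= e <= 1 by rewrite (ltW e0).
have [_ h3] := geometric_phase (t := fun j => t (j + k1')%N) (chain_rate01 D21) e01 s2 p1e k2'.
apply: (le_trans h3).
rewrite [leRHS]splitr lerD2r.
apply: geometric_le => //; first exact: chain_rate01.
rewrite /chain_rate (_ : k2'%:R * _ = k2'%:R * h / (4 * C * n%:R * D2 * (q - 1))).
  by rewrite ler_pdivlMr ?mulr_gt0// mulrC.
by field; rewrite !gt_eqF.
Qed.

End one_chain.
End decay.

(** * Gaussian integrals of quadratic exponentials, and the heat flow of the weight *)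

Section gaussian_quadratic.
Context {R : realType} {n : nat}.
Notation E := 'rV[R]_n.

Lemma expR_inv1B (u : R) : 0 <= u <= 2^-1 -> (1 - u)^-1 <= expR (2 * u).
Proof.
move=> /andP[u0 u1]; rewrite -[leLHS]div1r ler_pdivrMr; last lra.
have := expR_ge1Dx (2 * u) => e.
have h : (1 + 2 * u) * (1 - u) <= expR (2 * u) * (1 - u) by rewrite ler_wpM2r//; lra.
have h2 : 0 <= u * (1 - 2 * u) by rewrite mulr_ge0//; lra.
lra.
Qed.

Let gam_quadE (s s' : R) (b z : E) : gam s z * expR (dot b z + (s - s') * dot z z) =
  Num.sqrt (s / pi) ^+ n * expR (- (s' * dot z z) + dot b z).
Proof. by rewrite /gam -mulrA -expRD; congr (_ * expR _); ring. Qed.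

Let gam_quad_int (s s' : R) (b : E) : 0 < s -> 0 < s' ->
  (\int[leb n]_z (gam s z * expR (dot b z + (s - s') * dot z z))%:E =
   (Num.sqrt (s / s') ^+ n * expR (dot b b / (4 * s')))%:E)%E.
Proof.
move=> s0 s'0; have p0 := @pi_gt0 R.
under eq_eint do rewrite gam_quadE.
have m1 : measurable_fun setT (fun z : E => expR (- (s' * dot z z) + dot b z)).
  apply: (measurableT_comp (@measurable_expR _)); apply: measurable_funD.
    by apply: measurableT_comp => //; apply: measurable_funM => //; apply: measurable_dot; meas.
  by apply: measurable_dot; meas.
rewrite (eintZ (leb n) (exprn_ge0 n (sqrtr_ge0 _)) m1); last by move=> z; exact: expR_ge0.
rewrite gauss_lin// -EFinM mulrA -exprMn -sqrtrM; last by rewrite divr_ge0 ?ltW.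
congr (Num.sqrt _ ^+ _ * _)%:E; move: (@pi R) p0 => p p0; field; rewrite !gt_eqF//.
Qed.

(** The integral is explicit, with s' = 1/(4h) - kp in place of s = 1/(4h); the condition 8 h kp <=
    1 keeps s' above s/2. *)
Lemma gam_quad (h kp : R) (b : E) : 0 < h -> 0 <= kp -> 8 * h * kp <= 1 ->
  (\int[leb n]_z (gam (4 * h)^-1 z * expR (dot b z + kp * dot z z))%:E <=
   (expR (4 * n%:R * h * kp + 2 * h * dot b b))%:E)%E.
Proof.
move=> h0 kp0 hk; have s0 : 0 < (4 * h)^-1 by rewrite invr_gt0 mulr_gt0.
pose u := 4 * h * kp; have u0 : 0 <= u by rewrite !mulr_ge0// ltW.
have u1 : u <= 2^-1 by rewrite /u; lra.
have sE : (4 * h)^-1 - kp = (4 * h)^-1 * (1 - u) by rewrite /u; field; rewrite gt_eqF.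
have s'0 : 0 < (4 * h)^-1 - kp by rewrite sE mulr_gt0//; lra.
have := gam_quad_int b s0 s'0; rewrite (_ : (4 * h)^-1 - ((4 * h)^-1 - kp) = kp); last by ring.
move=> ->; rewrite lee_fin expRD; apply: ler_pM; rewrite ?expR_ge0 ?exprn_ge0 ?sqrtr_ge0//.
  rewrite (_ : 4 * n%:R * h * kp = n%:R * u); last by rewrite /u; ring.
  rewrite expRM_natl; apply: lerXn2r; rewrite ?nnegrE ?sqrtr_ge0 ?expR_ge0//.
  rewrite -(@ler_pXn2r _ 2)// ?nnegrE ?sqrtr_ge0 ?expR_ge0// sqr_sqrtr ?divr_ge0 ?(ltW s0) ?(ltW s'0)//.
  rewrite sE -expRM_natl (_ : (4 * h)^-1 / ((4 * h)^-1 * (1 - u)) = (1 - u)^-1).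
    by apply: expR_inv1B; rewrite u0.
  by field; rewrite !gt_eqF//; lra.
rewrite ler_expR sE (_ : dot b b / (4 * ((4 * h)^-1 * (1 - u))) = h * dot b b * (1 - u)^-1); last first.
  by field; rewrite !gt_eqF//; lra.
rewrite (_ : 2 * h * dot b b = h * dot b b * 2); last by ring.
rewrite ler_wpM2l ?mulr_ge0 ?dot_ge0 ?(ltW h0)//.
rewrite -[leLHS]div1r ler_pdivrMr; lra.
Qed.

Lemma gam_quad_lower (h kp : R) (b : E) : 0 < h -> 0 <= kp ->
  ((expR (- (2 * n%:R * h * kp)))%:E <=
   \int[leb n]_z (gam (4 * h)^-1 z * expR (dot b z - kp * dot z z))%:E)%E.
Proof.
move=> h0 kp0; have s0 : 0 < (4 * h)^-1 by rewrite invr_gt0 mulr_gt0.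
have s'0 : 0 < (4 * h)^-1 + kp by rewrite ltr_wpDr.
have := gam_quad_int b s0 s'0; rewrite (_ : (4 * h)^-1 - ((4 * h)^-1 + kp) = - kp); last by ring.
under eq_eint do rewrite mulNr.
move=> ->; rewrite lee_fin -[leLHS]mulr1; apply: ler_pM; [exact: expR_ge0|exact: ler01| |].
  rewrite (_ : - (2 * n%:R * h * kp) = n%:R * - (2 * h * kp)); last by ring.
  rewrite expRM_natl; apply: lerXn2r; rewrite ?nnegrE ?sqrtr_ge0 ?expR_ge0//.
  rewrite -(@ler_pXn2r _ 2)// ?nnegrE ?sqrtr_ge0 ?expR_ge0// sqr_sqrtr ?divr_ge0 ?(ltW s0) ?(ltW s'0)//.
  rewrite -expRM_natl (_ : 2 * - (2 * h * kp) = - (4 * h * kp)); last by ring.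
  rewrite (_ : (4 * h)^-1 / ((4 * h)^-1 + kp) = (1 + 4 * h * kp)^-1); last first.
    field; rewrite !gt_eqF//= ?ltr_wpDr ?mulr_ge0 ?(ltW h0)//.
  rewrite expRN lef_pV2 ?posrE ?expR_gt0 ?expR_ge1Dx// ltr_wpDr ?mulr_ge0 ?(ltW h0)//.
by rewrite -[leLHS]expR0 ler_expR divr_ge0 ?dot_ge0 ?mulr_ge0 ?(ltW s'0).
Qed.

End gaussian_quadratic.

Section log_potential.
Context {R : realType} {n : nat}.
Notation E := 'rV[R]_n.
Implicit Types x y z : E.

Lemma ln_le_sub1 (t : R) : 0 < t -> ln t <= t - 1.
Proof.
by move=> t0; have := @le_ln1Dx R (t - 1); rewrite (_ : 1 + (t - 1) = t); [apply; lra|ring].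
Qed.

Lemma ln_dot_upper x z : ln (1 + dot (x + z) (x + z)) <=
  ln (1 + dot x x) + (2 * dot x z + dot z z) / (1 + dot x x).
Proof.
have P0 := dot1_gt0 x; have Q0 := dot1_gt0 (x + z).
have q0 : 0 < (1 + dot (x + z) (x + z)) / (1 + dot x x) by rewrite divr_gt0.
rewrite -lerBlDl -ln_div ?posrE//; apply: (le_trans (ln_le_sub1 q0)).
apply: eq_lexx; rewrite !dotE (dotC z x); field; rewrite gt_eqF//.
Qed.

(** As for the upper bound, ln t <= t - 1, now for the inverse ratio. Once denominators are cleared
    the claim is polynomial and follows from Cauchy-Schwarz for x and z. *)
Lemma ln_dot_lower x z : ln (1 + dot x x) + 2 * dot x z / (1 + dot x x) - 8 * dot z z <=
  ln (1 + dot (x + z) (x + z)).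
Proof.
have P0 := dot1_gt0 x; have Q0 := dot1_gt0 (x + z).
have q0 : 0 < (1 + dot x x) / (1 + dot (x + z) (x + z)) by rewrite divr_gt0.
have := ln_le_sub1 q0; rewrite ln_div ?posrE// => h.
suff : (1 + dot x x) / (1 + dot (x + z) (x + z)) - 1 <= 8 * dot z z - 2 * dot x z / (1 + dot x x) by lra.
have QE : dot (x + z) (x + z) = dot x x + 2 * dot x z + dot z z.
  by rewrite !dotE (dotC z x); ring.
have c := dot_cauchy x z; have A0 := dot_ge0 x; have B0 := dot_ge0 z.
have Qd0 := dot_ge0 (x + z).
move: P0 Q0 Qd0 QE c A0 B0; clear.
move: (dot (x + z) (x + z)) (dot x x) (dot z z) (dot x z) => Qd A B s P0 Q0 Qd0 QE c A0 B0.
rewrite -subr_ge0.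
have -> : 8 * B - 2 * s / (1 + A) - ((1 + A) / (1 + Qd) - 1) =
  (8 * B * ((1 + A) * (1 + Qd)) - 2 * s * (1 + Qd) - (1 + A) * (A - Qd)) / ((1 + A) * (1 + Qd)).
  by field; rewrite !gt_eqF.
apply: divr_ge0; last by rewrite mulr_ge0// ltW.
have h1 : 0 <= B * (A * Qd) by rewrite !mulr_ge0.
have h2 : 0 <= B * A by rewrite mulr_ge0.
have h3 : 0 <= B * Qd by rewrite mulr_ge0.
have h4 : 2 * s * B <= (Qd - A) * B by rewrite ler_wpM2r//; lra.
have -> : 8 * B * ((1 + A) * (1 + Qd)) - 2 * s * (1 + Qd) - (1 + A) * (A - Qd) =
   8 * (B + B * A + B * Qd + B * (A * Qd)) - 4 * s ^+ 2 - 2 * s * B + (B + B * A).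
  by rewrite QE; ring.
move: h1 h2 h3 h4 c; rewrite [A * B]mulrC; lra.
Qed.

(* The inversion-like map [u / (1 + |u|^2)] is 1-Lipschitz. *)
Lemma student_drift_lipschitz x y :
  dot ((1 + dot x x)^-1 *: x - (1 + dot y y)^-1 *: y) ((1 + dot x x)^-1 *: x - (1 + dot y y)^-1 *: y) <=
  dot (x - y) (x - y).
Proof.
have P0 := dot1_gt0 x; have Q0 := dot1_gt0 y; have d0 := dot_ge0 (x - y).
have A0 := dot_ge0 x; have B0 := dot_ge0 y.
have UW : 1 <= (1 + dot x x) * (1 + dot y y) by rewrite mulr_ege1//; lra.
have -> : dot ((1 + dot x x)^-1 *: x - (1 + dot y y)^-1 *: y) ((1 + dot x x)^-1 *: x - (1 + dot y y)^-1 *: y) =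
  dot (x - y) (x - y) / ((1 + dot x x) * (1 + dot y y)) - ((1 + dot x x)^-1 - (1 + dot y y)^-1) ^+ 2.
  by rewrite !dotE (dotC y x); field; rewrite !gt_eqF.
apply: (@le_trans _ _ (dot (x - y) (x - y) / ((1 + dot x x) * (1 + dot y y)))).
  by rewrite gerBl sqr_ge0.
by rewrite ler_pdivrMr ?mulr_gt0// ler_peMr.
Qed.

Lemma student_drift_norm x : dot ((1 + dot x x)^-1 *: x) ((1 + dot x x)^-1 *: x) <= 4^-1.
Proof.
have P0 := dot1_gt0 x; rewrite !dotE.
have -> : (1 + dot x x)^-1 * ((1 + dot x x)^-1 * dot x x) = dot x x / (1 + dot x x) ^+ 2.
  by field; rewrite gt_eqF.
rewrite ler_pdivrMr ?exprn_gt0//; have := sqr_ge0 (1 - dot x x); lra.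
Qed.

Variables (c h : R).
Hypotheses (c0 : 0 <= c) (h0 : 0 < h).

Let heat_meanT x : ((heat_mean h (@wgt R n c) x)%:E =
  \int[leb n]_z (gam (4 * h)^-1 z * wgt c (x + z))%:E)%E.
Proof.
have mw : measurable_fun setT (@wgt R n c) by exact: (measurable_wgt _ (f := id)).
rewrite -heat_translation//; last exact: wgt_ge0.
rewrite -(heat_meanE h0 mw (wgt_gt0 c)); last by move=> y; apply: wgt_le1.
by apply: eq_eint => y; rewrite mulrC.
Qed.

(** [ln_dot_lower] bounds w(x + z)/w(x) by the exponential of a linear form plus 8c|z|^2, which
    [gam_quad] integrates; the linear form has bounded norm by [student_drift_norm]. The lower bound
    below uses [ln_dot_upper] in the same way. *)
Lemma heat_mean_wgt_le x : 64 * h * c <= 1 ->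
  heat_mean h (@wgt R n c) x <= expR (32 * n%:R * h * c + 2 * h * c ^+ 2) * wgt c x.
Proof.
move=> hc; rewrite -lee_fin heat_meanT.
pose b := - (2 * c) *: ((1 + dot x x)^-1 *: x).
have m1 : measurable_fun setT (fun z : E => gam (4 * h)^-1 z * expR (dot b z + 8 * c * dot z z)).
  apply: measurable_funM; first by apply: measurable_gam; meas.
  apply: (measurableT_comp (@measurable_expR _)); apply: measurable_funD; first by apply: measurable_dot; meas.
  by apply: measurable_funM => //; apply: measurable_dot; meas.
have p1 z : 0 <= gam (4 * h)^-1 z * expR (dot b z + 8 * c * dot z z) by rewrite mulr_ge0 ?gam_ge0 ?expR_ge0.
apply: (@le_trans _ _ ((wgt c x)%:E * \int[leb n]_z (gam (4 * h)^-1 z * expR (dot b z + 8 * c * dot z z))%:E)%E).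
  rewrite -(eintZ (leb n) (wgt_ge0 c x) m1 p1).
  apply: le_eint.
  - apply: measurable_funM; first by apply: measurable_gam; meas.
    by apply: measurable_wgt; apply: measurable_rvD; meas.
  - exact: measurable_funM.
  - by move=> z; rewrite mulr_ge0 ?gam_ge0 ?wgt_ge0.
  move=> z; rewrite mulrCA; apply: ler_wpM2l; first exact: gam_ge0.
  rewrite /wgt -expRD ler_expR; have := ler_wpM2l c0 (ln_dot_lower x z).
  rewrite /b !dotE (_ : - (2 * c) * ((1 + dot x x)^-1 * dot x z) = - c * (2 * dot x z / (1 + dot x x))); last first.
    by field; rewrite gt_eqF// dot1_gt0.
  lra.
rewrite [X in (_ <= X%:E)%E]mulrC [leRHS]EFinM; apply: lee_wpmul2l; first by rewrite lee_fin wgt_ge0.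
have k0 : 0 <= 8 * c by rewrite mulr_ge0.
have k1 : 8 * h * (8 * c) <= 1 by lra.
apply: (le_trans (gam_quad b h0 k0 k1)); rewrite lee_fin ler_expR.
have -> : 4 * n%:R * h * (8 * c) = 32 * n%:R * h * c by ring.
rewrite lerD2l /b; move: ((1 + dot x x)^-1 *: x) (student_drift_norm x) => v vn.
have k8 : 0 <= 8 * h * c ^+ 2 by rewrite !mulr_ge0 ?sqr_ge0// ltW.
by rewrite dotZl dotZr; have := ler_wpM2l k8 vn; lra.
Qed.

Lemma heat_mean_wgt_ge x :
  expR (- (2 * n%:R * h * c)) * wgt c x <= heat_mean h (@wgt R n c) x.
Proof.
rewrite -lee_fin heat_meanT.
pose b := - (2 * c) *: ((1 + dot x x)^-1 *: x).
have P0 := dot1_gt0 x; have A0 := dot_ge0 x.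
pose kp := c / (1 + dot x x); have k0 : 0 <= kp by rewrite divr_ge0// ltW.
have kc : kp <= c by rewrite ler_pdivrMr// ler_peMr//; lra.
have m1 : measurable_fun setT (fun z : E => gam (4 * h)^-1 z * expR (dot b z - kp * dot z z)).
  apply: measurable_funM; first by apply: measurable_gam; meas.
  apply: (measurableT_comp (@measurable_expR _)); apply: measurable_funB; first by apply: measurable_dot; meas.
  by apply: measurable_funM => //; apply: measurable_dot; meas.
have p1 z : 0 <= gam (4 * h)^-1 z * expR (dot b z - kp * dot z z) by rewrite mulr_ge0 ?gam_ge0 ?expR_ge0.
apply: (@le_trans _ _ ((wgt c x)%:E * \int[leb n]_z (gam (4 * h)^-1 z * expR (dot b z - kp * dot z z))%:E)%E).
  rewrite mulrC EFinM; apply: lee_wpmul2l; first by rewrite lee_fin wgt_ge0.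
  apply: le_trans (gam_quad_lower b h0 k0); rewrite lee_fin ler_expR lerN2.
  by rewrite ler_wpM2l ?mulr_ge0 ?(ltW h0).
rewrite -(eintZ (leb n) (wgt_ge0 c x) m1 p1).
apply: le_eint.
- exact: measurable_funM.
- apply: measurable_funM; first by apply: measurable_gam; meas.
  by apply: measurable_wgt; apply: measurable_rvD; meas.
- by move=> z; rewrite mulr_ge0 ?wgt_ge0.
move=> z; rewrite mulrCA; apply: ler_wpM2l; first exact: gam_ge0.
rewrite /wgt -expRD ler_expR; have := ler_wpM2l c0 (ln_dot_upper x z).
rewrite /b /kp !dotE.
have -> : - (2 * c) * ((1 + dot x x)^-1 * dot x z) - c / (1 + dot x x) * dot z z =
  - (c * ((2 * dot x z + dot z z) / (1 + dot x x))) by field; rewrite gt_eqF.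
move: (ln _) (ln _) (_ / _) => l1 l2 t; lra.
Qed.

End log_potential.

(** * Comparison of the LMC kernel with the chain kernel *)

Section pair_moment.
Context {R : realType} {n : nat}.
Notation E := 'rV[R]_n.

Lemma pi_le4 : pi <= 4 :> R.
Proof. by have := @pihalf_lt2 R; lra. Qed.

Variables (A c h : R) (g : E -> R) (m : E -> E).
Hypotheses (n0 : (0 < n)%N) (A1 : 1 <= A) (c0 : 0 < c) (h0 : 0 < h)
  (hc2 : h * c ^+ 2 <= 1) (hAc : 40 * h * A * c <= 1) (mg : measurable_fun setT g)
  (gT : forall z t, g z - g (z + t)%R <= - dot (m z) t + 8 * c * dot t t)
  (mB : forall z, dot (m z) (m z) <= 8 * c ^+ 2 * dot z z + 32 * c ^+ 4 * h ^+ 2).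

Let A0 : 0 < A. Proof. exact: lt_le_trans A1. Qed.
Let hc0 : 0 < h * c. Proof. by rewrite mulr_gt0. Qed.
Let hc1 : 40 * (h * c) <= 1.
Proof. by have := ler_wpM2r (ltW hc0) A1; move: hAc; lra. Qed.

(** A finite mesh suffices: the second-order terms of the N rotation steps add up to order 1/N, and
    N is taken so large that 1/N <= hc. *)
Let mesh : exists (N : nat) (th : R), [/\ (0 < N)%N /\ th = pi / (2 * N%:R), 0 < th <= 1,
  th <= 2 / N%:R, N%:R^-1 <= h * c & 0 < sin th].
Proof.
have [N hN] : exists N : nat, (h * c)^-1 <= N%:R.
  exists (Num.bound (h * c)^-1); apply: ltW; apply: le_lt_trans (archi_boundP _) => //.
  by rewrite invr_ge0 ltW.
have N40 : 40 <= N%:R :> R.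
  apply: le_trans hN; rewrite -[leRHS]div1r ler_pdivlMr//.
have Np : 0 < N%:R :> R by lra.
have p4 := pi_le4; have p0 := @pi_gt0 R.
have th0 : 0 < pi / (2 * N%:R) :> R by rewrite divr_gt0// mulr_gt0.
have th2 : pi / (2 * N%:R) <= 2 / N%:R :> R.
  rewrite ler_pdivrMr ?mulr_gt0// (_ : 2 / N%:R * (2 * N%:R) = 4)//; field; by rewrite gt_eqF.
have th1 : pi / (2 * N%:R) <= 1 :> R.
  by apply: (le_trans th2); rewrite ler_pdivrMr// mul1r; lra.
exists N, (pi / (2 * N%:R)); split=> //; first by rewrite -(ltr0n R).
- by rewrite th0.
- by rewrite -[h * c]invrK lef_pV2 ?posrE ?invr_gt0.
- apply: sin_gt0_pi; rewrite th0/=; apply: (le_lt_trans th1).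
  by apply: lt_le_trans (@pi_ge2 R); rewrite ltr1n.
Qed.

Lemma exp_subgradient (a u : R) : exists l, forall v, expR (a * u) + l * (v - u) <= expR (a * v).
Proof.
exists (a * expR (a * u)) => v; have := expR_ge1Dx (a * (v - u)).
rewrite -(ler_pM2l (expR_gt0 (a * u))) -expRD (_ : a * u + a * (v - u) = a * v); last by ring.
lra.
Qed.

Lemma dot_add_le (x y : E) : dot (x + y) (x + y) <= 2 * dot x x + 2 * dot y y.
Proof. by have := dot_ge0 (x - y); rewrite !dotE (dotC y x); lra. Qed.

(** The Taylor bound [gT] for one rotated increment t = -(1 - cos th) z + y. Since 1 - cos th <=
    2/N^2, its contributions are absorbed into |z|^2, leaving a linear and a quadratic term in y. *)
Let exponent (N : nat) (th : R) (z y : E) : (0 < N)%N -> 0 < th <= 1 -> th <= 2 / N%:R ->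
  N%:R^-1 <= h * c ->
  A * (N%:R * (g z - g (cos th *: z + y)%R)) <=
  (70 * A * h * c ^+ 2 * dot z z + 16 * A * c ^+ 4 * h ^+ 3) +
  (dot (- (A * N%:R) *: m z) y + 16 * A * N%:R * c * dot y y).
Proof.
move=> N0 /andP[th0 th1] thN Nhc; have Np : 0 < N%:R :> R by rewrite ltr0n.
pose k := 1 - cos th.
have k0 : 0 <= k by rewrite subr_ge0 cos_le1.
have Nr : 0 < N%:R^-1 :> R by rewrite invr_gt0.
have N1 : N%:R^-1 <= 1 :> R by rewrite invf_le1// ler1n.
have k2 : k <= 2 * N%:R^-1 ^+ 2.
  have := @cos_ge R th; rewrite (ltW th0) th1 => /(_ isT) => ct.
  have : th ^+ 2 <= (2 / N%:R) ^+ 2 by rewrite ler_sqr ?nnegrE ?divr_ge0// ltW.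
  by rewrite exprMn /k; lra.
have Nk : N%:R * k <= 2 * (h * c).
  have := ler_wpM2l (ltW Np) k2; rewrite (_ : N%:R * (2 * N%:R^-1 ^+ 2) = 2 * N%:R^-1); first lra.
  by field; rewrite gt_eqF.
have Nkk : N%:R * k ^+ 2 <= 4 * (h * c).
  have k2' : k <= 2.
    have : N%:R^-1 ^+ 2 <= 1 :> R by apply: exprn_ile1 => //; exact: ltW.
    lra.
  have := ler_wpM2l (mulr_ge0 (ltW Np) k0) k2'; rewrite expr2; lra.
have -> : cos th *: z + y = z + (- k *: z + y).
  by rewrite addrA /k opprB scalerBl scale1r addrC [z + (_ - _)]addrC subrK addrC.
have ANp : 0 <= A * N%:R by rewrite mulr_ge0 ?ltW.
have h1 := ler_wpM2l ANp (gT z (- k *: z + y)); rewrite [leLHS]mulrA; apply: (le_trans h1).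
have d1 := dot_add_le (- k *: z) y.
rewrite [dot (- k *: z) _]dotZl [dot z (- k *: z)]dotZr in d1.
have y0 : 0 < (4 * c)^-1 by rewrite invr_gt0 mulr_gt0.
have := dot_young (m z) z y0; rewrite (_ : 4 * (4 * c)^-1 = c^-1); last by field; rewrite gt_eqF.
rewrite invrK => young.
rewrite (_ : dot (m z) (- k *: z + y) = - k * dot (m z) z + dot (m z) y); last by rewrite !dotE.
rewrite dotZl; have := mB z.
clear h1; move: (dot (- k *: z + y) (- k *: z + y)) d1 => dd.
move: young (dot_ge0 z) (dot_ge0 y).
move: (dot (m z) (m z)) (dot (m z) z) (dot (m z) y) (dot z z) (dot y y) => mm mz my zz yy.
move=> young zz0 yy0 d1 mB'.
have mz1 : mz <= 3 * c * zz + 8 * c ^+ 3 * h ^+ 2.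
  apply: (le_trans (ler_norm _)); apply: (le_trans young).
  have := ler_wpM2l (ltW y0) mB'.
  rewrite (_ : (4 * c)^-1 * (8 * c ^+ 2 * zz + 32 * c ^+ 4 * h ^+ 2) = 2 * c * zz + 8 * c ^+ 3 * h ^+ 2); first lra.
  by field; rewrite gt_eqF.
have X0 : 0 <= 3 * c * zz + 8 * c ^+ 3 * h ^+ 2.
  by rewrite addr_ge0 ?mulr_ge0 ?exprn_ge0// ltW.
have e1 : A * N%:R * (k * mz) <= A * (6 * h * c ^+ 2 * zz + 16 * c ^+ 4 * h ^+ 3).
  have := ler_wpM2l (mulr_ge0 (ltW Np) k0) mz1; have := ler_wpM2r X0 Nk => u1 u2.
  have := ler_wpM2l (ltW A0) (le_trans u2 u1); lra.
have e2 : A * N%:R * (8 * c * dd) <= 64 * A * h * c ^+ 2 * zz + 16 * A * N%:R * c * yy.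
  have a1 : 0 <= A * N%:R * (8 * c) by rewrite mulr_ge0// mulr_ge0// ltW.
  have := ler_wpM2l a1 d1; have := ler_wpM2r zz0 Nkk.
  have a2 : 0 <= 16 * A * c by rewrite !mulr_ge0// ltW.
  move=> /(ler_wpM2l a2); lra.
lra.
Qed.

(** The rotation bound for exp(A u) reduces the difference of two independent copies to one scaled
    increment, integrated in y and then in z by [gam_quad]. Here [m] plays the gradient of g; its
    square is of order c^2|z|^2 + c^4 h^2, and |z|^2 has mean of order n h. Multiplied by the
    variance h of the increments, this gives an exponent of second order in h. *)
Lemma gaussian_pair_moment :
  (\int[leb n]_z \int[leb n]_y (gam (4 * h)^-1 z * gam (4 * h)^-1 y * expR (A * (g z - g y)))%:E <=
   (expR (1064 * n%:R * h ^+ 2 * A ^+ 2 * c ^+ 2))%:E)%E.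
Proof.
have [N [th [[N0 thE] th01 thN Nhc sn0]]] := mesh.
have Np : 0 < N%:R :> R by rewrite ltr0n.
pose s := (4 * h)^-1; have s0 : 0 < s by rewrite invr_gt0 mulr_gt0.
pose S := Num.sqrt (s / pi); have S0 : 0 <= S by exact: sqrtr_ge0.
pose Psi (u : R) := expR (A * u).
have mPsi : measurable_fun setT Psi by rewrite /Psi; meas.
have Psi0 u : 0 <= Psi u by exact: expR_ge0.
have MP := discrete_maurey_pisier s mPsi Psi0 (exp_subgradient A) mg N0 thE.
have mga (i : (E * E)%type -> E) : measurable_fun setT i -> measurable_fun setT (fun z => g (i z)).
  by move=> mi; exact: (measurableT_comp mg mi).
have mf1 : measurable_fun setT (fun z : (E * E)%type => Psi (g z.1 - g z.2) * expR (- (s * (dot z.1 z.1 + dot z.2 z.2)))).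
  apply: measurable_funM.
    by apply: (measurableT_comp mPsi); apply: measurable_funB; apply: mga; meas.
  apply: (measurableT_comp (@measurable_expR _)); apply: measurableT_comp => //.
  by apply: measurable_funM => //; apply: measurable_funD; apply: measurable_dot; meas.
have f10 (x y : E) : 0 <= Psi (g x - g y) * expR (- (s * (dot x x + dot y y))) by rewrite mulr_ge0 ?expR_ge0.
have -> : (\int[leb n]_z \int[leb n]_y (gam s z * gam s y * expR (A * (g z - g y)))%:E =
  ((S * S) ^+ n)%:E * \int[leb n]_z \int[leb n]_y (Psi (g z - g y) * expR (- (s * (dot z z + dot y y))))%:E)%E.
  rewrite -(eintZ2 (leb n) (leb n) (exprn_ge0 n (mulr_ge0 S0 S0)) mf1 f10).
  apply: eq_integral => z _; apply: eq_eint => y.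
  rewrite /gam -/S /Psi (_ : - (s * (dot z z + dot y y)) = - (s * dot z z) + - (s * dot y y)); last by ring.
  by rewrite expRD exprMn; ring.
apply: (le_trans (lee_wpmul2l _ MP)); first by rewrite lee_fin exprn_ge0// mulr_ge0.
set sn := sin th in sn0 *; set c' := cos th.
rewrite muleA -EFinM.
have CC0 : 0 <= (S * S) ^+ n * sn^-1 ^+ n by rewrite mulr_ge0 ?exprn_ge0 ?mulr_ge0 ?invr_ge0// ltW.
pose f2 (x y : E) := Psi (N%:R * (g x - g (c' *: x + y)%R)) * expR (- (s * (dot x x + sn^-2 * dot y y))).
have mf2 : measurable_fun setT (fun z : (E * E)%type => f2 z.1 z.2).
  apply: measurable_funM.
    apply: (measurableT_comp mPsi); apply: measurable_funM => //; apply: measurable_funB; apply: mga; first by meas.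
    by apply: measurable_rvD; [apply: measurable_rvZ; meas|meas].
  apply: (measurableT_comp (@measurable_expR _)); apply: measurableT_comp => //.
  apply: measurable_funM => //; apply: measurable_funD; first by apply: measurable_dot; meas.
  by apply: measurable_funM => //; apply: measurable_dot; meas.
have f20 x y : 0 <= f2 x y by rewrite mulr_ge0 ?expR_ge0.
rewrite -(eintZ2 (leb n) (leb n) CC0 mf2 f20).
(* Up to normalisation, the increment y carries heat noise at time h sin^2 th, of order h/N^2. *)
pose h' := h * sn ^+ 2; have h'0 : 0 < h' by rewrite mulr_gt0// exprn_gt0.
pose kp := 16 * A * N%:R * c; have kp0 : 0 <= kp by rewrite !mulr_ge0// ltW.
have snth : sn <= 2 / N%:R.
  by apply: le_trans thN; apply: sin_le; case/andP: th01 => /ltW.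
have h'4 : h' <= 4 * h / N%:R ^+ 2.
  have : sn ^+ 2 <= (2 / N%:R) ^+ 2 by rewrite ler_sqr ?nnegrE ?divr_ge0// ltW.
  by move=> /(ler_wpM2l (ltW h0)); rewrite exprMn exprVn /h'; lra.
have hN : h / N%:R <= h * (h * c) by rewrite ler_wpM2l// ltW.
have h'N : h' * N%:R <= 4 * (h * (h * c)).
  have := ler_wpM2r (ltW Np) h'4; rewrite (_ : 4 * h / N%:R ^+ 2 * N%:R = 4 * (h / N%:R)); first lra.
  by field; rewrite gt_eqF.
have h'NN : h' * N%:R ^+ 2 <= 4 * h.
  have := ler_wpM2r (ltW (exprn_gt0 2 Np)) h'4; rewrite (_ : 4 * h / N%:R ^+ 2 * N%:R ^+ 2 = 4 * h)//.
  by field; rewrite gt_eqF.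
have hh : (h * A * c) * (h * c) <= 1600^-1.
  have i1 : h * A * c <= 40^-1 by move: hAc; lra.
  have i2 : h * c <= 40^-1 by move: hc1; lra.
  have i3 : 0 <= h * A * c by rewrite !mulr_ge0// ltW.
  have := ler_pM i3 (ltW hc0) i1 i2; lra.
have k8 : 8 * h' * kp <= 1.
  have a0 : 0 <= 128 * A * c by rewrite !mulr_ge0// ltW.
  have := ler_wpM2l a0 h'N; rewrite /kp; move: hh; lra.
pose K2 := 70 * A * h * c ^+ 2; pose K3 := 16 * A * c ^+ 4 * h ^+ 3.
(* 134 = 70 + 64: the |z|^2 terms of [exponent] and those produced by the integral in y. [L]
   collects the constants. *)
pose kp2 := 134 * h * A ^+ 2 * c ^+ 2.
pose L := 256 * n%:R * A * h ^+ 2 * c ^+ 2 + 256 * h ^+ 3 * A ^+ 2 * c ^+ 4 + K3.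
have AA : A <= A ^+ 2 by rewrite expr2 ler_peMr// ltW.
have inner z : (\int[leb n]_y ((S * S) ^+ n * sn^-1 ^+ n * f2 z y)%:E <=
    (expR L * (gam s z * expR (kp2 * dot z z)))%:E)%E.
  pose b := - (A * N%:R) *: m z.
  have m3 : measurable_fun setT (fun y : E => gam (4 * h')^-1 y * expR (dot b y + kp * dot y y)).
    apply: measurable_funM; first by apply: measurable_gam; meas.
    apply: (measurableT_comp (@measurable_expR _)); apply: measurable_funD; first by apply: measurable_dot; meas.
    by apply: measurable_funM => //; apply: measurable_dot; meas.
  have p3 (y : E) : 0 <= gam (4 * h')^-1 y * expR (dot b y + kp * dot y y) by rewrite mulr_ge0 ?gam_ge0 ?expR_ge0.
  have C30 : 0 <= gam s z * expR (K2 * dot z z + K3) by rewrite mulr_ge0 ?gam_ge0 ?expR_ge0.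
  apply: (@le_trans _ _ ((gam s z * expR (K2 * dot z z + K3))%:E *
      \int[leb n]_y (gam (4 * h')^-1 y * expR (dot b y + kp * dot y y))%:E)%E).
    rewrite -(eintZ (leb n) C30 m3 p3); apply: le_eint.
    - apply: measurable_funM => //.
      exact: (measurableT_comp mf2 (measurable_fun_pair (@measurable_cst _ _ _ _ setT z) (@measurable_id _ _ setT))).
    - exact: measurable_funM.
    - by move=> y; rewrite mulr_ge0.
    move=> y; have ex := exponent z y N0 th01 thN Nhc.
    have -> : gam (4 * h')^-1 y = (S / sn) ^+ n * expR (- (s * (sn^-2 * dot y y))).
      have -> : (4 * h')^-1 = s * sn^-2 by rewrite /s /h'; field; rewrite !gt_eqF.
      rewrite /gam -[s * sn^-2 * dot y y]mulrA; congr (_ ^+ _ * expR _).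
      rewrite (_ : s * sn^-2 / pi = s / pi * sn^-1 ^+ 2).
        by rewrite sqrtrM ?divr_ge0 ?pi_ge0 ?(ltW s0)// sqrtr_sqr ger0_norm// invr_ge0 ltW.
      by rewrite exprVn; move: (@pi R) (sn^-2) => p q; ring.
    rewrite /f2 /Psi /gam -/S.
    rewrite (_ : - (s * (dot z z + sn^-2 * dot y y)) = - (s * dot z z) + - (s * (sn^-2 * dot y y))); last by ring.
    rewrite expRD.
    have -> : (S * S) ^+ n * sn^-1 ^+ n * (expR (A * (N%:R * (g z - g (c' *: z + y)))) *
       (expR (- (s * dot z z)) * expR (- (s * (sn^-2 * dot y y))))) =
      (S ^+ n * expR (- (s * dot z z)) * ((S / sn) ^+ n * expR (- (s * (sn^-2 * dot y y))))) *
       expR (A * (N%:R * (g z - g (c' *: z + y)))).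
      by rewrite !exprMn; ring.
    have -> : S ^+ n * expR (- (s * dot z z)) * expR (K2 * dot z z + K3) *
       ((S / sn) ^+ n * expR (- (s * (sn^-2 * dot y y))) * expR (dot b y + kp * dot y y)) =
      (S ^+ n * expR (- (s * dot z z)) * ((S / sn) ^+ n * expR (- (s * (sn^-2 * dot y y))))) *
       expR ((K2 * dot z z + K3) + (dot b y + kp * dot y y)).
      by rewrite [in RHS]expRD; ring.
    apply: ler_wpM2l; last by rewrite ler_expR.
    by rewrite !mulr_ge0 ?expR_ge0 ?exprn_ge0 ?divr_ge0// ltW.
  apply: (le_trans (lee_wpmul2l _ (gam_quad b h'0 kp0 k8))); first by rewrite lee_fin.
  rewrite -EFinM lee_fin -[leLHS]mulrA -expRD [leRHS]mulrCA -expRD; apply: ler_wpM2l; first exact: gam_ge0.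
  rewrite ler_expR /b dotZl dotZr; have := mB z; have := dot_ge0 z; have := dot_ge0 (m z).
  move: (dot (m z) (m z)) (dot z z) => mm zz mm0 zz0 mB'.
  have q1 : 4 * n%:R * h' * kp <= 256 * n%:R * A * h ^+ 2 * c ^+ 2.
    have a0 : 0 <= 64 * n%:R * A * c by rewrite !mulr_ge0// ltW.
    by have := ler_wpM2l a0 h'N; rewrite /kp; lra.
  have q2 : 2 * h' * (- (A * N%:R) * (- (A * N%:R) * mm)) <= 64 * h * A ^+ 2 * c ^+ 2 * zz + 256 * h ^+ 3 * A ^+ 2 * c ^+ 4.
    have a0 : 0 <= 2 * A ^+ 2 * mm := mulr_ge0 (mulr_ge0 (ler0n R 2) (sqr_ge0 A)) mm0.
    have a1 : 0 <= 8 * h * A ^+ 2 by rewrite !mulr_ge0 ?sqr_ge0// ltW.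
    have := ler_wpM2l a0 h'NN; have := ler_wpM2l a1 mB'; lra.
  have q3 : K2 * zz <= 70 * h * A ^+ 2 * c ^+ 2 * zz.
    have a0 : 0 <= 70 * h * c ^+ 2 * zz by rewrite !mulr_ge0 ?sqr_ge0// ltW.
    by have := ler_wpM2l a0 AA; rewrite /K2; lra.
  rewrite /L /kp2; lra.
have mq : measurable_fun setT (fun z : E => gam s z * expR (kp2 * dot z z)).
  apply: measurable_funM; first by apply: measurable_gam; meas.
  apply: (measurableT_comp (@measurable_expR _)).
  by apply: measurable_funM => //; apply: measurable_dot; meas.
have q0 (z : E) : 0 <= gam s z * expR (kp2 * dot z z) by rewrite mulr_ge0 ?gam_ge0 ?expR_ge0.
have kp20 : 0 <= kp2 by rewrite !mulr_ge0 ?sqr_ge0// ltW.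
have k82 : 8 * h * kp2 <= 1.
  have i1 : h * A * c <= 40^-1 by move: hAc; lra.
  have i3 : 0 <= h * A * c by rewrite !mulr_ge0// ltW.
  by have := ler_pM i3 i3 i1 i1; rewrite /kp2; lra.
have gq := gam_quad (n := n) 0 h0 kp20 k82.
rewrite dot0l mulr0 addr0 in gq.
apply: (@le_trans _ _ ((expR L)%:E * \int[leb n]_z (gam s z * expR (kp2 * dot z z))%:E)%E).
  rewrite -(eintZ (leb n) (expR_ge0 L) mq q0); apply: ge0_le_integral => //.
  - by move=> z _; apply: eint_ge0 => y; rewrite mulr_ge0.
  - apply: (measurable_eint (leb n) (f := fun z y => (S * S) ^+ n * sn^-1 ^+ n * f2 z y)).
      exact: measurable_funM.
    by move=> x y; rewrite mulr_ge0.
  - by apply/measurable_EFinP; exact: measurable_funM.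
have -> : (\int[leb n]_z (gam s z * expR (kp2 * dot z z))%:E =
  \int[leb n]_z (gam (4 * h)^-1 z * expR (dot 0 z + kp2 * dot z z))%:E)%E.
  by apply: eq_eint => z; rewrite dot0l add0r.
apply: (le_trans (lee_wpmul2l _ gq)); first by rewrite lee_fin expR_ge0.
(* 1064 = 256 + 256 + 16 + 4 x 134. *)
rewrite -EFinM lee_fin -expRD ler_expR /L /kp2 /K3.
have n1 : 1 <= n%:R :> R by rewrite ler1n.
have x0 : 0 <= h ^+ 2 * c ^+ 2 by rewrite mulr_ge0 ?sqr_ge0.
have xA : 0 <= h ^+ 2 * c ^+ 2 * A ^+ 2 by rewrite mulr_ge0 ?sqr_ge0.
have w1 : n%:R * (h ^+ 2 * c ^+ 2) * A <= n%:R * (h ^+ 2 * c ^+ 2) * A ^+ 2 by rewrite ler_wpM2l// mulr_ge0.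
have w2 : h ^+ 2 * c ^+ 2 * A ^+ 2 * (h * c ^+ 2) <= h ^+ 2 * c ^+ 2 * A ^+ 2 by rewrite ler_piMr.
have w3 : h ^+ 2 * c ^+ 2 * A ^+ 2 <= n%:R * (h ^+ 2 * c ^+ 2 * A ^+ 2) by rewrite ler_peMl.
have w4 : h ^+ 2 * c ^+ 2 * (h * c ^+ 2) * A <= h ^+ 2 * c ^+ 2 * (h * c ^+ 2) * A ^+ 2.
  by rewrite ler_wpM2l// mulr_ge0// mulr_ge0 ?sqr_ge0// ltW.
lra.
Qed.

End pair_moment.

Lemma mulr_balance (R : comPzRingType) (f p k p' k' : R) : p * k = p' * k' -> f * p * k = p' * (f * k').
Proof. by move=> e; rewrite -mulrA e mulrCA. Qed.

Section lmc_kernel.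
Context {R : realType} {n : nat}.
Notation E := 'rV[R]_n.
Variables (c h : R).
Implicit Types x y z : E.

Definition student_drift x : E := (1 + dot x x)^-1 *: x.

(** With 4c = nu + n this is x - h grad V(x) for the Student potential. *)
Definition lmc_drift x : E := x - (4 * c * h) *: student_drift x.

Definition lmc_kernel x y := heat h (lmc_drift x) y.

(** -ln w(y) minus the first-order part of its expansion at x: what remains of the weight once LMC
    has linearised it. *)
Definition log_ratio x y := c * ln (1 + dot y y) - 2 * c * dot (student_drift x) (y - x).

Notation w := (@wgt R n c).
Notation k := (chain_kernel h w).

Definition ratio_const x := heat_mean h w x * expR (- (4 * h * c ^+ 2 * dot (student_drift x) (student_drift x))).

Lemma measurable_student_drift : measurable_fun setT student_drift.
Proof.
apply: measurable_rvZ; last exact: measurable_id.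
apply: (measurableT_comp (@measurable_invr R)).
by apply: measurable_funD => //; apply: measurable_dot; meas.
Qed.

Lemma measurable_lmc_drift : measurable_fun setT lmc_drift.
Proof.
apply: measurable_rvD; first exact: measurable_id.
apply: measurable_rvN; apply: measurable_rvZ; first exact: measurable_cst.
exact: measurable_student_drift.
Qed.

Lemma measurable_lmc_kernel : measurable_fun setT (fun z : (E * E)%type => lmc_kernel z.1 z.2).
Proof.
apply: measurable_heat; last by meas.
exact: (measurableT_comp measurable_lmc_drift measurable_fst).
Qed.

Lemma measurable_log_ratio x : measurable_fun setT (log_ratio x).
Proof.
apply: measurable_funB.
  by apply: measurable_funM => //; apply: measurable_ln_dot; meas.
apply: measurable_funM => //; apply: measurable_dot; first exact: measurable_cst.
by apply: measurable_rvD; meas.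
Qed.

Lemma measurable_log_ratio2 : measurable_fun setT (fun z : (E * E)%type => log_ratio z.1 z.2).
Proof.
apply: measurable_funB.
  by apply: measurable_funM => //; apply: measurable_ln_dot; meas.
apply: measurable_funM => //; apply: measurable_dot.
  exact: (measurableT_comp measurable_student_drift measurable_fst).
by apply: measurable_rvD; [meas|apply: measurable_rvN; meas].
Qed.

Hypotheses (c0 : 0 < c) (h0 : 0 < h).

Let mw : measurable_fun setT w. Proof. exact: (measurable_wgt _ (f := id)). Qed.
Let w0 x : 0 < w x. Proof. exact: wgt_gt0. Qed.
Let w1 x : w x <= 1. Proof. exact: wgt_le1 (ltW c0). Qed.
Let Gm x : expR (- (2 * n%:R * h * c)) * w x <= heat_mean h w x.
Proof. exact: heat_mean_wgt_ge (ltW c0) h0 x. Qed.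
Let bm0 : 0 < expR (- (2 * n%:R * h * c)). Proof. exact: expR_gt0. Qed.
Let G0 x : 0 < heat_mean h w x. Proof. exact: (heat_mean_gt0 w0 bm0 Gm). Qed.

Lemma ratio_const_gt0 x : 0 < ratio_const x.
Proof. by rewrite mulr_gt0 ?expR_gt0. Qed.

(** Expanding the square in the LMC Gaussian gives heat h x y times a linear exponential in y - x.
    Division by w(y) leaves [log_ratio], and the factors in x alone make up [ratio_const]. *)
Lemma lmc_kernelE x y : lmc_kernel x y = k x y * (expR (log_ratio x y) * ratio_const x).
Proof.
rewrite /lmc_kernel /chain_kernel /ratio_const /log_ratio /heat /gam /wgt /lmc_drift.
have := G0 x; move: (heat_mean h _ x) (student_drift x) => G v G00.
set S := Num.sqrt _ ^+ n.
have -> : S * expR (- ((4 * h)^-1 * dot (x - y) (x - y))) * expR (- (c * ln (1 + dot y y))) / G *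
    (expR (c * ln (1 + dot y y) - 2 * c * dot v (y - x)) * (G * expR (- (4 * h * c ^+ 2 * dot v v)))) =
  S * (expR (- ((4 * h)^-1 * dot (x - y) (x - y))) * expR (- (c * ln (1 + dot y y))) *
    expR (c * ln (1 + dot y y) - 2 * c * dot v (y - x)) * expR (- (4 * h * c ^+ 2 * dot v v))).
  by field; rewrite gt_eqF.
rewrite -!expRD; congr (_ * expR _); rewrite !dotE (dotC y x) (dotC x v) (dotC y v).
by move: (ln _) => l; field; rewrite gt_eqF.
Qed.

Lemma lmc_kernel_ge0 x y : 0 <= lmc_kernel x y. Proof. exact: heat_ge0. Qed.

Lemma lmc_kernel_int x : (\int[leb n]_y (lmc_kernel x y)%:E = 1)%E.
Proof. exact: heat_int. Qed.

Let mlx x : measurable_fun setT (lmc_kernel x). Proof. by apply: measurable_heat; meas. Qed.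
Let mkx x : measurable_fun setT (k x).
Proof.
exact: (measurableT_comp (measurable_chain_kernel h mw w0) (measurable_fun_pair (@measurable_cst _ _ _ _ setT x) (@measurable_id _ _ setT))).
Qed.
Let k0 x y : 0 <= k x y. Proof. exact: chain_kernel_ge0 w0 bm0 Gm x y. Qed.
Let k1 x : (\int[leb n]_y (k x y)%:E = 1)%E. Proof. exact: chain_kernel_int h0 mw w0 w1 bm0 Gm x. Qed.

Let mexp x a : measurable_fun setT (fun y => expR (a * log_ratio x y)).
Proof.
apply: (measurableT_comp (@measurable_expR _)); apply: measurable_funM => //.
exact: measurable_log_ratio.
Qed.

Variable A : R.
Hypotheses (n0 : (0 < n)%N) (A1 : 1 <= A) (hc2 : h * c ^+ 2 <= 1) (hAc : 40 * h * A * c <= 1).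

Notation eta := (1064 * n%:R * h ^+ 2 * A ^+ 2 * c ^+ 2).

(** A product of moments of exp(A g) and exp(-A g) is a moment of the difference of two independent
    copies, in which additive constants of g cancel; [gaussian_pair_moment] then applies around the
    LMC mean. *)
Lemma lmc_pair_moment x :
  (\int[leb n]_y (lmc_kernel x y * expR (A * log_ratio x y))%:E *
   \int[leb n]_y (lmc_kernel x y * expR (- A * log_ratio x y))%:E <= (expR eta)%:E)%E.
Proof.
pose g z := log_ratio x (lmc_drift x + z).
(* The gradient of [g] at z. It is small near z = 0 because [lmc_drift x] is close to x. *)
pose m z := (2 * c) *: (student_drift (lmc_drift x + z) - student_drift x).
have mg : measurable_fun setT g.
  by apply: (measurableT_comp (measurable_log_ratio x)); apply: measurable_rvD; meas.
have gT z t : g z - g (z + t)%R <= - dot (m z) t + 8 * c * dot t t.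
  rewrite /g /m /log_ratio addrA; set y := lmc_drift x + z.
  have := ler_wpM2l (ltW c0) (ln_dot_lower y t).
  have -> : 2 * dot y t / (1 + dot y y) = 2 * dot (student_drift y) t.
    by rewrite /student_drift dotZl; ring.
  rewrite dotZl !dotE; move: (ln _) (ln _) => l1 l2; lra.
have mB z : dot (m z) (m z) <= 8 * c ^+ 2 * dot z z + 32 * c ^+ 4 * h ^+ 2.
  rewrite /m dotZl dotZr; have := student_drift_lipschitz (lmc_drift x + z) x.
  rewrite -/(student_drift _) -/(student_drift x); move: (dot _ _) => dd.
  have -> : lmc_drift x + z - x = - (4 * c * h) *: student_drift x + z.
    by rewrite /lmc_drift scaleNr addrAC [x - _]addrC addrK.
  have dl := dot_add_le (- (4 * c * h) *: student_drift x) z.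
  rewrite [dot (- (4 * c * h) *: _) (- (4 * c * h) *: _)]dotZl dotZr in dl.
  have v4 := student_drift_norm x; rewrite -/(student_drift x) in v4.
  move=> dy.
  have a0 : 0 <= 128 * c ^+ 4 * h ^+ 2 :=
    mulr_ge0 (mulr_ge0 (ler0n R 128) (exprn_ge0 4 (ltW c0))) (sqr_ge0 h).
  have a1 : 0 <= 4 * c ^+ 2 by rewrite mulr_ge0// sqr_ge0.
  have := ler_wpM2l a1 (le_trans dy dl); have := ler_wpM2l a0 v4.
  move: (dot (student_drift x) (student_drift x)) (dot z z) => vv zz; lra.
have := gaussian_pair_moment n0 A1 c0 h0 hc2 hAc mg gT mB; apply: le_trans.
have shift a : (\int[leb n]_y (lmc_kernel x y * expR (a * log_ratio x y))%:E =
   \int[leb n]_z (gam (4 * h)^-1 z * expR (a * g z))%:E)%E.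
  by rewrite /lmc_kernel heat_translation// => y; exact: expR_ge0.
have mga a : measurable_fun setT (fun z => gam (4 * h)^-1 z * expR (a * g z)).
  apply: measurable_funM; first by apply: measurable_gam; meas.
  by apply: (measurableT_comp (@measurable_expR _)); apply: measurable_funM.
have g0 a z : 0 <= gam (4 * h)^-1 z * expR (a * g z) by rewrite mulr_ge0 ?gam_ge0 ?expR_ge0.
rewrite !shift; apply: eq_lexx.
rewrite -ge0_integralZr//; first last.
- by apply: eint_ge0 => y; exact: g0.
- by move=> y _; rewrite lee_fin g0.
- by apply/measurable_EFinP; exact: mga.
apply: eq_integral => z _; rewrite -(eintZ (leb n) (g0 A z) (mga (- A)) (g0 (- A))).
apply: eq_eint => y; rewrite (_ : A * (g z - g y) = A * g z + - A * g y); last by ring.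
by rewrite expRD; ring.
Qed.

(* Since [k x] integrates to 1, [ratio_const x] is the [lmc_kernel x]-mean of
   [expR (- log_ratio x)]; Jensen's inequality then leaves a centered exponential moment. *)
Lemma lmc_ratio_moment x :
  (\int[leb n]_y (k x y * (expR (log_ratio x y) * ratio_const x) `^ (A + 1))%:E <= (expR eta)%:E)%E.
Proof.
have r0 := ratio_const_gt0 x.
have A0 : 0 < A by apply: lt_le_trans A1.
have e1 y : k x y * (expR (log_ratio x y) * ratio_const x) `^ (A + 1) =
   ratio_const x `^ A * (lmc_kernel x y * expR (A * log_ratio x y)).
  have z0 : 0 < expR (log_ratio x y) * ratio_const x by rewrite mulr_gt0 ?expR_gt0.
  rewrite lmc_kernelE powRD ?(gt_eqF z0) ?implybT// powRr1 ?(ltW z0)// powRM ?expR_ge0 ?(ltW r0)//.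
  by rewrite -[expR (log_ratio x y) `^ A]expRM [log_ratio x y * A]mulrC; ring.
under eq_eint do rewrite e1.
have mI : measurable_fun setT (fun y => lmc_kernel x y * expR (A * log_ratio x y)) by exact: measurable_funM.
have I0 y : 0 <= lmc_kernel x y * expR (A * log_ratio x y) by rewrite mulr_ge0 ?heat_ge0 ?expR_ge0.
rewrite (eintZ (leb n) (powR_ge0 _ _) mI I0).
apply: le_trans (lmc_pair_moment x); rewrite [leRHS]muleC; apply: lee_wpmul2r.
  exact: eint_ge0.
have mu : measurable_fun setT (fun y => expR (- log_ratio x y)).
  by apply: (measurableT_comp (@measurable_expR _)); apply: measurableT_comp => //; exact: measurable_log_ratio.
have Eu : (\int[leb n]_y (expR (- log_ratio x y) * lmc_kernel x y)%:E = (ratio_const x)%:E)%E.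
  rewrite -[RHS]mule1 -(k1 x) -(eintZ (leb n) (ltW r0) (mkx x) (k0 x)).
  apply: eq_eint => y; rewrite lmc_kernelE.
  by rewrite expRN; field; rewrite gt_eqF ?expR_gt0.
apply: (le_trans (jensen_powR (mlx x) (lmc_kernel_ge0 x) (lmc_kernel_int x) A1 mu (fun y => expR_ge0 _) Eu)).
apply: eq_lexx; apply: eq_eint => y; rewrite mulrC -expRM; congr (_ * expR _); ring.
Qed.

Section comparison.
Variables (f v r : E -> R) (B C : R).
Notation p := (chain_density h w).
Hypotheses (mp : measurable_fun setT p) (p0 : forall x, 0 <= p x)
  (mf : measurable_fun setT f) (f0 : forall x, 0 <= f x) (fB : forall x, f x <= B)
  (mr : measurable_fun setT r) (r0 : forall x, 0 <= r x) (r1 : (\int[leb n]_x (r x)%:E = 1)%E)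
  (mv : measurable_fun setT v) (v0 : forall x, 0 <= v x) (rE : forall x, r x = v x * (f x * p x))
  (rev : forall x y, p x * k x y = p y * k y x)
  (vC : (\int[leb n]_x (v x `^ (A + 1) * (f x * p x))%:E <= C%:E)%E).

Definition lmc_push x := fine (\int[leb n]_y (r y * lmc_kernel y x)%:E)%E.

Let mk : measurable_fun setT (fun z : (E * E)%type => k z.1 z.2).
Proof. exact: measurable_chain_kernel. Qed.

Let mrl y : measurable_fun setT (fun x => r x * lmc_kernel x y).
Proof.
apply: measurable_funM => //.
exact: (measurableT_comp measurable_lmc_kernel (measurable_fun_pair (@measurable_id _ _ setT) (@measurable_cst _ _ _ _ setT y))).
Qed.
Let rl0 x y : 0 <= r x * lmc_kernel x y. Proof. by rewrite mulr_ge0 ?heat_ge0. Qed.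
Let mrl2 : measurable_fun setT (fun z : (E * E)%type => r z.2 * lmc_kernel z.2 z.1).
Proof.
apply: measurable_funM; first exact: (measurableT_comp mr measurable_snd).
exact: (measurableT_comp measurable_lmc_kernel (measurable_fun_pair measurable_snd measurable_fst)).
Qed.

Lemma lmc_kernel_le x y : lmc_kernel x y <= Num.sqrt ((4 * h)^-1 / pi) ^+ n.
Proof.
rewrite /lmc_kernel /heat /gam ler_piMr ?exprn_ge0 ?sqrtr_ge0// -expR0 ler_expR oppr_le0.
by rewrite mulr_ge0 ?dot_ge0// invr_ge0 mulr_ge0// ltW.
Qed.

Lemma lmc_pushE y : (\int[leb n]_x (r x * lmc_kernel x y)%:E = (lmc_push y)%:E)%E.
Proof.
have S0 : 0 <= Num.sqrt ((4 * h)^-1 / pi) ^+ n :> R by rewrite exprn_ge0 ?sqrtr_ge0.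
rewrite fineK// ge0_fin_numE; last exact: eint_ge0.
apply: (@le_lt_trans _ _ (Num.sqrt ((4 * h)^-1 / pi) ^+ n)%:E); last exact: ltry.
rewrite -[leRHS]mule1 -r1 -(eintZ (leb n) S0 mr r0); apply: le_eint => //.
- exact: measurable_funM.
- by move=> x; rewrite mulrC ler_wpM2r// lmc_kernel_le.
Qed.

Lemma lmc_push_ge0 y : 0 <= lmc_push y.
Proof. by rewrite -lee_fin -lmc_pushE; exact: eint_ge0. Qed.

Lemma measurable_lmc_push : measurable_fun setT lmc_push.
Proof.
apply: (measurableT_comp (@fine_measurable _ setT measurableT)).
exact: (measurable_eint (leb n) (f := fun x y => r y * lmc_kernel y x) mrl2 (fun x y => rl0 y x)).
Qed.

Lemma lmc_push_int (g : E -> R) : measurable_fun setT g -> (forall x, 0 <= g x) ->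
  (\int[leb n]_y (lmc_push y * g y)%:E = \int[leb n]_x \int[leb n]_y (r x * (lmc_kernel x y * g y))%:E)%E.
Proof.
move=> mg g0.
rewrite (tonelli (leb n) (leb n) (f := fun x y => r x * (lmc_kernel x y * g y))); first last.
- by move=> x y; rewrite mulrA mulr_ge0.
- apply: measurable_funM; first exact: (measurableT_comp mr measurable_fst).
  by apply: measurable_funM; [exact: measurable_lmc_kernel|exact: (measurableT_comp mg measurable_snd)].
apply: eq_integral => y _; rewrite mulrC EFinM -lmc_pushE -(eintZ (leb n) (g0 y) (mrl y)); last by move=> x; exact: rl0.
by apply: eq_eint => x; ring.
Qed.

Lemma lmc_push_total : (\int[leb n]_y (lmc_push y)%:E = 1)%E.
Proof.
have := lmc_push_int (@measurable_cst _ _ _ _ setT (1 : R)) (fun=> ler01).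
under eq_eint do rewrite mulr1.
move=> ->; rewrite -r1; apply: eq_integral => x _.
under eq_eint do rewrite mulr1.
by rewrite (eintZ (leb n) (r0 x) (mlx x) (heat_ge0 _ _)) lmc_kernel_int mule1.
Qed.

(* [lmc_push r] is the [k]-average of [v] times the kernel ratio, so Jensen's inequality
   carries the moment of [v] over to the quotient of the two densities. *)
Lemma lmc_compare : exists v' : E -> R, [/\ measurable_fun setT v', forall y, 0 <= v' y,
  forall y, lmc_push y = v' y * (smooth (leb n) k f y * p y) &
  (\int[leb n]_y (v' y `^ (A + 1) * (smooth (leb n) k f y * p y))%:E <= (C * expR eta)%:E)%E].
Proof.
have lr := lmc_ratio_moment; move: (expR eta) (expR_ge0 eta) lr => e e0 lr.
pose rat x y := expR (log_ratio x y) * ratio_const x.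
have rat0 x y : 0 <= rat x y by rewrite mulr_ge0 ?expR_ge0// ltW// ratio_const_gt0.
have mrat : measurable_fun setT (fun z : (E * E)%type => rat z.1 z.2).
  apply: measurable_funM; first exact: (measurableT_comp (@measurable_expR _) measurable_log_ratio2).
  refine (measurableT_comp (f := ratio_const) _ measurable_fst).
  apply: measurable_funM; first exact: (measurable_heat_mean h mw w0).
  apply: (measurableT_comp (@measurable_expR _)); apply: measurableT_comp => //.
  by apply: measurable_funM => //; apply: measurable_dot; exact: measurable_student_drift.
have mKf := measurable_smooth (leb n) mk k0 mf f0.
pose q y := smooth (leb n) k f y * p y.
have mq : measurable_fun setT q := measurable_funM mKf mp.
have q0 y : 0 <= q y by rewrite mulr_ge0// (smooth_ge0 mk k0 k1 mf f0 fB).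
pose j x y := f x * p x * k x y.
have j0 x y : 0 <= j x y by rewrite mulr_ge0// mulr_ge0.
have mj : measurable_fun setT (fun z : (E * E)%type => j z.1 z.2).
  exact: (measurable_funM (measurableT_comp (measurable_funM mf mp) measurable_fst) mk).
have mjy y : measurable_fun setT (j^~ y).
  exact: (measurableT_comp mj (measurable_fun_pair (@measurable_id _ _ setT) (@measurable_cst _ _ _ _ setT y))).
have mry y : measurable_fun setT (fun x => v x * rat x y).
  apply: measurable_funM => //.
  exact: (measurableT_comp mrat (measurable_fun_pair (@measurable_id _ _ setT) (@measurable_cst _ _ _ _ setT y))).
have vr0 x y : 0 <= v x * rat x y by rewrite mulr_ge0.
have qE y : (\int[leb n]_x (j x y)%:E = (q y)%:E)%E.
  rewrite /q mulrC EFinM -(smoothE mk k0 k1 mf f0 fB y).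
  have mfk : measurable_fun setT (fun x => f x * k y x) := measurable_funM mf (mkx y).
  rewrite -(eintZ (leb n) (p0 y) mfk); last by move=> x; exact: mulr_ge0 (f0 x) (k0 y x).
  by apply: eq_eint => x; exact: (mulr_balance (f x) (rev x y)).
have pE y : (\int[leb n]_x (v x * rat x y * j x y)%:E = (lmc_push y)%:E)%E.
  rewrite -lmc_pushE; apply: eq_eint => x.
  have lE : lmc_kernel x y = k x y * rat x y := lmc_kernelE x y.
  rewrite rE lE /j; move: (k x y) (rat x y) (p x) => a1 a2 a3; ring.
pose v' y := lmc_push y / q y.
have mv' : measurable_fun setT v'.
  apply: measurable_funM; first exact: measurable_lmc_push.
  exact: (measurableT_comp (@measurable_invr R) mq).
have v'0 y : 0 <= v' y by rewrite divr_ge0// lmc_push_ge0.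
have A10 : 1 <= A + 1 by rewrite lerDr (le_trans ler01).
(* Jensen under the law of the previous point x given y, with density j x y/q y. *)
have jen y : ((v' y `^ (A + 1) * q y)%:E <= \int[leb n]_x ((v x * rat x y) `^ (A + 1) * j x y)%:E)%E.
  have [qy0|qn0] := eqVneq (q y) 0.
    by rewrite qy0 mulr0; apply: eint_ge0 => x; rewrite mulr_ge0 ?powR_ge0.
  have qp : 0 < q y by rewrite lt_neqAle eq_sym qn0 q0.
  have iq0 : 0 <= (q y)^-1 by rewrite invr_ge0.
  pose th x := (q y)^-1 * j x y.
  have mth : measurable_fun setT th := measurable_funM (measurable_cst _) (mjy y).
  have th0 x : 0 <= th x by rewrite mulr_ge0.
  have th1 : (\int[leb n]_x (th x)%:E = 1)%E.
    by rewrite (eintZ (leb n) iq0 (mjy y) (j0^~ y)) qE -EFinM mulVf.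
  have mvj : measurable_fun setT (fun x => v x * rat x y * j x y) := measurable_funM (mry y) (mjy y).
  have Eu : (\int[leb n]_x (v x * rat x y * th x)%:E = (v' y)%:E)%E.
    rewrite /v' mulrC EFinM -pE -(eintZ (leb n) iq0 mvj); last by move=> x; rewrite mulr_ge0.
    by apply: eq_eint => x; rewrite /th; ring.
  have := jensen_powR mth th0 th1 A10 (mry y) (vr0^~ y) Eu.
  have mvp : measurable_fun setT (fun x => (v x * rat x y) `^ (A + 1) * th x).
    exact: (measurable_funM (measurable_powRf _ (mry y)) mth).
  have q0' : (0 <= (q y)%:E)%E by rewrite lee_fin.
  move=> /(lee_wpmul2l q0'); rewrite -EFinM mulrC => jl; apply: (le_trans jl).
  rewrite -(eintZ (leb n) (q0 y) mvp); last by move=> x; rewrite mulr_ge0 ?powR_ge0.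
  by apply: eq_lexx; apply: eq_eint => x; rewrite /th mulrCA [q y * _]mulrA divff// mul1r.
exists v'; split=> //.
  (* Where q y = 0, j x y vanishes for almost every x, hence so does the pushed density; this agrees
     with the value 0 that division by zero gives to v' y. *)
  move=> y; rewrite /v' -/(q y); have [qy0|qn0] := eqVneq (q y) 0; last by rewrite divfK.
  rewrite qy0 mulr0; apply/EFin_inj; rewrite -pE.
  have j00 : (\int[leb n]_x (j x y)%:E = 0)%E by rewrite qE qy0.
  have : ae_eq (leb n) setT (fun x => (j x y)%:E) (cst 0%E).
    apply/ae_eq_integral_abs => //; first by apply/measurable_EFinP; exact: mjy.
    by rewrite -j00; apply: eq_integral => x _; rewrite abse_EFin ger0_norm.
  move=> jae; rewrite (ae_eq_integral (cst 0%E))//; first by rewrite integral0.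
  - by apply/measurable_EFinP; exact: (measurable_funM (mry y) (mjy y)).
  - apply: filterS jae => x /= jx _; have := jx I; rewrite /cst => -[->].
    by rewrite mulr0.
have mvj2 : measurable_fun setT (fun z : (E * E)%type => (v z.1 * rat z.1 z.2) `^ (A + 1) * j z.1 z.2).
  exact: (measurable_funM (measurable_powRf _ (measurable_funM (measurableT_comp mv measurable_fst) mrat)) mj).
have vj0 x y : 0 <= (v x * rat x y) `^ (A + 1) * j x y by rewrite mulr_ge0 ?powR_ge0.
apply: (@le_trans _ _ (\int[leb n]_y \int[leb n]_x ((v x * rat x y) `^ (A + 1) * j x y)%:E)%E).
  apply: ge0_le_integral => //.
  - by move=> y _; exact: (mulr_ge0 (powR_ge0 _ _) (q0 y)).
  - by apply/measurable_EFinP; exact: (measurable_funM (measurable_powRf _ mv') mq).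
  - apply: (measurable_eint (leb n) (f := fun y x => (v x * rat x y) `^ (A + 1) * j x y)).
      exact: (measurableT_comp mvj2 (measurable_fun_pair measurable_snd measurable_fst)).
    by move=> y x; exact: vj0.
rewrite -(tonelli (leb n) (leb n) mvj2 vj0).
have mvf : measurable_fun setT (fun x => v x `^ (A + 1) * (f x * p x)).
  by apply: measurable_funM; [exact: measurable_powRf|exact: measurable_funM].
have vf0 x : 0 <= v x `^ (A + 1) * (f x * p x) by rewrite mulr_ge0 ?powR_ge0// mulr_ge0.
apply: (@le_trans _ _ (e%:E * \int[leb n]_x (v x `^ (A + 1) * (f x * p x))%:E)%E); last first.
  apply: (@le_trans _ _ (e%:E * C%:E)%E).
    by apply: lee_wpmul2l => //; rewrite lee_fin.
  by apply: eq_lexx; rewrite -EFinM; congr EFin; exact: mulrC.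
rewrite -(eintZ (leb n) e0 mvf vf0); apply: ge0_le_integral => //.
- by move=> x _; apply: eint_ge0.
- exact: (measurable_eint (leb n) (f := fun x y => (v x * rat x y) `^ (A + 1) * j x y)).
- by apply/measurable_EFinP; exact: measurable_funM.
move=> x _.
have mkr : measurable_fun setT (fun y => k x y * rat x y `^ (A + 1)).
  apply: (measurable_funM (mkx x)); apply: measurable_powRf.
  exact: (measurableT_comp mrat (measurable_fun_pair (@measurable_cst _ _ _ _ setT x) (@measurable_id _ _ setT))).
have -> : (\int[leb n]_y ((v x * rat x y) `^ (A + 1) * j x y)%:E =
   (v x `^ (A + 1) * (f x * p x))%:E * \int[leb n]_y (k x y * rat x y `^ (A + 1))%:E)%E.
  rewrite -(eintZ (leb n) (vf0 x) mkr); last by move=> y; rewrite mulr_ge0 ?powR_ge0.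
  by apply: eq_eint => y; rewrite powRM// /j; ring.
apply: (@le_trans _ _ ((v x `^ (A + 1) * (f x * p x))%:E * e%:E)%E).
  apply: lee_wpmul2l; first by rewrite lee_fin.
  exact: lr.
by apply: eq_lexx; rewrite -EFinM; congr EFin; exact: mulrC.
Qed.

End comparison.
End lmc_kernel.

(** * Divergence bounds for the LMC iterates *)

Section lmc_decay.
Context {R : realType}.
Variables (a : R) (n : nat) (h Z M A : R).
Notation E := 'rV[R]_n.
Notation c := ((a + n%:R / 2) / 2).
Notation w := (@wgt R n c).
Notation p := (chain_density h w).
Notation k := (chain_kernel h w).
Notation bm := (expR (- (2 * n%:R * h * c))).
Notation bp := (expR (32 * n%:R * h * c + 2 * h * c ^+ 2)).
Notation eta := (1064 * n%:R * h ^+ 2 * A ^+ 2 * c ^+ 2).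
Hypotheses (n0 : (0 < n)%N) (a0 : 0 < a) (h0 : 0 < h) (M1 : 1 <= M) (Z0 : 0 < Z)
  (EZ : (\int[leb n]_x (wgt (a + n%:R / 2) (x : E))%:E = Z%:E)%E)
  (A1 : 1 <= A) (hc2 : h * c ^+ 2 <= 1) (hAc : 40 * h * A * c <= 1) (hc64 : 64 * h * c <= 1).

Lemma student_scale_gt0 : 0 < c.
Proof. by rewrite divr_gt0// ltr_wpDr// divr_ge0. Qed.

Let c0 := student_scale_gt0.
Let mw : measurable_fun setT w. Proof. exact: (measurable_wgt _ (f := id)). Qed.
Let w0 (x : E) : 0 < w x. Proof. exact: wgt_gt0. Qed.
Let w1 (x : E) : w x <= 1. Proof. exact: wgt_le1 (ltW c0). Qed.
Let bm0 : 0 < bm. Proof. exact: expR_gt0. Qed.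
Let Gm (x : E) : bm * w x <= heat_mean h w x. Proof. exact: heat_mean_wgt_ge (ltW c0) h0 x. Qed.
Let Gp (x : E) : heat_mean h w x <= bp * w x. Proof. exact: (heat_mean_wgt_le (ltW c0) h0 x hc64). Qed.
Let w2 (x : E) : w x ^+ 2 = wgt (a + n%:R / 2) x.
Proof. by rewrite expr2 wgtD; congr (wgt _ x); field. Qed.
Let EZ2 : (\int[leb n]_x (w x ^+ 2)%:E = Z%:E)%E.
Proof. by rewrite -EZ; apply: eq_eint => x; rewrite w2. Qed.

Lemma measurable_student_chain_density : measurable_fun setT p.
Proof. exact: measurable_chain_density. Qed.
Lemma student_chain_density_gt0 x : 0 < p x.
Proof. exact: (chain_density_gt0 mw w0 bm0 Z0 EZ2 Gm Gp x). Qed.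
Lemma student_chain_density_int : (\int[leb n]_x (p x)%:E = 1)%E.
Proof. exact: chain_density_int mw w0 bm0 Z0 EZ2 Gm Gp. Qed.
Let mp := measurable_student_chain_density.
Let p0 x : 0 <= p x. Proof. exact: ltW (student_chain_density_gt0 x). Qed.
Let rev x y : p x * k x y = p y * k y x.
Proof. exact: (chain_reversible mw w0 bm0 Z0 EZ2 Gm Gp). Qed.

Definition student_density (x : E) := wgt (a + n%:R / 2) x / Z.
Notation tp := student_density.

Lemma student_density_gt0 x : 0 < tp x.
Proof. by rewrite divr_gt0 ?wgt_gt0. Qed.

Lemma measurable_student_density : measurable_fun setT tp.
Proof. by apply: measurable_funM => //; exact: (measurable_wgt _ (f := id)). Qed.

(** [p] is w times its heat mean, which lies between bm w and bp w, divided by a mass between bm Z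
    and bp Z. The same comparison gives the converse bound in the next lemma. *)
Lemma chain_density_le x : p x <= bp / bm * tp x.
Proof.
have q0 := chain_mass_gt0 mw w0 bm0 Z0 EZ2 Gm Gp.
rewrite /chain_density /student_density -w2 ler_pdivrMr//.
have := chain_mass_ge mw w0 bm0 EZ2 Gm Gp; move: (chain_mass h w) q0 => Zp q0 hZ.
have e : bp / bm * (w x ^+ 2 / Z) * Zp = w x * (bp * w x) * (Zp / (bm * Z)).
  by field; rewrite !gt_eqF ?expR_gt0.
rewrite e; apply: (@le_trans _ _ (w x * (bp * w x))).
  by rewrite ler_wpM2l// ltW.
by rewrite ler_peMr ?ler_pdivlMr ?mul1r ?mulr_gt0// !mulr_ge0 ?expR_ge0// ltW.
Qed.

Lemma chain_density_ge x : tp x <= bp / bm * p x.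
Proof.
have q0 := chain_mass_gt0 mw w0 bm0 Z0 EZ2 Gm Gp.
rewrite /chain_density /student_density -w2 ler_pdivrMr//.
have := chain_mass_le mw w0 bm0 EZ2 Gm Gp; move: (chain_mass h w) q0 => Zp q0 hZ.
have e : bp / bm * (w x * heat_mean h w x / Zp) * Z = w x * (heat_mean h w x / bm) * (bp * Z / Zp).
  by field; rewrite !gt_eqF ?expR_gt0.
rewrite e; apply: (@le_trans _ _ (w x * (heat_mean h w x / bm))).
  by rewrite expr2 ler_wpM2l ?(ltW (w0 x))// ler_pdivlMr// mulrC.
have G0 : 0 <= heat_mean h w x by exact: ltW (heat_mean_gt0 w0 bm0 Gm x).
by rewrite ler_peMr ?ler_pdivlMr ?mul1r// mulr_ge0 ?divr_ge0 ?expR_ge0// ltW.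
Qed.

Notation adm := (@admissible R a n h M).

Lemma student_iter_admissible (j : nat) (f : E -> R) : adm f -> adm (iter j (smooth (leb n) k) f).
Proof. exact: (iter_admissible h0 bm0 Gm Gp Z0 EZ a0). Qed.

Variable f : E -> R.
Hypothesis af : adm f.
Notation fN N := (iter N (smooth (leb n) k) f).
Notation rN N := (iter N (lmc_push c h) (fun x => f x * p x)).

(** Induction with [lmc_compare]: each step multiplies the moment of order A + 1 of the quotient of
    the LMC and chain densities by e^eta. *)
Lemma lmc_iter N : [/\ measurable_fun setT (rN N), forall x, 0 <= rN N x,
  (\int[leb n]_x (rN N x)%:E = 1)%E &
  exists v : E -> R, [/\ measurable_fun setT v, forall x, 0 <= v x,
    forall x, rN N x = v x * (fN N x * p x) &
    (\int[leb n]_x (v x `^ (A + 1) * (fN N x * p x))%:E <= (expR (N%:R * eta))%:E)%E]].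
Proof.
elim: N => [|N [mr r0 r1 [v [mv v0 rE vC]]]].
  have [mf f0 fM f1] := af; split => //=.
  - exact: measurable_funM.
  - by move=> x; rewrite mulr_ge0.
  exists (fun=> 1); split=> // [x|]; first by rewrite mul1r.
  rewrite mul0r expR0 -f1 le_eqVlt; apply/orP; left; apply/eqP; apply: eq_eint => x.
  by rewrite powR1 mul1r.
have [mf f0 fM f1] := student_iter_admissible N af.
have [v' [mv' v'0 r'E v'C]] := lmc_compare c0 h0 n0 A1 hc2 hAc mp p0 mf f0 fM mr r0 r1 mv v0 rE rev vC.
split=> //=.
- exact: measurable_lmc_push.
- exact: (lmc_push_ge0 c h0 mr r0 r1).
- exact: (lmc_push_total c h0 mr r0 r1).
exists v'; split=> //; apply: (le_trans v'C); rewrite lee_fin -expRD ler_expR.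
by rewrite -[N.+1%:R]natr1 [leRHS]mulrDl mul1r.
Qed.

(** At A = 1 the controlled moment is E v^2, and E v = 1, so E (v - 1)^2 = E v^2 - 1. *)
Lemma lmc_chi2 N : A = 1 -> exists v : E -> R, [/\ measurable_fun setT v, forall x, 0 <= v x,
  forall x, rN N x = v x * (fN N x * p x) &
  (\int[leb n]_x ((v x - 1) ^+ 2 * (fN N x * p x))%:E <= (expR (N%:R * eta) - 1)%:E)%E].
Proof.
move=> A11; have [mr r0 r1 [v [mv v0 rE vC]]] := lmc_iter N.
have [mf f0 fM f1] := student_iter_admissible N af.
exists v; split=> //.
have mfp : measurable_fun setT (fun x => fN N x * p x) by exact: measurable_funM.
have fp0 x : 0 <= fN N x * p x by rewrite mulr_ge0.
have mvf : measurable_fun setT (fun x => v x * (fN N x * p x)) by exact: measurable_funM.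
have vf0 x : 0 <= v x * (fN N x * p x) by rewrite mulr_ge0.
have mv2 : measurable_fun setT (fun x => v x ^+ 2 * (fN N x * p x)).
  by apply: measurable_funM => //; exact: measurable_funX.
have vf20 x : 0 <= v x ^+ 2 * (fN N x * p x) by rewrite mulr_ge0// sqr_ge0.
have md : measurable_fun setT (fun x => (v x - 1) ^+ 2 * (fN N x * p x)).
  by apply: measurable_funM => //; apply: measurable_funX; exact: measurable_funB.
have d0 x : 0 <= (v x - 1) ^+ 2 * (fN N x * p x) by rewrite mulr_ge0// sqr_ge0.
have v1 : (\int[leb n]_x (v x * (fN N x * p x))%:E = 1)%E.
  by rewrite -r1; apply: eq_eint => x; rewrite rE.
have key : (\int[leb n]_x ((v x - 1) ^+ 2 * (fN N x * p x))%:E + 2%:E =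
    \int[leb n]_x (v x ^+ 2 * (fN N x * p x))%:E + 1)%E.
  have -> : (2%:E = \int[leb n]_x (2 * (v x * (fN N x * p x)))%:E :> \bar R)%E.
    by rewrite (eintZ (leb n) (ler0n R 2) mvf vf0) v1 mule1.
  have m2v : measurable_fun setT (fun x => 2 * (v x * (fN N x * p x))) by exact: measurable_funM.
  rewrite -(eintD (leb n) md m2v d0); last by move=> x; rewrite mulr_ge0.
  rewrite -f1 -(eintD (leb n) mv2 mfp vf20 fp0).
  by apply: eq_eint => x; ring.
have : (\int[leb n]_x (v x ^+ 2 * (fN N x * p x))%:E <= (expR (N%:R * eta))%:E)%E.
  apply: le_trans vC; apply: eq_lexx; apply: eq_eint => x.
  by rewrite -powR_mulrn// A11.
have v20 := eint_ge0 (leb n) vf20.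
move: key v20; case: (\int[leb n]_x (v x ^+ 2 * (fN N x * p x))%:E)%E => [s| |].
- case: (\int[leb n]_x ((v x - 1) ^+ 2 * (fN N x * p x))%:E)%E => [u| |]//.
  by rewrite -!EFinD => -[us] _; rewrite !lee_fin; move: us; lra.
- by move=> _ _; rewrite leye_eq.
- by move=> _; rewrite leeNy_eq.
Qed.

(** A weak triangle inequality for Renyi divergences. Under the law fN p, Cauchy-Schwarz splits v^q
    fN^(q-1) into the moment of v of order 2q = A + 1 and the moment of fN of order 2q - 1 under p.
    Passing from p to the target costs (bp/bm)^(q-1). *)
Lemma lmc_renyi N q : 2 <= q -> A = 2 * q - 1 ->
  (\int[leb n]_x ((rN N x / tp x) `^ q * tp x)%:E <=
   ((bp / bm) `^ (q - 1) * expR (N%:R * eta / 2 + (q - 1) * renyi_mean (leb n) p (2 * q - 1) (fN N)))%:E)%E.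
Proof.
move=> q2 Aq; have [mr r0 r1 [v [mv v0 rE vC]]] := lmc_iter N.
have [mf f0 fM f1] := student_iter_admissible N af.
have t0 := student_density_gt0.
have q0 : 0 < q by lra.
have q10 : 0 <= q - 1 by lra.
pose u x := Num.sqrt (fN N x * p x).
have fp0 x : 0 <= fN N x * p x by rewrite mulr_ge0.
have mu : measurable_fun setT u by apply: measurable_sqrt; exact: measurable_funM.
have u0 x : 0 <= u x by exact: sqrtr_ge0.
have u2 x : u x ^+ 2 = fN N x * p x by rewrite sqr_sqrtr.
pose F1 x := v x `^ q * u x. pose F2 x := fN N x `^ (q - 1) * u x.
have mF1 : measurable_fun setT F1 by apply: measurable_funM => //; exact: measurable_powRf.
have mF2 : measurable_fun setT F2 by apply: measurable_funM => //; exact: measurable_powRf.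
have F10 x : 0 <= F1 x by rewrite mulr_ge0 ?powR_ge0.
have F20 x : 0 <= F2 x by rewrite mulr_ge0 ?powR_ge0.
have sq (x s : R) : (x `^ s) ^+ 2 = x `^ (s * 2).
  by rewrite -powR_mulrn ?powR_ge0// -powRrM.
have e1 : (\int[leb n]_x (F1 x ^+ 2)%:E <= (expR (N%:R * eta))%:E)%E.
  apply: le_trans vC; apply: eq_lexx; apply: eq_eint => x.
  by rewrite /F1 exprMn u2 sq Aq; congr (_ `^ _ * _); ring.
have Q2 : 2 <= 2 * q - 1 by lra.
have F1' := mean_pow_ge1 mp p0 student_chain_density_int Q2 mf f0 fM f1.
have e2 : (\int[leb n]_x (F2 x ^+ 2)%:E <= (expR ((2 * q - 2) * renyi_mean (leb n) p (2 * q - 1) (fN N)))%:E)%E.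
  have fB x : fN N x `^ (2 * q - 1) <= M `^ (2 * q - 1).
    by apply: ge0_ler_powR; rewrite ?nnegrE//; [lra|exact: le_trans M1].
  have -> : expR ((2 * q - 2) * renyi_mean (leb n) p (2 * q - 1) (fN N)) = mean (leb n) p (fun x => fN N x `^ (2 * q - 1)).
    rewrite /renyi_mean (_ : (2 * q - 2) * _ = ln (mean (leb n) p (fun x => fN N x `^ (2 * q - 1)))); last first.
      by field; rewrite gt_eqF//; lra.
    by rewrite lnK// posrE (lt_le_trans ltr01).
  rewrite -(meanE mp p0 student_chain_density_int (measurable_powRf _ mf) (fun x => powR_ge0 _ _) fB).
  apply: eq_lexx; apply: eq_eint => x; rewrite /F2 exprMn u2 sq mulrA; congr (_ * _).
  rewrite mulrC (_ : (q - 1) * 2 = (2 * q - 1) - 1); last by ring.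
  by rewrite mulr_powRB1//; lra.
have [I [EI I0 I2]] := cauchy_schwarz mF1 mF2 F10 F20 e1 e2.
have IE : I <= expR (N%:R * eta / 2 + (q - 1) * renyi_mean (leb n) p (2 * q - 1) (fN N)).
  rewrite -(@ler_pXn2r _ 2)// ?nnegrE ?expR_ge0//; apply: (le_trans I2).
  rewrite -expRM_natl -expRD ler_expR; apply: eq_lexx; move: (N%:R * _) => s; by field.
have b0 : 0 < bp / bm by rewrite divr_gt0 ?expR_gt0.
have mF12 : measurable_fun setT (fun x => F1 x * F2 x) by exact: measurable_funM.
apply: (@le_trans _ _ (((bp / bm) `^ (q - 1))%:E * \int[leb n]_x (F1 x * F2 x)%:E)%E); last first.
  by rewrite EI -EFinM lee_fin ler_wpM2l ?powR_ge0.
rewrite -(eintZ (leb n) (powR_ge0 _ _) mF12); last by move=> x; rewrite mulr_ge0.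
have mtp := measurable_student_density.
apply: le_eint.
- apply: measurable_funM => //; apply: measurable_powRf; apply: measurable_funM => //.
  exact: (measurableT_comp (@measurable_invr R) mtp).
- exact: measurable_funM.
- by move=> x; rewrite mulr_ge0 ?powR_ge0// ltW.
move=> x; have tx := t0 x; have px := student_chain_density_gt0 x.
have -> : F1 x * F2 x = v x `^ q * fN N x `^ (q - 1) * (fN N x * p x).
  by rewrite /F1 /F2 -u2; ring.
rewrite rE.
have -> : v x * (fN N x * p x) / tp x = v x * fN N x * (p x / tp x) by field; rewrite gt_eqF.
have pt0 : 0 <= p x / tp x by rewrite divr_ge0 ?ltW.
rewrite (powRM q (mulr_ge0 (v0 x) (f0 x)) pt0) (powRM q (v0 x) (f0 x)).
have -> : (p x / tp x) `^ q = (p x / tp x) * (p x / tp x) `^ (q - 1) by rewrite mulr_powRB1.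
have -> : v x `^ q * fN N x `^ q * (p x / tp x * (p x / tp x) `^ (q - 1)) * tp x =
  (p x / tp x) `^ (q - 1) * (v x `^ q * fN N x `^ q * p x) by field; rewrite gt_eqF.
have -> : v x `^ q * fN N x `^ (q - 1) * (fN N x * p x) = v x `^ q * fN N x `^ q * p x.
  by rewrite -(mulr_powRB1 (f0 x) q0); ring.
apply: ler_wpM2r; first exact: mulr_ge0 (mulr_ge0 (powR_ge0 _ _) (powR_ge0 _ _)) (ltW px).
apply: ge0_ler_powR; rewrite ?nnegrE// ?(ltW b0)//.
by rewrite ler_pdivrMr//; exact: chain_density_le.
Qed.

End lmc_decay.

Section student_decay.
Context {R : realType}.
Notation chi n h c := (expR (34 * n%:R * h * c + 2 * h * c ^+ 2)).

Lemma expR_half_le2 (s : R) : s <= 2^-1 -> expR s <= 2.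
Proof.
move=> s1; rewrite -[expR s]invrK -expRN -[leRHS]invrK lef_pV2 ?posrE ?expR_gt0 ?invr_gt0//.
by have := expR_ge1Dx (- s); lra.
Qed.

(** [two_phase_decay] fed with [weak_poincare] at bandwidth 2h and with the two-sided bounds on the
    heat mean. The smallness of 34 n h c + 2 h c^2 yields bp^2 <= 2 and bp <= 2 bm. *)
Lemma student_chain_decay (a : R) : 0 < a -> exists C : R, 1 <= C /\
  forall (n N : nat) (h Z M q e : R) (f : 'rV[R]_n -> R) (c := (a + n%:R / 2) / 2)
    (D1 := (8 * C * M `^ q) `^ a^-1) (D2 := (8 * C * M `^ q / e) `^ a^-1)
    (t := renyi_mean (leb n) (chain_density h (wgt c))),
  (0 < n)%N -> 0 < h <= 1 -> 64 * h * c <= 1 -> 34 * n%:R * h * c + 2 * h * c ^+ 2 <= 4^-1 ->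
  0 < Z -> (\int[leb n]_x (wgt (a + n%:R / 2) x)%:E = Z%:E)%E -> 1 <= M -> 2 <= q -> 0 < e <= 1 ->
  admissible a h M f -> 1024 * n%:R ^+ 2 * (2 * h * D2) <= 1 ->
  8 * C * n%:R * D1 * (q - 1) * t q f + 4 * C * n%:R * D2 * (q - 1) * ln (2 / e) + h <= N%:R * h ->
  t q (iter N (smooth (leb n) (chain_kernel h (wgt c))) f) <= e.
Proof.
move=> a0; have [C0 [C00 wp]] := weak_poincare a0; exists (C0 + 1); split; first lra.
move=> n N h Z M q e f c D1 D2 t n0 /andP[h0 h1] hc64 hs Z0 EZ M1 q2 e01 af small hN.
have c0 : 0 < c by rewrite divr_gt0// ltr_wpDr// divr_ge0.
have bm0 : 0 < expR (- (2 * n%:R * h * c)) by exact: expR_gt0.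
have Gm x : expR (- (2 * n%:R * h * c)) * wgt c (x : 'rV[R]_n) <= heat_mean h (wgt c) x.
  exact: heat_mean_wgt_ge (ltW c0) h0 x.
have Gp x := heat_mean_wgt_le (ltW c0) h0 (x : 'rV[R]_n) hc64.
have nhc : 0 <= n%:R * h * c := mulr_ge0 (mulr_ge0 (ler0n R n) (ltW h0)) (ltW c0).
have hcc : 0 <= h * c ^+ 2 := mulr_ge0 (ltW h0) (sqr_ge0 c).
have bp2 : expR (32 * n%:R * h * c + 2 * h * c ^+ 2) ^+ 2 <= 2.
  by rewrite -expRM_natl; apply: expR_half_le2; move: nhc hcc hs; clear; lra.
have bpm : expR (32 * n%:R * h * c + 2 * h * c ^+ 2) <= 2 * expR (- (2 * n%:R * h * c)).
  rewrite -ler_pdivrMr ?expR_gt0// -expRN -expRD; apply: expR_half_le2; move: nhc hcc hs; clear; lra.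
have C1 : 0 < C0 + 1 by move: C00; clear; lra.
have q10 : 0 < q - 1 by move: q2; clear; lra.
have np : 0 < n%:R :> R by rewrite ltr0n.
have wp' (U B : R) (g : 'rV[R]_n -> R) : 0 <= U -> 1024 * n%:R ^+ 2 * (2 * h * expR U) <= 1 -> measurable_fun setT g ->
  (forall x, 0 <= g x) -> (forall x, g x <= B) -> _ := fun U0 s mg g0 gB =>
  wp n (2 * h) U B Z g n0 (mulr_gt0 (ltr0n R 2) h0) U0 s mg g0 gB EZ.
pose X1 := 8 * (C0 + 1) * n%:R * D1 * (q - 1) * t q f.
pose X2 := 4 * (C0 + 1) * n%:R * D2 * (q - 1) * ln (2 / e).
have t0 : 0 <= t q f by exact: (renyi_mean_ge0 bm0 Gm Gp Z0 EZ q2 af).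
have X10 : 0 <= X1 := mulr_ge0 (mulr_ge0 (mulr_ge0 (mulr_ge0 (mulr_ge0 (ler0n R 8) (ltW C1)) (ler0n R n)) (powR_ge0 _ _)) (ltW q10)) t0.
have X20 : 0 <= X2.
  have /andP[e0 e1] := e01.
  have l0 : 0 <= ln (2 / e) by rewrite ln_ge0// ler_pdivlMr//; move: e1; clear; lra.
  exact: mulr_ge0 (mulr_ge0 (mulr_ge0 (mulr_ge0 (mulr_ge0 (ler0n R 4) (ltW C1)) (ler0n R n)) (powR_ge0 _ _)) (ltW q10)) l0.
(* The length of the linear phase, rounded up; the summand h in the time condition pays for the
   rounding. *)
pose k1 := (Num.truncn (X1 / h)).+1.
have k1l : X1 <= k1%:R * h.
  rewrite -ler_pdivrMr//; apply: ltW; exact: truncnS_gt.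
have k1u : k1%:R * h <= X1 + h.
  rewrite -natr1 mulrDl mul1r lerD2r -ler_pdivlMr// truncn_le// divr_ge0 ?(ltW h0)//.
have kN : (k1 <= N)%N.
  rewrite -(ler_nat R) -(ler_pM2r h0); apply: (le_trans k1u); apply: le_trans hN.
  by rewrite lerD2r -/X1 -/X2 lerDl.
have k2l : X2 <= (N - k1)%:R * h.
  by rewrite natrB// mulrBl; move: hN k1u; rewrite -/X1 -/X2; clear; lra.
have := two_phase_decay n0 h0 h1 bm0 Gm Gp bp2 bpm Z0 EZ q2 a0 M1 C00 wp' e01 af small k1l k2l.
by rewrite subnK.
Qed.

Notation sd a n Z := (@student_density R a n Z).

(* The densities with respect to the student law and to the invariant law of the chain differ by a factor
   [chi n h c], which is close to [1]. *)
Lemma student_admissible (a : R) n (h Z M q : R) (g : 'rV[R]_n -> R)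
    (c := (a + n%:R / 2) / 2) (f := fun x => g x * (sd a n Z x / chain_density h (wgt c) x)) :
  (0 < n)%N -> 0 < a -> 0 < h -> 64 * h * c <= 1 -> 0 < Z ->
  (\int[leb n]_x (wgt (a + n%:R / 2) x)%:E = Z%:E)%E -> 2 <= q -> 1 <= M ->
  measurable_fun setT g -> (forall x, 0 <= g x) -> (forall x, g x <= M) ->
  (\int[leb n]_x (g x * sd a n Z x)%:E = 1)%E ->
  [/\ admissible a h (chi n h c * M) f, (fun x => f x * chain_density h (wgt c) x) = (fun x => g x * sd a n Z x) &
    renyi_mean (leb n) (chain_density h (wgt c)) q f <= renyi_mean (leb n) (sd a n Z) q g + (34 * n%:R * h * c + 2 * h * c ^+ 2)].
Proof.
move=> n0 a0 h0 hc Z0 EZ q2 M1 mg g0 gM g1.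
have c0 : 0 < c by exact: student_scale_gt0.
have pp (x : 'rV[R]_n) : 0 < chain_density h (wgt c) x by exact: (student_chain_density_gt0 a0 h0 Z0 EZ hc x).
have tp (x : 'rV[R]_n) : 0 < sd a n Z x by exact: student_density_gt0 Z0 x.
have mp : measurable_fun setT (chain_density h (@wgt R n c)) by exact: measurable_student_chain_density.
have mt : measurable_fun setT (sd a n Z) by exact: measurable_student_density.
have p1 : (\int[leb n]_x (chain_density h (@wgt R n c) x)%:E = 1)%E by exact: (student_chain_density_int a0 h0 Z0 EZ hc).
have chiE : expR (32 * n%:R * h * c + 2 * h * c ^+ 2) / expR (- (2 * n%:R * h * c)) = chi n h c.
  by rewrite -expRN -expRD; congr expR; ring.
have tpp (x : 'rV[R]_n) : sd a n Z x <= chi n h c * chain_density h (wgt c) x.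
  by rewrite -chiE; exact: (chain_density_ge a0 h0 Z0 EZ hc x).
have c00 : 0 < chi n h c by exact: expR_gt0.
have fp : (fun x => f x * chain_density h (wgt c) x) = (fun x => g x * sd a n Z x).
  by apply/funext => x; rewrite /f -mulrA divfK// gt_eqF.
have rat0 (x : 'rV[R]_n) : 0 <= sd a n Z x / chain_density h (wgt c) x by rewrite divr_ge0// ltW.
have ratc (x : 'rV[R]_n) : sd a n Z x / chain_density h (wgt c) x <= chi n h c by rewrite ler_pdivrMr.
have mrat : measurable_fun setT (fun x => sd a n Z x / chain_density h (wgt c) x).
  by apply: measurable_funM => //; exact: (measurableT_comp (@measurable_invr R) mp).
have mf : measurable_fun setT f by exact: measurable_funM.
have f0 x : 0 <= f x by rewrite mulr_ge0.
have fM x : f x <= chi n h c * M by rewrite mulrC ler_pM.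
have f1 : (\int[leb n]_x (f x * chain_density h (wgt c) x)%:E = 1)%E.
  by rewrite -g1; apply: eq_eint => x; have := congr1 (fun u => u x) fp.
split=> //.
have q0 : 0 <= q by lra.
have t1 : (\int[leb n]_x (sd a n Z x)%:E = 1)%E.
  under eq_eint do rewrite /student_density mulrC.
  rewrite eintZ ?invr_ge0 ?(ltW Z0)//; [|exact: (measurable_wgt _ (f := id))|by move=> x; exact: wgt_ge0].
  by rewrite EZ -EFinM mulVf// gt_eqF.
have p0 x := ltW (pp x). have t0 x := ltW (tp x).
have F1 := mean_pow_ge1 mp p0 p1 q2 mf f0 fM f1.
have G1 := mean_pow_ge1 mt t0 t1 q2 mg g0 gM g1.
have gB x : g x `^ q <= M `^ q by apply: ge0_ler_powR; rewrite ?nnegrE// (le_trans (g0 x)).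
have fB x : f x `^ q <= (chi n h c * M) `^ q by apply: ge0_ler_powR; rewrite ?nnegrE// (le_trans (f0 x)).
have FG : mean (leb n) (chain_density h (wgt c)) (fun x => f x `^ q) <=
    chi n h c `^ (q - 1) * mean (leb n) (sd a n Z) (fun x => g x `^ q).
  rewrite -lee_fin EFinM -(meanE mp p0 p1 (measurable_powRf q mf) (fun x => powR_ge0 _ _) fB).
  rewrite -(meanE mt t0 t1 (measurable_powRf q mg) (fun x => powR_ge0 _ _) gB).
  have mgt : measurable_fun setT (fun x => g x `^ q * sd a n Z x).
    by apply: measurable_funM => //; exact: measurable_powRf.
  rewrite -(eintZ (leb n) (powR_ge0 _ _) mgt); last by move=> x; rewrite mulr_ge0 ?powR_ge0.
  apply: le_eint.
  - by apply: measurable_funM => //; exact: measurable_powRf.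
  - exact: measurable_funM.
  - by move=> x; rewrite mulr_ge0 ?powR_ge0.
  move=> x; rewrite /f powRM//.
  have -> : (sd a n Z x / chain_density h (wgt c) x) `^ q = (sd a n Z x / chain_density h (wgt c) x) *
      (sd a n Z x / chain_density h (wgt c) x) `^ (q - 1) by rewrite mulr_powRB1//; lra.
  have -> : g x `^ q * (sd a n Z x / chain_density h (wgt c) x * (sd a n Z x / chain_density h (wgt c) x) `^ (q - 1)) * chain_density h (wgt c) x =
     (sd a n Z x / chain_density h (wgt c) x) `^ (q - 1) * (g x `^ q * sd a n Z x).
    move: (_ `^ (q - 1)) => X; field; rewrite gt_eqF//; exact: pp.
  apply: ler_wpM2r; first by rewrite mulr_ge0 ?powR_ge0.
  by apply: ge0_ler_powR; rewrite ?nnegrE// ?(ltW c00)//; lra.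
have cq0 : 0 < chi n h c `^ (q - 1) by rewrite powR_gt0.
have Fp := lt_le_trans ltr01 F1. have Gp := lt_le_trans ltr01 G1.
have : ln (mean (leb n) (chain_density h (wgt c)) (fun x => f x `^ q)) <=
   ln (chi n h c `^ (q - 1) * mean (leb n) (sd a n Z) (fun x => g x `^ q)).
  by rewrite ler_ln ?posrE// mulr_gt0.
rewrite lnM ?posrE// ln_powR expRK /renyi_mean => L.
have iq : 0 < q - 1 by lra.
rewrite ler_pdivrMr// mulrDl divfK ?gt_eqF//; apply: (le_trans L).
by rewrite addrC lerD2l mulrC.
Qed.

(** Error budget in units of q - 1: e/2 for the chain at order Q = 2q - 1, e/4 for the change from p
    to the target through s, and e/4 for the accumulated kernel ratios, which enter [lmc_renyi] as
    half of N eta. *)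
Lemma lmc_density_decay (a : R) : 0 < a -> exists C : R, 1 <= C /\
  forall (n N : nat) (h Z M q e : R) (g : 'rV[R]_n -> R) (c := (a + n%:R / 2) / 2)
    (s := 34 * n%:R * h * c + 2 * h * c ^+ 2) (Q := 2 * q - 1)
    (D1 := (16 * C * M `^ Q) `^ a^-1) (D := (32 * C * M `^ Q / e) `^ a^-1),
  (0 < n)%N -> 0 < h <= 1 -> 64 * h * c <= 1 -> h * c ^+ 2 <= 1 -> 40 * h * Q * c <= 1 ->
  Q * s <= 4^-1 -> s <= e / 4 -> N%:R * (1064 * n%:R * h ^+ 2 * Q ^+ 2 * c ^+ 2) <= e / 2 ->
  0 < Z -> (\int[leb n]_x (wgt (a + n%:R / 2) x)%:E = Z%:E)%E -> 1 <= M -> 2 <= q -> 0 < e <= 1 ->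
  measurable_fun setT g -> (forall x, 0 <= g x) -> (forall x, g x <= M) ->
  (\int[leb n]_x (g x * sd a n Z x)%:E = 1)%E ->
  1024 * n%:R ^+ 2 * (2 * h * D) <= 1 ->
  8 * C * n%:R * (Q - 1) * (D1 * (renyi_mean (leb n) (sd a n Z) Q g + 1) + D * ln (4 / e)) + 1 <= N%:R * h ->
  (\int[leb n]_x ((iter N (lmc_push c h) (fun x => g x * sd a n Z x) x / sd a n Z x) `^ q * sd a n Z x)%:E
    <= (expR ((q - 1) * e))%:E)%E.
Proof.
move=> a0; have [C [C1 dec]] := student_chain_decay a0; exists C; split=> //.
move=> n N h Z M q e g c s Q D1 D n0 h01 hc64 hc2 hQc Qs se Ne Z0 EZ M1 q2 e01 mg g0 gM g1 small hN.
have /andP[h0 h1] := h01; have /andP[e0 e1] := e01.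
have Q2 : 2 <= Q by rewrite /Q; move: q2; clear; lra.
have Q1 : 1 <= Q by move: Q2; clear; lra.
have s0 : 0 <= s.
  have c0 : 0 < c by exact: student_scale_gt0.
  exact: (addr_ge0 (mulr_ge0 (mulr_ge0 (mulr_ge0 (ler0n R 34) (ler0n R n)) (ltW h0)) (ltW c0)) (mulr_ge0 (mulr_ge0 (ler0n R 2) (ltW h0)) (sqr_ge0 c))).
have [af fp tf] := student_admissible n0 a0 h0 hc64 Z0 EZ Q2 M1 mg g0 gM g1.
rewrite -/c -/s in af fp tf.
set f := (fun x => g x * _) in af fp tf.
have chi1 : 1 <= expR s by rewrite -expR0 ler_expR.
have M'1 : 1 <= expR s * M by rewrite mulr_ege1.
have M0 : 0 <= M := le_trans ler01 M1.
have C0 : 0 <= C := le_trans ler01 C1.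
have MQ : (expR s * M) `^ Q <= 2 * M `^ Q.
  rewrite powRM ?expR_ge0// ler_wpM2r ?powR_ge0// -expRM mulrC; apply: expR_half_le2; move: Qs; clear; lra.
have MQ1 : 1 <= M `^ Q by rewrite -(powRr0 M); apply: ler_powR => //; exact: le_trans Q1.
have e2 : 0 < e / 2 <= 1 by move: e0 e1; clear => e0 e1; apply/andP; split; lra.
have ia : 0 <= a^-1 by rewrite invr_ge0 ltW.
have CM : 0 <= C * M `^ Q by rewrite mulr_ge0 ?powR_ge0.
have D2le : (8 * C * (expR s * M) `^ Q / (e / 2)) `^ a^-1 <= D.
  apply: ge0_ler_powR; rewrite ?nnegrE//.
  - by rewrite divr_ge0 ?divr_ge0 ?(ltW e0)// !mulr_ge0 ?powR_ge0.
  - by rewrite divr_ge0 ?(ltW e0)// !mulr_ge0 ?powR_ge0.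
  rewrite (_ : 8 * C * (expR s * M) `^ Q / (e / 2) = 16 * C * (expR s * M) `^ Q / e); last by field; rewrite gt_eqF.
  rewrite ler_wpM2r ?invr_ge0 ?(ltW e0)//.
  by have := ler_wpM2l (mulr_ge0 (ler0n R 16) C0) MQ; move: (_ `^ Q) (_ `^ Q); clear => *; lra.
have D1le : (8 * C * (expR s * M) `^ Q) `^ a^-1 <= D1.
  apply: ge0_ler_powR; rewrite ?nnegrE//.
  - by rewrite !mulr_ge0 ?powR_ge0.
  - by rewrite !mulr_ge0 ?powR_ge0.
  by have := ler_wpM2l (mulr_ge0 (ler0n R 8) C0) MQ; move: (_ `^ Q) (_ `^ Q); clear => *; lra.
have sm : 1024 * n%:R ^+ 2 * (2 * h * (8 * C * (expR s * M) `^ Q / (e / 2)) `^ a^-1) <= 1.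
  exact: (mul3_le1 (mulr_ge0 (ler0n R 1024) (sqr_ge0 _)) (mulr_ge0 (ler0n R 2) (ltW h0)) D2le small).
have s4 : s <= 4^-1 by apply: le_trans Qs; rewrite ler_peMl.
have bn : 0 <= 8 * C * n%:R * (Q - 1) by rewrite !mulr_ge0// subr_ge0.
have t0 : 0 <= renyi_mean (leb n) (chain_density h (wgt c)) Q f.
  have c0 : 0 < c by exact: student_scale_gt0.
  have Gm (x : 'rV[R]_n) : expR (- (2 * n%:R * h * c)) * wgt c x <= heat_mean h (wgt c) x.
    exact: heat_mean_wgt_ge (ltW c0) h0 x.
  have Gp (x : 'rV[R]_n) := heat_mean_wgt_le (ltW c0) h0 x hc64.
  exact: (renyi_mean_ge0 (expR_gt0 _) Gm Gp Z0 EZ Q2 af).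
have l0 : 0 <= ln (2 / (e / 2)) by rewrite ln_ge0// ler_pdivlMr ?divr_gt0//; move: e1; clear; lra.
have lE : ln (2 / (e / 2)) = ln (4 / e) by congr ln; field; rewrite gt_eqF.
have D0 : 0 <= D by exact: powR_ge0.
have tN : 8 * C * n%:R * (8 * C * (expR s * M) `^ Q) `^ a^-1 * (Q - 1) * renyi_mean (leb n) (chain_density h (wgt c)) Q f +
    4 * C * n%:R * (8 * C * (expR s * M) `^ Q / (e / 2)) `^ a^-1 * (Q - 1) * ln (2 / (e / 2)) + h <= N%:R * h.
  apply: le_trans hN; apply: lerD => //.
  have u1 := ler_wpM2l bn (ler_pM (powR_ge0 _ _) t0 D1le (le_trans tf (_ : _ <= renyi_mean (leb n) (sd a n Z) Q g + 1))).
  have {}u1 := u1 ltac:(by rewrite lerD2l; apply: (le_trans s4); rewrite invf_le1// ler1n).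
  have u2 := ler_wpM2l bn (ler_wpM2r l0 D2le).
  have u4 : 0 <= 8 * C * n%:R * (Q - 1) * ((8 * C * (expR s * M) `^ Q / (e / 2)) `^ a^-1 * ln (2 / (e / 2))).
    by rewrite mulr_ge0// mulr_ge0 ?powR_ge0.
  rewrite -lE; move: u1 u2 u4; move: (_ `^ a^-1) (_ `^ a^-1) (ln _) (renyi_mean _ _ _ _) (renyi_mean _ _ _ _); clear => *; lra.
have rN := dec n N h Z (expR s * M) Q (e / 2) f n0 h01 hc64 s4 Z0 EZ M'1 Q2 e2 af sm tN.
have := lmc_renyi n0 a0 h0 M'1 Z0 EZ Q1 hc2 hQc hc64 af N q2 (erefl Q).
rewrite fp => H; apply: (le_trans H).
rewrite lee_fin.
have -> : expR (32 * n%:R * h * c + 2 * h * c ^+ 2) / expR (- (2 * n%:R * h * c)) = expR s.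
  by rewrite -expRN -expRD; congr expR; rewrite /s; ring.
rewrite -expRM -expRD ler_expR.
have q1 : 1 <= q - 1 by move: q2; clear; lra.
have q10 : 0 <= q - 1 by move: q2; clear; lra.
have v1 := ler_wpM2l q10 rN; have v2 := ler_wpM2l q10 se.
have v3 : e <= (q - 1) * e by rewrite ler_peMl// ltW.
rewrite -/Q; move: v1 v2 v3 Ne; rewrite -/f.
rewrite -/c; move: (renyi_mean _ _ _ _) (N%:R * _); clear => u1 u2; lra.
Qed.

End student_decay.

(** * Renyi divergences and the Student law in terms of densities *)

Section densities.
Context d (T : measurableType d) (R : realType).
Local Open Scope ereal_scope.

Lemma density_dominates (mu nu : {measure set T -> \bar R}) (h : T -> \bar R) :
  measurable_fun setT h ->
  (forall A, measurable A -> nu A = \int[mu]_(x in A) h x) -> nu `<< mu.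
Proof.
move=> mh hE; apply/null_content_dominatesP => A mA A0.
by rewrite hE// null_set_integral//; exact: measurable_funS mh.
Qed.

Lemma density_integral (mu : {sigma_finite_measure set T -> \bar R})
    (nu : {finite_measure set T -> \bar R}) (h f : T -> R) :
  measurable_fun setT h -> (forall x, 0 <= h x)%R ->
  (forall A, measurable A -> nu A = \int[mu]_(x in A) (h x)%:E) ->
  measurable_fun setT f -> (forall x, 0 <= f x)%R ->
  \int[nu]_x (f x)%:E = \int[mu]_x (f x * h x)%:E.
Proof.
move=> mh h0 hE mf f0.
have mh' : measurable_fun setT (EFin \o h) by exact/measurable_EFinP.
have numu : nu `<< mu := density_dominates mh' hE.
rewrite -(Radon_Nikodym_SigmaFinite.change_of_variables numu (f := EFin \o f))//; last exact/measurable_EFinP.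
have intf := Radon_Nikodym_SigmaFinite.f_integrable numu.
have ae : ae_eq mu setT (Radon_Nikodym_SigmaFinite.f nu mu) (EFin \o h).
  apply: integral_ae_eq => // A _ mA.
  by rewrite -(Radon_Nikodym_SigmaFinite.f_integral numu)// hE.
apply: ae_eq_integral => //.
- by apply: emeasurable_funM; [exact/measurable_EFinP|exact: measurable_int intf].
- by apply/measurable_EFinP; exact: measurable_funM.
- by apply: filterS ae => x /= e _; rewrite e// EFinM.
Qed.

Variables (rho pi : probability T R).

Section given_density.
Variable g : T -> R.
Hypotheses (mg : measurable_fun setT g) (g0 : forall x, (0 <= g x)%R)
  (gE : forall A, measurable A -> rho A = \int[pi]_(x in A) (g x)%:E).

Let dom : rho `<< pi.
Proof. by apply: (density_dominates (h := EFin \o g)) => //; exact/measurable_EFinP. Qed.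

Lemma density_ae : ae_eq pi setT (density rho pi) (EFin \o g).
Proof.
have cdom : charge_of_finite_measure rho `<< pi by [].
apply: integral_ae_eq => //.
- exact: Radon_Nikodym_integrable.
- exact/measurable_EFinP.
- by move=> A _ mA; rewrite -Radon_Nikodym_integral// -gE.
Qed.

Lemma renyiE (q : R) : (1 < q)%R ->
  renyi q rho pi = ((q - 1)^-1)%:E * lne (\int[pi]_x (g x `^ q)%:E).
Proof.
move=> q1; have q0 : q != 0%R by rewrite gt_eqF// (lt_trans _ q1).
rewrite /renyi; case: asboolP => // _; congr (_ * lne _).
rewrite powR_Lnorm//; apply: ae_eq_integral => //.
- apply: (measurableT_comp (@measurable_poweR _ q)); apply: measurableT_comp => //.
  exact: measurable_int (Radon_Nikodym_integrable _).
- by apply/measurable_EFinP; exact: measurable_powRf.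
- apply: filterS density_ae => x /= e _.
  by rewrite e// /= ger0_norm// poweR_EFin.
Qed.

Lemma renyi_le (q e : R) : (1 < q)%R ->
  \int[pi]_x (g x `^ q)%:E <= (expR ((q - 1) * e))%:E -> renyi q rho pi <= e%:E.
Proof.
move=> q1; rewrite renyiE//.
have q10 : (0 < q - 1)%R by rewrite subr_gt0.
have : 0 <= \int[pi]_x (g x `^ q)%:E by apply: eint_ge0 => x; exact: powR_ge0.
case: (\int[pi]_x (g x `^ q)%:E) => [r r0|//|//]; rewrite lee_fin => rle /=.
case: ifPn => [_|]; first by rewrite gt0_muleNy ?leNye// lte_fin invr_gt0.
rewrite -ltNge => rp; rewrite -EFinM lee_fin mulrC ler_pdivrMr//.
by rewrite -ler_expR lnK// [X in (_ <= expR X)%R]mulrC.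
Qed.

End given_density.

(** Truncating the Radon-Nikodym derivative to [0, M], with M its essential supremum, gives a
    version of the density bounded everywhere; M >= 1 because the total mass is 1. *)
Lemma renyi_infty_density : renyi_infty rho pi < +oo -> exists (g : T -> R) (M : R),
  [/\ measurable_fun setT g, (forall x, 0 <= g x <= M)%R, (1 <= M)%R,
      forall A, measurable A -> rho A = \int[pi]_(x in A) (g x)%:E &
      fine (renyi_infty rho pi) = ln M].
Proof.
rewrite /renyi_infty; case: asboolP => // dom.
have cdom : charge_of_finite_measure rho `<< pi by [].
set D := density rho pi; have intD : pi.-integrable setT D := Radon_Nikodym_integrable cdom.
have mD := measurable_int _ intD.
have pi1 : pi setT = 1 by exact: probability_setT.
have := Lnorm_ge0 pi +oo D; rewrite unlock /= pi1 lte01; set L := ess_sup_inf.ess_sup pi (abse \o D) => L0 Loo.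
have LD : \forall x \ae pi, `|D x| <= L by exact: ess_sup_inf.ess_sup_ge.
have D0 : \forall x \ae pi, 0 <= D x.
  have := ae_eq_Radon_Nikodym_SigmaFinite dom measurableT; apply: filterS => x /= H.
  rewrite /D /density -H//; exact: (Radon_Nikodym_SigmaFinite.f_ge0 dom).
have [M LM] : exists M, L = M%:E.
  by move: L0 Loo; case: (L) => [M| |]//; exists M.
have M0 : (0 <= M)%R by move: L0; rewrite LM lee_fin.
pose g x := Num.min (Num.max (fine (D x)) 0%R) M.
have ge (x : T) : (0 <= g x <= M)%R.
  by rewrite le_min le_max lexx orbT ge_min lexx orbT M0.
have mg : measurable_fun setT g.
  apply: measurable_minr => //; apply: measurable_maxr => //.
  exact: (measurableT_comp (@fine_measurable _ setT measurableT)).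
have gE A : measurable A -> rho A = \int[pi]_(x in A) (g x)%:E.
  move=> mA; rewrite -[LHS]/(charge_of_finite_measure rho A) (Radon_Nikodym_integral cdom mA).
  apply: ae_eq_integral => //.
  - exact: measurable_funTS.
  - by apply/measurable_EFinP; exact: measurable_funTS.
  - apply: filterS2 LD D0 => x; rewrite LM => Dm Dp _; change (D x = (g x)%:E).
    rewrite /g; case: (D x) Dm Dp => [r| |]//=; rewrite !lee_fin => rM r0.
    by rewrite max_l// min_l// (le_trans (ler_norm r) rM).
have M1 : (1 <= M)%R.
  have : rho setT <= M%:E.
    rewrite gE//; apply: (@le_trans _ _ (\int[pi]_x (cst M%:E) x)).
      apply: ge0_le_integral => //.
      - by move=> x _; rewrite lee_fin; case/andP: (ge x).
      - exact/measurable_EFinP.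
      - by move=> x _; rewrite lee_fin; case/andP: (ge x).
    by rewrite integral_cst//= probability_setT mule1.
  by rewrite probability_setT lee_fin.
exists g, M; split; [exact: mg|exact: ge|exact: M1|exact: gE|].
by rewrite LM lne_EFin// (lt_le_trans ltr01 M1).
Qed.

End densities.

Section student_interface.
Context {R : realType}.
Local Open Scope ereal_scope.

Lemma exp_V_student n (nu : R) (x : 'rV[R]_n) :
  expR (- V_student nu x) = wgt (nu / 2 + n%:R / 2)%R x.
Proof.
have e : ((n%:R + nu) / 2 = nu / 2 + n%:R / 2 :> R)%R by rewrite mulrDl addrC.
by rewrite /wgt -e -enorm2.
Qed.

(** By [wgt_int] the mass of exp(-V) is finite and positive, so [gibbs] takes its normalised branch
    and not the Dirac default. *)
Lemma pi_studentE n (nu : R) : (0 < nu)%R -> exists Z : R, [/\ (0 < Z)%R,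
    \int[leb n]_x (wgt (nu / 2 + n%:R / 2)%R x)%:E = Z%:E &
    forall A, measurable A -> pi_student n nu A =
      \int[leb n]_(x in A) (student_density (nu / 2)%R Z x)%:E].
Proof.
move=> nu0; have a0 : (0 < nu / 2)%R by rewrite divr_gt0.
have b0 : (0 < nu / 2 + n%:R / 2)%R by rewrite ltr_pwDl// divr_ge0.
have [Ga [Ga0 GaE]] := gamma_int a0; have [Gb [Gb0 GbE]] := gamma_int b0.
have := wgt_int GaE Gb0 GbE.
set Z := (Ga / _)%R => ZE; exists Z.
have Z0 : (0 < Z)%R by rewrite divr_gt0// mulr_gt0// exprn_gt0// sqrtr_gt0 invr_gt0 pi_gt0.
split=> // A mA.
have VE B : exp_measure (V_student nu) B = \int[leb n]_(x in B) (wgt (nu / 2 + n%:R / 2)%R x)%:E.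
  by apply: eq_integral => x _; rewrite exp_V_student.
pose m : {measure set 'rV[R]_n -> \bar R} := exp_measure (V_student nu).
have mT : m setT = Z%:E by rewrite -ZE; exact: VE.
have -> : pi_student n nu A = m A * Z^-1%:E.
  change (mnormalize m (dirac (0%R : 'rV[R]_n)) A = m A * Z^-1%:E).
  by rewrite /mnormalize mT eqe gt_eqF.
have -> : m A = \int[leb n]_(x in A) (wgt (nu / 2 + n%:R / 2)%R x)%:E by exact: VE.
rewrite -ge0_integralZr//.
- by apply/measurable_EFinP; apply: measurable_funTS; exact: measurable_wgt.
- by move=> x _; rewrite lee_fin expR_ge0.
- by rewrite lee_fin invr_ge0 ltW.
Qed.

End student_interface.

(** * Laws of recursions driven by independent Gaussian noise *)

Section product_integrals.
Context {R : realType}.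
Local Open Scope ereal_scope.

Lemma integral_indic_EFin d (T : measurableType d) (m : {measure set T -> \bar R}) (A : set T)
    (f : T -> R) : measurable A ->
  \int[m]_(x in A) (f x)%:E = \int[m]_x (f x * \1_A x)%:E.
Proof.
move=> mA; rewrite integral_mkcond; apply: eq_integral => x _.
by rewrite patchE indicE; case: ifPn => xA; rewrite ?mulr1 ?mulr0.
Qed.

Lemma consrV0 n (x : 'rV[R]_n) t : consrV (x, t) ord0 ord0 = t.
Proof.
have -> : (ord0 : 'I_n.+1) = @lshift 1 n ord0 by apply/val_inj.
by rewrite /consrV (@row_mxEl _ 1 1 n) mxE.
Qed.

Lemma consrVS n (x : 'rV[R]_n) t i : consrV (x, t) ord0 (lift ord0 i) = x ord0 i.
Proof.
have -> : lift ord0 i = @rshift 1 n i by apply/val_inj.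
by rewrite /consrV (@row_mxEr _ 1 1 n).
Qed.

Lemma leb_prod_int n (g : 'I_n -> R -> R) (I : 'I_n -> R) :
  (forall i, measurable_fun setT (g i)) -> (forall i t, (0 <= g i t)%R) ->
  (forall i, \int[lebesgue_measure]_t (g i t)%:E = (I i)%:E) ->
  \int[leb n]_x (\prod_i g i (x ord0 i))%:E = (\prod_i I i)%:E.
Proof.
elim: n g I => [|n IH] g I mg g0 gI.
  under eq_integral do rewrite big_ord0.
  rewrite big_ord0 integral_cst//= mul1e; exact: diracT.
rewrite int_lebS; last 2 first.
- apply/measurable_EFinP; apply: measurable_prod => i _.
  exact: (measurableT_comp (mg i) (measurable_coord i)).
- by move=> x; rewrite lee_fin prodr_ge0.
have gn (i : 'I_n) := mg (lift ord0 i).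
transitivity (\int[leb n]_x (I ord0 * \prod_(i < n) g (lift ord0 i) (x ord0 i))%:E).
  apply: eq_integral => x _.
  under eq_integral do rewrite big_ord_recl consrV0.
  rewrite [RHS]EFinM -gI muleC -eintZ//.
  - apply: eq_integral => t _; rewrite mulrC; congr (_ * _)%:E%R.
    by apply: eq_bigr => i _; rewrite consrVS.
  - by apply: prodr_ge0.
  - exact: (mg ord0).
have I0 : (0 <= I ord0)%R by rewrite -lee_fin -gI; exact: eint_ge0.
rewrite eintZ//; last first.
- by move=> x; apply: prodr_ge0.
- apply: measurable_prod => i _.
  exact: (measurableT_comp (gn i) (measurable_coord i)).
by rewrite (IH (fun i => g (lift ord0 i)) (fun i => I (lift ord0 i)))// big_ord_recl EFinM.
Qed.

Definition box n (A : 'I_n -> set R) : set 'rV[R]_n := [set x | forall i, A i (x ord0 i)].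

Lemma boxE n (A : 'I_n -> set R) :
  box A = \bigcap_(i in [set: 'I_n]) ((fun x : 'rV[R]_n => x ord0 i) @^-1` A i).
Proof. by apply/seteqP; split => x /= H i; [move=> _|]; exact: H. Qed.

Lemma measurable_box n (A : 'I_n -> set R) : (forall i, measurable (A i)) -> measurable (box A).
Proof.
move=> mA; rewrite boxE; apply: fin_bigcap_measurable => // i _.
by rewrite -[X in measurable X]setTI; exact: measurable_coord.
Qed.

(** Boxes are stable under intersection and generate the sigma-algebra. *)
Lemma measure_box_unique n (m1 m2 : {measure set 'rV[R]_n -> \bar R}) : m1 setT < +oo ->
  (forall A, (forall i, measurable (A i)) -> m1 (box A) = m2 (box A)) ->
  forall A, measurable A -> m1 A = m2 A.
Proof.
move=> fin eqm A mA.
pose G := [set B : set 'rV[R]_n | exists C : 'I_n -> set R, (forall i, measurable (C i)) /\ B = box C].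
apply: (measure_unique G (fun=> setT)) => //.
- apply/seteqP; split; last first.
    apply: smallest_sub; first exact: sigma_algebra_measurable.
    by move=> _ [C [mC ->]]; exact: measurable_box.
  apply: smallest_sub; first exact: smallest_sigma_algebra.
  case: n => [|n] in m1 m2 fin eqm A mA G *; first by rewrite big_ord0.
  rewrite -bigcup_mkord_ord; apply: bigcup_sub => i Ii B [C mC <-].
  apply: sub_sigma_algebra; exists (fun j => if j == inord i then C else setT).
  split=> [j|]; first by case: ifP.
  rewrite setTI; apply/seteqP; split => x /= H.
    by move=> j; case: eqVneq => // ->.
  by have := H (inord i); rewrite eqxx.
- move=> _ _ [C [mC ->]] [D [mD ->]]; exists (fun i => C i `&` D i); split.
    by move=> i; exact: measurableI.
  by apply/seteqP; split => x /= => [[H1 H2] i|H]; split => // i; case: (H i).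
- move=> _; exists (fun=> setT); split => //.
  by apply/seteqP; split.
- by apply/seteqP; split => // x _; exists 0%N.
- by move=> _ [C [mC ->]]; exact: eqm.
Qed.

Lemma heat0_prod n (s : R) (x : 'rV[R]_n) : (0 < s)%R ->
  heat (s ^+ 2 / 2)%R 0%R x = (\prod_i normal_pdf 0 s (x ord0 i))%R.
Proof.
move=> s0; rewrite heatC /heat subr0 /gam.
have -> : normal_pdf 0 s = fun t => (normal_peak s * normal_fun 0 s t)%R by rewrite normal_pdfE ?gt_eqF.
rewrite big_split /=.
have p0 := pi_gt0 R; congr (_ * _)%R.
  rewrite prodr_const card_ord /normal_peak; congr (_ ^+ _)%R.
  have -> : ((4 * (s ^+ 2 / 2))^-1 / pi = (s ^+ 2 * pi *+ 2)^-1)%R.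
    by move: (pi : R) p0 => p p0; rewrite -mulr_natl; field; rewrite !gt_eqF.
  by rewrite sqrtrV// mulrn_wge0// mulr_ge0// ?sqr_ge0// ltW.
rewrite /normal_fun -expR_sum; congr expR.
rewrite /dot mulr_sumr -sumrN; apply: eq_bigr => i _.
by rewrite subr0 -mulr_natr; field; rewrite gt_eqF.
Qed.

End product_integrals.

Section laws.
Context d (O : measurableType d) {R : realType} (P : probability O R) (n : nat).
Notation E := 'rV[R]_n.
Implicit Types X Y Z : {mfun O >-> E}.
Local Open Scope ereal_scope.

Definition has_density Z (r : E -> R) : Prop :=
  forall A, measurable A -> P (Z @^-1` A) = \int[leb n]_(x in A) (r x)%:E.

Lemma centered_gaussian_density Z (s : R) : (0 < s)%R -> centered_gaussian P s Z ->
  has_density Z (heat (s ^+ 2 / 2)%R 0%R).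
Proof.
move=> s0 gZ.
have h0 : (0 < s ^+ 2 / 2)%R by rewrite divr_gt0 ?exprn_gt0.
have mheat : measurable_fun setT (fun x : E => heat (s ^+ 2 / 2)%R 0%R x).
  by apply: measurable_heat => //; exact: measurable_cst.
(* With the density written as exp(-V), [exp_measure] supplies the measure to be compared on
   boxes. *)
pose V (x : E) : R := (- ln (heat (s ^+ 2 / 2)%R 0%R x))%R.
have mV : measurable_fun setT V.
  apply: measurableT_comp => //; apply: measurableT_comp => //; exact: measurable_ln.
pose V' : {mfun E >-> R} := mfun_Sub (mem_set mV).
have VE A : exp_measure V' A = \int[leb n]_(x in A) (heat (s ^+ 2 / 2)%R 0%R x)%:E.
  by apply: eq_integral => x _; rewrite /= /V opprK lnK// posrE heat_gt0.
move=> A mA; rewrite -VE -[LHS]/(distribution P Z A).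
apply: measure_box_unique => //; first by apply: (le_lt_trans (probability_le1 (distribution P Z) measurableT)); rewrite ltry.
move=> B mB; change (P [set w | forall i, B i (Z w ord0 i)] = exp_measure V' (box B)).
rewrite VE gZ// integral_indic_EFin; last exact: measurable_box.
transitivity (\int[leb n]_x (\prod_i (normal_pdf 0 s (x ord0 i) * \1_(B i) (x ord0 i)))%:E); last first.
  apply: eq_integral => x _; rewrite heat0_prod// big_split/=; congr (_ * _)%:E%R.
  rewrite indicE; case: (boolP (x \in box B)) => [/set_mem H|/negP H].
    by apply: big1 => i _; rewrite indicE mem_set.
  have [i Hi] : exists i, ~ B i (x ord0 i).
    by apply/existsNP => H'; apply: H; rewrite inE.
  by rewrite (bigD1 i)//= indicE memNset// mul0r.
have fn i : normal_prob 0 s (B i) \is a fin_num.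
  exact: (@fin_num_measure _ _ _ (normal_prob 0 s : probability _ R) (B i) (mB i)).
rewrite (@leb_prod_int R n (fun i t => normal_pdf 0 s t * \1_(B i) t)%R (fun i => fine (normal_prob 0 s (B i)))); last 3 first.
- by move=> i; apply: measurable_funM; [exact: measurable_normal_pdf|exact: measurable_indic].
- by move=> i t; rewrite mulr_ge0// normal_pdf_ge0.
- move=> i; rewrite fineK//.
  by apply/esym; exact: (integral_indic_EFin (@lebesgue_measure R) (normal_pdf 0 s) (mB i)).
by rewrite (big_morph EFin EFinM (erefl 1)); apply: eq_bigr => i _; rewrite fineK.
Qed.

(** Extension from rectangles. Carrying the event [E0] along is what allows [noise_independent] to
    keep track of the later noises. *)
Lemma pair_law X Y (E0 : set O) : measurable E0 ->
  (forall A B, measurable A -> measurable B ->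
    P (X @^-1` A `&` Y @^-1` B `&` E0) = P E0 * (P (X @^-1` A) * P (Y @^-1` B))) ->
  forall S, measurable S -> P ((fun w => (X w, Y w)) @^-1` S `&` E0) =
    P E0 * (distribution P X \x distribution P Y) S.
Proof.
move=> mE ind S mS.
have mXY : measurable_fun setT (fun w => (X w, Y w)) by exact: measurable_fun_pair.
pose m1 := pushforward (mrestr P mE) (fun w => (X w, Y w)).
have PE0 : (0 <= fine (P E0))%R by exact: fine_ge0.
pose m2 := mscale (NngNum PE0) (distribution P X \x distribution P Y).
have PE : P E0 = (fine (P E0))%:E by rewrite fineK// fin_num_measure.
have m2E A : m2 A = P E0 * (distribution P X \x distribution P Y) A by rewrite /m2 /mscale /= PE.
rewrite -m2E -[LHS]/(m1 S).
pose C : set (set (E * E)) := [set C | exists2 A, measurable A & exists2 B, measurable B & A `*` B = C].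
apply: (measure_unique C (fun=> setT)) => //.
- exact: measurable_prod_measurableType.
- move=> _ _ [A mA [B mB <-]] [A' mA' [B' mB' <-]].
  exists (A `&` A'); first exact: measurableI.
  by exists (B `&` B'); [exact: measurableI|rewrite setXI].
- by move=> _; exists setT => //; exists setT => //; rewrite setXTT.
- by apply/seteqP; split => // x _; exists 0%N.
- move=> _ [A mA [B mB <-]]; change (m1 (A `*` B) = m2 (A `*` B)); rewrite m2E product_measure1E//.
  exact: ind.
- move=> _; change (P ((fun w => (X w, Y w)) @^-1` setT `&` E0) < +oo); rewrite preimage_setT setTI.
  by rewrite -ge0_fin_numE// fin_num_measure.
Qed.

Variables (x xi : nat -> {mfun O >-> E}) (D : E -> E) (a : R).
Hypotheses (mD : measurable_fun setT D)
  (ind : mutually_independent P (with_initial (x 0%N) (fun k => xi k)))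
  (xS : forall k w, x k.+1 w = (D (x k w) + a *: xi k w)%R).

Let T (z : E * E) : E := (D z.1 + a *: z.2)%R.

Let mT : measurable_fun setT T.
Proof.
apply: measurable_rvD; first exact: (measurableT_comp mD measurable_fst).
by apply: measurable_rvZ => //; exact: measurable_snd.
Qed.

Let future (s : seq nat) (B : nat -> set E) : set O := \bigcap_(j in [set` s]) xi j @^-1` B j.

Let measurable_future s B : (forall j, measurable (B j)) -> measurable (future s B).
Proof.
move=> mB; apply: bigcap_measurableType => j _.
by rewrite -[X in measurable X]setTI; exact: measurable_funP.
Qed.

Let mpre (Z : {mfun O >-> E}) A : measurable A -> measurable (Z @^-1` A).
Proof. by move=> mA; rewrite -[X in measurable X]setTI; exact: measurable_funP. Qed.

(** x (k+1) depends only on x k and xi k, which by induction are independent of each other and of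
    the noises after k. *)
Lemma noise_independent k s A (B : nat -> set E) : uniq s -> all (leq k) s ->
  measurable A -> (forall j, measurable (B j)) ->
  P (x k @^-1` A `&` future s B) = P (x k @^-1` A) * \prod_(j <- s) P (xi j @^-1` B j).
Proof.
elim: k s A B => [|k IH] s A B us ks mA mB.
  (* [with_initial] puts x 0 at index 0 and shifts the noises by one. *)
  pose A' j := if j is i.+1 then B i else A.
  have us' : uniq (0%N :: map S s).
    by rewrite /= map_inj_uniq ?us ?andbT; [apply/mapP => -[]|exact: succn_inj].
  have := ind us' (A := A').
  rewrite big_cons big_map /= => <-; last by case.
  congr (P _); apply/seteqP; split => w /=.
    move=> [H1 H2] [|j] /=; first by [].
    by rewrite inE /= (mem_map succn_inj) => js; exact: H2.
  move=> H; split; first by apply: (H 0%N); rewrite /= inE eqxx.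
  by move=> j js; apply: (H j.+1); rewrite /= inE /= (mem_map succn_inj).
(* The pair (x k, xi k) has the product law jointly with the event on later noises, by the induction
   hypothesis for [k :: s']. *)
have pl (s' : seq nat) : uniq s' -> all (leq k.+1) s' ->
    P (x k.+1 @^-1` A `&` future s' B) =
    P (future s' B) * (distribution P (x k) \x distribution P (xi k)) (T @^-1` A).
  move=> us' ks'; have ks'' : all (leq k) s'.
    by apply/allP => j js; exact: ltnW (allP ks' j js).
  have := @pair_law (x k) (xi k) (future s' B) (measurable_future s' mB) _ (T @^-1` A).
  rewrite -[X in measurable X]setTI => <-; last 1 first.
  - exact: mT.
  - congr (P (_ `&` _)); apply/seteqP; split => w /=; by rewrite xS.
  move=> A1 B1 mA1 mB1.
  pose B' j := if j == k then B1 else B j.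
  have mB' j : measurable (B' j) by rewrite /B'; case: ifP.
  have ks1 : k \notin s' by apply/negP => /(allP ks'); rewrite ltnn.
  have eqB j : j \in s' -> B' j = B j.
    by rewrite /B'; case: eqVneq => // ->; rewrite (negbTE ks1).
  have := IH (k :: s') A1 B'; rewrite /= ks1 us' leqnn ks'' => /(_ isT isT mA1 mB').
  have -> : x k @^-1` A1 `&` future (k :: s') B' =
      x k @^-1` A1 `&` xi k @^-1` B1 `&` future s' B.
    apply/seteqP; split => w /=.
      move=> [H1 H2]; split; first split => //.
        by have := H2 k; rewrite /B' eqxx; apply; rewrite /= inE eqxx.
      by move=> j js; have := H2 j; rewrite eqB//; apply; rewrite /= inE js orbT.
    move=> [[H1 H2] H3]; split => // j /=; rewrite inE => /orP[/eqP->|js].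
      by rewrite /B' eqxx.
    by rewrite eqB//; exact: H3.
  move=> ->; rewrite big_cons {1}/B' eqxx.
  have := IH s' setT B us' ks'' measurableT mB.
  rewrite preimage_setT setTI probability_setT mul1e => ->.
  rewrite [RHS]muleC -muleA; congr (_ * (_ * _)).
  by apply: eq_big_seq => j js; rewrite eqB.
have Ps : P (future s B) = \prod_(j <- s) P (xi j @^-1` B j).
  have ks' : all (leq k) s by apply/allP => j js; exact: ltnW (allP ks j js).
  have := IH s setT B us ks' measurableT mB.
  by rewrite preimage_setT setTI probability_setT mul1e.
rewrite pl// Ps muleC; congr (_ * _).
have := pl [::] isT isT.
have -> : future [::] B = setT by apply/seteqP; split.
by rewrite setIT probability_setT mul1e => ->.
Qed.

Lemma noise_step_law k A : measurable A ->
  P (x k.+1 @^-1` A) = (distribution P (x k) \x distribution P (xi k)) (T @^-1` A).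
Proof.
move=> mA.
have := @pair_law (x k) (xi k) setT measurableT _ (T @^-1` A).
rewrite setIT probability_setT mul1e => <-; last 2 first.
- move=> A1 B1 mA1 mB1; rewrite setIT mul1e.
  have -> : xi k @^-1` B1 = future [:: k] (fun=> B1).
    apply/seteqP; split => w /=; first by move=> H j; rewrite /= inE => /eqP->.
    by apply; rewrite /= inE.
  rewrite noise_independent//=; last by rewrite leqnn.
  rewrite big_seq1; congr (_ * P _).
  apply/seteqP; split => w /=; first by move=> H j; rewrite /= inE => /eqP->.
  by apply; rewrite /= inE.
- by rewrite -[X in measurable X]setTI; exact: mT.
by congr (P _); apply/seteqP; split => w /=; rewrite xS.
Qed.

End laws.

Section noise_density.
Context {R : realType}.
Local Open Scope ereal_scope.

Lemma gam_dilation n (a s : R) (z : 'rV[R]_n) : (0 < a)%R ->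
  (a ^+ n * gam s (a *: z) = gam (s * a ^+ 2) z)%R.
Proof.
move=> a0; rewrite /gam mulrA -exprMn dotZl dotZr; congr (_ ^+ _ * expR (- _))%R.
  have -> : (s * a ^+ 2 / pi = a ^+ 2 * (s / pi))%R by rewrite mulrAC mulrC.
  by rewrite [RHS]sqrtrM ?sqr_ge0// sqrtr_sqr gtr0_norm.
by rewrite expr2 !mulrA.
Qed.

Lemma heat_dilation n (a s h : R) (u : 'rV[R]_n) (A : set 'rV[R]_n) : (0 < a)%R -> (0 < h)%R ->
  (a ^+ 2 * s ^+ 2 = 2 * h)%R -> measurable A ->
  \int[leb n]_z (heat (s ^+ 2 / 2)%R 0%R z * \1_A (u + a *: z)%R)%:E =
  \int[leb n]_y (heat h u y * \1_A y)%:E.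
Proof.
move=> a0 h0 as2 mA.
have mi : measurable_fun setT (\1_A : 'rV[R]_n -> R) by exact: measurable_indic.
have mi2 : measurable_fun setT (fun y => \1_A (u + y)%R : R).
  by apply: (measurableT_comp mi); apply: measurable_rvD; [exact: measurable_cst|exact: measurable_id].
have mg t : measurable_fun setT (fun x : 'rV[R]_n => gam t x).
  by apply: measurable_gam; exact: measurable_id.
rewrite [RHS]heat_translation//.
rewrite [RHS](leb_scaling (f := fun y => (gam (4 * h)^-1%R y * \1_A (u + y)%R)%:E) a0); last 2 first.
- by apply/measurable_EFinP; exact: (measurable_funM (mg _) mi2).
- by move=> y; rewrite lee_fin mulr_ge0// gam_ge0.
have maz : measurable_fun setT (fun z : 'rV[R]_n => (a *: z)%R).
  by apply: measurable_rvZ; [exact: measurable_cst|exact: measurable_id].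
rewrite -[RHS]eintZ; last 3 first.
- exact: exprn_ge0 (ltW a0).
- exact: (measurable_funM (measurableT_comp (mg _) maz) (measurableT_comp mi2 maz)).
- by move=> y; rewrite mulr_ge0// gam_ge0.
apply: eq_eint => z; rewrite mulrA gam_dilation// heatC /heat subr0.
congr (gam _ _ * _)%R; have s0 : (s != 0)%R.
  apply/eqP => s0; move: as2; rewrite s0 expr0n mulr0 => /esym/eqP.
  by rewrite mulf_eq0 gt_eqF//= gt_eqF.
have -> : (4 * h = 2 * (a ^+ 2 * s ^+ 2))%R by rewrite as2 mulrA -natrM.
by field; rewrite s0 gt_eqF.
Qed.

Section iterates.
Context d (O : measurableType d) (P : probability O R) (n : nat).
Notation E := 'rV[R]_n.
Variables (x xi : nat -> {mfun O >-> E}) (c h a s : R) (r0 : E -> R).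
Hypotheses (c0 : (0 < c)%R) (h0 : (0 < h)%R) (a0 : (0 < a)%R) (s0 : (0 < s)%R)
  (as2 : (a ^+ 2 * s ^+ 2 = 2 * h)%R)
  (gxi : forall k, centered_gaussian P s (xi k))
  (ind : mutually_independent P (with_initial (x 0%N) (fun k => xi k)))
  (xS : forall k w, x k.+1 w = (lmc_drift c h (x k w) + a *: xi k w)%R)
  (mr : measurable_fun setT r0) (r00 : forall y, (0 <= r0 y)%R) (xr : has_density P (x 0%N) r0).

(** The scales a and s with a^2 s^2 = 2h are kept apart to cover both LMC (a = sqrt(2h), s = 1) and
    the Euler scheme of the diffusion (a = sqrt 2, s = sqrt h). *)
Lemma noise_density k : [/\ measurable_fun setT (iter k (lmc_push c h) r0),
  forall y, (0 <= iter k (lmc_push c h) r0 y)%R,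
  \int[leb n]_y (iter k (lmc_push c h) r0 y)%:E = 1 &
  has_density P (x k) (iter k (lmc_push c h) r0)].
Proof.
elim: k => [|k [mrk rk0 rk1 xk]] /=.
  by split=> //; rewrite -xr// preimage_setT probability_setT.
set r := iter k _ r0 in mrk rk0 rk1 xk *.
have mD : measurable_fun setT (lmc_drift c h : E -> E) := measurable_lmc_drift c h.
split.
- exact: measurable_lmc_push.
- exact: lmc_push_ge0.
- exact: lmc_push_total.
move=> A mA; rewrite (noise_step_law mD ind xS k mA).
have mi : measurable_fun setT (\1_A : E -> R) by exact: measurable_indic.
have i0 (y : E) : (0 <= (\1_A y : R))%R by [].
have mK : measurable_fun setT (fun z : E * E => (lmc_kernel c h z.1 z.2 * \1_A z.2)%R).
  by apply: measurable_funM; [exact: measurable_lmc_kernel|exact: (measurableT_comp mi measurable_snd)].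
have K0 (u y : E) : (0 <= lmc_kernel c h u y * \1_A y)%R by rewrite mulr_ge0// heat_ge0.
pose p (u : E) : R := fine (\int[leb n]_y (lmc_kernel c h u y * \1_A y)%:E).
have pE u : \int[leb n]_y (lmc_kernel c h u y * \1_A y)%:E = (p u)%:E.
  rewrite /p fineK// ge0_fin_numE; last exact: eint_ge0.
  apply: (@le_lt_trans _ _ 1); last exact: ltry.
  rewrite -(heat_int (lmc_drift c h u) h0); apply: le_eint => [||//|y].
  - exact: (measurableT_comp mK (measurable_fun_pair (@measurable_cst _ _ _ _ setT u) (@measurable_id _ _ setT))).
  - by apply: measurable_heat; [exact: measurable_cst|exact: measurable_id].
  - by rewrite ler_piMr ?heat_ge0// indicE; case: (_ \in _).
have mp : measurable_fun setT p.
  apply: (measurableT_comp (@fine_measurable _ setT measurableT)).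
  exact: (measurable_eint (leb n) mK K0).
have p0 u : (0 <= p u)%R by rewrite -lee_fin -pE; exact: eint_ge0.
transitivity (\int[distribution P (x k)]_u (p u)%:E).
  apply: eq_integral => u _; rewrite -pE -(heat_dilation _ a0 h0 as2 mA).
  change (P (xi k @^-1` xsection ((fun z : E * E => (lmc_drift c h z.1 + a *: z.2)%R) @^-1` A) u) =
    \int[leb n]_z (heat (s ^+ 2 / 2)%R 0%R z * \1_A (lmc_drift c h u + a *: z)%R)%:E).
  have -> : xsection ((fun z : E * E => (lmc_drift c h z.1 + a *: z.2)%R) @^-1` A) u =
      (fun z : E => (lmc_drift c h u + a *: z)%R) @^-1` A.
    by apply/seteqP; split => z /=; rewrite /xsection/= inE.
  have mu : measurable ((fun z : E => (lmc_drift c h u + a *: z)%R) @^-1` A).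
    rewrite -[X in measurable X]setTI.
    have : measurable_fun setT (fun z : E => (lmc_drift c h u + a *: z)%R); last exact.
    apply: measurable_rvD; first exact: measurable_cst.
    by apply: measurable_rvZ; [exact: measurable_cst|exact: measurable_id].
  by rewrite (centered_gaussian_density s0 (gxi k))// integral_indic_EFin.
have xk' B : measurable B -> distribution P (x k) B = \int[leb n]_(y in B) (r y)%:E by exact: xk.
rewrite (@density_integral _ _ _ (leb n) (distribution P (x k)) r p mrk rk0 xk' mp p0).
rewrite [RHS]integral_indic_EFin// (lmc_push_int c h0 mrk rk0 rk1 mi i0).
apply: eq_integral => u _; rewrite mulrC EFinM -pE -eintZ//.
exact: (measurableT_comp mK (measurable_fun_pair (@measurable_cst _ _ _ _ setT u) (@measurable_id _ _ setT))).
Qed.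

End iterates.
End noise_density.

(** * The Student gradient and initial densities *)

Section gradient.
Context {R : realType} (n : nat).
Notation E := 'rV[R]_n.

Lemma dot_shift (x : E) i t : dot (t *: delta_mx ord0 i + x) (t *: delta_mx ord0 i + x) =
  dot x x + 2 * t * x ord0 i + t ^+ 2.
Proof.
have e (y : E) : dot (delta_mx ord0 i) y = y ord0 i.
  rewrite /dot (bigD1 i)//= mxE !eqxx mul1r big1 ?addr0// => j ji.
  by rewrite mxE (negbTE ji) andbF mul0r.
rewrite !dotE e (dotC x) !e mxE !eqxx /=; ring.
Qed.

Lemma derive_line (f : E -> R) (x v : E) : 'D_v f x = 'D_1 (fun t : R => f (t *: v + x)) 0.
Proof.
rewrite /derive; apply: (congr1 (fun g : R -> R => lim (g @ 0^'))); apply/funext => t /=.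
by rewrite scale0r add0r addr0 /shift /= [_ *: 1]mulr1.
Qed.

Lemma grad_V_student (nu : R) (x : E) :
  grad (V_student nu) x = (n%:R + nu) *: student_drift x.
Proof.
apply/rowP => i; rewrite !mxE derive_line /V_student.
have K0 : 0 < 1 + dot x x by rewrite ltr_pwDl// -enorm2 sqr_ge0.
pose p (t : R) := 1 + dot x x + 2 * x ord0 i * t + t ^+ 2.
have -> : (fun t : R => (n%:R + nu) / 2 * ln (1 + enorm (t *: delta_mx ord0 i + x) ^+ 2)) =
    (fun t => (n%:R + nu) / 2 * ln (p t)).
  by apply/funext => t; rewrite enorm2 dot_shift /p; congr (_ * ln _); ring.
have p0 : p 0 = 1 + dot x x by rewrite /p mulr0 expr0n !addr0.
have dp : is_derive (0 : R) (1 : R) p (2 * x ord0 i).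
  rewrite /p; apply: is_derive_eq.
  by rewrite !scale0r !addr0 add0r mul1r [_ *: 1]mulr1.
have dl : is_derive (p 0) (1 : R) (@ln R) (p 0)^-1 by apply: is_derive1_ln; rewrite p0.
have dc := @is_derive1_comp R (@ln R) p 0 _ _ dl dp.
have dk := is_deriveZ ((n%:R + nu) / 2) dc.
have -> : (fun t : R => (n%:R + nu) / 2 * ln (p t)) = ((n%:R + nu) / 2 *: (@ln R \o p)) by [].
rewrite (@derive_val _ _ _ _ _ _ _ dk) p0 /GRing.scale /=; field.
by rewrite gt_eqF.
Qed.

End gradient.

Section student_laws.
Context {R : realType}.
Notation sd a n Z := (student_density a Z : 'rV[R]_n -> R).
Local Open Scope ereal_scope.

Lemma integral_pi_student n (nu Z : R) (f : 'rV[R]_n -> R) : (0 < Z)%R ->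
  (forall A, measurable A -> pi_student n nu A =
    \int[leb n]_(x in A) (sd (nu / 2)%R n Z x)%:E) ->
  measurable_fun setT f -> (forall x, 0 <= f x)%R ->
  \int[pi_student n nu]_x (f x)%:E = \int[leb n]_x (f x * sd (nu / 2)%R n Z x)%:E.
Proof.
move=> Z0 pE mf f0; apply: density_integral => //; first exact: measurable_student_density.
by move=> x; exact/ltW/student_density_gt0.
Qed.

(** Interface between the measures of the theorem and the analytic lemmas: the initial law gets a
    density g relative to the target, bounded by M = exp R_oo, and its divergences become
    [renyi_mean]. *)
Lemma student_start n (nu : R) (mu : probability 'rV[R]_n R) : (0 < nu)%R ->
  renyi_infty mu (pi_student n nu) < +oo -> exists (Z M : R) (g : 'rV[R]_n -> R),
  let sdn := sd (nu / 2)%R n Z in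
  [/\ [/\ (0 < Z)%R, \int[leb n]_x (wgt (nu / 2 + n%:R / 2)%R x)%:E = Z%:E &
      forall A, measurable A -> pi_student n nu A = \int[leb n]_(x in A) (sdn x)%:E],
    [/\ measurable_fun setT g, (forall x, 0 <= g x)%R, (forall x, g x <= M)%R & (1 <= M)%R],
    \int[leb n]_x (g x * sdn x)%:E = 1 /\ (forall A, measurable A -> mu A = \int[leb n]_(x in A) (g x * sdn x)%:E),
    fine (renyi_infty mu (pi_student n nu)) = ln M &
    forall q : R, (2 <= q)%R -> fine (renyi q mu (pi_student n nu)) = renyi_mean (leb n) sdn q g
      /\ (0 <= renyi_mean (leb n) sdn q g)%R].
Proof.
move=> nu0 rfin; have [Z [Z0 ZE piE]] := pi_studentE n nu0.
have [g [M [mg gM M1 gE rM]]] := renyi_infty_density rfin.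
exists Z, M, g => sdn.
have g0 x : (0 <= g x)%R by case/andP: (gM x).
have gB x : (g x <= M)%R by case/andP: (gM x).
have msd : measurable_fun setT sdn by exact: measurable_student_density.
have sd0 x : (0 <= sdn x)%R by exact/ltW/student_density_gt0.
have sd1 : \int[leb n]_x (sdn x)%:E = 1 by rewrite -piE// probability_setT.
have muE A : measurable A -> mu A = \int[leb n]_(x in A) (g x * sdn x)%:E.
  move=> mA; rewrite gE// (integral_indic_EFin _ g mA) (integral_indic_EFin _ (fun x => g x * sdn x)%R mA) (integral_pi_student Z0 piE).
  - by apply: eq_eint => x; rewrite mulrAC.
  - exact: (measurable_funM mg (measurable_indic mA)).
  - by move=> x; rewrite mulr_ge0.
have g1 : \int[leb n]_x (g x * sdn x)%:E = 1 by rewrite -muE// probability_setT.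
split=> // q q2.
have q1 : (1 < q)%R by rewrite (lt_le_trans _ q2)// ltr1n.
have q0 : (0 <= q)%R by rewrite (le_trans _ q2).
have F1 : (1 <= mean (leb n) sdn (fun x => g x `^ q))%R.
  exact: (@mean_pow_ge1 _ _ _ (leb n) sdn msd sd0 sd1 q M g q2 mg g0 gB g1).
split; last by rewrite /renyi_mean divr_ge0// ?ln_ge0// subr_ge0 ltW.
rewrite (renyiE mg g0 gE q1) (integral_pi_student Z0 piE); last 2 first.
- exact: measurable_powRf.
- by move=> x; exact: powR_ge0.
have gq x : (g x `^ q <= M `^ q)%R by apply: ge0_ler_powR; rewrite ?nnegrE// (le_trans ler01 M1).
rewrite (@meanE _ _ _ (leb n) sdn msd sd0 sd1 (fun x => g x `^ q)%R (M `^ q)%R (measurable_powRf q mg) (fun x => powR_ge0 _ _) gq).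
by rewrite lne_EFin ?(lt_le_trans ltr01 F1)//= mulrC.
Qed.

Lemma renyi_of_density n (nu Z q e : R) (rho : probability 'rV[R]_n R) (r : 'rV[R]_n -> R) :
  (0 < Z)%R -> (1 < q)%R ->
  (forall A, measurable A -> pi_student n nu A = \int[leb n]_(x in A) (sd (nu / 2)%R n Z x)%:E) ->
  measurable_fun setT r -> (forall x, 0 <= r x)%R ->
  (forall A, measurable A -> rho A = \int[leb n]_(x in A) (r x)%:E) ->
  \int[leb n]_x ((r x / sd (nu / 2)%R n Z x) `^ q * sd (nu / 2)%R n Z x)%:E <= (expR ((q - 1) * e))%:E ->
  renyi q rho (pi_student n nu) <= e%:E.
Proof.
move=> Z0 q1 piE mr r0 rE le.
set sdn := sd (nu / 2)%R n Z in piE le *.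
have msd : measurable_fun setT sdn by exact: measurable_student_density.
have sdp x : (0 < sdn x)%R by exact: student_density_gt0.
have mg : measurable_fun setT (fun x => r x / sdn x)%R.
  by exact: (measurable_funM mr (measurableT_comp (@measurable_invr R) msd)).
have g0 x : (0 <= r x / sdn x)%R by rewrite divr_ge0// ltW.
apply: (renyi_le mg g0 _ q1).
  move=> A mA; rewrite rE// (integral_indic_EFin _ r mA) (integral_indic_EFin _ (fun x => r x / sdn x)%R mA) (integral_pi_student Z0 piE).
  - by apply: eq_eint => x; rewrite mulrAC divfK ?gt_eqF.
  - exact: (measurable_funM mg (measurable_indic mA)).
  - by move=> x; rewrite mulr_ge0.
rewrite (integral_pi_student Z0 piE)//; first exact: measurable_powRf.
by move=> x; exact: powR_ge0.
Qed.

End student_laws.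

(** * Choice of the step size and convergence of LMC *)

Section step_size.
Context {R : realType}.

(** The total time T = N h is what the decay of the chain demands, of order n G (t + Y) L. N is of
    order A n^3 T^2 Mx/e, so that h = T/N satisfies A n^3 T h <= e. As c <= ka n, each smallness
    condition then follows from [A] being larger than its coefficient. Substituting T gives n^5 G^2
    (t + Y)^2 L^2 Mx/e, and (t + Y)^2 is comparable with t^2 + Y^2. *)
Lemma step_size_exists (n : nat) (c ka q e C G Y t L Mx a K0 K1 M : R)
    (Q := 2 * q - 1) (D1 := (16 * C * M `^ Q) `^ a^-1) (D := (32 * C * M `^ Q / e) `^ a^-1)
    (B := 8 * C * (Q - 1) * (K0 + 2 * K1) + 1)
    (A := 2128 * Q ^+ 2 * ka ^+ 2 + 64 * ka + ka ^+ 2 + 40 * Q * ka + 4 * Q * (34 * ka + 2 * ka ^+ 2) + 2048 * K1 + 1)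
    (rate := n%:R ^+ 5 * G ^+ 2 / e * (t ^+ 2 + Y ^+ 2) * Mx) :
  (0 < n)%N -> 0 < c -> c <= ka * n%:R -> 2 <= q -> 0 < e <= 1 -> 1 <= C -> 1 <= G -> 1 <= Y -> 0 <= t ->
  1 <= L -> ln (4 / e) <= 2 * L -> 1 <= Mx -> 0 <= K0 -> 0 <= K1 ->
  D1 = K0 * G -> D = K1 * (G * Y) ->
  exists (h : R) (N : nat), [/\ [/\ 0 < h <= 1, 64 * h * c <= 1, h * c ^+ 2 <= 1 & 40 * h * Q * c <= 1],
   [/\ Q * (34 * n%:R * h * c + 2 * h * c ^+ 2) <= 4^-1, 34 * n%:R * h * c + 2 * h * c ^+ 2 <= e / 4,
     N%:R * (1064 * n%:R * h ^+ 2 * Q ^+ 2 * c ^+ 2) <= e / 2 & 1024 * n%:R ^+ 2 * (2 * h * D) <= 1],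
   8 * C * n%:R * (Q - 1) * (D1 * (t + 1) + D * ln (4 / e)) + 1 <= N%:R * h,
   rate <= N%:R & N%:R <= 4 * A * B ^+ 2 * L ^+ 2 * rate].
Proof.
move=> n0 c0 cka q2 /andP[e0 e1] C1 G1 Y1 t0 L1 lnL Mx1 K00 K10 D1E DE.
have Q2 : 2 <= Q by rewrite /Q; move: q2; clear; lra.
have ka0 : 0 < ka by rewrite -(pmulr_lgt0 _ (_ : 0 < n%:R)) ?ltr0n// (lt_le_trans c0).
have n1 : 1 <= n%:R :> R by rewrite ler1n.
have C0 : 0 <= C := le_trans ler01 C1.
have Q10 : 0 <= Q - 1 by move: Q2; clear; lra.
have Q0 : 0 <= Q by move: Q2; clear; lra.
have L0 := le_trans ler01 L1; have G0 := le_trans ler01 G1; have Y0 := le_trans ler01 Y1.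
have B1 : 1 <= B.
  rewrite /B lerDr; exact: mulr_ge0 (mulr_ge0 (mulr_ge0 (ler0n R 8) C0) Q10) (addr_ge0 K00 (mulr_ge0 (ler0n R 2) K10)).
have B0 := le_trans ler01 B1.
have ka00 := ltW ka0; have kk := sqr_ge0 ka.
have [a1 a2 a3] : [/\ 0 <= Q ^+ 2 * ka ^+ 2, 0 <= Q * ka & 0 <= Q * ka ^+ 2].
  by split; [exact: mulr_ge0 (sqr_ge0 _) kk|exact: mulr_ge0|exact: mulr_ge0].
have w0 : 0 <= Q * (34 * ka + 2 * ka ^+ 2) by apply: mulr_ge0 => //; move: ka00 kk; clear; lra.
have AE : A = 2128 * (Q ^+ 2 * ka ^+ 2) + 64 * ka + ka ^+ 2 + 40 * (Q * ka) + 4 * (Q * (34 * ka + 2 * ka ^+ 2)) + 2048 * K1 + 1.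
  by rewrite /A -!mulrA.
have [A1 [Aa [Ab [Ac [Ad [Ae Af]]]]]] : 1 <= A /\ (2128 * (Q ^+ 2 * ka ^+ 2) <= A /\ (64 * ka <= A /\ (ka ^+ 2 <= A /\ (40 * (Q * ka) <= A /\
    (4 * (Q * (34 * ka + 2 * ka ^+ 2)) <= A /\ 2048 * K1 <= A))))).
  rewrite AE; move: a1 a2 ka00 kk K10 w0; move: (Q ^+ 2 * ka ^+ 2) (Q * ka) (ka ^+ 2) (Q * _); clear => *.
  by do !split; lra.
have A0 := lt_le_trans ltr01 A1.
pose T := B * (n%:R * (G * ((t + Y) * L))).
have tY1 : 1 <= t + Y by move: t0 Y1; clear; lra.
have X1 : 1 <= n%:R * (G * ((t + Y) * L)) by rewrite !mulr_ege1.
have T1 : 1 <= T by rewrite mulr_ege1.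
have T0 := lt_le_trans ltr01 T1.
(* The factor [Mx] >= 1 matches the rate from both sides. For a given T it only decreases h = T/N,
   which preserves the smallness conditions. *)
pose X := A * n%:R ^+ 3 * T ^+ 2 * Mx / e.
have X0 : 1 <= X.
  rewrite ler_pdivlMr// mul1r; apply: (le_trans e1); rewrite mulr_ege1// mulr_ege1 ?exprn_ege1//.
  by rewrite mulr_ege1 ?exprn_ege1.
pose N := (Num.truncn X).+1.
have XN : X <= N%:R by apply: ltW; exact: truncnS_gt.
have NX : N%:R <= 2 * X.
  have : (Num.truncn X)%:R <= X by rewrite truncn_le// (le_trans ler01).
  by rewrite /N -natr1; move: X0; clear; lra.
have N0 : 0 < N%:R :> R by rewrite ltr0n.
pose h := T / N%:R.
have h0 : 0 < h by rewrite divr_gt0.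
have NhT : N%:R * h = T by rewrite /h mulrC divfK// gt_eqF.
have np : 0 < n%:R :> R by rewrite ltr0n.
have hb : A * n%:R ^+ 3 * (T * h) <= e.
  have : A * n%:R ^+ 3 * T ^+ 2 <= e * N%:R.
    have u : A * n%:R ^+ 3 * T ^+ 2 <= A * n%:R ^+ 3 * T ^+ 2 * Mx.
      by rewrite ler_peMr// mulr_ge0 ?sqr_ge0// mulr_ge0 ?(ltW A0)//; exact: exprn_ge0 (ltW np).
    by apply: (le_trans u); have := ler_wpM2r (ltW e0) XN; rewrite /X divfK ?gt_eqF// [N%:R * _]mulrC.
  rewrite -(ler_pdivrMr _ _ N0) => H; apply: le_trans H.
  by rewrite /h expr2 !mulrA.
(* Quantities of a single step are coefficients times H, and accumulated ones are coefficients times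
   n T H; both H and n T H are at most e/A. *)
pose H := n%:R ^+ 2 * h.
have H0 : 0 <= H := mulr_ge0 (sqr_ge0 _) (ltW h0).
have hT : n%:R ^+ 3 * (T * h) = n%:R * T * H by rewrite /H; ring.
have nT1 : 1 <= n%:R * T by rewrite mulr_ege1.
have kT k : 0 <= k -> k <= A -> k * (n%:R * T * H) <= e.
  move=> k0 kA; apply: le_trans hb; rewrite -[leRHS]mulrA hT ler_wpM2r//.
  by rewrite mulr_ge0// (le_trans ler01).
have kb k : 0 <= k -> k <= A -> k * H <= e.
  by move=> k0 kA; apply: le_trans (kT k k0 kA); rewrite ler_wpM2l// ler_peMl.
have hH : h <= H by rewrite /H ler_peMl ?(ltW h0)// exprn_ege1.
have h0' := ltW h0; have c0' := ltW c0.
have hc : h * c <= ka * H.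
  apply: (le_trans (ler_wpM2l h0' cka)); rewrite /H mulrCA ler_wpM2l// mulrC ler_wpM2r//.
  by rewrite expr2 ler_peMl// ltW.
have hnc : n%:R * (h * c) <= ka * H.
  apply: (le_trans (ler_wpM2l (ltW np) (ler_wpM2l h0' cka))); apply: eq_lexx; rewrite /H; ring.
have c2 : c ^+ 2 <= ka ^+ 2 * n%:R ^+ 2 by rewrite -exprMn ler_pXn2r// nnegrE// mulr_ge0// ltW.
have hc2 : h * c ^+ 2 <= ka ^+ 2 * H.
  apply: (le_trans (ler_wpM2l h0' c2)); apply: eq_lexx; rewrite /H; ring.
have sH : 34 * n%:R * h * c + 2 * h * c ^+ 2 <= (34 * ka + 2 * ka ^+ 2) * H.
  have u := lerD (ler_wpM2l (ler0n R 34) hnc) (ler_wpM2l (ler0n R 2) hc2).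
  rewrite (_ : 34 * n%:R * h * c + 2 * h * c ^+ 2 = 34 * (n%:R * (h * c)) + 2 * (h * c ^+ 2)); last by ring.
  by apply: (le_trans u); apply: eq_lexx; ring.
have QsH : Q * (34 * n%:R * h * c + 2 * h * c ^+ 2) <= e / 4.
  have u := ler_wpM2l Q0 sH.
  have v : 4 * (Q * ((34 * ka + 2 * ka ^+ 2) * H)) <= e.
    by apply: le_trans (kb _ (mulr_ge0 (ler0n R 4) w0) Ae); apply: eq_lexx; ring.
  by rewrite ler_pdivlMr// mulrC; apply: le_trans v; rewrite ler_wpM2l.
have s0 : 0 <= 34 * n%:R * h * c + 2 * h * c ^+ 2.
  exact: (addr_ge0 (mulr_ge0 (mulr_ge0 (mulr_ge0 (ler0n R 34) (ler0n R n)) h0') c0') (mulr_ge0 (mulr_ge0 (ler0n R 2) h0') (sqr_ge0 c))).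
have GYT : G * Y <= T.
  rewrite /T; apply: (le_trans _ (ler_peMl (le_trans ler01 X1) B1)).
  apply: (@le_trans _ _ (G * ((t + Y) * L))); last by rewrite ler_peMl// mulr_ge0// mulr_ge0// (le_trans ler01).
  rewrite ler_wpM2l//; apply: (@le_trans _ _ (t + Y)); first by move: t0; clear; lra.
  by rewrite ler_peMr// (le_trans ler01).
exists h, N; split.
- split.
  + rewrite h0 /=; apply: (le_trans hH); apply: le_trans e1; rewrite -[H]mul1r; exact: kb.
  + have := kb _ (mulr_ge0 (ler0n R 64) ka00) Ab; have := ler_wpM2l (ler0n R 64) hc.
    by rewrite !mulrA; move: (64 * h * c) (64 * ka * H) e1; clear => *; lra.
  + by have := kb _ kk Ac; move: hc2 e1; move: (h * _) (_ * H); clear => *; lra.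
  + have := kb _ (mulr_ge0 (ler0n R 40) a2) Ad; have := ler_wpM2l (mulr_ge0 (ler0n R 40) Q0) hc.
    rewrite (_ : 40 * Q * (h * c) = 40 * h * Q * c); last by ring.
    rewrite (_ : 40 * Q * (ka * H) = 40 * (Q * ka) * H); last by ring.
    by move: (40 * h * Q * c) (_ * H) e1; clear => *; lra.
- split.
  + apply: (le_trans QsH); move: e1; clear; lra.
  + apply: le_trans QsH; rewrite ler_peMl//; move: Q2; clear; lra.
  + have -> : N%:R * (1064 * n%:R * h ^+ 2 * Q ^+ 2 * c ^+ 2) = 1064 * n%:R * h * Q ^+ 2 * c ^+ 2 * T by rewrite -NhT; ring.
    have u1 : 1064 * n%:R * h * Q ^+ 2 * c ^+ 2 * T <= 1064 * (Q ^+ 2 * ka ^+ 2 * (n%:R * T * H)).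
      have := ler_wpM2l (mulr_ge0 (mulr_ge0 (mulr_ge0 (mulr_ge0 (ler0n R 1064) (ltW np)) h0') (sqr_ge0 Q)) (ltW T0)) c2.
      rewrite (_ : 1064 * n%:R * h * Q ^+ 2 * T * c ^+ 2 = 1064 * n%:R * h * Q ^+ 2 * c ^+ 2 * T); last by ring.
      by rewrite (_ : 1064 * n%:R * h * Q ^+ 2 * T * (ka ^+ 2 * n%:R ^+ 2) = 1064 * (Q ^+ 2 * ka ^+ 2 * (n%:R * T * H))) //; rewrite /H; ring.
    apply: (le_trans u1); have := kT _ (mulr_ge0 (ler0n R 2128) a1) Aa; rewrite -(mulrA 2128).
    by move: (Q ^+ 2 * ka ^+ 2 * _); clear => *; lra.
  + rewrite DE; have := kT _ (mulr_ge0 (ler0n R 2048) K10) Af.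
    have u1 : K1 * H * (G * Y) <= K1 * (n%:R * T * H).
      rewrite -mulrA ler_wpM2l// mulrC ler_wpM2r//; apply: (le_trans GYT).
      by rewrite ler_peMl// ltW.
    have -> : 1024 * n%:R ^+ 2 * (2 * h * (K1 * (G * Y))) = 2048 * (K1 * H * (G * Y)) by rewrite /H; ring.
    rewrite -(mulrA 2048); move: u1 e1; move: (K1 * H * _) (K1 * (n%:R * T * H)); clear => *; lra.
- rewrite NhT D1E DE /T.
  have tL : t + 1 <= (t + Y) * L.
    apply: (@le_trans _ _ (t + Y)); [by rewrite lerD2l|by rewrite ler_peMr// (le_trans ler01)].
  have YL : Y * ln (4 / e) <= 2 * ((t + Y) * L).
    apply: (le_trans (ler_wpM2l Y0 lnL)); rewrite mulrCA ler_wpM2l// ler_wpM2r//.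
    by rewrite lerDr.
  have u1 := ler_wpM2l (mulr_ge0 K00 G0) tL; have u2 := ler_wpM2l (mulr_ge0 K10 G0) YL.
  have b0 : 0 <= 8 * C * n%:R * (Q - 1) := mulr_ge0 (mulr_ge0 (mulr_ge0 (ler0n R 8) C0) (ltW np)) Q10.
  have u3 := ler_wpM2l b0 (lerD u1 u2).
  rewrite -[K1 * (G * Y) * _]mulrA -[G * Y * _]mulrA [K1 * (G * _)]mulrA.
  apply: (le_trans (lerD u3 X1)); apply: eq_lexx; rewrite /B; ring.
- have XE : X = A * B ^+ 2 * L ^+ 2 * (n%:R ^+ 5 * G ^+ 2 / e * Mx) * (t + Y) ^+ 2 by rewrite /X /T; ring.
  apply: le_trans XN; rewrite XE.
  have W0 : 0 <= n%:R ^+ 5 * G ^+ 2 / e * Mx.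
    by rewrite mulr_ge0 ?(le_trans ler01 Mx1)// divr_ge0 ?(ltW e0)// mulr_ge0 ?sqr_ge0// exprn_ge0// ltW.
  have -> : rate = n%:R ^+ 5 * G ^+ 2 / e * Mx * (t ^+ 2 + Y ^+ 2) by rewrite /rate; ring.
  apply: ler_pM => //; first by rewrite addr_ge0 ?sqr_ge0.
    by rewrite ler_peMl// mulr_ege1 ?exprn_ege1// mulr_ege1 ?exprn_ege1.
  by rewrite sqrrD lerD2r lerDl mulrn_wge0// mulr_ge0.
- have XE : X = A * B ^+ 2 * L ^+ 2 * (n%:R ^+ 5 * G ^+ 2 / e * Mx) * (t + Y) ^+ 2 by rewrite /X /T; ring.
  apply: (le_trans NX); rewrite XE.
  have W0 : 0 <= n%:R ^+ 5 * G ^+ 2 / e * Mx.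
    by rewrite mulr_ge0 ?(le_trans ler01 Mx1)// divr_ge0 ?(ltW e0)// mulr_ge0 ?sqr_ge0// exprn_ge0// ltW.
  have -> : rate = n%:R ^+ 5 * G ^+ 2 / e * Mx * (t ^+ 2 + Y ^+ 2) by rewrite /rate; ring.
  have V0 : 0 <= A * B ^+ 2 * L ^+ 2 * (n%:R ^+ 5 * G ^+ 2 / e * Mx).
    by rewrite mulr_ge0// mulr_ge0 ?sqr_ge0// mulr_ge0 ?sqr_ge0// ltW.
  have := ler_wpM2l V0 (_ : (t + Y) ^+ 2 <= 2 * (t ^+ 2 + Y ^+ 2)).
  have tY2 : (t + Y) ^+ 2 <= 2 * (t ^+ 2 + Y ^+ 2) by have := sqr_ge0 (t - Y); clear; rewrite sqrrB sqrrD => *; lra.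
  move=> /(_ tY2) u.
  apply: (le_trans (ler_wpM2l (ler0n R 2) u)); apply: eq_lexx.
  by move: (n%:R ^+ 5 * _ / e * Mx) (A) => W A'; ring.
Qed.

End step_size.

Section lmc_convergence.
Context {R : realType}.

Lemma lmc_step_student n (nu h : R) (x : 'rV[R]_n) :
  x - h *: grad (V_student nu) x = lmc_drift ((nu / 2 + n%:R / 2) / 2) h x.
Proof.
rewrite grad_V_student scalerA /lmc_drift; congr (_ - _ *: _).
by field.
Qed.

Lemma powR_half_inv (nu x : R) : x `^ ((nu / 2)^-1) = x `^ (2 / nu).
Proof. by rewrite invf_div. Qed.

Lemma ln4_le2 : ln (4 : R) <= 2.
Proof.
rewrite -ler_expR lnK ?posrE//.
have e1 : 2 <= expR (1 : R) by have := expR_ge1Dx (1 : R); rewrite (_ : 1 + 1 = 2 :> R).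
rewrite (_ : 2 = 1 + 1 :> R)// [leRHS]expRD (_ : 4 = 2 * 2 :> R); last by rewrite -natrM.
exact: ler_pM.
Qed.

Lemma lmc_student_convergence (nu : R) : 0 < nu ->
  forall (c q : R), 0 < c -> 2 <= q ->
   exists (C : R) (p : nat), 0 < C /\
    forall (d : nat) (eps : R) (mu0 : probability 'rV[R]_d R),
      (0 < d)%N -> nu <= c * d%:R -> 0 < eps <= q^-1 ->
      (renyi_infty mu0 (pi_student d nu) < +oo)%E ->
      1 <= m_student d nu ->
      1 <= T_student nu q eps mu0 ->
      (1 <= renyi 2 mu0 (pi_hat nu q eps mu0) < +oo)%E ->
    exists (h : R) (N : nat),
      [/\ 0 < h,
          lmc_rate nu q eps mu0 / (C * log_factor nu q eps mu0 ^+ p) <= N%:R,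
          N%:R <= C * log_factor nu q eps mu0 ^+ p * lmc_rate nu q eps mu0 &
          forall (disp : measure_display) (O : measurableType disp)
            (P : probability O R) (x : nat -> {mfun O >-> 'rV[R]_d}),
            lmc P (V_student nu) h x -> has_law P (x 0%N) mu0 ->
            (renyi q (distribution P (x N)) (pi_student d nu) <= eps%:E)%E].
Proof.
move=> nu0 c q c0 q2.
have a0 : 0 < nu / 2 by rewrite divr_gt0.
have [C0 [C01 dec]] := lmc_density_decay a0.
pose Q := 2 * q - 1.
pose K0 := (16 * C0) `^ (2 / nu); pose K1 := (32 * C0) `^ (2 / nu).
(* From nu <= c d, the exponent (nu + d)/4 of the weight is at most [ka] d. *)
pose ka := (c + 1) / 4.
pose B := 8 * C0 * (Q - 1) * (K0 + 2 * K1) + 1.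
pose A := 2128 * Q ^+ 2 * ka ^+ 2 + 64 * ka + ka ^+ 2 + 40 * Q * ka + 4 * Q * (34 * ka + 2 * ka ^+ 2) + 2048 * K1 + 1.
(* The exponent 2 is the power of L in the step count; C >= 1 serves the lower bound on N. *)
exists (Num.max 1 (4 * A * B ^+ 2)), 2%N.
have C1 : 1 <= Num.max 1 (4 * A * B ^+ 2) by rewrite le_max lexx.
have CAB : 4 * A * B ^+ 2 <= Num.max 1 (4 * A * B ^+ 2) by rewrite le_max lexx orbT.
split; first exact: lt_le_trans C1.
move=> d eps mu0 d0 nuc /andP[e0 eq] rfin _ _ /andP[r2 r2oo].
have q0 : 0 < q by rewrite (lt_le_trans _ q2).
have Q2 : 2 <= Q by rewrite /Q; move: q2; clear; lra.
have e1 : eps <= 1 by rewrite (le_trans eq)// invf_le1// (le_trans _ q2)// ler1n.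
have [Z [M [g [[Z0 ZE piE] [mg g0 gM M1] [g1 muE] rM rE]]]] := student_start nu0 rfin.
set sdn := student_density (nu / 2) Z : 'rV[R]_d -> R in piE g1 muE rE.
have [tE t0] := rE Q Q2.
set t := renyi_mean (leb d) sdn Q g in tE t0.
have M0 : 0 < M := lt_le_trans ltr01 M1.
have lM0 : 0 <= ln M by rewrite ln_ge0.
have Qn : 0 <= 2 * Q / nu by rewrite divr_ge0 ?(ltW nu0)//; move: Q2; clear; lra.
(* G is (M^Q)^(2/nu) and Y is eps^(-2/nu), the variable parts of the truncation levels; their
   squares are the exponential and the power of 1/eps in the rate. *)
pose G := expR (2 * Q / nu * ln M).
pose Y := eps^-1 `^ (2 / nu).
pose L := log_factor nu q eps mu0.
pose R2h := fine (renyi 2 mu0 (pi_hat nu q eps mu0)).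
pose Mx := Num.max 1 (Num.sqrt (eps * R2h * ln M) / d%:R).
have G1 : 1 <= G by rewrite -expR0 ler_expR mulr_ge0.
have ei1 : 1 <= eps^-1 by rewrite invf_ge1.
have nui : 0 <= 2 / nu by rewrite divr_ge0// ltW.
have Y1 : 1 <= Y by rewrite -(powRr0 eps^-1); apply: ler_powR.
have l1 (u : R) : 0 <= u -> 0 <= ln (1 + u) by move=> u0; rewrite ln_ge0// lerDl.
have Lb : 1 + ln eps^-1 <= L.
  have b1 := ln_ge0 (_ : 1 <= d%:R :> R); have {}b1 := b1 ltac:(by rewrite ler1n).
  have b2 : 0 <= ln (1 + R2h) by apply: l1; rewrite fine_ge0// (le_trans _ r2)// lee_fin.
  have b3 := l1 _ lM0; have b4 := l1 _ t0.
  rewrite /L /log_factor tE rM -/R2h; move: b1 b2 b3 b4.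
  by move: (ln d%:R) (ln (1 + R2h)) (ln (1 + ln M)) (ln (1 + t)) (ln eps^-1); clear => *; lra.
have le0 : 0 <= ln eps^-1 by rewrite ln_ge0.
have L1 : 1 <= L by apply: le_trans Lb; rewrite lerDl.
have lnL : ln (4 / eps) <= 2 * L.
  rewrite lnM ?posrE ?invr_gt0//; have := ln4_le2; move: Lb le0.
  by move: (ln 4) (ln eps^-1); clear => *; lra.
have Mx1 : 1 <= Mx by rewrite le_max lexx.
have C00 : 0 <= C0 := le_trans ler01 C01.
have MQG : (M `^ Q) `^ (2 / nu) = G.
  rewrite -powRrM /powR gt_eqF// /G; congr (expR (_ * _)); ring.
have D1E : (16 * C0 * M `^ Q) `^ (nu / 2)^-1 = K0 * G.
  by rewrite powR_half_inv powRM ?powR_ge0 ?mulr_ge0// MQG.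
have DE : (32 * C0 * M `^ Q / eps) `^ (nu / 2)^-1 = K1 * (G * Y).
  rewrite powR_half_inv -mulrA powRM ?mulr_ge0 ?powR_ge0 ?invr_ge0 ?(ltW e0)//.
  by rewrite [(_ / eps) `^ _]powRM ?powR_ge0 ?invr_ge0 ?(ltW e0)// MQG.
have cc0 : 0 < (nu / 2 + d%:R / 2) / 2 :> R.
  by rewrite divr_gt0// ltr_pwDl// divr_ge0.
have cka : (nu / 2 + d%:R / 2) / 2 <= ka * d%:R by rewrite /ka; move: nuc; move: (d%:R : R); clear => u; lra.
have e01 : 0 < eps <= 1 by rewrite e0.
have [h [N [[h01 hc1 hc2 hc3] [s1 s2 Ne small] tN rN Nr]]] :=
  step_size_exists d0 cc0 cka q2 e01 C01 G1 Y1 t0 L1 lnL Mx1 (powR_ge0 _ _) (powR_ge0 _ _) D1E DE.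
have rateE : lmc_rate nu q eps mu0 = d%:R ^+ 5 * G ^+ 2 / eps * (t ^+ 2 + Y ^+ 2) * Mx.
  rewrite /lmc_rate rM tE -/R2h -/Mx; congr (_ * _ / _ * (_ + _) * _).
    by rewrite /G -expRM_natl; congr expR; rewrite -/Q; ring.
  by rewrite /Y expr2 -powRD ?invr_eq0 ?(gt_eqF e0) ?implybT//; congr (_ `^ _); field; rewrite gt_eqF.
rewrite -/L rateE.
set rate := d%:R ^+ 5 * _ / _ * _ * _ in rN Nr *.
have rate0 : 0 <= rate := mulr_ge0 (mulr_ge0 (divr_ge0 (mulr_ge0 (exprn_ge0 5 (ler0n R d)) (sqr_ge0 G)) (ltW e0))
  (addr_ge0 (sqr_ge0 t) (sqr_ge0 Y))) (le_trans ler01 Mx1).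
have L2 : 1 <= L ^+ 2 by rewrite exprn_ege1.
have /andP[h0 h1] := h01.
exists h, N; split => //.
- apply: le_trans rN; rewrite ler_pdivrMr; last by rewrite mulr_gt0 ?(lt_le_trans ltr01 C1)// (lt_le_trans ltr01 L2).
  by rewrite ler_peMr// mulr_ege1.
- apply: (le_trans Nr); rewrite ler_wpM2r// ler_wpM2r ?sqr_ge0//.
move=> disp O P x [xi [gxi ind xS]] x0.
have q1 : 1 < q by rewrite (lt_le_trans _ q2)// ltr1n.
have msd : measurable_fun setT sdn by exact: measurable_student_density.
have sd0 y : 0 <= sdn y by exact/ltW/student_density_gt0.
have x0d : has_density P (x 0%N) (fun y => g y * sdn y).
  by move=> S mS; rewrite -muE//; exact: x0.
have a0' : 0 < Num.sqrt (2 * h) by rewrite sqrtr_gt0 mulr_gt0.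
have as2 : Num.sqrt (2 * h) ^+ 2 * 1 ^+ 2 = 2 * h.
  by rewrite expr1n mulr1 sqr_sqrtr// mulr_ge0// ltW.
have xS' k w : x k.+1 w = lmc_drift ((nu / 2 + d%:R / 2) / 2) h (x k w) + Num.sqrt (2 * h) *: xi k w.
  by rewrite xS lmc_step_student.
have [mr r0 r1 dr] := noise_density h0 a0' ltr01 as2 gxi ind xS' (measurable_funM mg msd)
  (fun y => mulr_ge0 (g0 y) (sd0 y)) x0d N.
apply: (@renyi_of_density R d nu Z q eps (distribution P (x N)) _ Z0 q1 piE mr r0 dr).
exact: (dec d N h Z M q eps g d0 h01 hc1 hc2 hc3 s1 s2 Ne Z0 ZE M1 q2 e01 mg g0 gM g1 small tN).
Qed.

End lmc_convergence.

Import HBNNSimple.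

(** * From weak to setwise convergence under a uniform bound on densities *)

Section mean_linear.
Context d (T : measurableType d) (R : realType) (m : {sigma_finite_measure set T -> \bar R}) (th : T -> R).
Hypotheses (mth : measurable_fun setT th) (th0 : forall x, 0 <= th x)
  (th1 : (\int[m]_x (th x)%:E = 1)%E).

Definition bounded_nonneg (f : T -> R) : Prop :=
  measurable_fun setT f /\ exists B, forall x, 0 <= f x <= B.

Lemma bounded_meanE f : bounded_nonneg f -> (\int[m]_x (f x * th x)%:E = (mean m th f)%:E)%E.
Proof.
move=> [mf [B fB]]; apply: (@meanE _ _ _ m th mth th0 th1 f B mf).
- by move=> x; case/andP: (fB x).
- by move=> x; case/andP: (fB x).
Qed.

Lemma bounded_nonnegD f g : bounded_nonneg f -> bounded_nonneg g -> bounded_nonneg (fun x => f x + g x).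
Proof.
move=> [mf [B fB]] [mg [B' gB]]; split; first exact: measurable_funD.
exists (B + B') => x; have /andP[? ?] := fB x; have /andP[? ?] := gB x.
by rewrite addr_ge0// lerD.
Qed.

Lemma bounded_nonnegZ c f : 0 <= c -> bounded_nonneg f -> bounded_nonneg (fun x => c * f x).
Proof.
move=> c0 [mf [B fB]]; split; first by apply: measurable_funM => //; exact: measurable_cst.
by exists (c * B) => x; have /andP[? ?] := fB x; rewrite mulr_ge0// ler_wpM2l.
Qed.

Lemma mean_add f g : bounded_nonneg f -> bounded_nonneg g ->
  mean m th (fun x => f x + g x) = mean m th f + mean m th g.
Proof.
move=> bf bg; apply: EFin_inj; rewrite EFinD -!bounded_meanE//; last exact: bounded_nonnegD.
have [[mf [B fB]] [mg [B' gB]]] := (bf, bg).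
have f0 x : 0 <= f x by case/andP: (fB x).
have g0 x : 0 <= g x by case/andP: (gB x).
rewrite -ge0_integralD//.
- by apply: eq_eint => x; rewrite mulrDl.
- by move=> x _; rewrite lee_fin mulr_ge0.
- by apply/measurable_EFinP; exact: measurable_funM.
- by move=> x _; rewrite lee_fin mulr_ge0.
- by apply/measurable_EFinP; exact: measurable_funM.
Qed.

Lemma mean_scale c f : 0 <= c -> bounded_nonneg f ->
  mean m th (fun x => c * f x) = c * mean m th f.
Proof.
move=> c0 bf; apply: EFin_inj; rewrite EFinM -!bounded_meanE//; last exact: bounded_nonnegZ.
have [mf [B fB]] := bf; have f0 x : 0 <= f x by case/andP: (fB x).
rewrite -eintZ//; first by apply: eq_eint => x; rewrite mulrA.
- exact: measurable_funM.
- by move=> x; rewrite mulr_ge0.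
Qed.

Lemma mean_mono f g : bounded_nonneg f -> bounded_nonneg g -> (forall x, f x <= g x) ->
  mean m th f <= mean m th g.
Proof.
move=> bf bg fg; rewrite -lee_fin -!bounded_meanE//.
have [[mf [B fB]] [mg [B' gB]]] := (bf, bg).
apply: le_eint => [||x|x]; [exact: measurable_funM|exact: measurable_funM| |].
- by rewrite mulr_ge0//; case/andP: (fB x).
- by rewrite ler_wpM2r.
Qed.

Lemma mean_monotone_cvg (f_ : nat -> T -> R) f : (forall k, bounded_nonneg (f_ k)) -> bounded_nonneg f ->
  (forall x, {homo f_^~ x : i j / (i <= j)%N >-> i <= j}) ->
  (forall x, f_^~ x @ \oo --> f x) -> mean m th (f_ k) @[k --> \oo] --> mean m th f.
Proof.
move=> bf_ bf nd cv.
have f_0 k x : 0 <= f_ k x by have [_ [B H]] := bf_ k; case/andP: (H x).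
suff : (\int[m]_x (f_ k x * th x)%:E)%E @[k --> \oo] --> (mean m th f)%:E.
  under eq_fun do rewrite bounded_meanE//.
  by move/fine_cvgP => [].
have := @cvg_monotone_convergence _ _ _ m setT measurableT (fun k x => (f_ k x * th x)%:E).
have -> : (\int[m]_x (fun x0 : T => limn ((fun k x => (f_ k x * th x)%:E)^~ x0)) x = (mean m th f)%:E)%E.
  rewrite -bounded_meanE//; apply: eq_integral => x _; apply/cvg_lim => //.
  apply: cvg_EFin; first exact: nearW.
  have -> : fine \o (fun k => (f_ k x * th x)%:E) = (fun k => f_ k x * th x) by [].
  by apply: cvgMl; exact: cv.
apply => //.
- by move=> k; apply/measurable_EFinP; apply: measurable_funM => //; have [] := bf_ k.
- by move=> k x _; rewrite lee_fin mulr_ge0.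
- by move=> x _ i j ij; rewrite lee_fin ler_wpM2r//; exact: nd.
Qed.

End mean_linear.

Lemma dist_le3 (R : realType) (a b c d e : R) : `|a - b| <= e / 3 -> `|b - d| <= e / 3 ->
  0 <= c - d <= e / 3 -> `|a - c| <= e.
Proof.
rewrite !ler_norml => /andP[a1 a2] /andP[b1 b2] /andP[c1 c2]; apply/andP; split; lra.
Qed.

Section setwise_limit.
Context {R : realType} (n : nat) (pi nu : probability 'rV[R]_n R) (g : nat -> 'rV[R]_n -> R) (K : R).
Notation E := 'rV[R]_n.
Hypotheses (mg : forall N, measurable_fun setT (g N)) (g0 : forall N x, 0 <= g N x)
  (gK : forall N x, g N x <= K) (g1 : forall N, (\int[pi]_x (g N x)%:E = 1)%E).
Notation one := (fun _ : E => 1 : R).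
Notation I N f := (mean pi (g N) f).
Notation J f := (mean nu one f).
Notation Pi f := (mean pi one f).

(** Sequential continuity along coordinatewise limits, the form in which the Euler scheme
    converges. *)
Definition coord_continuous_test (f : E -> R) : Prop :=
  [/\ measurable_fun setT f, forall x, 0 <= f x <= 1 &
      forall (y : nat -> E) (x : E), (forall i, (y k) ord0 i @[k --> \oo] --> x ord0 i) ->
        f (y k) @[k --> \oo] --> f x].

Hypothesis weak : forall f, coord_continuous_test f -> I k f @[k --> \oo] --> J f.

Let m1 (p : probability E R) : (\int[p]_x (one x)%:E = 1)%E.
Proof. by rewrite integral_cst//= probability_setT mule1. Qed.

Let mone : measurable_fun setT one. Proof. exact: measurable_cst. Qed.
Let one0 (x : E) : 0 <= one x :> R. Proof. by []. Qed.

Let K0 : 0 <= K. Proof. exact: le_trans (g0 0%N 0) (gK _ _). Qed.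

Definition limit_test (f : E -> R) : Prop := bounded_nonneg f /\ (I k f @[k --> \oo] --> J f).

Let IK N f : bounded_nonneg f -> I N f <= K * Pi f.
Proof.
move=> bf; have [mf [B fB]] := bf.
have f0 x : 0 <= f x by case/andP: (fB x).
rewrite -lee_fin -(bounded_meanE (mg N) (g0 N) (g1 N) bf) EFinM -(bounded_meanE mone one0 (m1 pi) bf).
rewrite -eintZ//; last by move=> x; rewrite mulr1.
  apply: le_eint => [||x|x]; [exact: measurable_funM|by do 2 apply: measurable_funM => //; exact: measurable_cst| |].
  - by rewrite mulr_ge0.
  - by rewrite mulr1 mulrC ler_wpM2r.
by apply: measurable_funM.
Qed.

Lemma limit_testD f h : limit_test f -> limit_test h -> limit_test (fun x => f x + h x).
Proof.
move=> [bf cf] [bh ch]; split; first exact: bounded_nonnegD.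
rewrite (mean_add mone one0 (m1 nu) bf bh).
under eq_fun do rewrite (mean_add (mg _) (g0 _) (g1 _) bf bh).
exact: cvgD.
Qed.

Lemma limit_testZ c f : 0 <= c -> limit_test f -> limit_test (fun x => c * f x).
Proof.
move=> c0 [bf cf]; split; first exact: bounded_nonnegZ.
rewrite (mean_scale mone one0 (m1 nu) c0 bf).
under eq_fun do rewrite (mean_scale (mg _) (g0 _) (g1 _) c0 bf).
by apply: cvgMr.
Qed.

Lemma limit_testB f h : limit_test f -> limit_test h -> (forall x, h x <= f x) ->
  limit_test (fun x => f x - h x).
Proof.
move=> [bf cf] [bh ch] hf.
have bfh : bounded_nonneg (fun x => f x - h x).
  have [[mf [B fB]] [mh [B' hB]]] := (bf, bh).
  split; first exact: measurable_funB.
  exists B => x; rewrite subr_ge0 hf/=; have /andP[? ?] := fB x; have /andP[? ?] := hB x.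
  by rewrite (le_trans (_ : _ <= f x))// gerBl.
have e (p : probability E R) (th : E -> R) : measurable_fun setT th -> (forall x, 0 <= th x) ->
    (\int[p]_x (th x)%:E = 1)%E -> mean p th (fun x => f x - h x) = mean p th f - mean p th h.
  move=> mth th0 th1; apply/eqP; rewrite -subr_eq opprK; apply/eqP.
  rewrite -(mean_add mth th0 th1 bfh bh); congr (mean _ _ _); apply/funext => x.
  by rewrite subrK.
split=> //; rewrite (e nu one)//.
under eq_fun do rewrite (e pi (g _) (mg _) (g0 _) (g1 _)).
exact: cvgB.
Qed.

(** Since the densities are bounded by K, the error of replacing f by f_ k is at most K times its
    pi-mean, uniformly in N, so the monotone limit and the limit in N can be exchanged. *)
Lemma limit_test_monotone (f_ : nat -> E -> R) f : (forall k, limit_test (f_ k)) -> bounded_nonneg f ->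
  (forall x, {homo f_^~ x : i j / (i <= j)%N >-> i <= j}) ->
  (forall x, f_^~ x @ \oo --> f x) -> limit_test f.
Proof.
move=> tf_ bf nd cv; split=> //.
have bf_ k : bounded_nonneg (f_ k) := (tf_ k).1.
have lf k x : f_ k x <= f x.
  by apply: (@nondecreasing_cvgn_le _ (f_^~ x)); [move=> i j ij; exact: nd|exact: (cvgP _ (cv x))] || (
  have <- := cvg_lim (@Rhausdorff R) (cv x); apply: nondecreasing_cvgn_le;
    [by move=> i j ij; exact: nd|exact: cvgP (cv x)]).
have cJ := mean_monotone_cvg mone one0 (m1 nu) bf_ bf nd cv.
have cP := mean_monotone_cvg mone one0 (m1 pi) bf_ bf nd cv.
apply/cvgrPdist_le => e e0.
have e30 : 0 < e / 3 by rewrite divr_gt0.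
have eK : 0 < e / 3 / (K + 1) by rewrite divr_gt0// ltr_wpDl.
have [k [Jk Pk]] : exists k, `|J f - J (f_ k)| <= e / 3 /\ `|Pi f - Pi (f_ k)| <= e / 3 / (K + 1).
  move/cvgrPdist_le : cJ => /(_ _ e30) cJ; move/cvgrPdist_le : cP => /(_ _ eK) cP.
  have [k _ /(_ k (leqnn k)) [? ?]] := filterI cJ cP.
  by exists k.
have [_ ck] := tf_ k.
move/cvgrPdist_le : ck => /(_ _ e30); apply: filterS => N IN.
have bd : bounded_nonneg (fun x => f x - f_ k x).
  have [[mf [B fB]] [mh [B' hB]]] := (bf, bf_ k).
  split; first exact: measurable_funB.
  exists B => x; rewrite subr_ge0 lf/=; have /andP[? ?] := fB x; have /andP[? ?] := hB x.
  by rewrite (le_trans (_ : _ <= f x))// gerBl.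
have e' (th : E -> R) : measurable_fun setT th -> (forall x, 0 <= th x) ->
    (\int[pi]_x (th x)%:E = 1)%E -> mean pi th (fun x => f x - f_ k x) = mean pi th f - mean pi th (f_ k).
  move=> mth th0 th1; apply/eqP; rewrite -subr_eq opprK; apply/eqP.
  rewrite -(mean_add mth th0 th1 bd (bf_ k)); congr (mean _ _ _); apply/funext => x.
  by rewrite subrK.
have Ik : 0 <= I N f - I N (f_ k) <= e / 3.
  rewrite subr_ge0 (mean_mono (mg N) (g0 N) (g1 N) (bf_ k) bf (lf k)) /=.
  rewrite -(e' (g N))//; apply: (le_trans (IK N bd)); rewrite e'//.
  apply: (le_trans (ler_wpM2l K0 (le_trans (ler_norm _) Pk))).
  by rewrite mulrCA ler_piMr ?(ltW e30)// ler_pdivrMr ?ltr_wpDl// mul1r lerDl.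
exact: dist_le3 Jk IN Ik.
Qed.

(** Sets whose indicator is an increasing limit of continuous tests: stable under intersection and
    containing the coordinate rays, hence generating. *)
Let open_gen := [set A : set E | exists f_ : nat -> E -> R, [/\ forall k, coord_continuous_test (f_ k),
  forall x, {homo f_^~ x : i j / (i <= j)%N >-> i <= j} & forall x, f_^~ x @ \oo --> (\1_A x : R)]].

Let open_genI : setI_closed open_gen.
Proof.
move=> A B [f_ [tf nf cf]] [h_ [th nh ch]]; exists (fun k x => f_ k x * h_ k x); split.
- move=> k; have [mf f01 sf] := tf k; have [mh h01 sh] := th k; split.
  + exact: measurable_funM.
  + move=> x; have /andP[? ?] := f01 x; have /andP[? ?] := h01 x.
    by rewrite mulr_ge0// mulr_ile1.
  + by move=> y x yx; apply: cvgM; [exact: sf|exact: sh].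
- move=> x i j ij; have [_ f01 _] := tf i; have [_ h01 _] := th i.
  have /andP[? ?] := f01 x; have /andP[? ?] := h01 x.
  by apply: ler_pM => //; [exact: nf|exact: nh].
- by move=> x; rewrite indicI; apply: cvgM; [exact: cf|exact: ch].
Qed.

Let ray_gen (i : 'I_n) (s : R) : open_gen [set x : E | s < x ord0 i].
Proof.
exists (fun k x => Num.min 1 (k%:R * Num.max 0 (x ord0 i - s))); split.
- move=> k; split.
  + apply: measurable_minr => //; apply: measurable_funM => //; apply: measurable_maxr => //.
    by apply: measurable_funB => //; exact: measurable_coord.
  + by move=> x; rewrite ge_min lexx /= le_min ler01 /= mulr_ge0// le_max lexx.
  + move=> y x yx.
    under eq_fun do rewrite minr_absE maxr_absE.
    rewrite minr_absE maxr_absE.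
    have cu : (y j) ord0 i - s @[j --> \oo] --> x ord0 i - s by apply: cvgB; [exact: yx|exact: cvg_cst].
    have cm : (0 + ((y j) ord0 i - s) + `|0 - ((y j) ord0 i - s)|) / 2 @[j --> \oo] -->
        (0 + (x ord0 i - s) + `|0 - (x ord0 i - s)|) / 2.
      apply: cvgMl; apply: cvgD; first by apply: cvgD => //; exact: cvg_cst.
      by apply: cvg_norm; apply: cvgB => //; exact: cvg_cst.
    have ck := @cvgMr _ _ _ _ _ (k%:R : R) _ cm.
    apply: cvgMl; apply: cvgB; first by apply: cvgD; [exact: cvg_cst|exact: ck].
    by apply: cvg_norm; apply: cvgB; [exact: cvg_cst|exact: ck].
- move=> x a b ab; rewrite le_min ge_min lexx /= ge_min; apply/orP; right.
  by rewrite ler_wpM2r ?le_max ?lexx// ler_nat.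
- move=> x; rewrite indicE; case: (boolP (x \in _)) => [/set_mem/= sx|/negP sx].
    have [k0 hk0] : exists k0 : nat, 1 <= k0%:R * (x ord0 i - s).
      exists (Num.truncn (x ord0 i - s)^-1).+1.
      by rewrite -ler_pdivrMr ?subr_gt0// div1r ltW// truncnS_gt.
    apply: cvg_near_cst; exists k0 => // k /= kk.
    apply/eqP; rewrite min_l//; apply: (le_trans hk0).
    by rewrite max_r ?subr_ge0 ?(ltW sx)// ler_wpM2r ?subr_ge0 ?(ltW sx)// ler_nat.
  apply: cvg_near_cst; exists 0%N => // k _.
  have xs : x ord0 i <= s by rewrite leNgt; apply/negP => h; apply: sx; rewrite inE.
  by rewrite max_l ?subr_le0// mulr0 min_r.
Qed.

Let indic_bounded A : measurable A -> bounded_nonneg (\1_A : E -> R).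
Proof.
move=> mA; split; first exact: measurable_indic.
by exists 1 => x; rewrite indicE; case: (_ \in _); rewrite ?lexx ?ler01.
Qed.

Let gen_measurable : @measurable _ E `<=` <<s open_gen >>.
Proof.
move=> A mA.
have mid : measurable_fun setT (fun x : g_sigma_algebraType open_gen => (x : E)).
  apply: measurable_fun_rV => i; apply: (measurability _ (RGenOInfty.measurableE R)) => _ [_ [s ->] <-].
  rewrite setTI; apply: sub_sigma_algebra.
  have -> : (fun x : g_sigma_algebraType open_gen => (x : E) ord0 i) @^-1` `]s, +oo[%classic =
    [set x : E | s < x ord0 i] by apply/seteqP; split => x /=; rewrite in_itv/= andbT.
  exact: ray_gen.
by have := mid measurableT A mA; rewrite setTI.
Qed.

(** Dynkin's theorem: the sets whose indicator passes to the limit form a lambda-system containing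
    [open_gen]. *)
Lemma limit_test_indic A : measurable A -> limit_test (\1_A : E -> R).
Proof.
move=> mA; pose H := [set B : set E | measurable B /\ limit_test (\1_B : E -> R)].
have sH : forall X, (<<s open_gen >>) X -> X `<=` setT by [].
suff : H A by case.
apply: (lambda_system_subset open_genI (D := setT) (H := H) _ _ sH); last exact: gen_measurable.
- split => //.
  + split => //; split; first exact: indic_bounded.
    rewrite indicT; apply: cvg_near_cst; apply: nearW => k.
    have mean1 (p : probability E R) (th : E -> R) : (\int[p]_x (th x)%:E = 1)%E -> mean p th (cst 1) = 1.
      by move=> h; rewrite /mean; under eq_eint do rewrite mul1r; rewrite h.
    by apply/eqP; rewrite !mean1.
  + move=> A' B' BA [mA' tA] [mB' tB]; split; first exact: measurableD.
    have -> : (\1_(A' `\` B') : E -> R) = (fun x => \1_A' x - \1_B' x).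
      apply/funext => x; rewrite !indicE in_setD; case: (boolP (x \in B')) => xB /=; rewrite ?andbT ?andbF ?subr0//.
      by rewrite (mem_set (BA _ (set_mem xB))) subrr.
    apply: limit_testB => // x; rewrite !indicE; case: (boolP (x \in B')) => // xB.
    by rewrite (mem_set (BA _ (set_mem xB))).
  + move=> F ndF HF; have mF : measurable (\bigcup_i F i) by apply: bigcup_measurable => i _; have [] := HF i.
    split => //; apply: (limit_test_monotone (f_ := fun k => \1_(F k))).
    * by move=> k; have [] := HF k.
    * exact: indic_bounded.
    * move=> x i j ij; rewrite !indicE; case: (boolP (x \in F i)) => // xi.
      by have /subsetPset/(_ _ (set_mem xi)) xj := ndF _ _ ij; rewrite mem_set.
    * move=> x; rewrite indicE; case: (boolP (x \in _)) => [/set_mem [k _ Fk]|/negP xF].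
        apply: cvg_near_cst; exists k => // j /= kj.
        by rewrite indicE mem_set//; have /subsetPset := ndF _ _ kj; apply.
      apply: cvg_near_cst; exists 0%N => // j _.
      by rewrite indicE memNset// => Fj; apply: xF; rewrite inE; exists j.
- move=> B [f_ [tf nf cf]].
  have mB : measurable B.
    have -> : B = (\1_B : E -> R) @^-1` [set 1].
      apply/seteqP; split => x /=; rewrite indicE; first by move=> xB; rewrite mem_set.
      by case: (boolP (x \in B)) => [/set_mem//|_ /eqP]; rewrite eq_sym oner_eq0.
    rewrite -[X in measurable X]setTI.
    have : measurable_fun setT (\1_B : E -> R).
      by apply: (measurable_fun_cvg (h := f_)) => [k|x _]; [have [] := tf k|exact: cf].
    by apply.
  split => //; apply: (limit_test_monotone (f_ := f_)) => //; last exact: indic_bounded.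
  move=> k; have [mf f01 _] := tf k; split; last exact: weak.
  by split => //; exists 1.
Qed.

Lemma limit_test_bounded f : bounded_nonneg f -> limit_test f.
Proof.
move=> bf; have [mf [B fB]] := bf.
have f0 x : 0 <= f x by case/andP: (fB x).
have mf' : measurable_fun setT (EFin \o f) by exact/measurable_EFinP.
pose s_ (k : nat) : {nnsfun E >-> R} := nnsfun_approx (@measurableT _ E) mf' k.
have nds (x : E) (i j : nat) : (i <= j)%N -> s_ i x <= s_ j x.
  by move=> ij; have /lefP := nd_nnsfun_approx (@measurableT _ E) mf' ij; apply.
have cvs (x : E) : s_ k x @[k --> \oo] --> f x.
  have := @cvg_nnsfun_approx _ _ _ _ (@measurableT _ E) _ mf' (fun y _ => f0 y : (0 <= (EFin \o f) y)%E) x Logic.I.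
  by move=> /fine_cvgP [].
apply: (@limit_test_monotone (fun k (x : E) => s_ k x) f _ bf nds cvs).
move=> k; pose s := finmap.enum_fset (fset_set (range (s_ k))).
(* The maximum with 0 leaves the attained values unchanged and makes every coefficient nonnegative,
   as [limit_testZ] requires. *)
have -> : (fun x : E => s_ k x) = fun x => \sum_(i < size s) Num.max 0 s`_i * \1_(s_ k @^-1` [set s`_i]) x.
  apply/funext => x; rewrite (fimfunEord (s_ k)); apply: eq_bigr => i _.
  rewrite indicE; case: (boolP (x \in _)) => [/set_mem /= e|_]; last by rewrite !mulr0.
  by rewrite max_r// -/s -e.
  move: (size s) => j; elim: j => [|j IH].
    have -> : (fun x : E => \sum_(i < 0) Num.max 0 s`_i * \1_(s_ k @^-1` [set s`_i]) x) = (fun x => 0 * \1_setT x : R).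
      by apply/funext => x; rewrite big_ord0 mul0r.
    by apply: limit_testZ => //; exact: limit_test_indic.
  have -> : (fun x : E => \sum_(i < j.+1) Num.max 0 s`_i * \1_(s_ k @^-1` [set s`_i]) x) =
     (fun x => \sum_(i < j) Num.max 0 s`_i * \1_(s_ k @^-1` [set s`_i]) x + Num.max 0 s`_j * \1_(s_ k @^-1` [set s`_j]) x).
    by apply/funext => x; rewrite big_ord_recr.
  apply: limit_testD => //; apply: limit_testZ; first by rewrite le_max lexx.
  by apply: limit_test_indic; rewrite -[X in measurable X]setTI; exact: measurable_funPT.
Qed.

End setwise_limit.

(** * Pathwise convergence of the Euler scheme *)

Section euler_scheme.
Context {R : realType}.

Lemma near_forall_fin {T : Type} (F : set_system T) (I : finType) (P : I -> T -> Prop) : Filter F ->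
  (forall i, \forall x \near F, P i x) -> \forall x \near F, forall i, P i x.
Proof.
move=> FF H; have : \forall x \near F, forall i, i \in enum I -> P i x.
  elim: (enum I) => [|a s IH]; first exact: nearW.
  by apply: filterS2 IH (H a) => x h1 h2 i; rewrite inE => /orP[/eqP->//|]; exact: h1.
by apply: filterS => x h i; apply: h; rewrite mem_enum.
Qed.

(** Heine's theorem, through the near-covering form of the compactness of [0, T]. *)
Lemma uniform_modulus (f : R -> R) (T d : R) : {within `[0, +oo[%classic, continuous f} -> 0 < d ->
  exists2 r : R, 0 < r & forall s t, 0 <= s <= T -> 0 <= t <= T -> `|s - t| <= r -> `|f s - f t| <= d.
Proof.
move=> cf d0.
have loc x : 0 <= x -> exists2 r : R, 0 < r & forall s, 0 <= s -> `|s - x| < r -> `|f s - f x| <= d / 2.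
  move=> x0; have /subspace_continuousP/(_ x) := cf.
  rewrite /= in_itv/= andbT => /(_ x0)/cvgrPdist_le/(_ (d / 2)); rewrite divr_gt0// => /(_ isT).
  rewrite /within /= => /nbhs_ballP [r /= r0 H]; exists r => // s s0 sx.
  by rewrite distrC; apply: H; [rewrite /ball/= distrC|rewrite in_itv/= s0].
have /compact_near_coveringP cov := @segment_compact R 0 T.
have := cov R (0 : R)^'+ (fun r s => 0 <= s -> forall t, 0 <= t -> `|s - t| <= r -> `|f s - f t| <= d) _.
have H : forall x, `[0, T]%classic x -> \forall x' \near x & r \near (0 : R)^'+,
    0 <= x' -> forall t, 0 <= t -> `|x' - t| <= r -> `|f x' - f t| <= d.
  move=> x /=; rewrite in_itv/= => /andP[x0 _]; have [r r0 Hr] := loc x x0.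
  exists ((fun y : R => `|y - x| < r / 2) : set R, (fun u : R => u < r / 2) : set R).
    split; last by apply: nbhs_right_lt; rewrite divr_gt0.
    apply/nbhs_ballP; exists (r / 2) => /=; first by rewrite divr_gt0.
    by move=> y; rewrite /ball/= distrC.
  move=> [y u] [/= yx ur] y0 t t0 yt.
  have yr : `|y - x| < r by apply: (lt_trans yx); move: r0; clear; lra.
  have tr : `|t - x| < r.
    have -> : t - x = (t - y) + (y - x) by ring.
    apply: (le_lt_trans (ler_normD _ _)); rewrite (distrC t y).
    by move: yt yx ur; move: `|y - t| `|y - x|; clear => *; lra.
  have -> : f y - f t = (f y - f x) - (f t - f x) by ring.
  apply: (le_trans (ler_normB _ _)).
  by have := Hr _ y0 yr; have := Hr _ t0 tr; move: `|f y - f x| `|f t - f x|; clear => *; lra.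
move=> /(_ _ H) nr.
have [r [r0 Hr]] : exists r : R, 0 < r /\ `[0, T]%classic `<=`
    (fun s => 0 <= s -> forall t, 0 <= t -> `|s - t| <= r -> `|f s - f t| <= d).
  have : \forall r \near (0 : R)^'+, 0 < r /\ `[0, T]%classic `<=`
    (fun s => 0 <= s -> forall t, 0 <= t -> `|s - t| <= r -> `|f s - f t| <= d).
    by near=> r; split; [near: r; exact: nbhs_right_gt|near: r].
  by move=> /filter_ex.
exists r => // s t /andP[s0 sT] /andP[t0 _] st; apply: Hr => //=.
by rewrite in_itv/= s0.
Unshelve. all: by end_near. Qed.

Lemma continuous_nonneg_integrable (f : R -> R) (t : R) : {within `[0, +oo[%classic, continuous f} ->
  (@lebesgue_measure R).-integrable `[0, t]%classic (EFin \o f).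
Proof.
move=> cf; apply: continuous_compact_integrable; first exact: segment_compact.
apply: (continuous_subspaceW _ cf) => x /=; rewrite !in_itv/= => /andP[-> _] //.
Qed.

Lemma integral_increment (f : R -> R) (a b m e : R) : {within `[0, +oo[%classic, continuous f} ->
  0 <= a <= b -> (forall s, a <= s <= b -> `|f s - m| <= e) ->
  `|\int[lebesgue_measure]_(s in `[0, b]) f s - \int[lebesgue_measure]_(s in `[0, a]) f s - (b - a) * m|
    <= (b - a) * e.
Proof.
move=> cf /andP[a0 ab] H.
have fint := @continuous_nonneg_integrable f b cf.
rewrite (@Rintegral_itvB R f (BLeft 0) (BRight b) a fint)//.
have fint' : (@lebesgue_measure R).-integrable `]a, b]%classic (EFin \o f).
  apply: (integrableS _ _ _ fint) => //= x /=; rewrite !in_itv/= => /andP[ax ->].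
  by rewrite andbT (le_trans a0 (ltW ax)).
have cint (c : R) : (@lebesgue_measure R).-integrable `]a, b]%classic (EFin \o (fun _ : R => c)).
  have cc : {within `[0, +oo[%classic, continuous (fun _ : R => c)}.
    by apply: continuous_subspaceT => z; exact: cst_continuous.
  have ci := @continuous_nonneg_integrable (fun _ : R => c) b cc.
  apply: (integrableS _ _ _ ci) => //= x /=; rewrite !in_itv/= => /andP[ax ->].
  by rewrite andbT (le_trans a0 (ltW ax)).
have ce (c : R) : \int[lebesgue_measure]_(s in `]a, b]) c = (b - a) * c.
  have -> : \int[lebesgue_measure]_(s in `]a, b]) c = c * fine (@lebesgue_measure R [set` `]a, b]%R]).
    exact: (Rintegral_cst (@lebesgue_measure R)).
  rewrite lebesgue_measure_itv/= lte_fin; case: ltgtP ab => //= [_ _|-> _].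
    by rewrite mulrC.
  by rewrite subrr mulr0 mul0r.
have lo : (b - a) * (m - e) <= \int[lebesgue_measure]_(s in `]a, b]) f s.
  rewrite -ce; apply: le_Rintegral => // s /=; rewrite in_itv/= => /andP[as_ sb].
  have := H s; rewrite (ltW as_) sb => /(_ isT); rewrite ler_norml => /andP[u _].
  by move: u; clear; lra.
have hi : \int[lebesgue_measure]_(s in `]a, b]) f s <= (b - a) * (m + e).
  rewrite -ce; apply: le_Rintegral => // s /=; rewrite in_itv/= => /andP[as_ sb].
  have := H s; rewrite (ltW as_) sb => /(_ isT); rewrite ler_norml => /andP[_ u].
  by move: u; clear; lra.
rewrite ler_norml; move: lo hi; rewrite mulrBr mulrDr.
move: ((b - a) * m) ((b - a) * e) (\int[_]_(_ in _) _) => u v w; clear => lo hi.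
by apply/andP; split; lra.
Qed.

Section scheme.
Context (n : nat) (G : 'rV[R]_n -> 'rV[R]_n) (La T : R) (x b : R -> 'rV[R]_n) (be : R).
Notation E := 'rV[R]_n.
Hypotheses (La0 : 0 <= La) (T0 : 0 < T)
  (GL : forall (u v : E) r i, (forall j, `|u ord0 j - v ord0 j| <= r) -> `|G u ord0 i - G v ord0 i| <= La * r)
  (cx : {within `[0, +oo[%classic, continuous x})
  (xE : forall t, 0 <= t -> x t = x 0
          - \row_i (\int[lebesgue_measure]_(s in `[0, t]) G (x s) ord0 i) + be *: b t).

Fixpoint euler (h : R) (k : nat) : E :=
  if k is j.+1 then euler h j - h *: G (euler h j) + be *: (b (j.+1%:R * h) - b (j%:R * h)) else x 0.

Let cxi i : {within `[0, +oo[%classic, continuous (fun t => x t ord0 i)}.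
Proof.
move=> t; apply: (@continuous_comp _ _ _ (x : subspace _ -> E) (fun u : E => u ord0 i)); first exact: cx.
exact: coord_continuous.
Qed.

Let cGx i : {within `[0, +oo[%classic, continuous (fun t => G (x t) ord0 i)}.
Proof.
apply/subspace_continuousP => t t0; apply/cvgrPdist_le => e e0.
have [La1 La10 La1e] : exists2 l, 0 < l & La * l <= e.
  exists (e / (La + 1)); first by rewrite divr_gt0// ltr_wpDl.
  by rewrite mulrCA ler_piMr ?(ltW e0)// ler_pdivrMr ?ltr_wpDl// mul1r lerDl.
have H : \forall s \near within `[0, +oo[%classic (nbhs t), forall j, `|x t ord0 j - x s ord0 j| <= La1.
  apply: near_forall_fin => j; have /subspace_continuousP/(_ t t0) := @cxi j.
  by move/cvgrPdist_le => /(_ _ La10).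
by apply: filterS H => s Hs; exact: (le_trans (GL i Hs) La1e).
Qed.

(** Discrete Gronwall. Over one step the drift along the path differs from the drift of the scheme
    by at most La times the current error plus the modulus d; the additive noise is common to both
    and cancels. *)
Lemma euler_error h d k : 0 < h -> 0 <= d -> k%:R * h <= T ->
  (forall s t j, 0 <= s <= T -> 0 <= t <= T -> `|s - t| <= h -> `|x s ord0 j - x t ord0 j| <= d) ->
  forall i, `|x (k%:R * h) ord0 i - euler h k ord0 i| <= ((1 + h * La) ^+ k - 1) * d.
Proof.
move=> h0 d0 + mod; elim: k => [|k IH] kT i.
  have z : 0%:R * h = 0 by rewrite mul0r.
  by rewrite z /= expr0 !subrr mul0r normr0.
have kT' : k%:R * h <= T by apply: le_trans kT; rewrite ler_wpM2r ?(ltW h0)// ler_nat.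
have kh0 : 0 <= k%:R * h by rewrite mulr_ge0// ltW.
have kh1 : k.+1%:R * h = k%:R * h + h by rewrite -natr1 mulrDl mul1r.
set D := ((1 + h * La) ^+ k - 1) * d.
have D0 : 0 <= D by rewrite mulr_ge0// subr_ge0 exprn_ege1// lerDl mulr_ge0// ltW.
have Hm s : k%:R * h <= s <= k.+1%:R * h -> `|G (x s) ord0 i - G (euler h k) ord0 i| <= La * (D + d).
  move=> /andP[s1 s2]; apply: GL => j.
  have -> : x s ord0 j - euler h k ord0 j = (x (k%:R * h) ord0 j - euler h k ord0 j) + (x s ord0 j - x (k%:R * h) ord0 j) by ring.
  apply: (le_trans (ler_normD _ _)); apply: lerD; first exact: IH.
  apply: mod.
  - by rewrite (le_trans kh0 s1) (le_trans s2).
  - by rewrite kh0.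
  - by rewrite ger0_norm ?subr_ge0// lerBlDl -kh1.
have kab : 0 <= k%:R * h <= k.+1%:R * h by rewrite kh0 kh1 lerDl ltW.
have H := @integral_increment (fun s => G (x s) ord0 i) _ _ (G (euler h k) ord0 i) (La * (D + d)) (@cGx i) kab Hm.
rewrite kh1 (_ : k%:R * h + h - k%:R * h = h) in H; last by ring.
have x1 : x (k.+1%:R * h) ord0 i - euler h k.+1 ord0 i =
   (x (k%:R * h) ord0 i - euler h k ord0 i) - (\int[lebesgue_measure]_(s in `[0, k%:R * h + h]) G (x s) ord0 i -
    \int[lebesgue_measure]_(s in `[0, k%:R * h]) G (x s) ord0 i - h * G (euler h k) ord0 i).
  rewrite kh1 [x (_ + _)]xE ?addr_ge0 ?(ltW h0)// [x (k%:R * h)]xE//= !mxE kh1.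
  by move: (\int[_]_(_ in _) _) (\int[_]_(_ in _) _) => I1 I2; ring.
rewrite x1; apply: (le_trans (ler_normB _ _)).
apply: (le_trans (lerD (IH kT' i) H)); rewrite -/D exprS /D.
by apply: eq_lexx; ring.
Qed.

Lemma euler_cvg (i : 'I_n) : euler (T / k.+1%:R) k.+1 ord0 i @[k --> \oo] --> x T ord0 i.
Proof.
apply/cvgrPdist_le => e e0.
(* The Gronwall factor (1 + hLa)^N - 1 is at most exp(La T) when N h = T, so this modulus yields the
   error e. *)
pose d := e / expR (La * T).
have d0 : 0 < d by rewrite divr_gt0// expR_gt0.
have [r r0 Hr] : exists2 r : R, 0 < r & forall s t j, 0 <= s <= T -> 0 <= t <= T -> `|s - t| <= r ->
    `|x s ord0 j - x t ord0 j| <= d.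
  have : \forall r \near (0 : R)^'+, forall j, forall s t, 0 <= s <= T -> 0 <= t <= T -> `|s - t| <= r ->
    `|x s ord0 j - x t ord0 j| <= d.
    apply: near_forall_fin => j; have [r r0 Hr] := uniform_modulus T (@cxi j) d0.
    near=> u => s t sT tT st; apply: Hr => //; apply: (le_trans st).
    by near: u; exact: nbhs_right_le.
  move=> H; have : \forall r \near (0 : R)^'+, 0 < r /\ (forall j, forall s t, 0 <= s <= T -> 0 <= t <= T -> `|s - t| <= r ->
    `|x s ord0 j - x t ord0 j| <= d).
    by near=> r; split; [near: r; exact: nbhs_right_gt|near: r].
  by move=> /filter_ex [r [r0 Hr]]; exists r => // s t j; exact: Hr.
exists (Num.truncn (T / r)).+1 => // k kT.
have {}kT : (Num.truncn (T / r) < k)%N by exact: kT.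
set y := euler _ _.
have k0 : 0 < k.+1%:R :> R by rewrite ltr0n.
have kh : k.+1%:R * (T / k.+1%:R) = T by rewrite mulrC divfK// gt_eqF.
have hr : T / k.+1%:R <= r.
  rewrite ler_pdivrMr// mulrC -ler_pdivrMr//; apply: ltW; apply: (lt_trans (truncnS_gt _)).
  by rewrite ltr_nat.
have h0 : 0 < T / k.+1%:R by rewrite divr_gt0.
have := @euler_error (T / k.+1%:R) d k.+1 h0 (ltW d0); rewrite kh lexx => /(_ isT).
move=> /(_ (fun s t j sT tT st => Hr s t j sT tT (le_trans st hr)) i) H.
rewrite -/y in H; apply: (le_trans H); rewrite /d -[leRHS](divfK (_ : expR (La * T) != 0)) ?gt_eqF ?expR_gt0//.
rewrite mulrC ler_wpM2l ?(ltW d0)//; apply: (@le_trans _ _ (expR (T / k.+1%:R * La) ^+ k.+1)).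
  rewrite lerBlDr; apply: (@le_trans _ _ (expR (T / k.+1%:R * La) ^+ k.+1)); last by rewrite lerDl.
  have b0 : 0 <= 1 + T / k.+1%:R * La by rewrite addr_ge0// mulr_ge0// ltW.
  by rewrite ler_pXn2r ?nnegrE ?expR_ge0//; exact: expR_ge1Dx.
by rewrite -expRM_natl mulrA kh mulrC.
Unshelve. all: by end_near. Qed.

End scheme.
End euler_scheme.

(** * Lower semicontinuity of the Renyi divergence *)

Lemma powR_predr (R : realType) (x q : R) : 0 <= x -> q != 0 -> x `^ q = x `^ (q - 1) * x.
Proof.
move=> x0 q0; transitivity (x `^ (q - 1) * x `^ 1); last by rewrite (powRr1 x0).
by rewrite -powRD ?subrK ?(negbTE q0).
Qed.

Section renyi_limit.
Context {R : realType} (n : nat) (pi nu : probability 'rV[R]_n R) (g : nat -> 'rV[R]_n -> R) (K : R).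
Notation E := 'rV[R]_n.
Hypotheses (mg : forall N, measurable_fun setT (g N)) (g0 : forall N x, 0 <= g N x)
  (gK : forall N x, g N x <= K) (g1 : forall N, (\int[pi]_x (g N x)%:E = 1)%E)
  (weak : forall f, coord_continuous_test f -> mean pi (g k) f @[k --> \oo] --> mean nu (fun=> 1) f).

Let mone : measurable_fun setT (fun _ : E => 1 : R). Proof. exact: measurable_cst. Qed.
Let one0 (x : E) : 0 <= (fun _ : E => 1 : R) x. Proof. by []. Qed.
Let m1 (p : probability E R) : (\int[p]_x ((fun _ : E => 1 : R) x)%:E = 1)%E.
Proof. by rewrite integral_cst//= probability_setT mule1. Qed.

Let lim f : bounded_nonneg f -> mean pi (g k) f @[k --> \oo] --> mean nu (fun=> 1) f.
Proof. by move=> bf; have [] := limit_test_bounded mg g0 gK g1 weak bf. Qed.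

Let nuE f : bounded_nonneg f -> (\int[nu]_x (f x)%:E = (mean nu (fun=> 1) f)%:E)%E.
Proof.
move=> bf; rewrite -(bounded_meanE mone one0 (m1 nu) bf).
by apply: eq_eint => x; rewrite mulr1.
Qed.

Let dom : nu `<< pi.
Proof.
apply/null_content_dominatesP => A mA A0.
have bA : bounded_nonneg (\1_A : E -> R).
  split; first exact: measurable_indic.
  by exists 1 => x; rewrite indicE; case: (_ \in _); rewrite ?lexx ?ler01.
have := lim bA.
have -> : (fun k => mean pi (g k) (\1_A : E -> R)) = (fun _ => 0).
  apply/funext => k; rewrite /mean.
  under eq_eint do rewrite mulrC.
  by rewrite -(integral_indic_EFin pi (g k) mA) null_set_integral//; apply/measurable_EFinP; exact: measurable_funTS.
move=> /(cvg_lim (@Rhausdorff R)); rewrite lim_cst// => e.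
by have := nuE bA; rewrite -e integral_indic// setIT.
Qed.

Let density_exists : exists D : E -> R, [/\ measurable_fun setT D, forall x, 0 <= D x &
  forall A, measurable A -> (nu A = \int[pi]_(x in A) (D x)%:E)%E].
Proof.
have cdom : charge_of_finite_measure nu `<< pi by [].
set D := density nu pi; have intD : pi.-integrable setT D := Radon_Nikodym_integrable cdom.
have mD := measurable_int _ intD.
have D0 : \forall x \ae pi, (0 <= D x)%E.
  have := ae_eq_Radon_Nikodym_SigmaFinite dom measurableT; apply: filterS => x /= H.
  rewrite /D /density -H//; exact: (Radon_Nikodym_SigmaFinite.f_ge0 dom).
have Dfin : \forall x \ae pi, setT x -> D x \is a fin_num := integrable_ae measurableT intD.
have mG : measurable_fun setT (fun x => Num.max (fine (D x)) 0).
  apply: measurable_maxr => //; exact: (measurableT_comp (@fine_measurable _ setT measurableT)).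
exists (fun x => Num.max (fine (D x)) 0); split => //.
  by move=> x; rewrite le_max lexx orbT.
move=> A mA; rewrite -[LHS]/(charge_of_finite_measure nu A) (Radon_Nikodym_integral cdom mA).
apply: ae_eq_integral => //.
- exact: measurable_funTS.
- by apply/measurable_EFinP; exact: measurable_funTS.
- apply: filterS2 Dfin D0 => x; rewrite -/D => Df Dp _; change (D x = (Num.max (fine (D x)) 0)%:E).
  have Df' := Df Logic.I; rewrite max_l ?fine_ge0//.
  by rewrite fineK.
Qed.

(** Duality. Let D be the limit density, u = min(D, B), F = E u^q and X the common bound. Then F is
    at most the nu-mean of u^(q-1), which is the limit of the pi-means of g_k u^(q-1); Young bounds
    these by (1 - 1/q) F + X/q. As F is finite, F <= X, and B tends to infinity. *)
Lemma renyi_limit (q e : R) : 2 <= q ->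
  (\forall k \near \oo, (\int[pi]_x (g k x `^ q)%:E <= (expR ((q - 1) * e))%:E)%E) ->
  (renyi q nu pi <= e%:E)%E.
Proof.
move=> q2 qb; have [D [mD D0 DE]] := density_exists.
have q1 : 1 < q by rewrite (lt_le_trans _ q2)// ltr1n.
have q0 : 0 < q by rewrite (lt_trans _ q1).
have q10 : 0 < q - 1 by rewrite subr_gt0.
apply: (renyi_le mD D0 DE q1).
set X := expR ((q - 1) * e) in qb *.
pose u (B : nat) x := Num.min (D x) B%:R.
have mu B : measurable_fun setT (u B) by apply: measurable_minr => //; exact: measurable_cst.
have u0 B x : 0 <= u B x by rewrite le_min D0 ler0n.
have uB B x : u B x <= B%:R by rewrite ge_min lexx orbT.
have pow_bd B r : 0 <= r -> bounded_nonneg (fun x => u B x `^ r).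
  move=> r0; split; first exact: measurable_powRf.
  exists (B%:R `^ r) => x; rewrite powR_ge0/=; apply: ge0_ler_powR; rewrite ?nnegrE//.
have key B : mean pi (fun=> 1) (fun x => u B x `^ q) <= X.
  set F := mean _ _ _.
  have FE : (\int[pi]_x (u B x `^ q)%:E = F%:E)%E.
    rewrite -(bounded_meanE mone one0 (m1 pi) (pow_bd B q (ltW q0))).
    by apply: eq_eint => x; rewrite mulr1.
  have bphi := pow_bd B (q - 1) (ltW q10).
  have FJ : F <= mean nu (fun=> 1) (fun x => u B x `^ (q - 1)).
    rewrite -lee_fin -FE -nuE// (@density_integral _ _ _ pi nu D _ mD D0 DE (measurable_powRf (q - 1) (mu B)) (fun x => powR_ge0 _ _)).
    apply: le_eint => [||x|x].
    - exact: measurable_powRf.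
    - exact: (measurable_funM (measurable_powRf (q - 1) (mu B)) mD).
    - exact: powR_ge0.
    - rewrite (powR_predr (u0 B x)) ?gt_eqF//.
      by rewrite ler_wpM2l ?powR_ge0// ge_min lexx.
  have Ib : \forall k \near \oo, mean pi (g k) (fun x => u B x `^ (q - 1)) <= (1 - q^-1) * F + q^-1 * X.
    apply: filterS qb => k qk.
    rewrite -lee_fin -(bounded_meanE (mg k) (g0 k) (g1 k) bphi) EFinD EFinM.
    have c1 : 0 <= 1 - q^-1 by rewrite subr_ge0 invf_le1// ltW.
    have c2 : 0 <= q^-1 by rewrite invr_ge0 ltW.
    have gq : (q^-1%:E * \int[pi]_x (g k x `^ q)%:E <= (q^-1 * X)%:E)%E.
      by rewrite EFinM lee_wpmul2l.
    apply: le_trans (leeD (lexx _) gq); rewrite -FE -!eintZ//; last 4 first.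
    - exact: measurable_powRf.
    - by move=> x; exact: powR_ge0.
    - exact: measurable_powRf.
    - by move=> x; exact: powR_ge0.
    rewrite -ge0_integralD//; last 4 first.
    - by move=> x _; rewrite lee_fin mulr_ge0// powR_ge0.
    - by apply/measurable_EFinP; apply: measurable_funM; [exact: measurable_cst|exact: measurable_powRf].
    - by move=> x _; rewrite lee_fin mulr_ge0// powR_ge0.
    - by apply/measurable_EFinP; apply: measurable_funM; [exact: measurable_cst|exact: measurable_powRf].
    under [leRHS]eq_integral do rewrite -EFinD.
    apply: le_eint => [||x|x].
    - exact: (measurable_funM (measurable_powRf (q - 1) (mu B)) (mg k)).
    - apply: measurable_funD; apply: measurable_funM; [exact: measurable_cst|exact: measurable_powRf|exact: measurable_cst|exact: measurable_powRf].
    - by rewrite mulr_ge0// powR_ge0.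
    - have r0 : 0 < q / (q - 1) by rewrite divr_gt0.
      have rq : (q / (q - 1))^-1 + q^-1 = 1 by field; rewrite !gt_eqF.
      have := conjugate_powR (powR_ge0 (u B x) (q - 1)) (g0 k x) r0 q0 rq.
      rewrite -powRrM (_ : (q - 1) * (q / (q - 1)) = q); last by field; rewrite gt_eqF.
      move=> H; apply: (le_trans H); apply: eq_lexx.
      have -> : (q / (q - 1))^-1 = 1 - q^-1 by apply: (addIr q^-1); rewrite rq subrK.
      by rewrite mulrC [X in _ + X]mulrC.
  have JF : mean nu (fun=> 1) (fun x => u B x `^ (q - 1)) <= (1 - q^-1) * F + q^-1 * X.
    have cv := lim bphi; have <- := cvg_lim (@Rhausdorff R) cv.
    by apply: limr_le Ib; apply/cvg_ex; eexists; exact: cv.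
  have := le_trans FJ JF; rewrite mulrBl mul1r -subr_ge0.
  have -> : F - q^-1 * F + q^-1 * X - F = q^-1 * (X - F) by ring.
  by rewrite pmulr_rge0 ?invr_gt0// subr_ge0.
have := @cvg_monotone_convergence _ _ _ pi setT measurableT (fun B x => (u B x `^ q)%:E).
have -> : (\int[pi]_x (fun x0 : E => limn ((fun B x => (u B x `^ q)%:E)^~ x0)) x = \int[pi]_x (D x `^ q)%:E)%E.
  apply: eq_integral => x _; apply/cvg_lim => //.
  apply: cvg_near_cst; exists (Num.truncn (D x)).+1 => // B /= DB.
  rewrite /u min_l//; apply: (le_trans (ltW (truncnS_gt _))); by rewrite ler_nat.
move=> cv; have {}cv := cv _ _ _.
have cvX : (\int[pi]_x (u B x `^ q)%:E)%E @[B --> \oo] --> (\int[pi]_x (D x `^ q)%:E)%E.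
  apply: cv.
  - by move=> B; apply/measurable_EFinP; exact: measurable_powRf.
  - by move=> B x _; rewrite lee_fin powR_ge0.
  - move=> x _ i j ij; rewrite lee_fin; apply: ge0_ler_powR; rewrite ?nnegrE ?(ltW q0)//.
    by rewrite /u le_min ge_min lexx/= ge_min ler_nat ij orbT.
have <- := cvg_lim (@ereal_hausdorff R) cvX.
apply: lime_le; first by apply/cvg_ex; eexists; exact: cvX.
apply: nearW => B; have := key B; rewrite -lee_fin; apply: le_trans.
rewrite -(bounded_meanE mone one0 (m1 pi) (pow_bd B q (ltW q0))).
by apply: eq_lexx; apply: eq_eint => x; rewrite mulr1.
Qed.

End renyi_limit.

(** * Convergence of the Langevin diffusion *)

Section chi_square_distance.
Context d (T : measurableType d) (R : realType) (m : {sigma_finite_measure set T -> \bar R}).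

(** |v - 1| is at most (de + (v - 1)^2/de)/2, whose mean is at most de. *)
Lemma chi2_mean_close (th v f : T -> R) (de : R) : measurable_fun setT th -> (forall x, 0 <= th x) ->
  (\int[m]_x (th x)%:E = 1)%E -> measurable_fun setT v -> (forall x, 0 <= v x) ->
  (\int[m]_x (v x * th x)%:E = 1)%E -> (\int[m]_x ((v x - 1) ^+ 2 * th x)%:E <= (de ^+ 2)%:E)%E -> 0 < de ->
  measurable_fun setT f -> (forall x, 0 <= f x <= 1) ->
  `|mean m (fun x => v x * th x) f - mean m th f| <= de.
Proof.
move=> mth th0 th1 mv v0 v1 chi de0 mf f01.
have f0 x : 0 <= f x by case/andP: (f01 x).
have bf : bounded_nonneg f by split => //; exists 1.
have mvt : measurable_fun setT (fun x => v x * th x) by exact: measurable_funM.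
have vt0 x : 0 <= v x * th x by rewrite mulr_ge0.
have aE := bounded_meanE mvt vt0 v1 bf; have bE := bounded_meanE mth th0 th1 bf.
pose Wt x := (de + (v x - 1) ^+ 2 / de) / 2 * th x.
have mv2 : measurable_fun setT (fun x => (v x - 1) ^+ 2).
  by apply: measurable_funX; apply: measurable_funB => //; exact: measurable_cst.
have mW : measurable_fun setT Wt.
  apply: measurable_funM => //; apply: measurable_funM; last exact: measurable_cst.
  apply: measurable_funD; first exact: measurable_cst.
  by apply: measurable_funM => //; exact: measurable_cst.
have W0 x : 0 <= Wt x by rewrite mulr_ge0// divr_ge0// addr_ge0 ?(ltW de0)// divr_ge0 ?sqr_ge0// ltW.
have Wle : (\int[m]_x (Wt x)%:E <= de%:E)%E.
  have -> : (\int[m]_x (Wt x)%:E = (de / 2)%:E * \int[m]_x (th x)%:E + (2 * de)^-1%:E * \int[m]_x ((v x - 1) ^+ 2 * th x)%:E)%E.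
    have d2 : 0 <= de / 2 by rewrite divr_ge0// ltW.
    have d3 : 0 <= (2 * de)^-1 by rewrite invr_ge0 mulr_ge0// ltW.
    rewrite -!eintZ//; last 2 first.
    - exact: (measurable_funM mv2 mth).
    - by move=> x; rewrite mulr_ge0// sqr_ge0.
    rewrite -ge0_integralD//.
    - by apply: eq_eint => x; rewrite /Wt; field; rewrite gt_eqF.
    - by move=> x _; rewrite lee_fin mulr_ge0.
    - by apply/measurable_EFinP; apply: measurable_funM => //; exact: measurable_cst.
    - by move=> x _; rewrite lee_fin mulr_ge0// mulr_ge0// sqr_ge0.
    - by apply/measurable_EFinP; apply: measurable_funM; [exact: measurable_cst|exact: (measurable_funM mv2 mth)].
  rewrite th1 mule1; have : ((2 * de)^-1%:E * \int[m]_x ((v x - 1) ^+ 2 * th x)%:E <= ((2 * de)^-1 * de ^+ 2)%:E)%E.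
    by rewrite EFinM lee_wpmul2l// lee_fin invr_ge0 mulr_ge0// ltW.
  move=> H; apply: (le_trans (leeD (lexx _) H)); rewrite -EFinD lee_fin.
  by apply: eq_lexx; field; rewrite gt_eqF.
have amgm x : `|v x - 1| <= (de + (v x - 1) ^+ 2 / de) / 2.
  rewrite -(real_normK (num_real (v x - 1))); move: `|v x - 1| => y.
  rewrite -subr_ge0 (_ : _ - y = (de - y) ^+ 2 / (2 * de)); last by field; rewrite gt_eqF.
  by rewrite divr_ge0 ?sqr_ge0// mulr_ge0// ltW.
have side (u w : T -> R) (a b : R) : measurable_fun setT u -> measurable_fun setT w -> (forall x, 0 <= u x) -> (forall x, 0 <= w x) ->
    (\int[m]_x (u x)%:E = a%:E)%E -> (\int[m]_x (w x)%:E = b%:E)%E ->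
    (forall x, u x <= w x + Wt x) -> a - b <= de.
  move=> mu mw u0 w0 aE' bE' uw; rewrite lerBlDl -lee_fin -aE' EFinD -bE'.
  apply: le_trans (leeD (lexx _) Wle); rewrite -ge0_integralD//.
  - apply: le_eint => // x; exact: measurable_funD.
  - by move=> x _; rewrite lee_fin.
  - exact/measurable_EFinP.
  - by move=> x _; rewrite lee_fin.
  - exact/measurable_EFinP.
have m1 := measurable_funM mf mvt; have m2 := measurable_funM mf mth.
have p1 x : 0 <= f x * (v x * th x) by rewrite mulr_ge0.
have p2 x : 0 <= f x * th x by rewrite mulr_ge0.
have fW x (y : R) : y <= `|v x - 1| -> f x * (y * th x) <= Wt x.
  move=> yv; have /andP[_ f1] := f01 x.
  apply: (@le_trans _ _ (f x * (`|v x - 1| * th x))); first by rewrite ler_wpM2l// ler_wpM2r.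
  apply: (@le_trans _ _ (`|v x - 1| * th x)); first by rewrite ler_piMl// mulr_ge0.
  by rewrite ler_wpM2r.
rewrite ler_norml lerNl opprB; apply/andP; split.
- apply: (side _ _ _ _ m2 m1 p2 p1 bE aE) => x; rewrite -lerBlDl.
  have -> : f x * th x - f x * (v x * th x) = f x * ((1 - v x) * th x) by ring.
  by apply: fW; rewrite distrC ler_norm.
- apply: (side _ _ _ _ m1 m2 p1 p2 aE bE) => x; rewrite -lerBlDl.
  have -> : f x * (v x * th x) - f x * th x = f x * ((v x - 1) * th x) by ring.
  by apply: fW; rewrite ler_norm.
Qed.

End chi_square_distance.

Section chain_snapshot.
Context {R : realType}.
Notation sd a n Z := (student_density a Z : 'rV[R]_n -> R).

(** G is the density relative to the target of the chain after N steps. The conclusion keeps what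
    survives the limit of small steps: a bound independent of N, the divergence estimate and the
    proximity to the LMC law. The factor 4 is e^s <= 2 used twice, on entering and on leaving the
    densities relative to p. *)
Lemma chain_snapshot (a : R) : 0 < a -> exists C : R, 1 <= C /\
  forall (n N : nat) (h Z M q e : R) (g : 'rV[R]_n -> R) (c := (a + n%:R / 2) / 2)
    (s := 34 * n%:R * h * c + 2 * h * c ^+ 2)
    (D1 := (16 * C * M `^ q) `^ a^-1) (D := (16 * C * M `^ q / e) `^ a^-1),
  (0 < n)%N -> 0 < h <= 1 -> 64 * h * c <= 1 -> h * c ^+ 2 <= 1 -> 40 * h * 1 * c <= 1 ->
  q * s <= 4^-1 ->
  0 < Z -> (\int[leb n]_x (wgt (a + n%:R / 2) x)%:E = Z%:E)%E -> 1 <= M -> 2 <= q -> 0 < e <= 1 ->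
  measurable_fun setT g -> (forall x, 0 <= g x) -> (forall x, g x <= M) ->
  (\int[leb n]_x (g x * sd a n Z x)%:E = 1)%E ->
  1024 * n%:R ^+ 2 * (2 * h * D) <= 1 ->
  8 * C * n%:R * D1 * (q - 1) * (renyi_mean (leb n) (sd a n Z) q g + s) +
    4 * C * n%:R * D * (q - 1) * ln (2 / e) + h <= N%:R * h ->
  exists G : 'rV[R]_n -> R, [/\ measurable_fun setT G, forall x, 0 <= G x <= 4 * M,
    (\int[leb n]_x (G x * sd a n Z x)%:E = 1)%E,
    (\int[leb n]_x (G x `^ q * sd a n Z x)%:E <= (expR ((q - 1) * (e + s)))%:E)%E &
    forall (f : 'rV[R]_n -> R) (de : R), measurable_fun setT f -> (forall x, 0 <= f x <= 1) -> 0 < de ->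
      expR (N%:R * (1064 * n%:R * h ^+ 2 * 1 ^+ 2 * c ^+ 2)) - 1 <= de ^+ 2 ->
      `|mean (leb n) (iter N (lmc_push c h) (fun x => g x * sd a n Z x)) f
        - mean (leb n) (fun x => G x * sd a n Z x) f| <= de].
Proof.
move=> a0; have [C [C1 dec]] := student_chain_decay a0; exists C; split=> //.
move=> n N h Z M q e g c s D1 D n0 h01 hc64 hc2 hc40 qs Z0 EZ M1 q2 e01 mg g0 gM g1 small hN.
have /andP[h0 h1] := h01; have /andP[e0 e1] := e01.
have c0 : 0 < c by exact: student_scale_gt0.
have s0 : 0 <= s.
  exact: (addr_ge0 (mulr_ge0 (mulr_ge0 (mulr_ge0 (ler0n R 34) (ler0n R n)) (ltW h0)) (ltW c0)) (mulr_ge0 (mulr_ge0 (ler0n R 2) (ltW h0)) (sqr_ge0 c))).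
have [af fp tf] := student_admissible n0 a0 h0 hc64 Z0 EZ q2 M1 mg g0 gM g1.
rewrite -/c -/s in af fp tf.
set f := (fun x => g x * _) in af fp tf.
have q0 : 0 <= q by rewrite (le_trans _ q2).
have q10 : 0 < q - 1 by move: q2; clear; lra.
have chi1 : 1 <= expR s by rewrite -expR0 ler_expR.
have M'1 : 1 <= expR s * M by rewrite mulr_ege1.
have M0 : 0 <= M := le_trans ler01 M1.
have C0 : 0 <= C := le_trans ler01 C1.
have s4 : s <= 4^-1 by apply: le_trans qs; rewrite ler_peMl// (le_trans _ q2)// ler1n.
have es2 : expR s <= 2 by apply: expR_half_le2; move: s4; clear; lra.
have Mq : (expR s * M) `^ q <= 2 * M `^ q.
  rewrite powRM ?expR_ge0// ler_wpM2r ?powR_ge0// -expRM mulrC; apply: expR_half_le2; move: qs; clear; lra.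
have ia : 0 <= a^-1 by rewrite invr_ge0 ltW.
have C8 : 8 * C * (expR s * M) `^ q <= 16 * C * M `^ q.
  by have := ler_wpM2l (mulr_ge0 (ler0n R 8) C0) Mq; move: (_ `^ q) (_ `^ q); clear => *; lra.
have p8 : 0 <= 8 * C * (expR s * M) `^ q by rewrite !mulr_ge0 ?powR_ge0.
have p16 : 0 <= 16 * C * M `^ q by rewrite !mulr_ge0 ?powR_ge0.
have D1le : (8 * C * (expR s * M) `^ q) `^ a^-1 <= D1 by apply: ge0_ler_powR; rewrite ?nnegrE.
have Dle : (8 * C * (expR s * M) `^ q / e) `^ a^-1 <= D.
  apply: ge0_ler_powR; rewrite ?nnegrE// ?divr_ge0 ?(ltW e0)//.
  by rewrite ler_wpM2r ?invr_ge0 ?(ltW e0).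
have sm : 1024 * n%:R ^+ 2 * (2 * h * (8 * C * (expR s * M) `^ q / e) `^ a^-1) <= 1.
  exact: (mul3_le1 (mulr_ge0 (ler0n R 1024) (sqr_ge0 _)) (mulr_ge0 (ler0n R 2) (ltW h0)) Dle small).
have Gm (x : 'rV[R]_n) : expR (- (2 * n%:R * h * c)) * wgt c x <= heat_mean h (wgt c) x.
  exact: heat_mean_wgt_ge (ltW c0) h0 x.
have Gp (x : 'rV[R]_n) := heat_mean_wgt_le (ltW c0) h0 x hc64.
have t0 : 0 <= renyi_mean (leb n) (chain_density h (wgt c)) q f.
  exact: (renyi_mean_ge0 (expR_gt0 _) Gm Gp Z0 EZ q2 af).
have l0 : 0 <= ln (2 / e) by rewrite ln_ge0// ler_pdivlMr//; move: e1; clear; lra.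
have tN : 8 * C * n%:R * (8 * C * (expR s * M) `^ q) `^ a^-1 * (q - 1) * renyi_mean (leb n) (chain_density h (wgt c)) q f +
    4 * C * n%:R * (8 * C * (expR s * M) `^ q / e) `^ a^-1 * (q - 1) * ln (2 / e) + h <= N%:R * h.
  have b8 : 0 <= 8 * C * n%:R := mulr_ge0 (mulr_ge0 (ler0n R 8) C0) (ler0n R n).
  have b4 : 0 <= 4 * C * n%:R := mulr_ge0 (mulr_ge0 (ler0n R 4) C0) (ler0n R n).
  have u1 := ler_pM (mulr_ge0 (mulr_ge0 b8 (powR_ge0 _ _)) (ltW q10)) t0 (ler_wpM2r (ltW q10) (ler_wpM2l b8 D1le)) tf.
  have u2 := ler_wpM2r l0 (ler_wpM2r (ltW q10) (ler_wpM2l b4 Dle)).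
  exact: le_trans (lerD (lerD u1 u2) (lexx h)) hN.
have rN := dec n N h Z (expR s * M) q e f n0 h01 hc64 s4 Z0 EZ M'1 q2 e01 af sm tN.
set p := chain_density h (wgt c) in rN fp tf t0.
set fN := iter N (smooth (leb n) (chain_kernel h (wgt c))) f in rN.
have [mfN fN0 fNM fN1] : admissible a h (expR s * M) fN.
  exact: (iter_admissible h0 (expR_gt0 _) Gm Gp Z0 EZ a0 N af).
rewrite -/c -/p in fN1.
have mp : measurable_fun setT p by exact: (measurable_student_chain_density a h).
have p0 x : 0 <= p x by exact/ltW/(student_chain_density_gt0 a0 h0 Z0 EZ hc64).
have p1 : (\int[leb n]_x (p x)%:E = 1)%E by exact: (student_chain_density_int a0 h0 Z0 EZ hc64).
have psd x : p x <= expR s * sd a n Z x.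
  have := chain_density_le a0 h0 Z0 EZ hc64 x.
  rewrite -/c -/p (_ : expR (32 * n%:R * h * c + 2 * h * c ^+ 2) / expR (- (2 * n%:R * h * c)) = expR s)//.
  by rewrite -expRN -expRD; congr expR; rewrite /s; ring.
have msd : measurable_fun setT (sd a n Z) by exact: measurable_student_density.
have sdp x : 0 < sd a n Z x by exact: student_density_gt0.
pose G x := fN x * (p x / sd a n Z x).
have Gsd x : G x * sd a n Z x = fN x * p x by rewrite /G mulrA divfK// gt_eqF.
have mG : measurable_fun setT G.
  exact: (measurable_funM mfN (measurable_funM mp (measurableT_comp (@measurable_invr R) msd))).
have pr0 x : 0 <= p x / sd a n Z x by rewrite divr_ge0// ltW.
have pr x : p x / sd a n Z x <= expR s by rewrite ler_pdivrMr.
exists G; split => //.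
- move=> x; rewrite mulr_ge0//=; apply: (le_trans (ler_pM (fN0 x) (pr0 x) (fNM x) (pr x))).
  apply: (@le_trans _ _ (2 * M * 2)); first by apply: ler_pM; rewrite ?mulr_ge0 ?expR_ge0// ler_wpM2r.
  by apply: eq_lexx; ring.
- by under eq_eint do rewrite Gsd.
- have fq x : fN x `^ q <= (expR s * M) `^ q.
    by apply: ge0_ler_powR; rewrite ?nnegrE// (le_trans ler01 M'1).
  have FE := @meanE _ _ _ (leb n) p mp p0 p1 (fun x => fN x `^ q) ((expR s * M) `^ q) (measurable_powRf q mfN) (fun x => powR_ge0 _ _) fq.
  have F1 : 1 <= mean (leb n) p (fun x => fN x `^ q).
    exact: (@mean_pow_ge1 _ _ _ (leb n) p mp p0 p1 q (expR s * M) fN q2 mfN fN0 fNM fN1).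
  have Fle : mean (leb n) p (fun x => fN x `^ q) <= expR ((q - 1) * e).
    move: rN; rewrite /renyi_mean ler_pdivrMr// => rN.
    by rewrite -[leLHS]lnK ?posrE ?(lt_le_trans ltr01 F1)// ler_expR mulrC.
  apply: (@le_trans _ _ (\int[leb n]_x (expR (s * (q - 1)) * (fN x `^ q * p x))%:E)%E).
    apply: le_eint => [||x|x].
    + exact: (measurable_funM (measurable_powRf q mG) msd).
    + by apply: measurable_funM; [exact: measurable_cst|exact: (measurable_funM (measurable_powRf q mfN) mp)].
    + by rewrite mulr_ge0 ?powR_ge0// ltW.
    + rewrite /G powRM//.
      have -> : (p x / sd a n Z x) `^ q = (p x / sd a n Z x) `^ (q - 1) * (p x / sd a n Z x).
        by rewrite -powR_predr// gt_eqF// (lt_le_trans _ q2).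
      have -> : fN x `^ q * ((p x / sd a n Z x) `^ (q - 1) * (p x / sd a n Z x)) * sd a n Z x =
          (p x / sd a n Z x) `^ (q - 1) * (fN x `^ q * p x).
        have alg (U V W p' : R) : W != 0 -> U * (V * (p' / W)) * W = V * (U * p') by move=> W0; field.
        by apply: alg; rewrite gt_eqF.
      have e2 : (p x / sd a n Z x) `^ (q - 1) <= expR (s * (q - 1)).
        by rewrite expRM; apply: ge0_ler_powR; rewrite ?nnegrE ?expR_ge0// ltW.
      by apply: ler_wpM2r => //; rewrite mulr_ge0// powR_ge0.
  rewrite eintZ ?expR_ge0//.
  + rewrite FE -EFinM lee_fin; apply: (le_trans (ler_wpM2l (expR_ge0 _) Fle)).
    by rewrite -expRD; apply: eq_lexx; congr expR; ring.
  + exact: (measurable_funM (measurable_powRf q mfN) mp).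
  + by move=> x; rewrite mulr_ge0 ?powR_ge0.
move=> ph de mph ph01 de0 hde.
have := @lmc_chi2 R a n h Z (expR s * M) 1 n0 a0 h0 Z0 EZ (lexx _) hc2 hc40 hc64 f af N erefl.
rewrite -/c -/p -/fN => -[v [mv v0 rE chi]].
rewrite fp in rE.
have thE : (fun x => G x * sd a n Z x) = (fun x => fN x * p x) by apply/funext.
have -> : iter N (lmc_push c h) (fun x => g x * sd a n Z x) = (fun x => v x * (fN x * p x)) by apply/funext.
rewrite thE; apply: chi2_mean_close => //.
- exact: measurable_funM.
- by move=> x; rewrite mulr_ge0.
- have [_ _ r1 _] := @lmc_iter R a n h Z (expR s * M) 1 n0 a0 h0 Z0 EZ (lexx _) hc2 hc40 hc64 f af N.
  by rewrite -r1 -/c -/p fp; apply: eq_eint => x; rewrite rE.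
- by apply: (le_trans chi); rewrite lee_fin.
Qed.

End chain_snapshot.

Section langevin_convergence.
Context {R : realType}.

(** The drift is 1-Lipschitz for the Euclidean norm, and passing to the coordinatewise maximum costs
    at most the factor n. *)
Lemma grad_student_lipschitz n (nu : R) (u v : 'rV[R]_n) r i : 0 < nu ->
  (forall j, `|u ord0 j - v ord0 j| <= r) ->
  `|grad (V_student nu) u ord0 i - grad (V_student nu) v ord0 i| <= (n%:R + nu) * n%:R * r.
Proof.
move=> nu0 uv; rewrite !grad_V_student !mxE.
have r0 : 0 <= r := le_trans (normr_ge0 _) (uv i).
have n1 : 1 <= n%:R :> R by rewrite ler1n; case: (n) i => [[]|].
have lip := student_drift_lipschitz u v.
have di (y : 'rV[R]_n) j : y ord0 j ^+ 2 <= dot y y.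
  rewrite /dot (bigD1 j)//= -expr2 lerDl sumr_ge0// => k _; exact: sqr_ge0.
have duv : dot (u - v) (u - v) <= (n%:R * r) ^+ 2.
  apply: (@le_trans _ _ (\sum_(j < n) r ^+ 2)).
    apply: ler_sum => j _; rewrite !mxE -expr2 -(real_normK (num_real _)).
    by rewrite ler_pXn2r ?nnegrE.
  apply: (@le_trans _ _ (n%:R * r ^+ 2)); first by rewrite sumr_const card_ord mulr_natl.
  rewrite exprMn; apply: ler_wpM2r; first exact: sqr_ge0.
  by rewrite expr2 ler_peMl// (le_trans ler01).
have sq : ((1 + dot u u)^-1 * u ord0 i - (1 + dot v v)^-1 * v ord0 i) ^+ 2 <= (n%:R * r) ^+ 2.
  apply: le_trans (le_trans lip duv); apply: le_trans (di _ i); by rewrite !mxE.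
rewrite -mulrBr normrM gtr0_norm ?ltr_wpDl// -mulrA ler_wpM2l//; first by rewrite addr_ge0// ltW.
rewrite -(@ler_pXn2r _ 2) ?nnegrE ?mulr_ge0 ?(le_trans ler01 n1)//.
by rewrite real_normK ?num_real.
Qed.

Lemma expR_sub1_le (x : R) : 0 <= x <= 2^-1 -> expR x - 1 <= 2 * x.
Proof.
move=> /andP[x0 x1]; rewrite lerBlDl.
have p0 : 0 < 1 - x by move: x1; clear; lra.
have e1 : expR x <= (1 - x)^-1.
  by rewrite -[expR x]invrK -expRN lef_pV2 ?posrE ?expR_gt0//; exact: expR_ge1Dx.
apply: (le_trans e1); rewrite -div1r ler_pdivrMr//.
have : 0 <= x * (1 - 2 * x) by rewrite mulr_ge0//; move: x1; clear; lra.
by rewrite (_ : (1 + 2 * x) * (1 - x) = 1 + x * (1 - 2 * x)) ?lerDl//; ring.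
Qed.

(** The time condition of the diffusion implies the step budget of the chain. Each phase contributes
    a multiple of C0 K0, and the corrections s and h are absorbed because the logarithmic term l is
    at least 1/2. *)
Lemma diffusion_time_bound (n : nat) (C0 K0 q G Y t l s h lq T : R) :
  1 <= n%:R :> R -> 2 <= q -> 1 <= C0 -> 0 <= K0 -> 1 <= G -> 1 <= Y -> 0 <= t -> 2^-1 <= l -> 0 <= s <= 4^-1 -> h <= 1 ->
  lq <= 2 * l ->
  (16 * C0 * K0 + 2) * q * n%:R * G * (t + Y * l) <= T ->
  8 * C0 * n%:R * (K0 * G) * (q - 1) * (t + s) + 4 * C0 * n%:R * (K0 * (G * Y)) * (q - 1) * lq + h <= T.
Proof.
move=> n1 q2 C1 K00 G1 Y1 t0 l2 /andP[s0 s4] h1 lql; apply: le_trans.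
have n0 : 0 <= n%:R :> R by rewrite ler0n.
have C00 := le_trans ler01 C1; have G0 := le_trans ler01 G1; have Y0 := le_trans ler01 Y1.
have l0 : 0 <= l by move: l2; clear; lra.
have Yl : l <= Y * l by rewrite ler_peMl.
have q1 : 0 <= q - 1 by move: q2; clear; lra.
have qq : q - 1 <= q by move: q2; clear; lra.
have b0 : 0 <= C0 * K0 * (n%:R * G) := mulr_ge0 (mulr_ge0 C00 K00) (mulr_ge0 n0 G0).
have ts : t + s <= t + Y * l by rewrite lerD2l; move: s4 l2 Yl; move: (Y * l); clear => *; lra.
have tY0 : 0 <= t + s by rewrite addr_ge0.
have x1 := ler_wpM2l b0 (ler_pM q1 tY0 qq ts).
have l0' : Y * lq <= 2 * (Y * l) by rewrite mulrCA ler_wpM2l.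
have x2 : C0 * K0 * (n%:R * G) * ((q - 1) * (Y * lq)) <= C0 * K0 * (n%:R * G) * (q * (2 * (Y * l))).
  rewrite ler_wpM2l//; apply: (le_trans (ler_wpM2l q1 l0')); rewrite ler_wpM2r//.
  by rewrite !mulr_ge0.
have qnG : 1 <= q * n%:R * G by rewrite mulr_ege1// mulr_ege1//; move: q2; clear; lra.
have Yl2 : 2^-1 <= t + Y * l by move: l2 Yl t0; move: (Y * l); clear => *; lra.
have x3 : 2^-1 <= q * n%:R * G * (t + Y * l).
  by apply: (le_trans Yl2); rewrite ler_peMl// (le_trans _ Yl2).
have x4 : 0 <= C0 * K0 * (n%:R * G) * (q * t) by rewrite mulr_ge0// mulr_ge0// (le_trans _ q2).
move: x1 x2 x3 x4.
rewrite (_ : 8 * C0 * n%:R * (K0 * G) * (q - 1) * (t + s) = 8 * (C0 * K0 * (n%:R * G) * ((q - 1) * (t + s)))); last by ring.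
rewrite (_ : 4 * C0 * n%:R * (K0 * (G * Y)) * (q - 1) * lq = 4 * (C0 * K0 * (n%:R * G) * ((q - 1) * (Y * lq)))); last by ring.
rewrite (_ : (16 * C0 * K0 + 2) * q * n%:R * G * (t + Y * l) = 16 * (C0 * K0 * (n%:R * G) * (q * (t + Y * l))) + 2 * (q * n%:R * G * (t + Y * l))); last by ring.
rewrite (_ : C0 * K0 * (n%:R * G) * (q * (2 * (Y * l))) = 2 * (C0 * K0 * (n%:R * G) * (q * (t + Y * l))) - 2 * (C0 * K0 * (n%:R * G) * (q * t))); last by ring.
move: (C0 * K0 * (n%:R * G) * ((q - 1) * (t + s))) (C0 * K0 * (n%:R * G) * (q * (t + Y * l)))
  (C0 * K0 * (n%:R * G) * ((q - 1) * (Y * lq))) (C0 * K0 * (n%:R * G) * (q * t)) (q * n%:R * G * (t + Y * l)) h1.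
clear => *; lra.
Qed.

Section euler_law.
Context disp (O : measurableType disp) (P : probability O R) (n : nat) (nu h : R)
  (X B : R -> {mfun O >-> 'rV[R]_n}) (r0 : 'rV[R]_n -> R).
Notation E := 'rV[R]_n.
Notation c := ((nu / 2 + n%:R / 2) / 2).
Hypotheses (nu0 : 0 < nu) (h0 : 0 < h) (bm : brownian_motion_indep P (X 0) B)
  (mr : measurable_fun setT r0) (r00 : forall y, 0 <= r0 y) (Xr : has_density P (X 0) r0).

Definition euler_path k (w : O) : E :=
  euler (grad (V_student nu)) (fun t => X t w) (fun t => B t w) (Num.sqrt 2) h k.

Let xi_fun k (w : O) : E := B (k.+1%:R * h) w - B (k%:R * h) w.

Let mxi k : measurable_fun setT (xi_fun k).
Proof. by apply: measurable_rvD; [exact: measurable_funPT|apply: measurable_rvN; exact: measurable_funPT]. Qed.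

Lemma euler_pathS k w : euler_path k.+1 w = lmc_drift c h (euler_path k w) + Num.sqrt 2 *: xi_fun k w.
Proof. by rewrite -lmc_step_student. Qed.

Lemma measurable_euler_path k : measurable_fun setT (euler_path k).
Proof.
elim: k => [|k IH]; first exact: (@measurable_funPT _ _ _ _ (X 0)).
have -> : euler_path k.+1 = (fun w => lmc_drift c h (euler_path k w) + Num.sqrt 2 *: xi_fun k w).
  by apply/funext => w; rewrite euler_pathS.
apply: measurable_rvD; first exact: (measurableT_comp (measurable_lmc_drift c h) IH).
by apply: measurable_rvZ; [exact: measurable_cst|exact: mxi].
Qed.

Definition euler_rv k : {mfun O >-> E} := mfun_Sub (mem_set (measurable_euler_path k)).

Lemma euler_density k : [/\ measurable_fun setT (iter k (lmc_push c h) r0),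
  forall y, 0 <= iter k (lmc_push c h) r0 y,
  (\int[leb n]_y (iter k (lmc_push c h) r0 y)%:E = 1)%E &
  has_density P (euler_rv k) (iter k (lmc_push c h) r0)].
Proof.
pose xi k : {mfun O >-> E} := mfun_Sub (mem_set (mxi k)).
have [_ inc ind] := bm.
have s2 : 0 < Num.sqrt 2 :> R by rewrite sqrtr_gt0.
have sh : 0 < Num.sqrt h by rewrite sqrtr_gt0.
have as2 : Num.sqrt 2 ^+ 2 * Num.sqrt h ^+ 2 = 2 * h by rewrite !sqr_sqrtr// ltW.
apply: (@noise_density R _ O P n euler_rv xi c h (Num.sqrt 2) (Num.sqrt h) r0) => //.
- move=> j; have := inc (j%:R * h) (j.+1%:R * h).
  rewrite mulr_ge0 ?(ltW h0)// ltr_pM2r// ltr_nat ltnSn => /(_ isT isT).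
  by rewrite -mulrBl -natrB// subSnn mul1r.
- have := ind (fun j => j%:R * h); rewrite mul0r => /(_ erefl); apply.
  by move=> i j ij; rewrite ler_wpM2r ?(ltW h0)// ler_nat.
- by move=> j w; exact: euler_pathS.
Qed.

Lemma euler_mean k (f : E -> R) : measurable_fun setT f -> (forall x, 0 <= f x <= 1) ->
  (\int[P]_w (f (euler_path k w))%:E = (mean (leb n) (iter k (lmc_push c h) r0) f)%:E)%E.
Proof.
move=> mf f01; have [mrk rk0 rk1 dk] := euler_density k.
have f0 x : 0 <= f x by case/andP: (f01 x).
transitivity (\int[distribution P (euler_rv k)]_y (f y)%:E)%E.
  apply/esym; apply: (ge0_integral_distribution (euler_rv k) (f := EFin \o f)).
  - exact/measurable_EFinP.
  - by move=> y; rewrite lee_fin.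
rewrite (@density_integral _ _ _ (leb n) (distribution P (euler_rv k)) _ f mrk rk0 dk mf f0).
by rewrite (bounded_meanE mrk rk0 rk1)//; split => //; exists 1.
Qed.

End euler_law.

End langevin_convergence.

Section langevin_main.
Context {R : realType}.

Lemma le_sum6 (x2 x3 x4 x5 x6 : R) (A := 1 + x2 + x3 + x4 + x5 + x6) :
  0 <= x2 -> 0 <= x3 -> 0 <= x4 -> 0 <= x5 -> 0 <= x6 ->
  1 <= A /\ (x2 <= A /\ (x3 <= A /\ (x4 <= A /\ (x5 <= A /\ x6 <= A)))).
Proof. by rewrite /A => *; do !split; lra. Qed.

Lemma langevin_student_convergence (nu : R) : 0 < nu ->
  exists2 C : R, 0 < C &
    forall (d : nat) (q eps : R), (0 < d)%N -> 2 <= q -> 0 < eps <= q^-1 ->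
    forall (disp : measure_display) (O : measurableType disp)
      (P : probability O R) (rho0 : probability 'rV[R]_d R)
      (X : R -> {mfun O >-> 'rV[R]_d}),
    langevin_diffusion P (V_student nu) X -> has_law P (X 0) rho0 ->
    (renyi_infty rho0 (pi_student d nu) < +oo)%E ->
    forall T : R,
      C * q * d%:R *
        expR (2 * q * fine (renyi_infty rho0 (pi_student d nu)) / nu) *
        (fine (renyi q rho0 (pi_student d nu)) +
           eps^-1 `^ (2 / nu) * ln eps^-1) <= T ->
      (renyi q (distribution P (X T)) (pi_student d nu) <= eps%:E)%E.
Proof.
move=> nu0; have a0 : 0 < nu / 2 by rewrite divr_gt0.
have [C0 [C01 snap]] := chain_snapshot a0.
have C00 : 0 <= C0 := le_trans ler01 C01.
pose K0 := (16 * C0) `^ (2 / nu).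
have K00 : 0 <= K0 by exact: powR_ge0.
have CK : 0 < 16 * C0 * K0 + 2 by rewrite ltr_wpDl// mulr_ge0// mulr_ge0.
exists (16 * C0 * K0 + 2) => //.
move=> d q eps d0 q2 /andP[e0 eq] disp O P rho0 X [B bm Xae] X0 rfin T TC.
have q0 : 0 < q by rewrite (lt_le_trans _ q2).
have q1 : 1 < q by rewrite (lt_le_trans _ q2)// ltr1n.
have q10 : 0 < q - 1 by rewrite subr_gt0.
have e1 : eps <= 1 by rewrite (le_trans eq)// invf_le1// (le_trans _ q2)// ler1n.
have e01 : 0 < eps <= 1 by rewrite e0.
have [Z [M [g [[Z0 ZE piE] [mg g0 gM M1] [g1 muE] rM rE]]]] := student_start nu0 rfin.
set sdn := student_density (nu / 2) Z : 'rV[R]_d -> R in piE g1 muE rE.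
have [tE t0] := rE q q2.
set t := renyi_mean (leb d) sdn q g in tE t0.
have M0 : 0 < M := lt_le_trans ltr01 M1.
have lM0 : 0 <= ln M by rewrite ln_ge0.
pose G := expR (2 * q * ln M / nu); pose Y := eps^-1 `^ (2 / nu); pose l := ln eps^-1.
rewrite rM tE -/G -/Y -/l in TC.
have n1 : 1 <= d%:R :> R by rewrite ler1n.
have G1 : 1 <= G by rewrite -expR0 ler_expR divr_ge0 ?(ltW nu0)// mulr_ge0// mulr_ge0// ltW.
have ei1 : 1 <= eps^-1 by rewrite invf_ge1.
(* From eps <= 1/q <= 1/2 one gets ln(1/eps) >= ln 2 >= 1/2, so the logarithm can absorb
   constants. *)
have ei2 : 2 <= eps^-1 by rewrite (le_trans q2)// -(invrK q) lef_pV2 ?posrE ?invr_gt0.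
have Y1 : 1 <= Y by rewrite -(powRr0 eps^-1); apply: ler_powR => //; rewrite divr_ge0// ltW.
have ln2 : 2^-1 <= ln (2 : R) by rewrite -ler_expR lnK ?posrE//; exact: expR_half_le2.
have ln2l : ln (2 : R) <= l by rewrite ler_ln ?posrE// invr_gt0.
have l2 : 2^-1 <= l := le_trans ln2 ln2l.
have lq : ln (2 / eps) <= 2 * l.
  rewrite lnM ?posrE ?invr_gt0// -/l (_ : 2 * l = l + l) ?lerD2r//; ring.
have MQG : (M `^ q) `^ (2 / nu) = G.
  by rewrite -powRrM /powR gt_eqF// /G; congr expR; ring.
have D1E : (16 * C0 * M `^ q) `^ (nu / 2)^-1 = K0 * G.
  by rewrite powR_half_inv powRM ?powR_ge0 ?mulr_ge0// MQG.
have DE : (16 * C0 * M `^ q / eps) `^ (nu / 2)^-1 = K0 * (G * Y).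
  rewrite powR_half_inv -mulrA powRM ?mulr_ge0 ?powR_ge0 ?invr_ge0 ?(ltW e0)//.
  by rewrite [(_ / eps) `^ _]powRM ?powR_ge0 ?invr_ge0 ?(ltW e0)// MQG.
pose c : R := (nu / 2 + d%:R / 2) / 2.
have c0 : 0 < c by rewrite divr_gt0// ltr_pwDl// divr_ge0.
pose w0 := 34 * d%:R * c + 2 * c ^+ 2.
have w00 : 0 <= w0.
  exact: addr_ge0 (mulr_ge0 (mulr_ge0 (ler0n R 34) (ler0n R d)) (ltW c0)) (mulr_ge0 (ler0n R 2) (sqr_ge0 c)).
pose DY := d%:R ^+ 2 * (K0 * (G * Y)).
have DY0 : 0 <= DY.
  exact: mulr_ge0 (sqr_ge0 _) (mulr_ge0 K00 (mulr_ge0 (le_trans ler01 G1) (le_trans ler01 Y1))).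
pose A := 1 + 64 * c + c ^+ 2 + 40 * c + 4 * (q * w0) + 2048 * DY.
have qw0 : 0 <= q * w0 by rewrite mulr_ge0// ltW.
have [A1 [A2 [A3 [A4 [A5 A6]]]]] : 1 <= A /\ (64 * c <= A /\ (c ^+ 2 <= A /\ (40 * c <= A /\ (4 * (q * w0) <= A /\ 2048 * DY <= A)))).
  exact: (le_sum6 (mulr_ge0 (ler0n R 64) (ltW c0)) (sqr_ge0 c) (mulr_ge0 (ler0n R 40) (ltW c0)) (mulr_ge0 (ler0n R 4) qw0) (mulr_ge0 (ler0n R 2048) DY0)).
have A0 : 0 < A := lt_le_trans ltr01 A1.
have T0 : 0 < T.
  apply: lt_le_trans TC; rewrite mulr_gt0 ?expR_gt0//; last first.
    by rewrite ltr_wpDl// mulr_gt0 ?(lt_le_trans ltr01 Y1)// (lt_le_trans _ l2)// invr_gt0.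
  by rewrite mulr_gt0 ?expR_gt0// mulr_gt0 ?ltr0n// mulr_gt0.
(* Starting the step counts above T A makes h A <= 1, so the smallness conditions of
   [chain_snapshot] hold for every k. *)
pose k0 := Num.truncn (T * A).
pose N (k : nat) := (k0 + k).+1; pose h (k : nat) := T / (N k)%:R.
have N0 k : 0 < (N k)%:R :> R by rewrite ltr0n.
have h0 k : 0 < h k by rewrite divr_gt0.
have NhT k : (N k)%:R * h k = T by rewrite /h mulrC divfK// gt_eqF.
have hA k : h k * A <= 1.
  rewrite /h mulrAC ler_pdivrMr// mul1r; apply: ltW; apply: (lt_le_trans (truncnS_gt _)).
  by rewrite ler_nat ltnS leq_addr.
have hw k w : w <= A -> h k * w <= 1 by move=> wA; apply: le_trans (hA k); rewrite ler_wpM2l// ltW.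
have hsmall de : 0 < de -> \forall k \near \oo, h k <= de.
  move=> de0; exists (Num.truncn (T / de)) => // k /= kT.
  rewrite /h ler_pdivrMr// mulrC -ler_pdivrMr//; apply: ltW; apply: (lt_le_trans (truncnS_gt _)).
  by rewrite ler_nat ltnS (leq_trans kT)// leq_addl.
have sE k : 34 * d%:R * h k * c + 2 * h k * c ^+ 2 = h k * w0 by rewrite /w0; ring.
have Sk k : exists Gk : 'rV[R]_d -> R, [/\ measurable_fun setT Gk, forall x, 0 <= Gk x <= 4 * M,
    (\int[leb d]_x (Gk x * sdn x)%:E = 1)%E,
    (\int[leb d]_x (Gk x `^ q * sdn x)%:E <= (expR ((q - 1) * (eps + (34 * d%:R * h k * c + 2 * h k * c ^+ 2))))%:E)%E &
    forall (f : 'rV[R]_d -> R) (de : R), measurable_fun setT f -> (forall x, 0 <= f x <= 1) -> 0 < de ->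
      expR ((N k)%:R * (1064 * d%:R * h k ^+ 2 * 1 ^+ 2 * c ^+ 2)) - 1 <= de ^+ 2 ->
      `|mean (leb d) (iter (N k) (lmc_push c (h k)) (fun x => g x * sdn x)) f
        - mean (leb d) (fun x => Gk x * sdn x) f| <= de].
  have b1 : 0 < h k <= 1 by rewrite h0 -[h k]mulr1 hw.
  have b2 : 64 * h k * c <= 1.
    by have := hw k _ A2; rewrite (_ : h k * (64 * c) = 64 * h k * c); last by ring.
  have b3 : h k * c ^+ 2 <= 1 by exact: hw.
  have b4 : 40 * h k * 1 * c <= 1.
    by have := hw k _ A4; rewrite (_ : h k * (40 * c) = 40 * h k * 1 * c); last by ring.
  have qs : 4 * (q * (h k * w0)) <= 1.
    by have := hw k _ A5; rewrite (_ : h k * (4 * (q * w0)) = 4 * (q * (h k * w0))); last by ring.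
  have b5 : q * (34 * d%:R * h k * c + 2 * h k * c ^+ 2) <= 4^-1.
    by rewrite sE; move: qs; move: (q * (h k * w0)); clear => *; lra.
  have b6 : 1024 * d%:R ^+ 2 * (2 * h k * (16 * C0 * M `^ q / eps) `^ (nu / 2)^-1) <= 1.
    rewrite DE; have := hw k _ A6; rewrite (_ : h k * (2048 * DY) = 1024 * d%:R ^+ 2 * (2 * h k * (K0 * (G * Y)))); first exact.
    by rewrite /DY; ring.
  have b7 : 8 * C0 * d%:R * (16 * C0 * M `^ q) `^ (nu / 2)^-1 * (q - 1) * (t + (34 * d%:R * h k * c + 2 * h k * c ^+ 2)) +
      4 * C0 * d%:R * (16 * C0 * M `^ q / eps) `^ (nu / 2)^-1 * (q - 1) * ln (2 / eps) + h k <= (N k)%:R * h k.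
    rewrite D1E DE NhT sE; have /andP[_ hk1] := b1.
    have hw0 : 0 <= h k * w0 by rewrite mulr_ge0// ltW.
    have s4 : 0 <= h k * w0 <= 4^-1.
      rewrite hw0 /=; have : h k * w0 <= q * (h k * w0) by rewrite ler_peMl// ltW.
      by move: qs; move: (q * (h k * w0)) (h k * w0); clear => *; lra.
    exact: (diffusion_time_bound n1 q2 C01 K00 G1 Y1 t0 l2 s4 hk1 lq TC).
  exact: (snap d (N k) (h k) Z M q eps g d0 b1 b2 b3 b4 b5 Z0 ZE M1 q2 e01 mg g0 gM g1 b6 b7).
have [Gs HG] := choice Sk.
have msd : measurable_fun setT sdn by exact: measurable_student_density.
have sd0 y : 0 <= sdn y by exact/ltW/student_density_gt0.
have gM' k x : 0 <= Gs k x <= 4 * M by have [_ H _ _ _] := HG k.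
have Gs0 k x : 0 <= Gs k x by case/andP: (gM' k x).
have GsM k x : Gs k x <= 4 * M by case/andP: (gM' k x).
have mGs k : measurable_fun setT (Gs k) by have [] := HG k.
have piI (f : 'rV[R]_d -> R) : measurable_fun setT f -> (forall x, 0 <= f x) ->
    (\int[pi_student d nu]_x (f x)%:E = \int[leb d]_x (f x * sdn x)%:E)%E.
  exact: (integral_pi_student Z0 piE).
have Gs1 k : (\int[pi_student d nu]_x (Gs k x)%:E = 1)%E by rewrite piI//; have [] := HG k.
have mr : measurable_fun setT (fun y => g y * sdn y) by exact: measurable_funM.
have r00 y : 0 <= g y * sdn y by rewrite mulr_ge0.
have Xr : has_density P (X 0) (fun y => g y * sdn y) by move=> S mS; rewrite -muE//; exact: X0.
(* The means under the scheme converge by dominated convergence along the paths, and the chi-square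
   bound transfers the limit to the chain densities. *)
have weak f : coord_continuous_test f ->
    mean (pi_student d nu) (Gs k) f @[k --> \oo] --> mean (distribution P (X T)) (fun=> 1) f.
  move=> [mf f01 fc].
  have f0 x : 0 <= f x by case/andP: (f01 x).
  have em k := euler_mean nu (h0 k) bm mr r00 Xr (N k) mf f01.
  have JE : (\int[P]_w (f (X T w))%:E = (mean (distribution P (X T)) (fun=> 1) f)%:E)%E.
    have bf : bounded_nonneg f by split => //; exists 1.
    have o1 : (\int[distribution P (X T)]_x (1 : R)%:E = 1)%E by rewrite integral_cst//= probability_setT mule1.
    transitivity (\int[distribution P (X T)]_x (f x)%:E)%E.
      apply/esym; apply: (ge0_integral_distribution (X T) (f := EFin \o f)).
      - exact/measurable_EFinP.
      - by move=> x; rewrite lee_fin.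
    rewrite -(bounded_meanE (@measurable_cst _ _ _ _ setT (1 : R)) (fun=> ler01) o1 bf).
    by apply: eq_eint => x; rewrite mulr1.
  have cu : mean (leb d) (iter (N k) (lmc_push c (h k)) (fun y => g y * sdn y)) f @[k --> \oo]
      --> mean (distribution P (X T)) (fun=> 1) f.
    suff : (\int[P]_w (f (euler_path nu (h k) X B (N k) w))%:E)%E @[k --> \oo] --> (\int[P]_w (f (X T w))%:E)%E.
      by rewrite JE; under eq_fun do rewrite em; move/fine_cvgP => [].
    have aecv : {ae P, forall w, (f (euler_path nu (h k) X B (N k) w))%:E @[k --> \oo] --> (f (X T w))%:E}.
      apply: filterS Xae => w [cX XE].
      apply: cvg_EFin; first exact: nearW.
      apply: fc => i.
      have La0 : 0 <= (d%:R + nu) * d%:R by rewrite mulr_ge0// addr_ge0// ltW.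
      have ec := @euler_cvg R d (grad (V_student nu)) ((d%:R + nu) * d%:R) T (fun t => X t w) (fun t => B t w) (Num.sqrt 2)
        La0 T0 (fun u v r i => @grad_student_lipschitz R d nu u v r i nu0) cX XE i.
      apply/cvgrPdist_le => e e00; move/cvgrPdist_le : ec => /(_ e e00) [j _ Hj].
      exists j => // k jk; apply: (Hj (k0 + k)%N).
      by apply: (leq_trans (jk : (j <= k)%N)); rewrite leq_addl.
    have mfE k : measurable_fun setT (fun w => (f (euler_path nu (h k) X B (N k) w))%:E).
      by apply/measurable_EFinP; exact: (measurableT_comp mf (measurable_euler_path nu (h k) X B (N k))).
    have mfX : measurable_fun setT (fun w => (f (X T w))%:E).
      by apply/measurable_EFinP; exact: (measurableT_comp mf (@measurable_funPT _ _ _ _ (X T))).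
    have i1 : P.-integrable setT (cst 1%E : O -> \bar R) by exact: finite_measure_integrable_cst.
    have cvw : {ae P, forall w, setT w -> (f (euler_path nu (h k) X B (N k) w))%:E @[k --> \oo] --> (f (X T w))%:E}.
      by apply: filterS aecv => w H _; exact: H.
    have bdw : {ae P, forall w (k : nat), setT w -> (`|(f (euler_path nu (h k) X B (N k) w))%:E| <= (cst 1%E : O -> \bar R) w)%E}.
      by apply: aeW => w k _; rewrite /= lee_fin ger0_norm//; case/andP: (f01 (euler_path nu (h k) X B (N k) w)).
    have [_ _ DC] := dominated_convergence measurableT mfE mfX cvw i1 bdw.
    exact: DC.
  apply/cvgrPdist_le => e e00.
  have e20 : 0 < e / 2 by rewrite divr_gt0.
  move/cvgrPdist_le : cu => /(_ _ e20) cu.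
  (* Since N h = T is fixed, the accumulated exponent is h times [E0] and vanishes with h. *)
  pose E0 := 1064 * d%:R * T * c ^+ 2.
  have d0R : 0 < d%:R :> R by rewrite ltr0n.
  have E00 : 0 < E0 := mulr_gt0 (mulr_gt0 (mulr_gt0 (ltr0Sn R 1063) d0R) T0) (exprn_gt0 2 c0).
  pose z := Num.min 2^-1 ((e / 2) ^+ 2 / 2).
  have z0 : 0 < z by rewrite lt_min invr_gt0 ltr0n divr_gt0// exprn_gt0.
  have hz := hsmall (z / E0) (divr_gt0 z0 E00).
  apply: filterS2 cu hz => k uk hk.
  have [_ _ _ _ close] := HG k.
  have xE : (N k)%:R * (1064 * d%:R * h k ^+ 2 * 1 ^+ 2 * c ^+ 2) = h k * E0.
    by rewrite /E0 -(NhT k); ring.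
  have hE : h k * E0 <= z by rewrite -ler_pdivlMr.
  have hx : 0 <= h k * E0 <= 2^-1.
    by rewrite mulr_ge0 ?(ltW (h0 k)) ?(ltW E00)//= (le_trans hE)// ge_min lexx.
  have hz2 : 2 * (h k * E0) <= (e / 2) ^+ 2.
    apply: (@le_trans _ _ (2 * z)); first by rewrite ler_wpM2l.
    by rewrite mulrC -ler_pdivlMr// ge_min lexx orbT.
  have H := close f (e / 2) mf f01 e20; rewrite xE in H.
  have {}H := H (le_trans (expR_sub1_le hx) hz2).
  have Ieq : mean (pi_student d nu) (Gs k) f = mean (leb d) (fun x => Gs k x * sdn x) f.
    rewrite /mean piI; last 2 first.
    - exact: measurable_funM.
    - by move=> x; rewrite mulr_ge0.
    by under eq_eint do rewrite -mulrA.
  rewrite Ieq.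
  have -> : mean (distribution P (X T)) (fun=> 1) f - mean (leb d) (fun x => Gs k x * sdn x) f =
     (mean (distribution P (X T)) (fun=> 1) f - mean (leb d) (iter (N k) (lmc_push c (h k)) (fun y => g y * sdn y)) f) +
     (mean (leb d) (iter (N k) (lmc_push c (h k)) (fun y => g y * sdn y)) f - mean (leb d) (fun x => Gs k x * sdn x) f) by ring.
  apply: (le_trans (ler_normD _ _)); rewrite [leRHS](splitr e); exact: lerD.
(* The change of density adds h w0 to the divergence bound for each k; it is eventually below any
   slack [de]. *)
apply/lee_addgt0Pr => de de0; rewrite -EFinD.
apply: (renyi_limit mGs Gs0 GsM Gs1 weak q2).
have w10 : 0 < w0 + 1 by rewrite ltr_wpDl.
have := hsmall (de / (w0 + 1)) (divr_gt0 de0 w10); apply: filterS => k hk.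
rewrite piI; last 2 first.
- exact: measurable_powRf.
- by move=> x; exact: powR_ge0.
have [_ _ _ Hq _] := HG k; rewrite sE in Hq; apply: (le_trans Hq); rewrite lee_fin ler_expR ler_wpM2l ?(ltW q10)// lerD2l.
apply: (@le_trans _ _ (h k * (w0 + 1))); first by rewrite ler_wpM2l ?(ltW (h0 k))// lerDl.
by rewrite -ler_pdivlMr.
Qed.

End langevin_main.

Theorem corollary8 (R : realType) (nu : R) (hnu : 0 < nu) :
  (exists2 C : R, 0 < C &
    forall (d : nat) (q eps : R), (0 < d)%N -> 2 <= q -> 0 < eps <= q^-1 ->
    forall (disp : measure_display) (O : measurableType disp)
      (P : probability O R) (rho0 : probability 'rV[R]_d R)
      (X : R -> {mfun O >-> 'rV[R]_d}),
    langevin_diffusion P (V_student nu) X -> has_law P (X 0) rho0 ->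
    (renyi_infty rho0 (pi_student d nu) < +oo)%E ->
    forall T : R,
      C * q * d%:R *
        expR (2 * q * fine (renyi_infty rho0 (pi_student d nu)) / nu) *
        (fine (renyi q rho0 (pi_student d nu)) +
           eps^-1 `^ (2 / nu) * ln eps^-1) <= T ->
      (renyi q (distribution P (X T)) (pi_student d nu) <= eps%:E)%E)
  /\
  (forall (c q : R), 0 < c -> 2 <= q ->
   exists (C : R) (p : nat), 0 < C /\
    forall (d : nat) (eps : R) (mu0 : probability 'rV[R]_d R),
      (0 < d)%N -> nu <= c * d%:R -> 0 < eps <= q^-1 ->
      (renyi_infty mu0 (pi_student d nu) < +oo)%E ->
      1 <= m_student d nu ->
      1 <= T_student nu q eps mu0 ->
      (1 <= renyi 2 mu0 (pi_hat nu q eps mu0) < +oo)%E ->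
    exists (h : R) (N : nat),
      [/\ 0 < h,
          lmc_rate nu q eps mu0 / (C * log_factor nu q eps mu0 ^+ p) <= N%:R,
          N%:R <= C * log_factor nu q eps mu0 ^+ p * lmc_rate nu q eps mu0 &
          forall (disp : measure_display) (O : measurableType disp)
            (P : probability O R) (x : nat -> {mfun O >-> 'rV[R]_d}),
            lmc P (V_student nu) h x -> has_law P (x 0%N) mu0 ->
            (renyi q (distribution P (x N)) (pi_student d nu) <= eps%:E)%E]).
Proof.
split; first exact: langevin_student_convergence.
exact: lmc_student_convergence.
Qed.
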